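(* The operator $\overline{\partial}:L^2_{2,0}(\mathbb{O},z\text{-only})\dashrightarrow L^2_{2,1}(\mathbb{O})$ has closed range. The range is the orthogonal complement of the form $\overline{\phi}\wedge\phi\wedge\psi$ in the closed subspace $L^2_{2,1}(\mathbb{O},z\text{-only})$ of $L^2_{2,1}(\mathbb{O})$.
   Context: Fix $\beta>0$. Let $\mathbb{C}^*=\mathbb{C}\setminus\{0\}$, $\Gamma_\beta=\{e^{2k\pi\beta}:k\in\mathbb{Z}\}$ (a multiplicative subgroup of $\mathbb{C}^*$), and let $\mathbb{E}=\mathbb{C}^*/\Gamma_\beta$ be the resulting elliptic curve, with projection $\pi:\mathbb{C}^*\to\mathbb{E}$, $w\mapsto[w]$. Let $\mathbb{P}$ be the complex projective line with inhomogeneous coordinate $z:\mathbb{P}\to\mathbb{C}\cup\{\infty\}$, and $X=\mathbb{P}\times\mathbb{E}$. Define $$\mathbb{O}=\{(z,[w])\in\mathbb{P}\times\mathbb{E}:\ \mathrm{Re}(zw)>0\}$$ (the condition does not depend on the lift $w$ of $[w]$; on $\mathbb{O}$ the coordinate $z$ takes all values in $\mathbb{C}^*$). Let $\phi=\dfrac{dz}{1+|z|^2}$ on $\mathbb{P}$, and let $\psi$ be the holomorphic $1$-form on $\mathbb{E}$ with $\pi^*\psi=dw/w$; the same symbols denote their pullbacks to $X$. $\mathbb{O}$ carries the restriction of the Hermitian metric $ds^2=\phi\otimes\overline{\phi}+\psi\otimes\overline{\psi}$ on $X$, for which $\phi,\psi$ are pointwise orthonormal. $L^2_{p,q}(\mathbb{O})$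 is the Hilbert space of square-integrable $(p,q)$-forms on $\mathbb{O}$, and $\overline{\partial}$ denotes the (weak) maximal realization, with domain $\{f\in L^2_{p,q}(\mathbb{O}):\overline{\partial} f\in L^2_{p,q+1}(\mathbb{O})\}$, $\overline{\partial} f$ in the sense of distributions. $L^2_{2,0}(\mathbb{O},z\text{-only})$ is the closed subspace of $L^2_{2,0}(\mathbb{O})$ of forms $u\,dz\wedge\psi$ whose coefficient $u$ is a function of $z$ alone; $L^2_{2,1}(\mathbb{O},z\text{-only})$ is the closed subspace of $L^2_{2,1}(\mathbb{O})$ of forms $v\,d\overline{z}\wedge dz\wedge\psi$ with $v$ a function of $z$ alone. The operator in the claim is the restriction of $\overline{\partial}$ to $L^2_{2,0}(\mathbb{O},z\text{-only})\cap\mathrm{Dom}(\overline{\partial})$. *)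

(* Defs.v *)
From HB Require Import structures.
From mathcomp Require Import all_boot all_order all_algebra.
From mathcomp Require Import generic_quotient.
From mathcomp Require Import all_classical all_reals all_analysis.
From mathcomp Require Import complex.

Set Implicit Arguments.
Unset Strict Implicit.
Unset Printing Implicit Defensive.

Import Order.TTheory GRing.Theory Num.Theory numFieldNormedType.Exports.

Local Open Scope classical_set_scope.
Local Open Scope complex_scope.
Local Open Scope quotient_scope.
Local Open Scope ring_scope.

Definition cstar (R : realType) := {w : R[i] | w != 0}.

Definition Gamma (R : realType) (beta : R) : set R[i] :=
  [set (expR (2 * k%:~R * pi * beta))%:C | k in [set: int]].

Definition Gamma_rel (R : realType) (beta : R) (w w' : cstar R) : bool :=
  `[< exists2 g, Gamma beta g & val w' = g * val w >].

Lemma Gamma_rel_refl (R : realType) (beta : R) : reflexive (Gamma_rel beta).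
Proof.
move=> w; apply/asboolP; exists 1; last by rewrite mul1r.
by exists 0 => //; rewrite !(mulr0, mul0r) expR0.
Qed.

Lemma Gamma_rel_sym (R : realType) (beta : R) : symmetric (Gamma_rel beta).
Proof.
have sym (w w' : cstar R) : Gamma_rel beta w w' -> Gamma_rel beta w' w.
  move=> /asboolP[_ [k _ <-] ew]; apply/asboolP.
  exists (expR (2 * (- k)%:~R * pi * beta))%:C; first by exists (- k).
  rewrite ew mulrA -rmorphM /= -expRD -mulrDl -mulrDl -mulrDr -intrD addNr.
  by rewrite !(mulr0, mul0r) expR0 mul1r.
by move=> w w'; apply/idP/idP; apply: sym.
Qed.

Lemma Gamma_rel_trans (R : realType) (beta : R) : transitive (Gamma_rel beta).
Proof.
move=> w2 w1 w3 /asboolP[_ [k _ <-] e2] /asboolP[_ [l _ <-] e3].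
apply/asboolP; exists (expR (2 * (l + k)%:~R * pi * beta))%:C.
  by exists (l + k).
rewrite e3 e2 mulrA -rmorphM /= -expRD.
by rewrite -mulrDl -mulrDl -mulrDr -intrD.
Qed.

Definition Gamma_equiv (R : realType) (beta : R) : equiv_rel (cstar R) :=
  EquivRel (Gamma_rel beta) (@Gamma_rel_refl R beta) (@Gamma_rel_sym R beta)
    (@Gamma_rel_trans R beta).

(* The elliptic curve C^* / Gamma_beta. *)
Definition ellE (R : realType) (beta : R) := {eq_quot (Gamma_equiv beta)}.

Definition ellpi (R : realType) (beta : R) (w : cstar R) : ellE beta :=
  \pi_(ellE beta) w.

Lemma ellpi_eq (R : realType) (beta : R) (w w' : cstar R) :
  ellpi beta w = ellpi beta w' <-> Gamma_rel beta w w'.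
Proof. by rewrite /ellpi; split => [/eqmodP|?] //; apply/eqmodP. Qed.

(* P x E; the inhomogeneous coordinate of P is z at Some z, infinity at None. *)
Definition ambient (R : realType) (beta : R) : Type :=
  (option R[i] * ellE beta)%type.

Definition domO (R : realType) (beta : R) : set (ambient beta) :=
  [set x | exists (z : R[i]) (w : cstar R),
     x = (Some z, ellpi beta w) /\ 0 < complex.Re (z * val w)].
Arguments domO {R} beta _.

Definition cexp (R : realType) (zeta : R[i]) : R[i] :=
  let: rho +i* theta := zeta in
  (expR rho * cos theta) +i* (expR rho * sin theta).

Lemma cexp_neq0 (R : realType) (zeta : R[i]) : cexp zeta != 0.
Proof.
case: zeta => rho theta; apply/eqP => -[ec es].
have /eqP := cos2Dsin2 theta.
have e0 : expR rho != 0 :> R by rewrite gt_eqF ?expR_gt0.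
move/eqP: ec; rewrite mulf_eq0 (negbTE e0) => /eqP ->.
move/eqP: es; rewrite mulf_eq0 (negbTE e0) => /eqP ->.
by rewrite expr0n addr0 eq_sym oner_eq0.
Qed.

Definition cexp_star (R : realType) (zeta : R[i]) : cstar R :=
  exist _ (cexp zeta) (cexp_neq0 zeta).

(* Real coordinates ((x, y), (rho, theta)) with z = x + i y and
   w = exp (rho + i theta).  In the holomorphic coordinate
   zeta = rho + i theta = log w of E, the form psi = dw/w is d zeta, so the
   area element of psi (x) conj psi is d rho d theta. *)
Notation coords R := ((R * R) * (R * R))%type.

Definition zc (R : realType) (p : coords R) : R[i] :=
  p.1.1 +i* p.1.2.

Definition zetac (R : realType) (p : coords R) : R[i] :=
  p.2.1 +i* p.2.2.

Definition cover (R : realType) (beta : R) (p : coords R) :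
    ambient beta :=
  (Some (zc p), ellpi beta (cexp_star (zetac p))).

Definition lift (R : realType) (beta : R) (T : Type)
    (F : ambient beta -> T) : coords R -> T := F \o cover beta.

Definition coverO (R : realType) (beta : R) : set (coords R) :=
  cover beta @^-1` domO beta.

(* cover maps this set bijectively onto O: [zeta] |-> [exp zeta] identifies E
   with C / (2 pi beta Z + 2 i pi Z). *)
Definition fundO (R : realType) (beta : R) : set (coords R) :=
  [set p | coverO beta p /\
     (0 <= p.2.1 < 2 * pi * beta) /\ (0 <= p.2.2 < 2 * pi)].

Definition leb2 (R : realType) :
    set (measurableTypeR R * measurableTypeR R) -> \bar R :=
  (@lebesgue_measure R \x @lebesgue_measure R)%E.
Arguments leb2 : clear implicits.
HB.instance Definition _ (R : realType) := Measure.on (leb2 R).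
Lemma leb2_sigma_finite (R : realType) : sigma_finite setT (leb2 R).
Proof.
have /sigma_finiteP[F [TF ndF Foo]] := sigma_finiteT (@lebesgue_measure R).
exists (fun n => F n `*` F n).
  rewrite -setXTT [in LHS]TF predeqE => -[x y]; split.
    move=> [/= [n _ Fnx] [k _ Gky]]; exists (maxn n k) => //; split.
    - by move: x Fnx; exact/subsetPset/ndF/leq_maxl.
    - by move: y Gky; exact/subsetPset/ndF/leq_maxr.
  by move=> [n _ []/= ? ?]; split; exists n.
move=> k; have [? ?] := Foo k.
split; first exact: measurableX.
by rewrite /leb2 product_measure1E// lte_mul_pinfty// ge0_fin_numE.
Qed.
HB.instance Definition _ (R : realType) :=
  Measure_isSigmaFinite.Build _ _ _ (leb2 R) (@leb2_sigma_finite R).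
Definition leb4 (R : realType) :
    set ((measurableTypeR R * measurableTypeR R) *
         (measurableTypeR R * measurableTypeR R)) -> \bar R :=
  (leb2 R \x leb2 R)%E.
Arguments leb4 : clear implicits.
HB.instance Definition _ (R : realType) := Measure.on (leb4 R).

Definition normCsq (R : realType) (c : R[i]) : R :=
  complex.Re c ^+ 2 + complex.Im c ^+ 2.

(* 1 + |z|^2, so that dz = hz * phi. *)
Definition hz (R : realType) (p : coords R) : R := 1 + normCsq (zc p).

(* Integrals over O of functions of the coordinates, with respect to
   dx dy d rho d theta; the volume element of ds^2 is this one divided by
   hz ^ 2. *)
Definition Cintegral (R : realType) (beta : R) (F : coords R -> R[i]) : R[i] :=
  Rintegral (leb4 R) (fundO beta) (fun p => complex.Re (F p)) +i*
  Rintegral (leb4 R) (fundO beta) (fun p => complex.Im (F p)).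

Definition vol_integral (R : realType) (beta : R)
    (F : ambient beta -> R[i]) : R[i] :=
  Cintegral beta (fun p => lift F p / (hz p ^+ 2)%:C).

Definition vol_integral_ge0 (R : realType) (beta : R)
    (F : ambient beta -> R) : \bar R :=
  (\int[leb4 R]_(p in fundO beta) (lift F p / hz p ^+ 2)%:E)%E.

Definition measurableO (R : realType) (beta : R)
    (F : ambient beta -> R[i]) : Prop :=
  measurable_fun (coverO beta) (fun p => complex.Re (lift F p)) /\
  measurable_fun (coverO beta) (fun p => complex.Im (lift F p)).

(* The coefficient a stands for the (2,0)-form a phi /\ psi. *)
Definition form20 (R : realType) (beta : R) := ambient beta -> R[i].

(* The pair (b, c) stands for the (2,1)-form
   b conj phi /\ phi /\ psi + c conj psi /\ phi /\ psi.
   Only the values of the coefficients on O matter. *)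
Definition form21 (R : realType) (beta : R) : Type :=
  ((ambient beta -> R[i]) * (ambient beta -> R[i]))%type.

Definition normsq20 (R : realType) (beta : R) (f : form20 beta) : \bar R :=
  vol_integral_ge0 (fun x => normCsq (f x)).

Definition normsq21 (R : realType) (beta : R) (g : form21 beta) : \bar R :=
  vol_integral_ge0 (fun x => normCsq (g.1 x) + normCsq (g.2 x)).

Definition inner21 (R : realType) (beta : R) (g g' : form21 beta) : R[i] :=
  vol_integral (fun x => g.1 x * (g'.1 x)^*%C + g.2 x * (g'.2 x)^*%C).

Definition sub21 (R : realType) (beta : R) (g g' : form21 beta) : form21 beta :=
  (fun x => g.1 x - g'.1 x, fun x => g.2 x - g'.2 x).

(* L^2 spaces are given by representatives; the sets of forms considered below
   are stable under changing (measurable) representatives. *)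
Definition L2_20 (R : realType) (beta : R) : set (form20 beta) :=
  [set f | measurableO f /\ (normsq20 f < +oo)%E].
Arguments L2_20 {R} beta _.

Definition L2_21 (R : realType) (beta : R) : set (form21 beta) :=
  [set g | [/\ measurableO g.1, measurableO g.2 & (normsq21 g < +oo)%E]].
Arguments L2_21 {R} beta _.

(* u dz /\ psi = (u * hz) phi /\ psi *)
Definition L2_20_zonly (R : realType) (beta : R) : set (form20 beta) :=
  [set f | L2_20 beta f /\ exists u : R[i] -> R[i],
     {ae leb4 R, forall p, coverO beta p -> lift f p = u (zc p) * (hz p)%:C}].
Arguments L2_20_zonly {R} beta _.

(* v conj dz /\ dz /\ psi = (v * hz ^ 2) conj phi /\ phi /\ psi *)
Definition L2_21_zonly (R : realType) (beta : R) : set (form21 beta) :=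
  [set g | L2_21 beta g /\ exists v : R[i] -> R[i],
     {ae leb4 R, forall p, coverO beta p ->
        lift g.1 p = v (zc p) * (hz p ^+ 2)%:C /\ lift g.2 p = 0}].
Arguments L2_21_zonly {R} beta _.

Definition closed_in_L2_21 (R : realType) (beta : R)
    (S : set (form21 beta)) : Prop :=
  S `<=` L2_21 beta /\
  forall g, L2_21 beta g ->
    (forall e : R, 0 < e ->
       exists2 h, S h & (normsq21 (sub21 g h) < (e ^+ 2)%:E)%E) ->
    S g.

Fixpoint iterD (R : realType) (s : seq (coords R)) (f : coords R -> R) :
    coords R -> R :=
  if s is v :: s' then 'D_v (iterD s' f) else f.

Definition smooth (R : realType) (f : coords R -> R) : Prop :=
  forall (s : seq (coords R)) (p : coords R), differentiable (iterD s f) p.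

(* C_c^oo(O), each function being extended by 0. *)
Definition test_fun (R : realType) (beta : R)
    (chi : ambient beta -> R[i]) : Prop :=
  [/\ smooth (fun p => complex.Re (lift chi p)),
      smooth (fun p => complex.Im (lift chi p))
    & exists K : set (coords R),
        [/\ compact K, K `<=` coverO beta
          & forall x, chi x != 0 -> (cover beta @` K) x]].

Definition Cderive (R : realType) (v : coords R) (F : coords R -> R[i])
    (p : coords R) : R[i] :=
  'D_v (fun q => complex.Re (F q)) p +i* 'D_v (fun q => complex.Im (F q)) p.

Definition d_zbar (R : realType) (F : coords R -> R[i]) (p : coords R) : R[i] :=
  (Cderive ((1, 0), (0, 0)) F p + 'i%C * Cderive ((0, 1), (0, 0)) F p) / 2.

Definition d_zetabar (R : realType) (F : coords R -> R[i]) (p : coords R) :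
    R[i] :=
  (Cderive ((0, 0), (1, 0)) F p + 'i%C * Cderive ((0, 0), (0, 1)) F p) / 2.

(* v is the distributional derivative D u on O, D being a constant coefficient
   first order operator. *)
Definition weak_derivative (R : realType) (beta : R)
    (D : (coords R -> R[i]) -> coords R -> R[i]) (u v : coords R -> R[i]) :
    Prop :=
  forall chi : ambient beta -> R[i], test_fun chi ->
    Cintegral beta (fun p => u p * D (lift chi) p) =
    - Cintegral beta (fun p => v p * lift chi p).

(* For f = a phi /\ psi = u dz /\ psi with u = a / hz,
     dbar f = (d u / d conj z) conj dz /\ dz /\ psi
            + (d u / d conj zeta) conj psi /\ dz /\ psi,
   while b conj phi /\ phi /\ psi + c conj psi /\ phi /\ psi
       = (b / hz ^ 2) conj dz /\ dz /\ psi + (c / hz) conj psi /\ dz /\ psi. *)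
Definition weak_dbar (R : realType) (beta : R) (f : form20 beta)
    (g : form21 beta) : Prop :=
  weak_derivative beta (@d_zbar R)
    (fun p => lift f p / (hz p)%:C) (fun p => lift g.1 p / (hz p ^+ 2)%:C) /\
  weak_derivative beta (@d_zetabar R)
    (fun p => lift f p / (hz p)%:C) (fun p => lift g.2 p / (hz p)%:C).

(* The range of the maximal realization of dbar restricted to z-only forms. *)
Definition range_dbar_zonly (R : realType) (beta : R) : set (form21 beta) :=
  [set g | L2_21 beta g /\ exists2 f, L2_20_zonly beta f & weak_dbar f g].
Arguments range_dbar_zonly {R} beta _.

(* conj phi /\ phi /\ psi *)
Definition phibar_phi_psi (R : realType) (beta : R) : form21 beta :=
  (fun=> 1, fun=> 0).

Definition orth_complement_in (R : realType) (beta : R)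
    (M : set (form21 beta)) (h : form21 beta) : set (form21 beta) :=
  [set g | M g /\ inner21 g h = 0].

(* Main.v *)
(** Write [v = g.1 / hz ^ 2]; a z-only [f = u dz /\ psi] solves [dbar f = g] iff [d u / d conj z = v] and
[g.2 = 0] weakly on O.

Necessity.  The angular cutoffs [kappa_n] of [Re (z w) / |z|], equal to 1 in the limit, have z-derivatives
that are total theta-derivatives and so integrate to zero along the fibres of [z].  As [u] depends on [z]
alone, the weak equation thus holds against [eta(z) kappa_n], hence against every [eta] in
C_c^oo(C^* ), with no derivative of [kappa_n] left over.  Therefore [v] equals its fibre average a.e., and
testing with cutoffs [eta_n] of C^* whose gradients are bounded in L^2 and concentrate near 0 and
infinity gives [int v = 0], because [u] is in L^2.

Sufficiency.  If [int v = 0] and [(1 + |z|^2) v] is in L^2, then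
[u(z) = (1/pi) int v(z') (1/(z - z') - conj z/(1 + |z|^2))] solves the equation by Cauchy-Pompeiu, the
subtracted term contributing nothing; it gives the kernel the modulus
[(1 + |z'|^2)^(1/2) / ((1 + |z|^2)^(1/2) |z - z'|)] at most, to which a product Schur test applies since
[|z - z'|^-1 <= |x - x'|^(-1/2) |y - y'|^(-1/2)].

Closedness.  Fibre averages and the total integral are continuous for the L^1 norm of [v], which the L^2
norm of [g] controls, as O has finite volume. *)

From HB Require Import structures.
From mathcomp Require Import all_boot all_order all_algebra.
From mathcomp Require Import generic_quotient.
From mathcomp Require Import all_classical all_reals all_analysis.
From mathcomp Require Import measurable_realfun.
From mathcomp Require Import complex ring lra zify.
Require Import Defs.
Set Implicit Arguments.
Unset Strict Implicit.
Unset Printing Implicit Defensive.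
Import Order.TTheory GRing.Theory Num.Theory numFieldNormedType.Exports.
Local Open Scope classical_set_scope.
Local Open Scope ring_scope.

(** * Real-valued integrals *)

Section generic_integral.
Context d (T : measurableType d) (R : realType) (mu : {measure set T -> \bar R}).

(** The obstacle is that O is not a product: the fibre over z is one half of E and turns with arg z,
    so no nonzero function of z alone is a test function on O and the equation in z cannot be tested
    directly. Everything is pulled back to the real coordinates (x, y, rho, theta): a coefficient
    becomes an invariant function, O the set [0 < tfun p], an integral over O one over a period
    strip, and a complex identity a pair of real ones. Almost every fibre has the same area
    [fibre_mass], which makes fibre averages compatible with Lebesgue measure in z. In the norms of
    the forms, u is measured in the flat L^2 of the plane and v with the weight (1 + |z|^2)^2. A
    solution decaying at infinity behaves there like (int v) / (pi z), which is square-integrable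
    only if int v = 0; the missing point z = 0 adds no condition, since cutoffs around a point of
    the plane have bounded energy. Cauchy-Schwarz is mostly used in the linear form |a b| <= l a^2 +
    b^2 / l, integrated for a free l > 0 which is chosen or optimised at the end. *)

Definition rint (f : T -> R) : Prop := mu.-integrable setT (EFin \o f).

Lemma rint_measurable f : rint f -> measurable_fun setT f.
Proof. by move=> /measurable_int; move/measurable_EFinP. Qed.

Lemma rint_le (f g : T -> R) : measurable_fun setT f -> (forall x, `|f x| <= g x) ->
  rint g -> rint f.
Proof.
move=> mf fg; apply: le_integrable => //; first exact/measurable_EFinP.
by move=> x _ /=; rewrite lee_fin (le_trans (fg x))// ler_norm.
Qed.

Lemma rint_lt_pinfty (f g : T -> R) : measurable_fun setT f -> (forall x, `|f x| <= g x) ->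
  (\int[mu]_x (g x)%:E < +oo)%E -> measurable_fun setT g -> rint f.
Proof.
move=> mf fg goo mg; apply: (rint_le mf fg); apply/integrableP; split.
  exact/measurable_EFinP.
rewrite (eq_integral (fun x => (g x)%:E)) // => x _ /=.
by rewrite ger0_norm// (le_trans _ (fg x)).
Qed.

Lemma rintD f g : rint f -> rint g -> rint (fun x => f x + g x).
Proof. by move=> rf rg; have := integrableD measurableT rf rg. Qed.

Lemma rintB f g : rint f -> rint g -> rint (fun x => f x - g x).
Proof. by move=> rf rg; have := integrableB measurableT rf rg. Qed.

Lemma rintN f : rint f -> rint (fun x => - f x).
Proof. by move=> rf; have := integrableN rf. Qed.

Lemma rintZ k f : rint f -> rint (fun x => k * f x).
Proof. by move=> rf; have := integrableZl measurableT k rf. Qed.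

Lemma rint_norm f : rint f -> rint (fun x => `|f x|).
Proof. by move=> /integrable_norm. Qed.

Lemma rint_ext f g : f =1 g -> rint f -> rint g.
Proof. by move=> /funext ->. Qed.

Lemma rint_ae (f g : T -> R) : measurable_fun setT g -> {ae mu, forall x, f x = g x} ->
  rint f -> rint g.
Proof.
move=> mg fg /integrableP[mf foo]; apply/integrableP; split.
  exact/measurable_EFinP.
rewrite (_ : \int[mu]_x _ = \int[mu]_x `|(EFin \o f) x|)%E //.
apply: ae_eq_integral => //.
- by apply: measurableT_comp => //; exact/measurable_EFinP.
- exact: measurableT_comp.
- by apply: filterS fg => x /= fgx _; rewrite fgx.
Qed.

Lemma RintE f : rint f -> (\int[mu]_x (f x)%:E)%E = (Rintegral mu setT f)%:E.
Proof.
by move=> rf; rewrite /Rintegral fineK//; exact: integrable_fin_num rf.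
Qed.

Lemma Rint_ext f g : f =1 g -> Rintegral mu setT f = Rintegral mu setT g.
Proof. by move=> /funext ->. Qed.

Lemma Rint_ae (f g : T -> R) : measurable_fun setT f -> measurable_fun setT g ->
  {ae mu, forall x, f x = g x} -> Rintegral mu setT f = Rintegral mu setT g.
Proof.
move=> mf mg fg; congr fine; apply: ae_eq_integral => //.
- exact/measurable_EFinP.
- exact/measurable_EFinP.
- by apply: filterS fg => x /= fgx _; rewrite fgx.
Qed.

Lemma RintD f g : rint f -> rint g ->
  \int[mu]_x (f x + g x) =
  Rintegral mu setT f + Rintegral mu setT g.
Proof. by move=> rf rg; rewrite RintegralD. Qed.

Lemma RintB f g : rint f -> rint g ->
  \int[mu]_x (f x - g x) =
  Rintegral mu setT f - Rintegral mu setT g.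
Proof. by move=> rf rg; rewrite RintegralB. Qed.

Lemma RintZ k f : rint f ->
  \int[mu]_x (k * f x) = k * Rintegral mu setT f.
Proof. by move=> rf; rewrite RintegralZl. Qed.

Lemma RintN f : rint f ->
  \int[mu]_x (- f x) = - Rintegral mu setT f.
Proof.
by move=> rf; rewrite -mulN1r -RintZ//; apply: Rint_ext => x; rewrite mulN1r.
Qed.

Lemma Rint0 : Rintegral mu setT (fun=> 0) = 0 :> R.
Proof. by rewrite /Rintegral integral0. Qed.

Lemma Rint_norm_le f : rint f ->
  `|Rintegral mu setT f| <= \int[mu]_x (`|f x|).
Proof. by move=> rf; exact: le_normr_Rintegral. Qed.

Lemma Rint_le f g : rint f -> rint g -> (forall x, f x <= g x) ->
  Rintegral mu setT f <= Rintegral mu setT g.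
Proof. by move=> rf rg fg; apply: le_Rintegral. Qed.

Lemma Rint_ge0 f : (forall x, 0 <= f x) -> 0 <= Rintegral mu setT f.
Proof. by move=> f0; apply: Rintegral_ge0. Qed.

Lemma Rint_dominated (F : (T -> R)^nat) (f g : T -> R) :
  (forall n, measurable_fun setT (F n)) ->
  (forall x, F ^~ x @ \oo --> f x) -> rint g ->
  (forall n x, `|F n x| <= g x) ->
  rint f /\ Rintegral mu setT (F n) @[n --> \oo] --> Rintegral mu setT f.
Proof.
move=> mF Ff rg Fg.
have mf : measurable_fun setT f by apply: (measurable_fun_cvg (h := F)).
have rF n : rint (F n) by apply: rint_le rg.
have rf : rint f.
  apply: rint_le rg => // x.
  have cn : `|F n x| @[n --> \oo] --> `|f x| by apply: cvg_norm; exact: Ff.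
  rewrite -(cvg_lim _ cn)//; apply: limr_le => //.
    by apply/cvg_ex; eexists; exact: cn.
  exact: nearW.
split => //.
have := @dominated_cvg _ _ _ mu setT measurableT (fun n => EFin \o F n) (EFin \o f)
  (EFin \o g).
move=> /(_ _ _ _ rg) H.
apply: fine_cvg; rewrite -RintE//=.
apply: H => //.
- by move=> n; exact/measurable_EFinP.
- by move=> x _; apply: cvg_EFin => //=; [exact: nearW|exact: Ff].
- by move=> n x _; rewrite /= lee_fin.
Qed.

Lemma Rint_dominated_eq (F : (T -> R)^nat) (f g : T -> R) (c : R^nat) (l : R) :
  (forall n, measurable_fun setT (F n)) ->
  (forall x, F ^~ x @ \oo --> f x) -> rint g ->
  (forall n x, `|F n x| <= g x) ->
  (forall n, Rintegral mu setT (F n) = c n) -> c n @[n --> \oo] --> l ->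
  Rintegral mu setT f = l.
Proof.
move=> mF Ff rg Fg Fc cl; have [_] := Rint_dominated mF Ff rg Fg.
by under eq_fun do rewrite Fc; move/cvg_unique; apply.
Qed.

Lemma Rint_norm0_ae f : rint f -> \int[mu]_x (`|f x|) = 0 ->
  {ae mu, forall x, f x = 0}.
Proof.
move=> rf f0; have := RintE (rint_norm rf); rewrite f0 => f0'.
have mf : measurable_fun setT (EFin \o f) by exact: measurable_int rf.
have /(ae_eq_integral_abs mu measurableT mf) : (\int[mu]_x `|(EFin \o f) x|)%E = 0%E := f0'.
by apply: filterS => x /(_ I) [].
Qed.

Lemma ae_imp (P Q : T -> Prop) : (forall x, P x -> Q x) ->
  {ae mu, forall x, P x} -> {ae mu, forall x, Q x}.
Proof.
move=> PQ [N [mN N0 PN]]; exists N; split => // x /= nQ.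
by apply: PN => /= Px; exact/nQ/PQ.
Qed.

Lemma ae_and (P Q : T -> Prop) : {ae mu, forall x, P x} ->
  {ae mu, forall x, Q x} -> {ae mu, forall x, P x /\ Q x}.
Proof.
move=> HP HQ; have := negligibleU HP HQ; apply: negligibleS => x /= nPQ.
by have [Px|nP] := pselect (P x); [right => Qx; exact: nPQ|left].
Qed.

End generic_integral.

(** * Fubini, fibre integrals and null sets in products *)

Section generic_fubini.
Context d1 d2 (T1 : measurableType d1) (T2 : measurableType d2) (R : realType).
Variables (m1 : {sigma_finite_measure set T1 -> \bar R}).
Variables (m2 : {sigma_finite_measure set T2 -> \bar R}).
Local Notation m := (m1 \x m2)%E.

Lemma ae_rint1 f : rint m f -> {ae m1, forall x, rint m2 (fun y => f (x, y))}.
Proof. by move=> rf; have := ae_integrable1 rf. Qed.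

(** The real integral reads 0 on a fibre whose extended integral is infinite, so it agrees with
    [fubini_F] only where the latter is finite, that is almost everywhere. Measurability holds
    exactly, being that of [fine] after [fubini_F]. *)
Lemma Rint_fiber1 (f : T1 * T2 -> R) : rint m f ->
  measurable_fun setT (fun x => \int[m2]_y (f (x, y))) /\
  rint m1 (fun x => \int[m2]_y (f (x, y))).
Proof.
move=> rf.
have mF := measurable_fubini_F rf.
have mG : measurable_fun setT (fun x => \int[m2]_y (f (x, y))).
  exact: (@measurableT_comp _ _ _ _ _ _ fine _ (fubini_F m2 (EFin \o f))).
split => //.
have := integrable_fubini_F rf; rewrite /rint => iF.
have aeF := integrable_ae measurableT iF.
move: iF => /integrableP[_ foo]; apply/integrableP; split; first exact/measurable_EFinP.
rewrite (_ : \int[m1]_x _ = \int[m1]_x `|fubini_F m2 (EFin \o f) x|)%E //.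
apply: ae_eq_integral => //.
- by apply: measurableT_comp => //; exact/measurable_EFinP.
- exact: measurableT_comp.
- apply: filterS aeF => x /= /(_ I) fx _ /=.
  by rewrite -[in RHS](fineK fx).
Qed.

Lemma integrable_fubini_G (f : T1 * T2 -> \bar R) :
  m.-integrable setT f -> m2.-integrable setT (fubini_G m1 f).
Proof.
move=> rf; have mf := measurable_int _ rf.
apply/integrableP; split; first exact: measurable_fubini_G rf.
have /integrable21ltyP := rf => /(_ mf); apply: le_lt_trans.
apply: ge0_le_integral => //.
- by apply: measurableT_comp => //; exact: measurable_fubini_G rf.
- have mfa : measurable_fun setT (abse \o f) by exact: measurableT_comp.
  by have := @measurable_fun_fubini_tonelli_G _ _ _ _ _ m1 (abse \o f) mfa; apply => x; exact: abse_ge0.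
- move=> y _; apply: le_abse_integral => //.
  exact: measurableT_comp.
Qed.

Lemma Rint_fiber2 (f : T1 * T2 -> R) : rint m f ->
  measurable_fun setT (fun y => \int[m1]_x (f (x, y))) /\
  rint m2 (fun y => \int[m1]_x (f (x, y))).
Proof.
move=> rf.
have mF := measurable_fubini_G rf.
have mG : measurable_fun setT (fun y => \int[m1]_x (f (x, y))).
  exact: (@measurableT_comp _ _ _ _ _ _ fine _ (fubini_G m1 (EFin \o f))).
split => //.
have := integrable_fubini_G rf; rewrite /rint => iF.
have aeF := integrable_ae measurableT iF.
move: iF => /integrableP[_ foo]; apply/integrableP; split; first exact/measurable_EFinP.
rewrite (_ : \int[m2]_x _ = \int[m2]_x `|fubini_G m1 (EFin \o f) x|)%E //.
apply: ae_eq_integral => //.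
- by apply: measurableT_comp => //; exact/measurable_EFinP.
- exact: measurableT_comp.
- apply: filterS aeF => x /= /(_ I) fx _ /=.
  by rewrite -[in RHS](fineK fx).
Qed.

Lemma Rint_fubini1 (f : T1 * T2 -> R) : rint m f ->
  Rintegral m setT f =
  \int[m1]_x (\int[m2]_y (f (x, y))).
Proof.
move=> rf; have [mF iF] := Rint_fiber1 rf.
have := integral12_prod_meas1 rf; rewrite (RintE rf) => H.
apply: EFin_inj; rewrite -H -(RintE iF); apply: ae_eq_integral => //.
- exact: measurable_fubini_F rf.
- exact/measurable_EFinP.
- have := integrable_fubini_F rf; move=> /(integrable_ae measurableT).
  apply: filterS => x /(_ I) fx _; rewrite /= /Rintegral fineK//.
Qed.

Lemma Rint_fubini2 (f : T1 * T2 -> R) : rint m f ->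
  Rintegral m setT f =
  \int[m2]_y (\int[m1]_x (f (x, y))).
Proof.
move=> rf; have [mF iF] := Rint_fiber2 rf.
have := integral21_prod_meas1 rf; rewrite (RintE rf) => H.
apply: EFin_inj; rewrite -H -(RintE iF); apply: ae_eq_integral => //.
- exact: measurable_fubini_G rf.
- exact/measurable_EFinP.
- have := integrable_fubini_G rf; move=> /(integrable_ae measurableT).
  apply: filterS => x /(_ I) fx _; rewrite /= /Rintegral fineK//.
Qed.

(** The measure of a null set is the integral of the measures of its sections, a nonnegative
    function which therefore vanishes almost everywhere. *)
Lemma ae_section1 (P : T1 * T2 -> Prop) : {ae m, forall p, P p} ->
  {ae m1, forall x, {ae m2, forall y, P (x, y)}}.
Proof.
move=> [N [mN N0 PN]].
have : (\int[m1]_x (m2 \o xsection N) x)%E = 0%E by rewrite -[RHS]N0.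
rewrite (_ : \int[m1]_x _ = \int[m1]_x `|(m2 \o xsection N) x|)%E; last first.
  by apply: eq_integral => x _; rewrite gee0_abs// measure_ge0.
have mx : measurable_fun setT (m2 \o xsection N) by exact: measurable_fun_xsection.
move=> /(ae_eq_integral_abs m1 measurableT mx).
apply: filterS => x /(_ I) /= Nx0.
exists (xsection N x); split => //; first exact: measurable_xsection.
by move=> y /= nP; rewrite /xsection/= inE; exact: PN.
Qed.

Lemma ae_fst (P : T1 -> Prop) : {ae m1, forall x, P x} ->
  {ae m, forall p, P p.1}.
Proof.
move=> [N [mN N0 PN]]; exists (N `*` setT); split.
- exact: measurableX.
- by transitivity (m1 N * m2 setT)%E; [exact: product_measure1E|rewrite N0 mul0e].
- by move=> [x y] /= nP; split => //; exact: PN.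
Qed.

Lemma ae_snd (P : T2 -> Prop) : {ae m2, forall x, P x} ->
  {ae m, forall p, P p.2}.
Proof.
move=> [N [mN N0 PN]]; exists (setT `*` N); split.
- exact: measurableX.
- by transitivity (m1 setT * m2 N)%E; [exact: product_measure1E|rewrite N0 mule0].
- by move=> [x y] /= nP; split => //; exact: PN.
Qed.

Lemma rint_prod (f : T1 -> R) (g : T2 -> R) : rint m1 f -> rint m2 g ->
  rint m (fun p => f p.1 * g p.2) /\
  \int[m]_p (f p.1 * g p.2) =
  Rintegral m1 setT f * Rintegral m2 setT g.
Proof.
move=> rf rg.
have mf := rint_measurable rf; have mg := rint_measurable rg.
have mfg : measurable_fun setT (fun p : T1 * T2 => f p.1 * g p.2).
  by apply: measurable_funM; apply: measurableT_comp.
have rfg : rint m (fun p => f p.1 * g p.2).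
  apply/integrable12ltyP; first exact/measurable_EFinP.
  rewrite (eq_integral (fun x => `|f x|%:E * (\int[m2]_y `|g y|%:E)))%E.
    rewrite ge0_integralZr//=.
    - rewrite (RintE (rint_norm rf)) (RintE (rint_norm rg)) -EFinM.
      by rewrite ltry.
    - by apply/measurable_EFinP; exact: measurableT_comp.
    - by apply: integral_ge0 => x _; rewrite lee_fin.
  move=> x _; rewrite -ge0_integralZl//=.
  - by apply: eq_integral => y _; rewrite normrM EFinM.
  - by apply/measurable_EFinP; exact: measurableT_comp.
split => //; rewrite Rint_fubini1//=.
under eq_Rintegral do rewrite RintZ//.
by under eq_Rintegral do rewrite mulrC; rewrite RintZ// mulrC.
Qed.

End generic_fubini.

(** * Change of variables under maps that rescale a measure *)

Section measure_preserving.
Context d (T : measurableType d) (R : realType) (mu : {measure set T -> \bar R}).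
Variable phi : T -> T.
Hypothesis mphi : measurable_fun setT phi.
Variable k : {nonneg R}.
Hypothesis muphi : forall A, measurable A -> mu A = (k%:num%:E * mu (phi @^-1` A))%E.

(** [muphi] says that [mu] is [k] times its own image under [phi], and integrating against an image
    measure is integrating the composite. *)
Lemma ge0_integral_scaling (f : T -> \bar R) : measurable_fun setT f ->
  (forall x, 0 <= f x)%E ->
  (\int[mu]_x f x)%E = (k%:num%:E * \int[mu]_x f (phi x))%E.
Proof.
move=> mf f0.
have -> : (\int[mu]_x f x)%E = (\int[mscale k (pushforward mu phi)]_x f x)%E.
  by move=> m; apply: eq_measure_integral => A mA _; rewrite muphi.
by rewrite ge0_integral_mscale// ge0_integral_pushforward.
Qed.

Lemma rint_scaling (f : T -> R) : 0 < k%:num -> rint mu f -> rint mu (f \o phi).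
Proof.
move=> k0 rf; have mf := rint_measurable rf.
move: rf => /integrableP[_ foo].
apply/integrableP; split; first by apply/measurable_EFinP; exact: measurableT_comp.
have mE : measurable_fun setT (abse \o (EFin \o f)).
  by apply: measurableT_comp => //; exact/measurable_EFinP.
move: foo; rewrite (@ge0_integral_scaling (abse \o (EFin \o f)))//; last first.
  by move=> x /=; rewrite lee_fin.
rewrite /=.
set I := (\int[mu]_x _)%E.
have : (0 <= I)%E by exact: integral_ge0.
by case: I => // r; rewrite ?ltry// gt0_muley// lte_fin.
Qed.

Lemma Rint_scaling (f : T -> R) : 0 < k%:num -> rint mu f ->
  Rintegral mu setT f = k%:num * Rintegral mu setT (f \o phi).
Proof.
move=> k0 rf; have mf := rint_measurable rf; have rfp := rint_scaling k0 rf.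
have mE : measurable_fun setT (EFin \o f) by exact/measurable_EFinP.
rewrite /Rintegral integralE [in RHS]integralE.
rewrite (ge0_integral_scaling (f := ((EFin \o f)^\+)%E))//; last exact: measurable_funepos.
rewrite (ge0_integral_scaling (f := ((EFin \o f)^\-)%E))//; last exact: measurable_funeneg.
have i1 := integrable_pos_fin_num measurableT rfp.
have i2 := integrable_neg_fin_num measurableT rfp.
have e1 : (\int[mu]_x (EFin \o f)^\+ (phi x) = \int[mu]_x ((EFin \o (f \o phi))^\+ x))%E.
  by apply: eq_integral => x _; rewrite !funeposE.
have e2 : (\int[mu]_x (EFin \o f)^\- (phi x) = \int[mu]_x ((EFin \o (f \o phi))^\- x))%E.
  by apply: eq_integral => x _; rewrite !funenegE.
rewrite e1 e2; set X := (\int[mu]_x _)%E in i1 *; set Y := (\int[mu]_x _)%E in i2 *.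
by rewrite -(fineK i1) -(fineK i2) /= mulrBr.
Qed.

End measure_preserving.

Section lebesgue_affine.
Context {R : realType}.
Local Notation mu := (@lebesgue_measure R).
Variables (c b : R).
Hypothesis c0 : 0 < c.
Let phi (x : R) : R := c * x + b.

Lemma measurable_affine : measurable_fun setT phi.
Proof.
by apply: measurable_funD => //; apply: measurable_funM.
Qed.

(** Both sides are measures, and they agree on the intervals []u, v]], which determine Lebesgue
    measure. *)
Lemma lebesgue_measure_affine (A : set (measurableTypeR R)) : measurable A ->
  mu A = (c%:E * mu (phi @^-1` A))%E.
Proof.
move=> mA; have c0' : 0 <= c by exact: ltW.
have := @lebesgue_measure_unique R (mscale (NngNum c0') (pushforward mu (phi : R -> measurableTypeR R))).
move=> /(_ measurable_affine) ->//.
move=> _ [[u v]] _ <-.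
rewrite [RHS](_ : _ = c%:E * mu (phi @^-1` `]u, v]%classic))%E//.
have -> : phi @^-1` `]u, v]%classic = `](u - b) / c, (v - b) / c]%classic.
  by apply/seteqP; split => x /=; rewrite /phi !in_itv/= ltr_pdivrMr// ler_pdivlMr//
    ltrBlDr lerBrDr mulrC.
rewrite !lebesgue_measure_itv/= !lte_fin ltr_pM2r ?invr_gt0// ltrD2r.
case: ifP => uv; rewrite ?mule0// -!EFinB -EFinM; congr EFin.
by field; rewrite gt_eqF.
Qed.

Lemma Rint_affine (f : R -> R) : rint mu f ->
  rint mu (fun x => f (c * x + b)) /\
  Rintegral mu setT f = c * \int[mu]_x (f (c * x + b)).
Proof.
move=> rf; have c0' : 0 <= c by exact: ltW.
have H := @rint_scaling _ _ _ mu phi measurable_affine (NngNum c0') lebesgue_measure_affine f c0 rf.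
split => //.
exact: (@Rint_scaling _ _ _ mu phi measurable_affine (NngNum c0') lebesgue_measure_affine f c0 rf).
Qed.

End lebesgue_affine.

Section product_preserving.
Context d1 d2 (T1 : measurableType d1) (T2 : measurableType d2) (R : realType).
Variables (m1 : {sigma_finite_measure set T1 -> \bar R}).
Variables (m2 : {sigma_finite_measure set T2 -> \bar R}).
Variables (f1 : T1 -> T1) (f2 : T2 -> T2).
Hypotheses (mf1 : measurable_fun setT f1) (mf2 : measurable_fun setT f2).
Hypothesis p1 : forall A, measurable A -> m1 (f1 @^-1` A) = m1 A.
Hypothesis p2 : forall A, measurable A -> m2 (f2 @^-1` A) = m2 A.
Let phi (p : T1 * T2) := (f1 p.1, f2 p.2).

Lemma measurable_prod_map : measurable_fun setT phi.
Proof.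
by apply/measurable_fun_pair => /=; apply: measurableT_comp.
Qed.

(** Rectangles determine the product measure; on a rectangle the claim is the product of [p1] and
    [p2]. *)
Lemma product_measure_preserving (A : set (T1 * T2)) : measurable A ->
  (m1 \x m2)%E (phi @^-1` A) = (m1 \x m2)%E A.
Proof.
move=> mA; symmetry.
have mphi := measurable_prod_map.
apply: (@product_measure_unique _ _ _ _ _ m1 m2 (pushforward (m1 \x m2)%E phi)) => //.
move=> B C mB mC; rewrite /pushforward.
rewrite [LHS](_ : _ = (m1 \x m2)%E (phi @^-1` (B `*` C)))//.
have -> : phi @^-1` (B `*` C) = (f1 @^-1` B) `*` (f2 @^-1` C) by [].
have mB' : measurable (f1 @^-1` B) by rewrite -[X in measurable X]setTI; exact: mf1.
have mC' : measurable (f2 @^-1` C) by rewrite -[X in measurable X]setTI; exact: mf2.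
by transitivity (m1 (f1 @^-1` B) * m2 (f2 @^-1` C))%E;
  [exact: product_measure1E|rewrite p1// p2].
Qed.
End product_preserving.

(** Inversion is not continuous at 0. Writing 1 / x as x times the real power -1 of x^2 reduces it
    to a measurable power, and the factor x restores the value 0 at 0. *)
Lemma measurable_inv {R : realType} : measurable_fun setT (@GRing.inv R).
Proof.
rewrite [X in measurable_fun _ X](_ : _ = fun x : R => x * ((x ^+ 2) `^ (-1))).
  apply: measurable_funM => //.
  apply: (measurableT_comp (measurable_powR (-1))).
  exact: measurable_funX.
apply/funext => x; rewrite powR_inv1 ?sqr_ge0//.
have [->|x0] := eqVneq x 0; first by rewrite invr0 mul0r.
by field.
Qed.

(** * Majorants and measurability *)

Section majorant.
Context {R : realType}.
Local Notation mu := (@lebesgue_measure R).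

(** The one-variable majorant behind all kernel estimates: |t|^(-1/2) near 0 and |t|^(-3/2) at
    infinity, hence integrable. The value 1 at 0, where the formula alone would give 0, lets the
    pointwise bounds by [Lmaj] hold at 0 as well. *)
Definition Lmaj (t : R) : R :=
  if t == 0 then 1 else (Num.sqrt `|t| * (1 + `|t|))^-1.

Lemma Lmaj_ge0 t : 0 <= Lmaj t.
Proof.
rewrite /Lmaj; case: ifP => [_|_]; first exact: ler01.
by rewrite invr_ge0 mulr_ge0// ?sqrtr_ge0// addr_ge0.
Qed.

Lemma measurable_Lmaj : measurable_fun setT Lmaj.
Proof.
apply: measurable_fun_ifT => //=.
  exact: measurable_fun_eqr.
apply: (measurableT_comp measurable_inv).
apply: measurable_funM.
  apply: measurableT_comp => //; apply: continuous_measurable_fun.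
  exact: sqrt_continuous.
by apply: measurable_funD.
Qed.

(** On the positive half-line a primitive is 2 atan (sqrt x), with values in [0, pi). The shift to n
    + 2 orders the endpoints strictly already for n = 0. *)
Lemma Lmaj_integral_itv (n : nat) :
  (\int[mu]_(x in `[(n.+2%:R^-1)%R, (n.+2%:R)%R]) (Lmaj x)%:E <= pi%:E)%E.
Proof.
set a : R := n.+2%:R^-1; set b : R := n.+2%:R.
have a0 : 0 < a by rewrite invr_gt0.
have ab : a < b.
  rewrite /a /b; apply: (@lt_trans _ _ 1); last by rewrite ltr1n.
  by rewrite invf_lt1// ltr1n.
pose f (x : R) := (Num.sqrt x * (1 + x))^-1.
pose F : R -> R := 2 \*: (atan \o Num.sqrt).
have dF (x : R) : 0 < x -> is_derive x 1 F (f x).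
  move=> x0; rewrite /F.
  have sx : 0 < Num.sqrt x by rewrite sqrtr_gt0.
  have H0 : is_derive x 1 F (2 * ((1 + Num.sqrt x ^+ 2)^-1 * (2 * Num.sqrt x)^-1)).
    have H1 : is_derive x 1 (atan \o Num.sqrt) ((1 + Num.sqrt x ^+ 2)^-1 * (2 * Num.sqrt x)^-1).
      exact: (is_derive1_comp (is_derive1_atan _) (is_derive1_sqrt x0)).
    exact: (is_deriveZ 2 H1).
  apply: (is_derive_eq H0); rewrite sqr_sqrtr ?ltW// /f; field.
  by rewrite !gt_eqF// addr_gt0.
have cF (x : R) : 0 < x -> {for x, continuous F}.
  move=> x0; apply: differentiable_continuous; apply/derivable1_diffP.
  by have := dF x x0.
have cf (x : R) : 0 < x -> {for x, continuous f}.
  move=> x0; apply: cvgV; last first.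
    apply: cvgM; first exact: sqrt_continuous.
    by apply: cvgD; [exact: cvg_cst|exact: cvg_id].
  by rewrite gt_eqF// mulr_gt0 ?sqrtr_gt0// addr_gt0.
have -> : (\int[mu]_(x in `[a, b]) (Lmaj x)%:E = \int[mu]_(x in `[a, b]) (f x)%:E)%E.
  apply: eq_integral => x; rewrite inE/= in_itv/= => /andP[ax _].
  have x0 : 0 < x by exact: lt_le_trans ax.
  by rewrite /Lmaj gt_eqF// gtr0_norm.
rewrite (@continuous_FTC2 _ f F a b)//.
- rewrite /F -EFinB lee_fin !fctE/=.
  have := atan_ltpi2 (Num.sqrt b); have : 0 <= atan (Num.sqrt a).
    by rewrite -atan0; apply/ltW/lt_atan; rewrite sqrtr_gt0.
  rewrite /GRing.scale/=; lra.
- apply: continuous_in_subspaceT => x; rewrite inE/= in_itv/= => /andP[ax _].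
  exact/cf/(lt_le_trans a0).
- split.
  + move=> x; rewrite in_itv/= => /andP[ax _].
    by have [] := dF x (lt_trans a0 ax).
  + exact/cvg_at_right_filter/cF.
  + by apply/cvg_at_left_filter/cF/(lt_trans a0).
- move=> x; rewrite in_itv/= => /andP[ax _].
  rewrite derive1E; have [_ ->] := dF x (lt_trans a0 ax); by [].
Qed.

(** Monotone convergence carries the bound pi from the intervals [1 / (n + 2), n + 2] to the
    positive half-line; [Lmaj] is even, so a reflection settles the other half. *)
Lemma rint_Lmaj : rint mu Lmaj.
Proof.
pose F : nat -> set (measurableTypeR R) := fun n => [set` `[(n.+2%:R^-1 : R), n.+2%:R]].
have pos : (\int[mu]_(x in \bigcup_i F i) (Lmaj x)%:E <= pi%:E)%E.
  have H := @ge0_nondecreasing_set_cvg_integral _ (measurableTypeR R) R F (EFin \o Lmaj) mu.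
  have {}H : (\int[mu]_(x in F i) (Lmaj x)%:E)%E @[i --> \oo] -->
     (\int[mu]_(x in \bigcup_i F i) (Lmaj x)%:E)%E.
    apply: H => //.
    - move=> m n mn; apply/subsetPset => x; rewrite /F/= !in_itv/= => /andP[h1 h2].
      apply/andP; split.
        by rewrite (le_trans _ h1)// lef_pV2 ?posrE// ler_nat.
      by rewrite (le_trans h2)// ler_nat.
    - by move=> i; exact: measurable_itv.
    - move=> i; have mLE : measurable_fun setT (EFin \o Lmaj) by apply/measurable_EFinP; exact: measurable_Lmaj.
      exact: (measurable_funTS mLE).
    - by move=> i x _; rewrite lee_fin Lmaj_ge0.
  rewrite -(cvg_lim _ H)//; apply: lime_le.
    by apply/cvg_ex; eexists; exact: H.
  by apply: nearW => n; exact: Lmaj_integral_itv.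
have UF : \bigcup_i F i = `]0, +oo[%classic :> set R.
  apply/seteqP; split => x; rewrite /F/=.
    move=> [n _]; rewrite /= !in_itv/= andbT => /andP[h1 h2].
    by apply: lt_le_trans h1; rewrite invr_gt0.
  rewrite in_itv/= andbT => x0.
  have xV0 : 0 < x^-1 by rewrite invr_gt0.
  exists (maxn (Num.bound x) (Num.bound x^-1)) => //=.
  have h1 : x < (Num.bound x)%:R by apply: archi_boundP; exact: ltW.
  have h2 : x^-1 < (Num.bound x^-1)%:R by apply: archi_boundP; exact: ltW.
  set m := maxn _ _.
  have m1 : (Num.bound x)%:R <= m.+2%:R :> R by rewrite ler_nat /m; lia.
  have m2 : (Num.bound x^-1)%:R <= m.+2%:R :> R by rewrite ler_nat /m; lia.
  rewrite in_itv/=; apply/andP; split; last by rewrite ltW// (lt_le_trans h1).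
  rewrite -(invrK x) lef_pV2 ?posrE//.
  by rewrite ltW// (lt_le_trans h2).
rewrite UF in pos.
have Lsym x : Lmaj (- x) = Lmaj x by rewrite /Lmaj oppr_eq0 normrN.
have mL := measurable_Lmaj.
apply/integrableP; split; first exact/measurable_EFinP.
have -> : (\int[mu]_x `|(EFin \o Lmaj) x| = \int[mu]_x (Lmaj x)%:E)%E.
  by apply: eq_integral => x _ /=; rewrite ger0_norm// Lmaj_ge0.
have mLE : measurable_fun setT (EFin \o Lmaj) by apply/measurable_EFinP; exact: mL.
have mLT : measurable_fun (setT : set (measurableTypeR R)) (EFin \o Lmaj) by exact: mLE.
pose A : set (measurableTypeR R) := `]-oo, 0]%classic.
pose B : set (measurableTypeR R) := `]0, +oo[%classic.
have -> : (\int[mu]_x (Lmaj x)%:E = \int[mu]_(x in A `|` B) (Lmaj x)%:E)%E.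
  congr (integral _ _ _); apply/seteqP; split => x //= _.
  by rewrite /A /B/= !in_itv/= andbT; case: leP; [left|right].
rewrite ge0_integral_setU//=; last 5 first.
- exact: measurable_itv.
- exact: measurable_itv.
- exact: (measurable_funTS mLT).
- by move=> x _; rewrite lee_fin Lmaj_ge0.
- apply/disj_setPS => x /=; rewrite /A /B/= !in_itv/= andbT => -[]; case: leP => //.
have := @ge0_integration_by_substitution0 R (EFin \o Lmaj) mLE.
move=> /(_ (fun r => Lmaj_ge0 r)) H.
have -> : (\int[mu]_(x in A) (Lmaj x)%:E = \int[mu]_(x in A) (EFin \o Lmaj) (- (x : R))%R)%E.
  by apply: eq_integral => x _; rewrite /= Lsym.
rewrite -H -integral_itv_obnd_cbnd; last exact: measurable_funTS.
by apply: lte_add_pinfty; apply: (le_lt_trans pos); rewrite ltry.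
Qed.
End majorant.

(** * Borel measurability of continuous functions on products *)

Section continuous_measurability.
Context {R : realType}.

(** The openness predicate is a parameter because the sigma-algebra lives on products of
    [measurableTypeR R] and the topology on products of [R], two structures on one carrier. *)
Definition has_measurable_basis d (T : measurableType d) (op : set T -> Prop) :=
  exists b : nat -> set T, (forall n, measurable (b n)) /\
    forall U x, op U -> U x -> exists n, b n x /\ b n `<=` U.

(** An open set is the union of the basic sets that it contains, and there are countably many of
    these. *)
Lemma open_measurable_of_basis d (T : measurableType d) (op : set T -> Prop) :
  has_measurable_basis op -> forall U, op U -> measurable U.
Proof.
move=> [b [mb bU]] U oU.
have -> : U = \bigcup_(n in [set n | b n `<=` U]) b n.
  apply/seteqP; split => [x Ux|x [n /= nU] nx]; last exact: nU.
  by have [n [nx nU]] := bU U x oU Ux; exists n.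
exact: bigcup_measurable.
Qed.

Lemma real_measurable_basis :
  has_measurable_basis (fun U : set (measurableTypeR R) => open (U : set R)).
Proof.
pose g (c : rat * rat) : set (measurableTypeR R) := [set` `](ratr c.1 : R), ratr c.2[].
exists (fun n => if unpickle n is Some c then g c else set0); split.
  by move=> n; case: unpickle => [c|] //; exact: measurable_itv.
move=> U x oU Ux.
have : nbhs (x : R) U by exact: open_nbhs_nbhs.
move=> /nbhs_ballP[e /= e0 eU].
have [q1] : exists q, ratr q \in `]x - e, x[ by apply: rat_in_itvoo; rewrite gtrBl.
have [q2] : exists q, ratr q \in `]x, x + e[ by apply: rat_in_itvoo; rewrite ltrDl.
rewrite !in_itv/= => /andP[q2x q2e] /andP[q1e q1x].
exists (pickle (q1, q2)); rewrite pickleK /g/=; split; first by rewrite in_itv/= q1x.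
move=> y; rewrite /= in_itv/= => /andP[y1 y2]; apply: eU.
rewrite -ball_normE/= ltr_norml; apply/andP; split; lra.
Qed.

Lemma real2_measurable_basis :
  has_measurable_basis (fun U : set (measurableTypeR R * measurableTypeR R) =>
    open (U : set (R * R)%type)).
Proof.
have [b [mb bU]] := real_measurable_basis.
exists (fun n => if unpickle n is Some (i, j) then b i `*` b j else set0); split.
  by move=> n; case: unpickle => [[i j]|] //; exact: measurableX.
move=> U [x y] oU Uxy.
have : nbhs ((x, y) : R * R) U by exact: open_nbhs_nbhs.
move=> [[A B] /= [Ax By] ABU].
move: Ax By; rewrite !nbhsE => -[A' [oA' A'x] A'A] [B' [oB' B'y] B'B].
have [i [ix iA]] := bU A' x oA' A'x; have [j [jy jB]] := bU B' y oB' B'y.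
exists (pickle (i, j)); rewrite pickleK; split => // -[u v] [/= /iA/A'A Au /jB/B'B Bv].
exact: (ABU (u, v)).
Qed.

Lemma coords_measurable_basis :
  has_measurable_basis (fun U : set (coords (measurableTypeR R)) =>
    open (U : set (coords R))).
Proof.
have [b [mb bU]] := real2_measurable_basis.
exists (fun n => if unpickle n is Some (i, j) then b i `*` b j else set0); split.
  by move=> n; case: unpickle => [[i j]|] //; exact: measurableX.
move=> U [x y] oU Uxy.
have : nbhs ((x, y) : coords R) U by exact: open_nbhs_nbhs.
move=> [[A B] /= [Ax By] ABU].
move: Ax By; rewrite !nbhsE => -[A' [oA' A'x] A'A] [B' [oB' B'y] B'B].
have [i [ix iA]] := bU A' x oA' A'x; have [j [jy jB]] := bU B' y oB' B'y.
exists (pickle (i, j)); rewrite pickleK; split => // -[u v] [/= /iA/A'A Au /jB/B'B Bv].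
exact: (ABU (u, v)).
Qed.

Lemma open_measurable2 (U : set (R * R)%type) : open U ->
  measurable (U : set (measurableTypeR R * measurableTypeR R)).
Proof. exact: (open_measurable_of_basis real2_measurable_basis). Qed.

Lemma open_measurable4 (U : set (coords R)) : open U ->
  measurable (U : set (coords (measurableTypeR R))).
Proof. exact: (open_measurable_of_basis coords_measurable_basis). Qed.

Lemma continuous_measurable2 (f : R * R -> R) : continuous f ->
  measurable_fun setT (f : measurableTypeR R * measurableTypeR R -> measurableTypeR R).
Proof.
move=> cf; apply: (@measurability _ _ _ _ _ _ (@RGenOInfty.G R)).
  exact: RGenOInfty.measurableE.
move=> _ [_ [x ->] <-]; rewrite setTI; apply: open_measurable2.
apply: open_comp; [by move=> y _; exact: cf|exact: interval_open].
Qed.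

Lemma continuous_measurable4 (f : coords R -> R) : continuous f ->
  measurable_fun setT (f : coords (measurableTypeR R) -> measurableTypeR R).
Proof.
move=> cf; apply: (@measurability _ _ _ _ _ _ (@RGenOInfty.G R)).
  exact: RGenOInfty.measurableE.
move=> _ [_ [x ->] <-]; rewrite setTI; apply: open_measurable4.
apply: open_comp; [by move=> y _; exact: cf|exact: interval_open].
Qed.

End continuous_measurability.

(** * Integrals of derivatives *)

Section FTC.
Context {R : realType}.
Local Notation mu := (@lebesgue_measure R).

Lemma Rint_derive_itv (f g : R -> R) (a b : R) : a < b ->
  (forall x : R, is_derive x 1 f (g x)) -> continuous g ->
  rint mu (fun x => \1_(`[a, b]%classic : set R) x * g x) /\
  \int[mu]_x (\1_(`[a, b]%classic : set R) x * g x) = f b - f a.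
Proof.
move=> ab dfg cg.
have E : (fun x => \1_(`[a, b]%classic : set R) x * g x) = g \_ `[a, b]%classic.
  by apply/funext => x; rewrite patch_indic/= mulrC.
have cf : continuous f.
  move=> x; apply: differentiable_continuous; apply/derivable1_diffP.
  by have := dfg x.
rewrite E; split.
  have : mu.-integrable `[a, b] (EFin \o g).
    apply: continuous_compact_integrable; first exact: segment_compact.
    exact: continuous_subspaceT.
  have mab : measurable (`[a, b]%classic : set (measurableTypeR R)) by exact: measurable_itv.
  move=> H; have := (@integrable_mkcond _ _ _ mu _ (EFin \o g) mab).1 H.
  by rewrite /rint -restrict_EFin.
rewrite -Rintegral_mkcond /Rintegral (@continuous_FTC2 _ g f a b)//.
- exact: continuous_subspaceT.
- split.
  + by move=> x _; have := dfg x.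
  + exact/cvg_at_right_filter/cf.
  + exact/cvg_at_left_filter/cf.
- by move=> x _; rewrite derive1E; have [_ ->] := dfg x.
Qed.

Lemma Rint_derive_compact_support (f g : R -> R) (M : R) :
  (forall x : R, is_derive x 1 f (g x)) -> continuous g ->
  (forall x, M < `|x| -> f x = 0 /\ g x = 0) ->
  rint mu g /\ Rintegral mu setT g = 0.
Proof.
move=> dfg cg fM.
(* The endpoints must lie strictly beyond M, where f and g vanish, and the interval must be
   nondegenerate for negative M too. *)
pose a := `|M| + 1.
have aa : - a < a.
  by rewrite -subr_gt0 opprK addr_gt0// ltr_wpDl.
have Ma : M < a by rewrite /a (le_lt_trans (ler_norm _))// ltrDl.
have := Rint_derive_itv aa dfg cg.
have -> : (fun x => \1_(`[(- a), a]%classic : set R) x * g x) = g.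
  apply/funext => x; rewrite indicE mem_setE in_itv/= -ler_norml.
  case: lerP => xa; first by rewrite mul1r.
  by rewrite mul0r; have [_ ->] := fM x (lt_trans Ma xa).
have na : `|a| = a by rewrite ger0_norm// addr_ge0.
have [-> _] : f a = 0 /\ g a = 0 by apply: fM; rewrite na.
have [-> _] : f (- a) = 0 /\ g (- a) = 0 by apply: fM; rewrite normrN na.
by rewrite subr0.
Qed.

End FTC.

(** * Smooth functions *)

Section directional.
Context {R : realType} {X Y : normedModType R}.

Lemma is_derive_line (f : X -> R) (q v : X) (t : R) :
  derivable f (q + t *: v) v ->
  is_derive t 1 (fun s : R => f (q + s *: v)) ('D_v f (q + t *: v)).
Proof.
move=> df.
have E : (fun h : R => h^-1 *: (((fun s : R => f (q + s *: v)) \o shift t) (h *: (1:R)) - f (q + t *: v)))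
  = (fun h : R => h^-1 *: ((f \o shift (q + t *: v)) (h *: v) - f (q + t *: v))).
  apply/funext => h /=; congr (_ *: (f _ - _)).
  by rewrite [h%:A]mulr1 scalerDl addrCA.
split; first by rewrite /derivable E.
by rewrite /derive E.
Qed.

(** The difference quotients of the two sides coincide for every increment, before any limit is
    taken. *)
Lemma derive_affine (f : X -> R) (A : Y -> X) (L : Y -> X) (p v : Y) :
  (forall h : R, A (h *: v + p) = h *: L v + A p) ->
  'D_v (f \o A) p = 'D_(L v) f (A p).
Proof.
move=> AL; rewrite /derive.
have -> : (fun h : R => h^-1 *: (((f \o A) \o shift p) (h *: v) - (f \o A) p))
  = (fun h : R => h^-1 *: ((f \o shift (A p)) (h *: L v) - f (A p))) => //.
by apply/funext => h /=; rewrite AL.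
Qed.

Lemma derive_near0 (f : X -> R) (p v : X) :
  (\forall q \near p, f q = 0) -> 'D_v f p = 0.
Proof.
move=> f0.
have -> : 'D_v f p = 'D_v (cst (0 : R)) p.
  by apply: near_eq_derive.
by rewrite derive_cst.
Qed.

Lemma derive_comp1 (h : R -> R) (f : X -> R) (p v : X) :
  derivable h (f p) 1 -> differentiable f p ->
  differentiable (h \o f) p /\ 'D_v (h \o f) p = derive1 h (f p) * 'D_v f p.
Proof.
move=> /derivable1_diffP dh df; have dhf := differentiable_comp df dh.
split => //; rewrite deriveE// diff_comp//= [in RHS]deriveE//.
rewrite derive1E'//=.
rewrite -[in LHS](mulr1 ('d f p v)) -[X in 'd h _ X]/('d f p v *: (1 : R)).
by rewrite linearZ/= mulrC.
Qed.

End directional.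

(** * Smooth functions of one variable and the flat function *)

Section smooth1.
Context {R : realType}.

Definition smooth1 (h : R -> R) := forall n x, derivable (derive1n n h) x 1.

(** Iterated derivatives need no formula: they never leave a class of derivable functions that is
    stable under derivation. *)
Lemma smooth1_class (P : (R -> R) -> Prop) :
  (forall h, P h -> (forall x, derivable h x 1) /\ P (derive1 h)) ->
  forall h, P h -> smooth1 h.
Proof.
move=> PP h Ph n.
suff : P (derive1n n h) by move=> /PP[].
elim: n => [|n IHn]; first by [].
by rewrite derive1nS; apply PP.
Qed.

Lemma smooth1_derive h : smooth1 h -> smooth1 (derive1 h).
Proof. by move=> sh n x; rewrite -derive1Sn; exact: sh. Qed.

Lemma smooth1_derivable h x : smooth1 h -> derivable h x 1.
Proof. by move=> sh; exact: (sh 0%N). Qed.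

(** The functions t^(-n) exp(-1/t), extended by 0: every derivative of the classical flat function
    exp(-1/t) is a linear combination of them. *)
Definition flat (n : nat) (t : R) : R :=
  if 0 < t then t ^- n * expR (- t^-1) else 0.

(** With s = 1/t, exp(s) = exp(s / (n+2))^(n+2) >= (s / (n+2))^(n+2), which beats t^(-n) by two
    powers of t. These two powers annihilate the difference quotient at 0, and later bound the
    derivative of [bump]. *)
Lemma flat_bound n : exists C : R, 0 <= C /\ forall t, `|flat n t| <= C * t ^+ 2.
Proof.
exists (n.+2%:R ^+ n.+2); split; first exact: exprn_ge0.
move=> t; rewrite /flat; case: ifPn => t0; last first.
  by rewrite normr0; apply: mulr_ge0; [exact: exprn_ge0|exact: sqr_ge0].
rewrite ger0_norm; last by rewrite mulr_ge0 ?expR_ge0// invr_ge0 exprn_ge0// ltW.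
have tV : 0 < t^-1 by rewrite invr_gt0.
have k0 : 0 < n.+2%:R :> R by [].
have : (t^-1 / n.+2%:R) ^+ n.+2 <= expR (t^-1).
  have -> : expR t^-1 = expR (t^-1 / n.+2%:R) ^+ n.+2.
    rewrite -expRM_natl; congr expR; rewrite mulrC divfK// gt_eqF//.
  rewrite lerXn2r ?nnegrE ?expR_ge0 ?divr_ge0 ?ltW//.
  by rewrite (lt_le_trans _ (expR_ge1Dx _))// ltrDr.
rewrite expr_div_n ler_pdivrMr ?exprn_gt0// => H.
rewrite expRN ler_pdivrMr ?expR_gt0//.
rewrite exprVn in H.
have -> : t ^- n = t ^+ 2 * t ^- n.+2.
  rewrite [t ^+ n.+2]exprS [t ^+ n.+1]exprS; field.
  by rewrite ?expf_neq0 ?gt_eqF.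
rewrite [leRHS](_ : _ = t ^+ 2 * (expR t^-1 * n.+2%:R ^+ n.+2)); last by ring.
by rewrite ler_wpM2l ?sqr_ge0.
Qed.

Lemma is_derive_flat n (t : R) :
  is_derive t 1 (flat n) (- n%:R * flat n.+1 t + flat n.+2 t).
Proof.
have [t0|t0|t0] := ltgtP 0 t.
- have Hi : is_derive t 1 (@GRing.inv R) (- t ^- 2).
    have := @is_deriveV _ id t 1 1 _ _; rewrite gt_eqF// => /(_ isT) H.
    by apply: is_derive_eq; rewrite scaler1.
  have He : is_derive t 1 (fun s : R => expR (- s^-1)) (expR (- t^-1) * t ^- 2).
    have := @is_derive1_comp _ expR (- (@GRing.inv R)) t _ _ (is_derive_expR _) (is_deriveN Hi).
    by rewrite opprK.
  have Hn : is_derive t 1 (fun s : R => s ^- n) (- n%:R * t ^- n.+1).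
    have := is_deriveX n Hi => H.
    have E : (fun s : R => s ^- n) = (@GRing.inv R) ^+ n.
      by apply/funext => s; rewrite exprfctE exprVn.
    rewrite E; apply: (is_derive_eq H).
    case: n {He H E} => [|n]; first by rewrite !mul0r oppr0 mul0r scale0r.
    change (n.+1%:R * t^-1 ^+ n * - t ^- 2 = - n.+1%:R * t ^- n.+2).
    rewrite exprVn [t ^+ n.+2]exprS [t ^+ n.+1]exprS; field.
    by rewrite ?expf_neq0 ?gt_eqF.
  apply: (@near_eq_is_derive _ _ _ ((fun s : R => s ^- n) * (fun s : R => expR (- s^-1)))).
  + near=> s; rewrite /flat ifT//.
    near: s; exact: lt_nbhsr.
  + apply: (is_derive_eq (is_deriveM Hn He)).
    rewrite /flat t0.
    change (t ^- n * (expR (- t^-1) / t ^+ 2) + expR (- t^-1) * (- n%:R / t ^+ n.+1) =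
      - n%:R * (t ^- n.+1 * expR (- t^-1)) + t ^- n.+2 * expR (- t^-1)).
    rewrite [t ^+ n.+2]exprS [t ^+ n.+1]exprS; field.
    by rewrite ?expf_neq0 ?gt_eqF.
- rewrite /flat !ltNge !(ltW t0)/= mulr0 addr0.
  apply: (@near_eq_is_derive _ _ _ (cst 0)).
  + near=> s; rewrite /flat ltNge ltW//.
    near: s; exact: lt_nbhsl.
- rewrite -t0 {2 3}/flat ltxx mulr0 addr0.
  have [C [C0 HC]] := flat_bound n.
  have Hlim : h^-1 *: (flat n (h *: 1 + 0) - flat n 0) @[h --> 0^'] --> (0 : R).
    apply/cvgr0Pnorm_le => e e0.
    (* The quotient at 0 is at most C |h|. Only [0 <= C] is known, so the radius is taken as e / (C
       + 1). *)
    have C1 : 0 < C + 1 by rewrite ltr_wpDl.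
    near=> h.
    have h0 : h != 0 by near: h; exact: nbhs_dnbhs_neq.
    rewrite {2}/flat ltxx subr0 addr0 [h *: 1]mulr1 /GRing.scale/= normrM normfV.
    rewrite ler_pdivrMl ?normr_gt0// (le_trans (HC h))//.
    rewrite -real_normK ?num_real// expr2 mulrA mulrC ler_wpM2l//.
    have : `|h| <= e / (C + 1).
      near: h; apply: nbhs_dnbhs.
      have := @nbhs0_le R R (e / (C + 1)); apply.
      exact: divr_gt0.
    rewrite ler_pdivlMr// => H; apply: le_trans H.
    by rewrite mulrC ler_wpM2l// lerDl.
  split; first by apply/cvg_ex; exists 0.
  exact: cvg_lim.
Unshelve. all: by end_near. Qed.

(** The derivative of one [flat n] is a combination of two others, so the linear span is the
    smallest convenient class for [smooth1_class]. *)
Inductive flat_span : (R -> R) -> Prop :=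
| flat_base n : flat_span (flat n)
| flat_add f g : flat_span f -> flat_span g -> flat_span (f + g)
| flat_scale (k : R) f : flat_span f -> flat_span (k *: f).

Lemma flat_span_derive h : flat_span h ->
  (forall x, derivable h x 1) /\ flat_span (derive1 h).
Proof.
elim => [n|f g _ [df Df] _ [dg Dg]|k f _ [df Df]].
- split; first by move=> x; have := is_derive_flat n x.
  have -> : derive1 (flat n) = - n%:R *: flat n.+1 + flat n.+2.
    by apply/funext => x; rewrite derive1E; have [_ ->] := is_derive_flat n x.
  by apply: flat_add; [apply: flat_scale|]; exact: flat_base.
- split; first by move=> x; exact: derivableD.
  have -> : derive1 (f + g) = derive1 f + derive1 g by apply/funext => x; rewrite derive1E deriveD// -!derive1E.
  exact: flat_add.
- split; first by move=> x; exact: derivableZ.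
  have -> : derive1 (k *: f) = k *: derive1 f by apply/funext => x; rewrite derive1E deriveZ// -derive1E.
  exact: flat_scale.
Qed.

Definition bump : R -> R := flat 0.

Lemma smooth1_bump : smooth1 bump.
Proof. exact: (smooth1_class flat_span_derive (flat_base 0)). Qed.

Lemma bump_gt0 t : 0 < t -> 0 < bump t.
Proof. by move=> t0; rewrite /bump /flat t0 expr0 invr1 mul1r expR_gt0. Qed.

Lemma bump_le0 t : t <= 0 -> bump t = 0.
Proof. by move=> t0; rewrite /bump /flat ltNge t0. Qed.

Lemma bump_ge0 t : 0 <= bump t.
Proof. by case: (lerP t 0) => [/bump_le0 ->|/bump_gt0/ltW]. Qed.

Lemma bump_le1 t : bump t <= 1.
Proof.
rewrite /bump /flat; case: ifP => // t0.
by rewrite expr0 invr1 mul1r -expR0 ler_expR oppr_le0 invr_ge0 ltW.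
Qed.

(** For t > 0 the sequence is exp(-1 / (n t)), which increases to 1. The limit is the indicator of
    the open half-line, exact at t = 0, so open conditions are approximated by smooth functions at
    every point. *)
Lemma bump_cvg (t : R) :
  bump (n%:R * t) @[n --> \oo] --> (if 0 < t then 1 else 0 : R).
Proof.
case: ifPn => t0; last first.
  apply: cvg_near_cst; apply: nearW => n; apply: bump_le0.
  by rewrite mulr_ge0_le0// leNgt.
have H : - (n%:R * t)^-1 @[n --> \oo] --> (0 : R).
  rewrite -oppr0; apply: cvgN.
  have : t^-1 * n%:R^-1 @[n --> \oo] --> t^-1 * (0 : R).
    apply: cvgMr; apply/gtr0_cvgV0.
      near=> n; rewrite ltr0n; near: n; exact: nbhs_infty_gt.
    exact: cvgr_idn.
  rewrite mulr0; apply: cvg_trans; apply: near_eq_cvg; apply: nearW => n.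
  by rewrite invfM mulrC.
have : expR (- (n%:R * t)^-1) @[n --> \oo] --> (1 : R).
  have c0 := @continuous_expR R 0; rewrite -[X in _ --> X]expR0.
  exact: (@cvg_comp _ _ _ (fun n : nat => - (n%:R * t)^-1) expR _ _ _ H c0).
apply: cvg_trans; apply: near_eq_cvg; near=> n.
rewrite /bump /flat ifT ?expr0 ?invr1 ?mul1r//.
by rewrite mulr_gt0// ltr0n; near: n; exact: nbhs_infty_gt.
Unshelve. all: by end_near. Qed.

Lemma derive_bump_le0 t : t <= 0 -> derive1 bump t = 0.
Proof.
move=> t0; rewrite derive1E; have [_ ->] := is_derive_flat 0 t.
by rewrite /flat !ltNge t0/= mulr0 addr0.
Qed.

(** Derivation preserves the plane spanned by cosine and sine, so both are treated at once by a
    two-parameter class. *)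
Lemma smooth1_cos_sin (a b : R) : smooth1 (a *: cos + b *: sin).
Proof.
apply: (smooth1_class (P := fun h => exists a b : R, h = a *: cos + b *: sin)).
  move=> h [c [d' ->]]; split.
    by move=> x; apply: derivableD; apply: derivableZ.
  exists d', (- c); apply/funext => x.
  rewrite derive1E; have H : is_derive x 1 (c *: cos + d' *: sin : R -> R) (c *: (- sin x) + d' *: cos x).
    exact: is_deriveD.
  by have [_ ->] := H; rewrite addrC !fctE scalerN scaleNr.
by exists a, b.
Qed.

End smooth1.

(** * Smooth functions of the four real coordinates *)

Section smooth_functions.
Context {R : realType}.
Local Notation T := (coords R).
Implicit Types (f g : T -> R) (v p : T).

Lemma smooth_class (P : (T -> R) -> Prop) :
  (forall f, P f -> (forall p, differentiable f p) /\ forall v, P ('D_v f)) ->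
  forall f, P f -> smooth f.
Proof.
move=> PP f Pf s.
suff : P (iterD s f) by move=> /PP[].
by elim: s => [|v s IHs]//=; apply PP.
Qed.

Lemma smooth_differentiable f p : smooth f -> differentiable f p.
Proof. by move=> sf; exact: (sf [::]). Qed.

Lemma smooth_continuous f : smooth f -> continuous f.
Proof. by move=> sf p; exact/differentiable_continuous/smooth_differentiable. Qed.

Lemma smooth_derivable f p v : smooth f -> derivable f p v.
Proof. by move=> sf; exact/diff_derivable/smooth_differentiable. Qed.

Lemma smooth_derive f v : smooth f -> smooth ('D_v f).
Proof.
move=> sf s p; have -> : iterD s ('D_v f) = iterD (rcons s v) f.
  by elim: s {p} => [|w s IHs]//=; rewrite IHs.
exact: sf.
Qed.

(** By the Leibniz and chain rules this class is stable under directional derivatives, so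
    [smooth_class] gives closure under all the operations at once. Inverse and square root have
    their own constructors: they are smooth only off 0 and on the positive half-line, while
    [sc_comp] asks for smoothness on the whole line. *)
Inductive smooth_closure : (T -> R) -> Prop :=
| sc_smooth f : smooth f -> smooth_closure f
| sc_add f g : smooth_closure f -> smooth_closure g -> smooth_closure (f + g)
| sc_mul f g : smooth_closure f -> smooth_closure g -> smooth_closure (f * g)
| sc_comp h f : smooth1 h -> smooth_closure f -> smooth_closure (h \o f)
| sc_inv f : (forall p, f p != 0) -> smooth_closure f ->
    smooth_closure (fun p => (f p)^-1)
| sc_sqrt f : (forall p, 0 < f p) -> smooth_closure f ->
    smooth_closure (Num.sqrt \o f).

Lemma smooth_cst (k : R) : smooth (cst k : T -> R).
Proof.
apply: (smooth_class (P := fun f => exists k : R, f = cst k)); last by exists k.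
move=> f [l ->]; split => [p|v]; first exact: differentiable_cst.
by exists 0; apply/funext => p; rewrite derive_cst.
Qed.

Lemma derivableV' (f : T -> R) p v : f p != 0 -> differentiable f p ->
  differentiable (fun q => (f q)^-1) p /\
  'D_v (fun q => (f q)^-1) p = - 'D_v f p * (f p)^-1 * (f p)^-1.
Proof.
move=> fp0 df; have dfp : derivable f p v by exact: diff_derivable.
split; first exact: differentiableV.
rewrite deriveV//; change (- f p ^- 2 * 'D_v f p = - 'D_v f p * (f p)^-1 * (f p)^-1).
by field.
Qed.

Lemma derive_sqrt' (f : T -> R) p v : 0 < f p -> differentiable f p ->
  differentiable (Num.sqrt \o f) p /\
  'D_v (Num.sqrt \o f) p = 2^-1 * (Num.sqrt (f p))^-1 * 'D_v f p.
Proof.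
move=> fp0 df.
have [ds Ds] := is_derive1_sqrt fp0.
have [H ->] := derive_comp1 v ds df; split => //.
by rewrite derive1E Ds invfM.
Qed.

Lemma smooth_closureP f : smooth_closure f -> smooth f.
Proof.
apply: smooth_class => {}f.
elim => [{}f sf|{}f g sf [df Df] sg [dg Dg]|{}f g sf [df Df] sg [dg Dg]|h {}f sh sf [df Df]
  |{}f f0 sf [df Df]|{}f f0 sf [df Df]].
- split => [p|v]; first exact: smooth_differentiable.
  exact/sc_smooth/smooth_derive.
- split => [p|v]; first exact: differentiableD.
  have -> : 'D_v (f + g) = 'D_v f + 'D_v g.
    by apply/funext => p; rewrite deriveD//; exact: diff_derivable.
  exact: sc_add.
- split => [p|v]; first exact: differentiableM.
  have -> : 'D_v (f * g) = f * 'D_v g + g * 'D_v f.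
    by apply/funext => p; rewrite deriveM//; exact: diff_derivable.
  by apply: sc_add; apply: sc_mul.
- have H p v := derive_comp1 v (smooth1_derivable sh) (df p).
  split => [p|v]; first by have [] := H p p.
  have -> : 'D_v (h \o f) = (derive1 h \o f) * 'D_v f.
    by apply/funext => p; have [_ ->] := H p v.
  apply: sc_mul => //; apply: sc_comp => //; exact: smooth1_derive.
- have H p v := derivableV' v (f0 p) (df p).
  split => [p|v]; first by have [] := H p p.
  have -> : 'D_v (fun p => (f p)^-1) = (cst (-1) * 'D_v f) * ((fun p => (f p)^-1) * (fun p => (f p)^-1)).
    by apply/funext => p; have [_ ->] := H p v; rewrite !fctE mulN1r mulrA.
  apply: sc_mul; last by apply: sc_mul; apply: sc_inv.
  by apply: sc_mul => //; exact/sc_smooth/smooth_cst.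
- have H p v := derive_sqrt' v (f0 p) (df p).
  split => [p|v]; first by have [] := H p p.
  have -> : 'D_v (Num.sqrt \o f) = (cst 2^-1 * (fun p => ((Num.sqrt \o f) p)^-1)) * 'D_v f.
    by apply/funext => p; have [_ ->] := H p v.
  apply: sc_mul => //; apply: sc_mul; first exact/sc_smooth/smooth_cst.
  by apply: sc_inv; [move=> p; rewrite gt_eqF// sqrtr_gt0|apply: sc_sqrt].
Qed.

Lemma smoothD f g : smooth f -> smooth g -> smooth (fun p => f p + g p).
Proof. by move=> sf sg; apply/smooth_closureP/sc_add; exact: sc_smooth. Qed.

Lemma smoothM f g : smooth f -> smooth g -> smooth (fun p => f p * g p).
Proof. by move=> sf sg; apply/smooth_closureP/sc_mul; exact: sc_smooth. Qed.

Lemma smoothB f g : smooth f -> smooth g -> smooth (fun p => f p - g p).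
Proof.
move=> sf sg; have -> : (fun p => f p - g p) = (fun p => f p + cst (-1) p * g p).
  by apply/funext => p; rewrite /cst mulN1r.
apply: smoothD => //; apply: smoothM => //; exact: smooth_cst.
Qed.

Lemma smooth_comp h f : smooth1 h -> smooth f -> smooth (fun p => h (f p)).
Proof. by move=> sh sf; apply/smooth_closureP/sc_comp => //; exact: sc_smooth. Qed.

Lemma smoothV f : (forall p, f p != 0) -> smooth f -> smooth (fun p => (f p)^-1).
Proof. by move=> f0 sf; apply/smooth_closureP/sc_inv => //; exact: sc_smooth. Qed.

Lemma smooth_sqrt f : (forall p, 0 < f p) -> smooth f ->
  smooth (fun p => Num.sqrt (f p)).
Proof. by move=> f0 sf; apply/smooth_closureP/sc_sqrt => //; exact: sc_smooth. Qed.

Lemma derive_coord (L : T -> R) p v :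
  (forall (h : R) v p, L (h *: v + p) = h * L v + L p) -> 'D_v L p = L v.
Proof.
move=> HL; apply: cvg_lim => //; apply: cvg_near_cst; near=> h.
rewrite /= HL addrK.
change (h^-1 * (h * L v) = L v).
rewrite mulrA mulVf ?mul1r//; near: h; exact: nbhs_dnbhs_neq.
Unshelve. all: by end_near. Qed.

Lemma differentiable_linear (L : T -> R) p :
  (forall (h : R) v p, L (h *: v + p) = h * L v + L p) -> continuous L ->
  differentiable L p.
Proof.
move=> HL cL; have linL : linear (L : T -> R^o) by move=> h u w; exact: HL.
pose L' : {linear T -> R^o} := HB.pack L (GRing.isLinear.Build R T R^o *:%R L linL).
exact: (@linear_differentiable _ _ _ L').
Qed.

Lemma smooth_linear (L : T -> R) (dL : forall p, differentiable L p)
  (HL : forall (h : R) v p, L (h *: v + p) = h * L v + L p) : smooth L.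
Proof.
apply: (smooth_class (P := fun f => f = L \/ exists k : R, f = cst k)); last by left.
move=> f [->|[k ->]]; split => //.
- by move=> v; right; exists (L v); apply/funext => p; exact: derive_coord.
- by move=> v; right; exists 0; apply/funext => p; rewrite derive_cst.
Qed.

Lemma smooth_coords : [/\ smooth (fun p : T => p.1.1), smooth (fun p : T => p.1.2),
  smooth (fun p : T => p.2.1) & smooth (fun p : T => p.2.2)].
Proof.
have c1 : continuous (fst : T -> R * R) by move=> p; exact: cvg_fst.
have c2 : continuous (snd : T -> R * R) by move=> p; exact: cvg_snd.
have d1 : continuous (fst : R * R -> R) by move=> p; exact: cvg_fst.
have d2 : continuous (snd : R * R -> R) by move=> p; exact: cvg_snd.
split; apply: smooth_linear => // p; apply: differentiable_linear => //.
- by move=> q; apply: (continuous_comp (@c1 q)); exact: d1.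
- by move=> q; apply: (continuous_comp (@c1 q)); exact: d2.
- by move=> q; apply: (continuous_comp (@c2 q)); exact: d1.
- by move=> q; apply: (continuous_comp (@c2 q)); exact: d2.
Qed.

(** Let A be the affine map that freezes the second pair of coordinates. The functions f \o A with f
    smooth form a stable class, a derivative along v becoming one of f along (v.1, 0). *)
Lemma smooth_slice f (w : R * R) : smooth f -> smooth (fun p : T => f (p.1, w)).
Proof.
move=> sf; pose A (p : T) : T := (p.1, w).
have HA (h : R) v p : A (h *: v + p) = h *: ((v.1, 0) : T) + A p.
  rewrite /A; congr pair => //=.
  by rewrite -[LHS]add0r; congr +%R; rewrite scaler0.
have dA p : differentiable A p.
  have -> : A = (fun p => ((p.1, 0) : T) + (0, w)).
    by apply/funext => q; rewrite /A; congr pair => /=; rewrite ?addr0 ?add0r.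
  apply: differentiableD; last exact: differentiable_cst.
  pose L (p : T) : T := (p.1, 0).
  have linL : linear L.
    by move=> h u u'; rewrite /L; congr pair; rewrite /= scaler0 addr0.
  pose L' : {linear T -> T} := HB.pack L (GRing.isLinear.Build R T T *:%R L linL).
  apply: (@linear_differentiable _ _ _ L').
  move=> q; exact: (@cvg_pair _ _ _ (nbhs q) _ _ _ _ _ fst (fun=> 0 : R * R) cvg_fst (cvg_cst _)).
apply: (smooth_class (P := fun g => exists2 f, smooth f & g = f \o A)); last by exists f.
move=> _ [{sf}f sf ->]; split => [p|v].
  apply: differentiable_comp => //; exact: smooth_differentiable.
exists ('D_((v.1, 0) : T) f); first exact: smooth_derive.
apply/funext => p.
exact: (@derive_affine _ T T f A (fun v : T => (v.1, 0) : T) p v (fun h => HA h v p)).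
Qed.

End smooth_functions.

(** * The covering of O *)

Section trigonometry.
Local Open Scope complex_scope.
Context {R : realType}.

Lemma cosD2pi_int (x : R) (k : int) : cos (x + 2 * k%:~R * pi) = cos x.
Proof.
have H n (y : R) : cos (y + 2 * n%:R * pi) = cos y.
  rewrite -[in RHS](periodicn (@cosD2pi R) n y); congr cos; congr +%R.
  by rewrite -mulr_natr -(mulr_natr pi); ring.
case: k => n; first exact: H.
rewrite -[in RHS](subrK (2 * n.+1%:R * pi) x) H; congr cos.
by rewrite NegzE mulrNz mulrN mulNr.
Qed.

Lemma sinD2pi_int (x : R) (k : int) : sin (x + 2 * k%:~R * pi) = sin x.
Proof. by rewrite -!cosBpihalf addrAC cosD2pi_int. Qed.

Lemma floor_itv_period (P x : R) : 0 < P ->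
  0 <= x - (Num.floor (x / P))%:~R * P < P.
Proof.
move=> P0; have /andP[h1 h2] := floor_itv (x / P).
rewrite subr_ge0 -ler_pdivlMr// h1/= ltrBlDr.
by move: h2; rewrite ltr_pdivrMr// intrD mulrDl mul1r addrC.
Qed.

(** Reduce x to y in [0, 2 pi). There 1 - cos y = 2 sin^2(y/2), and sin(y/2) is positive unless y =
    0. *)
Lemma cos_eq1 (x : R) : cos x = 1 -> exists k : int, x = 2 * k%:~R * pi.
Proof.
move=> cx; have pi2 : 0 < 2 * pi :> R by rewrite mulr_gt0// pi_gt0.
set k := Num.floor (x / (2 * pi)).
exists k; have /andP[] := floor_itv_period x pi2; rewrite -/k => y0 y1.
set y := x - _ in y0 y1.
have cy : cos y = 1.
  rewrite -cx -(cosD2pi_int y k); congr cos; rewrite /y; ring.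
have [y00|yn0] := eqVneq y 0.
  by move/eqP: y00; rewrite /y subr_eq0 => /eqP ->; ring.
have s0 : 0 < sin (y / 2).
  apply: sin_gt0_pi; apply/andP; split.
    by rewrite divr_gt0// lt_neqAle eq_sym yn0.
  by rewrite ltr_pdivrMr// mulrC.
have : cos y = 1 - sin (y / 2) ^+ 2 *+ 2.
  have -> : cos y = cos ((y / 2) *+ 2) by congr cos; rewrite -mulr_natr divfK.
  rewrite cos_mulr2n cos2sin2; ring.
rewrite cy => /eqP; rewrite -subr_eq0 opprB addrC subrK => /eqP h.
have : 0 < sin (y / 2) ^+ 2 *+ 2 by rewrite pmulrn_lgt0// exprn_gt0.
by rewrite h ltxx.
Qed.

Lemma cos_sin_eq (x y : R) : cos x = cos y -> sin x = sin y ->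
  exists k : int, x = y + 2 * k%:~R * pi.
Proof.
move=> cxy sxy; have [|k xk] := @cos_eq1 (x - y).
  by rewrite cosB cxy sxy -!expr2 cos2Dsin2.
by exists k; rewrite -xk addrC subrK.
Qed.

End trigonometry.

(** * The deck group and test functions in coordinates *)

Section cover.
Local Open Scope complex_scope.
Context {R : realType} (beta : R).
Hypothesis beta_gt0 : 0 < beta.
Local Notation T := (coords R).

Definition period : R := 2 * pi * beta.

Lemma period_gt0 : 0 < period.
Proof. by rewrite !mulr_gt0// pi_gt0. Qed.

(** Comparing moduli fixes rho up to a multiple of the period; dividing by the common modulus then
    leaves equal cosines and sines, which fix theta modulo 2 pi. *)
Lemma cover_eqP (p q : T) : cover beta p = cover beta q <->
  p.1 = q.1 /\ exists k l : int, q.2.1 = p.2.1 + k%:~R * period /\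
    q.2.2 = p.2.2 + 2 * l%:~R * pi.
Proof.
case: p => [[x y] [r t]]; case: q => [[x' y'] [r' t']]; rewrite /cover /zc /zetac/=.
split.
- move=> [<- <-] /ellpi_eq /asboolP[_ [k _ <-]] /= [].
  rewrite !mul0r ?subr0 ?addr0 => e1 e2; split => //.
  have c2 := cos2Dsin2 t; have c2' := cos2Dsin2 t'.
  set g := expR (2 * _ * _ * _) in e1 e2.
  have er : expR r' = g * expR r.
    apply/eqP; rewrite -(@eqrXn2 _ 2)// ?mulr_ge0 ?expR_ge0//; apply/eqP.
    rewrite -[LHS]mulr1 -[in LHS]c2' -[RHS]mulr1 -[in RHS]c2.
    rewrite !mulrDr -!exprMn -!mulrA -e1 -e2; ring.
  have g0 : g * expR r != 0 by rewrite -er gt_eqF// expR_gt0.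
  have ec : cos t' = cos t.
    by apply: (mulfI g0); rewrite -{1}er e1 mulrA.
  have es : sin t' = sin t.
    by apply: (mulfI g0); rewrite -{1}er e2 mulrA.
  have [l tl] := cos_sin_eq ec es.
  exists k, l; split => //.
  by move: er; rewrite -expRD => /expR_inj ->; rewrite /period; ring.
- move=> [[<- <-] [k [l [-> ->]]]]; congr pair.
  apply/ellpi_eq/asboolP => /=; exists (expR (2 * k%:~R * pi * beta))%:C; first by exists k.
  rewrite /= cosD2pi_int sinD2pi_int.
  have -> : expR (r + k%:~R * period) = expR (2 * k%:~R * pi * beta) * expR r.
    by rewrite -expRD; congr expR; rewrite /period; ring.
  apply/eqP; rewrite eq_complex/= !mul0r ?subr0 ?addr0 !mulrA ?eqxx//.
Qed.

(** This is Re (z w) / |w|. Dividing by |w| keeps the sign that defines O and makes the function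
    invariant under the group. *)
Definition tfun (p : T) : R := p.1.1 * cos p.2.2 - p.1.2 * sin p.2.2.

Lemma coverOP (p : T) : coverO beta p <-> 0 < tfun p.
Proof.
rewrite /coverO /domO/=; case: p => [[x y] [r t]]; rewrite /tfun /cover /zc /zetac/=.
split.
- move=> [z [w [[<- /ellpi_eq /asboolP[_ [k _ <-]] ew]]]].
  rewrite ew/= !mul0r ?subr0 ?addr0.
  have g0 := expR_gt0 (2 * k%:~R * pi * beta); have r0 := expR_gt0 r.
  set g := expR (2 * _ * _ * _) in g0 *.
  have -> : x * (g * (expR r * cos t)) - y * (g * (expR r * sin t)) =
    (g * expR r) * (x * cos t - y * sin t) by ring.
  by rewrite pmulr_rgt0// mulr_gt0.
- move=> t0; exists (x +i* y), (cexp_star (r +i* t)); split => //=.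
  have -> : x * (expR r * cos t) - y * (expR r * sin t) =
    expR r * (x * cos t - y * sin t) by ring.
  by rewrite mulr_gt0// expR_gt0.
Qed.

Definition invariant_fun (U : Type) (b : T -> U) :=
  forall p q, cover beta p = cover beta q -> b p = b q.

Lemma invariant_funP (U : Type) (b : T -> U) :
  (forall z r t (k l : int), b (z, (r + k%:~R * period, t + 2 * l%:~R * pi)) = b (z, (r, t))) ->
  invariant_fun b.
Proof.
move=> H [z [r t]] [z' [r' t']] /cover_eqP[/= <- [k [l [-> ->]]]].
by rewrite H.
Qed.

Lemma tfun_invariant : invariant_fun tfun.
Proof.
by apply: invariant_funP => z r t k l; rewrite /tfun/= cosD2pi_int sinD2pi_int.
Qed.

Lemma lift_invariant (U : Type) (F : ambient beta -> U) : invariant_fun (lift F).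
Proof. by move=> p q pq; rewrite /lift/= pq. Qed.

(** Any preimage may be chosen when [b] is invariant; [u0] is the value at points that [cover] does
    not reach, such as those over infinity. *)
Definition descend (U : Type) (u0 : U) (b : T -> U) (x : ambient beta) : U :=
  if pselect (exists p, cover beta p = x) is left e then b (projT1 (cid e)) else u0.

Lemma lift_descend (U : Type) (u0 : U) (b : T -> U) : invariant_fun b ->
  lift (descend u0 b) = b.
Proof.
move=> ib; apply/funext => p; rewrite /lift/= /descend; case: pselect => [e|[]].
  by apply: ib; exact: (projT2 (cid e)).
by exists p.
Qed.

Lemma descend_neq0 (b : T -> R[i]) (x : ambient beta) :
  descend 0 b x != 0 -> exists p, cover beta p = x /\ b p != 0.
Proof.
rewrite /descend; case: pselect => [e|]; last by rewrite eqxx.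
by move=> b0; exists (projT1 (cid e)); split => //; exact: (projT2 (cid e)).
Qed.

(** A test function seen on the covering. Compact support in O amounts to a positive lower bound on
    [tfun] and a bound on z, because rho and theta can be reduced to one period. *)
Definition real_test (b : T -> R) := [/\ smooth b, invariant_fun b &
  exists c M : R, 0 < c /\ forall p, b p != 0 ->
    [/\ c <= tfun p, `|p.1.1| <= M & `|p.1.2| <= M]].

Lemma smooth_tfun : smooth tfun.
Proof.
have [s1 s2 s3 s4] := @smooth_coords R.
apply: smoothB; apply: smoothM => //.
- have := smooth_comp (@smooth1_cos_sin R 1 0) s4.
  by congr smooth; apply/funext => p; rewrite !fctE scale1r scale0r addr0.
- have := smooth_comp (@smooth1_cos_sin R 0 1) s4.
  by congr smooth; apply/funext => p; rewrite !fctE scale1r scale0r add0r.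
Qed.

Lemma normC_neq0 (z : R[i]) : (z != 0) = (complex.Re z != 0) || (complex.Im z != 0).
Proof. by case: z => a b; rewrite eq_complex/= negb_and. Qed.

(** The constants are the extreme values of [tfun], |x| and |y| on the compact set K; being
    invariant, these functions keep the bounds on all translates of K. *)
Lemma test_fun_real (chi : ambient beta -> R[i]) : test_fun chi ->
  real_test (fun p => complex.Re (lift chi p)) /\ real_test (fun p => complex.Im (lift chi p)).
Proof.
move=> [s1 s2 [K [cK KO Kchi]]].
suff [c [M [c0 H]]] : exists c M : R, 0 < c /\ forall p, lift chi p != 0 ->
    [/\ c <= tfun p, `|p.1.1| <= M & `|p.1.2| <= M].
  split; split => //.
  - by move=> p q pq; rewrite (lift_invariant chi pq).
  - exists c, M; split => // p hp; apply: H; rewrite normC_neq0 hp//.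
  - by move=> p q pq; rewrite (lift_invariant chi pq).
  - exists c, M; split => // p hp; apply: H; rewrite normC_neq0 hp orbT//.
have [K0|K0] := pselect (K !=set0); last first.
  exists 1, 0; split => // p /Kchi [q Kq _]; exfalso; apply: K0; by exists q.
have c_t : {within K, continuous tfun}.
  by apply: continuous_subspaceT => p; exact: (smooth_continuous smooth_tfun).
have [s3 s4 _ _] := @smooth_coords R.
have c_x : {within K, continuous (fun p : T => `|p.1.1|)}.
  apply: continuous_subspaceT => p; apply: cvg_norm; exact: (smooth_continuous s3).
have c_y : {within K, continuous (fun p : T => `|p.1.2|)}.
  apply: continuous_subspaceT => p; apply: cvg_norm; exact: (smooth_continuous s4).
have [a Ka Ha] := compact_EVT_min K0 cK c_t.
have [b Kb Hb] := compact_EVT_max K0 cK c_x.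
have [d Kd Hd] := compact_EVT_max K0 cK c_y.
exists (tfun a), (Num.max `|b.1.1| `|d.1.2|); split.
  by rewrite inE in Ka; exact/coverOP/KO.
move=> p /Kchi[q Kq qp].
rewrite -(tfun_invariant qp); have /cover_eqP[<- _] := qp.
have Kq' : q \in K by rewrite inE.
by split; [exact: Ha|rewrite le_max Hb|rewrite le_max Hd ?orbT].
Qed.

Lemma real_test_test_fun (b1 b2 : T -> R) : real_test b1 -> real_test b2 ->
  exists chi : ambient beta -> R[i], test_fun chi /\
    lift chi = fun p => b1 p +i* b2 p.
Proof.
move=> [s1 i1 [c1 [M1 [c10 H1]]]] [s2 i2 [c2 [M2 [c20 H2]]]].
pose b p := b1 p +i* b2 p.
have ib : invariant_fun b by move=> p q pq; rewrite /b (i1 _ _ pq) (i2 _ _ pq).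
have lb := lift_descend (0 : R[i]) ib.
exists (descend 0 b); split => //; split.
- by have -> : (fun p => complex.Re (lift (descend 0 b) p)) = b1 by rewrite lb.
- by have -> : (fun p => complex.Im (lift (descend 0 b) p)) = b2 by rewrite lb.
pose c := Num.min c1 c2; pose M := Num.max M1 M2.
have c0 : 0 < c by rewrite lt_min c10.
have HbM p : b p != 0 -> [/\ c <= tfun p, `|p.1.1| <= M & `|p.1.2| <= M].
  rewrite normC_neq0/= => /orP[/H1|/H2] [h1 h2 h3].
    by split; rewrite ?ge_min ?le_max ?h1 ?h2 ?h3.
  by split; rewrite ?ge_min ?le_max ?h1 ?h2 ?h3 ?orbT.
(* The closed period rectangle contains a representative of every class, so this compact box meets
   every orbit of the support. *)
pose Box : set T := (`[- M, M]%classic `*` `[- M, M]%classic) `*`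
   (`[0, period]%classic `*` `[0, 2 * pi]%classic).
exists (Box `&` [set p | c <= tfun p]); split.
- apply: compact_closedI.
    by apply: compact_setX; apply: compact_setX; exact: segment_compact.
  apply: (closed_comp (f := tfun) (D := [set x | c <= x])); last exact: closed_ge.
  by move=> p _; exact: (smooth_continuous smooth_tfun).
- by move=> p [_ /= ct]; apply/coverOP; exact: lt_le_trans ct.
move=> x /(descend_neq0)[p [<- bp]].
have [t1 x1 y1] := HbM p bp.
case: p bp t1 x1 y1 => [z [r t]] bp t1 x1 y1.
pose q : T := (z, (r - (Num.floor (r / period))%:~R * period,
   t - 2 * (Num.floor (t / (2 * pi)))%:~R * pi)).
have pq : cover beta (z, (r, t)) = cover beta q.
  apply/cover_eqP; split => //=.
  exists (- Num.floor (r / period)), (- Num.floor (t / (2 * pi))).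
  by rewrite !mulrNz !mulNr mulrN mulNr.
exists q => //; split; last by rewrite /= -(tfun_invariant pq).
have pi2 : 0 < 2 * pi :> R by rewrite mulr_gt0// pi_gt0.
have /andP[h1 h2] := floor_itv_period r period_gt0.
have /andP[h3 h4] := floor_itv_period t pi2.
have e : 2 * (Num.floor (t / (2 * pi)))%:~R * pi = (Num.floor (t / (2 * pi)))%:~R * (2 * pi) :> R.
  by ring.
split; split; rewrite /q /= in_itv/= -?ler_norml//.
  by rewrite h1 ltW.
by rewrite e h3 ltW.
Qed.

End cover.

(** * The fundamental domain *)

Section strip_indicator.
Local Open Scope complex_scope.
Context {R : realType}.
Local Notation mu := (@lebesgue_measure R).

Definition ico (a b x : R) : R := if a <= x < b then 1 else 0.

Lemma ico_indic a b : ico a b = \1_(`[a, b[%classic : set R).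
Proof.
apply/funext => x; rewrite indicE mem_setE /ico in_itv/=; by case: ifP.
Qed.

Lemma measurable_ico a b : measurable_fun setT (ico a b).
Proof. by rewrite ico_indic; exact: measurable_indic. Qed.

Lemma ico_ge0 a b x : 0 <= ico a b x.
Proof. by rewrite /ico; case: ifP. Qed.

Lemma rint_ico a b : a <= b -> rint mu (ico a b) /\ Rintegral mu setT (ico a b) = b - a.
Proof.
move=> ab; have i : rint mu (ico a b).
  by rewrite ico_indic; exact: (@integrable_indic_itv R a b true true).
split => //; apply: EFin_inj; rewrite -RintE// ico_indic.
rewrite integral_indic// setIT.
rewrite [LHS](@lebesgue_measure_itv R `[a, b[)/= lte_fin.
case: ltP => [//|ba]; have -> : b = a by apply/eqP; rewrite eq_le ab ba.
by rewrite subrr.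
Qed.

End strip_indicator.

Section fundamental_domain.
Local Open Scope complex_scope.
Context {R : realType} (beta : R).
Hypothesis beta_gt0 : 0 < beta.
Local Notation T := (coords R).
Local Notation mu1 := (@lebesgue_measure R).
Local Notation mu2 := (leb2 R).
Local Notation mu4 := (leb4 R).
Local Notation P := (period beta).

Lemma fubini4 (f : T -> R) : rint mu4 f ->
  Rintegral mu4 setT f = \int[mu2]_z (\int[mu2]_w (f (z, w))).
Proof. exact: Rint_fubini1. Qed.

Lemma fubini4' (f : T -> R) : rint mu4 f ->
  Rintegral mu4 setT f = \int[mu2]_w (\int[mu2]_z (f (z, w))).
Proof. exact: Rint_fubini2. Qed.

Definition strip (w : R * R) : R := ico 0 P w.1 * ico 0 (2 * pi) w.2.
Definition oI (p : T) : R := if 0 < tfun p then 1 else 0.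
(* the indicator of [fundO] *)
Definition fundI (p : T) : R := oI p * strip p.2.

Lemma strip_ge0 w : 0 <= strip w.
Proof. by rewrite mulr_ge0 ?ico_ge0. Qed.

Lemma oI_ge0 p : 0 <= oI p. Proof. by rewrite /oI; case: ifP. Qed.
Lemma oI_le1 p : oI p <= 1. Proof. by rewrite /oI; case: ifP. Qed.
Lemma fundI_ge0 p : 0 <= fundI p. Proof. by rewrite mulr_ge0 ?oI_ge0 ?strip_ge0. Qed.

Lemma fundI_indic : fundI = \1_(fundO beta).
Proof.
apply/funext => p; rewrite indicE /fundI /oI /strip /ico.
have -> : (p \in fundO beta) = [&& 0 < tfun p, 0 <= p.2.1 < P & 0 <= p.2.2 < 2 * pi].
  apply/idP/idP; first by rewrite inE => -[/(coverOP beta) -> [-> ->]].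
  move=> /and3P[t0 h1 h2]; rewrite inE; split; [exact/coverOP|by []].
by case: ifP => _; rewrite ?mul0r// mul1r; case: ifP => _; rewrite ?mul0r//= mul1r; case: ifP.
Qed.

Lemma open_coverO : open (coverO beta).
Proof.
have -> : coverO beta = tfun @^-1` [set x | 0 < x].
  by apply/seteqP; split => p /(coverOP beta).
apply: open_comp => [p _|]; last exact: open_gt.
exact/smooth_continuous/smooth_tfun.
Qed.

Lemma measurable_coverO : measurable (coverO beta : set (coords (measurableTypeR R))).
Proof. apply: open_measurable4; exact: open_coverO. Qed.

Lemma measurable_strip : measurable_fun setT (strip : measurableTypeR R * measurableTypeR R -> measurableTypeR R).
Proof.
apply: measurable_funM.
  by apply: (measurableT_comp (measurable_ico _ _)).
by apply: (measurableT_comp (measurable_ico _ _)).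
Qed.

Lemma oI_indic : oI = \1_(coverO beta).
Proof.
apply/funext => p; rewrite indicE /oI.
have -> : (p \in coverO beta) = (0 < tfun p).
  by apply/idP/idP; rewrite inE => /(coverOP beta).
by case: ifP.
Qed.

Lemma fundI_out (p : T) : ~ coverO beta p -> fundI p = 0.
Proof. by move=> nO; rewrite /fundI oI_indic indicE memNset// mul0r. Qed.

Lemma measurable_oI : measurable_fun setT (oI : coords (measurableTypeR R) -> measurableTypeR R).
Proof. by rewrite oI_indic; apply: measurable_indic; exact: measurable_coverO. Qed.

Lemma measurable_fundI : measurable_fun setT (fundI : coords (measurableTypeR R) -> measurableTypeR R).
Proof.
apply: measurable_funM; first exact: measurable_oI.
by apply: (measurableT_comp measurable_strip).
Qed.

Lemma measurable_oIM (F : T -> R) : measurable_fun (coverO beta) F ->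
  measurable_fun setT (fun p : coords (measurableTypeR R) => oI p * F p : measurableTypeR R).
Proof.
move=> mF.
have := (measurable_restrictT F measurable_coverO).1 mF.
rewrite patch_indic -oI_indic.
by congr (measurable_fun _ _); apply/funext => p; rewrite /= mulrC.
Qed.

Lemma measurable_fundIM (F : T -> R) : measurable_fun (coverO beta) F ->
  measurable_fun setT (fun p : coords (measurableTypeR R) => fundI p * F p : measurableTypeR R).
Proof.
move=> mF; rewrite (_ : (fun p => _) = fun p => strip p.2 * (oI p * F p)); last first.
  by apply/funext => p; rewrite /fundI; ring.
apply: measurable_funM; last exact: measurable_oIM.
by apply: (measurableT_comp measurable_strip).
Qed.

Lemma Rint_fundO (F : T -> R) :
  Rintegral mu4 (fundO beta) F = \int[mu4]_p (fundI p * F p).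
Proof.
rewrite Rintegral_mkcond; apply: Rint_ext => p.
by rewrite patch_indic/= fundI_indic mulrC.
Qed.

Lemma integral_fundO (F : T -> R) :
  (\int[mu4]_(p in fundO beta) (F p)%:E = \int[mu4]_p (fundI p * F p)%:E)%E.
Proof.
rewrite integral_mkcond; apply: eq_integral => p _.
rewrite restrict_EFin; congr EFin.
by rewrite patch_indic/= fundI_indic mulrC.
Qed.

Lemma coord_nz_ae : {ae mu2, forall z : R * R, z.1 != 0}.
Proof.
have H : {ae mu1, forall x : R, x != 0}.
  exists [set 0]; split => //; first exact: lebesgue_measure_set1.
  by move=> x /= /negP; rewrite negbK => /eqP.
exact: (@ae_fst _ _ _ _ _ mu1 mu1 _ H).
Qed.

(** Adding pi to t changes the sign of x cos t - y sin t. Up to its zeros, exactly one of t and t +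
    pi is counted, so the positive set has half the length of the circle. *)
Lemma theta_fibre (x y : R) : x != 0 ->
  let h := fun t => if 0 < x * cos t - y * sin t then 1 else 0 : R in
  rint mu1 (fun t => h t * ico 0 (2 * pi) t) /\
  \int[mu1]_t (h t * ico 0 (2 * pi) t) = pi.
Proof.
move=> x0 h.
pose g t : R := x * cos t - y * sin t.
have pi0 : 0 < pi :> R by exact: pi_gt0.
have mg : measurable_fun setT g.
  apply: continuous_measurable_fun => t; apply: cvgB; apply: cvgM;
    by [exact: cvg_cst|exact: continuous_cos|exact: continuous_sin].
have mh : measurable_fun setT h.
  by apply: measurable_fun_ifT => //; apply: measurable_fun_ltr.
have h01 t : 0 <= h t <= 1 by rewrite /h; case: ifP; rewrite ?lexx ?ler01.
have gpi t : g (t + pi) = - g t.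
  by rewrite /g cosDpi sinDpi; ring.
have r1 a b : a <= b -> rint mu1 (fun t => h t * ico a b t).
  move=> ab; apply: (@rint_le _ _ _ mu1 _ (ico a b)).
  - by apply: measurable_funM => //; exact: measurable_ico.
  - move=> t; have /andP[h0 h1] := h01 t.
    by rewrite ger0_norm ?mulr_ge0 ?ico_ge0// ler_piMl ?ico_ge0.
  - by have [] := rint_ico ab.
have le2 : 0 <= 2 * pi :> R by rewrite mulr_ge0// ltW.
have lepi2 : pi <= 2 * pi :> R by rewrite ler_peMl ?ltW// ltr1n.
split; first exact: r1.
have E t : h t * ico 0 (2 * pi) t = h t * ico 0 pi t + h t * ico pi (2 * pi) t.
  rewrite -mulrDr; congr (_ * _); rewrite /ico.
  by case: (lerP 0 t) => t0; case: (ltP t pi) => t1; case: (ltP t (2 * pi)) => t2 //=;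
    rewrite ?addr0 ?add0r//; exfalso; lra.
rewrite (@Rint_ext _ _ _ mu1 _ _ E) RintD//; [|exact/r1/ltW|exact: r1].
have [r2 ->] := Rint_affine pi (ltr01 : (0 : R) < 1) (r1 pi (2 * pi) lepi2).
rewrite mul1r -RintD//; [|exact/r1/ltW].
have [i1 i2] := @rint_ico R 0 pi (ltW pi0); rewrite subr0 in i2.
rewrite -[RHS]i2; apply: Rint_ae.
- apply: rint_measurable; apply: rintD; [exact/r1/ltW|exact: r2].
- exact: measurable_ico.
(* Two zeros s < t in [0, pi) would give x sin(t - s) = 0 with 0 < t - s < pi; so the exceptional
   set has at most one point. *)
have sub : is_subset1 [set t : R | 0 <= t < pi /\ g t = 0].
  move=> s t [/= s0 gs] [t0 gt].
  apply/eqP; have [//|st] := eqVneq s t; exfalso.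
  wlog st' : s t s0 t0 gs gt st / s < t.
    move=> H; have [|ts] := ltP s t; first exact: H.
    by apply: (H t s) => //; [rewrite eq_sym|rewrite lt_neqAle eq_sym st].
  have : sin (t - s) = 0.
    apply: (mulfI x0); rewrite mulr0 sinB.
    have e1 : x * cos s = y * sin s by move/eqP: gs; rewrite subr_eq0 => /eqP.
    have e2 : x * cos t = y * sin t by move/eqP: gt; rewrite subr_eq0 => /eqP.
    transitivity (sin t * (x * cos s) - sin s * (x * cos t)); first by ring.
    by rewrite e1 e2; ring.
  apply/eqP; rewrite gt_eqF//; apply: sin_gt0_pi; lra.
have N0 : {ae mu1, forall t, ~ (0 <= t < pi /\ g t = 0)}.
  have [[t0 Ht0]|nt] := pselect (exists t, 0 <= t < pi /\ g t = 0).
    exists [set t0]; split => //; first exact: lebesgue_measure_set1.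
    by move=> t /= /contrapT Ht; exact: sub.
  exists set0; split => //.
  by move=> t /= /contrapT Ht; apply: nt; exists t.
apply: (@ae_imp _ _ _ mu1 _ _ _ N0) => t /= Nt.
have -> : 1 * t + pi = t + pi by rewrite mul1r.
have -> : h (t + pi) = if g t < 0 then 1 else 0.
  by rewrite /h -/(g _) gpi oppr_gt0.
rewrite /h -/(g t) /ico.
case: (lerP 0 t) => t0; case: (ltP t pi) => t1 //=; last 3 first.
- have -> : (pi <= t + pi < 2 * pi) = false by apply/negbTE/negP; lra.
  by rewrite !mulr0 addr0.
- have -> : (pi <= t + pi < 2 * pi) = false by apply/negbTE/negP; lra.
  by rewrite !mulr0 addr0.
- have -> : (pi <= t + pi < 2 * pi) = false by apply/negbTE/negP; lra.
  by rewrite !mulr0 addr0.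
have -> : (pi <= t + pi < 2 * pi) = true by lra.
rewrite !mulr1; case: (ltgtP (g t) 0) => gt //; rewrite ?addr0 ?add0r//.
by exfalso; apply: Nt; rewrite t0 t1.
Qed.

(** Half the area of the period rectangle: the area of the fibre of O over z, the same for all z
    with nonzero real part. *)
Definition fibre_mass : R := P * pi.

Lemma fibre_mass_gt0 : 0 < fibre_mass.
Proof. by rewrite mulr_gt0 ?pi_gt0// period_gt0. Qed.

Lemma fundI_fibre (z : R * R) : z.1 != 0 ->
  rint mu2 (fun w => fundI (z, w)) /\
  \int[mu2]_w (fundI (z, w)) = fibre_mass.
Proof.
move=> z0; have [r1 i1] := theta_fibre z.2 z0.
have [r2 i2] := @rint_ico R 0 P (ltW (period_gt0 beta_gt0)).
have := @rint_prod _ _ _ _ _ mu1 mu1 _ _ r2 r1; rewrite i1 i2 subr0.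
have E : (fun p : measurableTypeR R * measurableTypeR R => ico 0 P p.1 *
    ((if 0 < z.1 * cos p.2 - z.2 * sin p.2 then 1 else 0) * ico 0 (2 * pi) p.2)) =
    (fun w => fundI (z, w)) by apply/funext => w; rewrite /fundI /strip /oI/= mulrCA.
by rewrite E.
Qed.

Lemma leb2_shift (a b : R) (A : set (measurableTypeR R * measurableTypeR R)) : measurable A ->
  mu2 ((fun w : measurableTypeR R * measurableTypeR R => (1 * w.1 + a, 1 * w.2 + b)) @^-1` A) = mu2 A.
Proof.
have H c (B : set (measurableTypeR R)) : measurable B -> mu1 ((fun x => 1 * x + c) @^-1` B) = mu1 B.
  by move=> mB; rewrite [RHS](lebesgue_measure_affine c ltr01)// mul1e.
exact: (@product_measure_preserving _ _ _ _ _ mu1 mu1 (fun x => 1 * x + a) (fun x => 1 * x + b)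
  (@measurable_affine R 1 a) (@measurable_affine R 1 b) (H a) (H b)).
Qed.

Lemma ae_shift4 (a b : R) (Q : T -> Prop) : {ae mu4, forall p, Q p} ->
  {ae mu4, forall p : T, Q (p.1, (1 * p.2.1 + a, 1 * p.2.2 + b))}.
Proof.
move=> [N [mN N0 QN]].
pose s (w : measurableTypeR R * measurableTypeR R) := (1 * w.1 + a, 1 * w.2 + b).
have ms : measurable_fun setT s.
  by apply/measurable_fun_pair => /=; apply: (measurableT_comp (measurable_affine _ _)).
pose phi (p : coords (measurableTypeR R)) := (p.1, s p.2).
have mphi : measurable_fun setT phi.
  by apply/measurable_fun_pair => /=; [|apply: (measurableT_comp ms)].
exists (phi @^-1` N); split.
- by rewrite -[X in measurable X]setTI; exact: mphi.
- rewrite -[RHS]N0.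
  apply: (@product_measure_preserving _ _ _ _ _ mu2 mu2 id s _ ms _ (leb2_shift a b)) => //.
- by move=> p /= nQ; exact: QN.
Qed.

(** The translates of [fundO] by the deck group cover [coverO]; they are countably many, and each
    translation preserves null sets. *)
Lemma ae_cover (Q : T -> Prop) :
  (forall p q, cover beta p = cover beta q -> Q p -> Q q) ->
  {ae mu4, forall p, fundO beta p -> Q p} -> {ae mu4, forall p, coverO beta p -> Q p}.
Proof.
move=> Qi aeQ.
pose s (kl : int * int) (p : T) : T :=
  (p.1, (1 * p.2.1 + kl.1%:~R * P, 1 * p.2.2 + 2 * kl.2%:~R * pi)).
have aen (n : nat) : {ae mu4, forall p, if (unpickle n : option (int * int)) is Some kl
    then fundO beta (s kl p) -> Q (s kl p) else True}.
  case: (unpickle n : option (int * int)) => [kl|]; last exact: aeW.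
  exact: (ae_shift4 (kl.1%:~R * P) (2 * kl.2%:~R * pi) aeQ).
have := ae_foralln aen; apply: filterS => -[z [r t]] /= H /(coverOP beta) Op.
have pi2 : 0 < 2 * pi :> R by rewrite mulr_gt0// pi_gt0.
pose k := - Num.floor (r / P); pose l := - Num.floor (t / (2 * pi)).
have := H (pickle (k, l)); rewrite pickleK => {}H.
have pq : cover beta (z, (r, t)) = cover beta (s (k, l) (z, (r, t))).
  by apply/cover_eqP; split => //=; exists k, l; rewrite !mul1r.
apply: (Qi _ _ (esym pq)); apply: H; split.
  by apply/coverOP; rewrite -(tfun_invariant pq).
have h1 := floor_itv_period r (period_gt0 beta_gt0).
have h2 := floor_itv_period t pi2.
rewrite /= !mul1r /k /l !mulrNz !mulNr mulrN mulNr; split => //.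
by rewrite (_ : 2 * _ * pi = (Num.floor (t / (2 * pi)))%:~R * (2 * pi))//; ring.
Qed.

End fundamental_domain.

(** * The fundamental lemma of the calculus of variations *)

Section dynkin_zero.
Local Open Scope complex_scope.
Context d (T : measurableType d) (R : realType) (mu : {measure set T -> \bar R}).
Context d' (T' : measurableType d').

Lemma indic_comp_setI (q : T -> T') (A : set T') (F : T -> R) (mA : measurable A)
  (mq : measurable_fun setT q) : rint mu F -> rint mu (fun x => \1_A (q x) * F x).
Proof.
move=> rF; apply: (rint_le _ _ (rint_norm rF)).
  apply: measurable_funM; last exact: (rint_measurable rF).
  by apply: (measurableT_comp (measurable_indic mA)).
by move=> x; rewrite indicE; case: (_ \in _); rewrite ?mul1r// mul0r normr0.
Qed.

(** A |-> int 1_A(q) F is a finite signed measure, as F is integrable, and the sets on which it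
    vanishes form a Dynkin system. Taking a coordinate for q allows treating the variables one after
    the other. *)
Lemma dynkin_zero (q : T -> T') (G : set (set T')) (F : T -> R) :
  measurable_fun setT q -> rint mu F ->
  measurable = <<s G >> -> setI_closed G ->
  Rintegral mu setT F = 0 ->
  (forall A, G A -> \int[mu]_x (\1_A (q x) * F x) = 0) ->
  forall A, measurable A -> \int[mu]_x (\1_A (q x) * F x) = 0.
Proof.
move=> mq rF mG GI F0 GF A mA.
have mGA B : G B -> measurable B by rewrite mG; exact: sub_sigma_algebra.
pose P (A : set T') := \int[mu]_x (\1_A (q x) * F x) = 0.
apply: (@dynkin_induction _ T' G P mG GI) => //.
- by rewrite /P -[RHS]F0; apply: Rint_ext => x; rewrite indicT mul1r.
- move=> S mS PS; rewrite /P.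
  have -> : (fun x => \1_(~` S) (q x) * F x) = (fun x => F x - \1_S (q x) * F x).
    apply/funext => x; rewrite !indicE in_setC; case: (_ \in _) => /=; ring.
  rewrite RintB//; first by rewrite F0 PS subrr.
  exact: indic_comp_setI.
- move=> K mK tK PK; rewrite /P.
  pose L n := \bigcup_(i < n) K i.
  have mL n : measurable (L n) by apply: bigcup_measurable => i _; exact: mK.
  have L0 n : \int[mu]_x (\1_(L n) (q x) * F x) = 0.
    elim: n => [|n IHn].
      rewrite -(@Rint0 _ _ R mu); apply: Rint_ext => x.
      by rewrite /L bigcup_mkord big_ord0 indic0 mul0r.
    have -> : (fun x => \1_(L n.+1) (q x) * F x) =
       (fun x => \1_(L n) (q x) * F x + \1_(K n) (q x) * F x).
      apply/funext => x; rewrite -mulrDl; congr (_ * _).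
      rewrite /L bigcup_mkord big_ord_recr/= -bigcup_mkord -/(L n).
      rewrite !indicE in_setU.
      have : ~~ ((q x \in L n) && (q x \in K n)).
        apply/negP => /andP[]; rewrite !inE => -[i /= ni Ki] Kn.
        have /trivIsetP /(_ i n I I) := tK.
        have in_ : i != n by rewrite ltn_eqF.
        by move=> /(_ in_) /seteqP[] /(_ (q x)) H _; exact: H.
      by case: (_ \in _); case: (_ \in _) => //=; rewrite ?addr0 ?add0r.
    by rewrite RintD ?IHn ?PK ?addr0//; exact: indic_comp_setI.
  apply: (@Rint_dominated_eq _ _ _ mu (fun n x => \1_(L n) (q x) * F x) _
    (fun x => `|F x|) _ 0 _ _ _ _ L0 (cvg_cst 0)).
  + by move=> n; apply: rint_measurable; exact: indic_comp_setI.
  + move=> x; apply: cvgM; last exact: cvg_cst.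
    have [[k _ Kk]|nK] := pselect ((\bigcup_k K k) (q x)).
      apply: cvg_near_cst; near=> n.
      rewrite !indicE !mem_set//; first by exists k.
      by exists k => //=; near: n; exact: nbhs_infty_gt.
    apply: cvg_near_cst; apply: nearW => n.
    rewrite !indicE !memNset// => -[k _ Kk]; by apply: nK; exists k.
  + exact: rint_norm.
  + by move=> n x; rewrite indicE; case: (_ \in _); rewrite ?mul1r// mul0r normr0.
- by rewrite -mG.
Unshelve. all: by end_near. Qed.
End dynkin_zero.

Section intervals.
Local Open Scope complex_scope.
Context d (T : measurableType d) (R : realType) (mu : {measure set T -> \bar R}).

Definition ioo (a b x : R) : R := if a < x < b then 1 else 0.

Lemma measurable_ioo a b : measurable_fun setT (ioo a b).
Proof.
have -> : ioo a b = \1_(`]a, b[%classic : set R).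
  by apply/funext => x; rewrite indicE mem_setE /ioo in_itv/=; case: ifP.
exact: measurable_indic.
Qed.

Lemma rint_ioo (q : T -> R) (F : T -> R) a b : measurable_fun setT q ->
  rint mu F -> rint mu (fun x => ioo a b (q x) * F x).
Proof.
move=> mq rF; apply: (rint_le _ _ (rint_norm rF)).
  apply: measurable_funM; last exact: (rint_measurable rF).
  by apply: (measurableT_comp (measurable_ioo _ _)).
by move=> x; rewrite /ioo; case: ifP => _; rewrite ?mul1r// mul0r normr0.
Qed.

(** The rays ]a, +oo[ generate the Borel sets and are stable under intersection. Each is the limit
    of ]a, n[, and the line is the limit of ]-n, n[; dominated convergence does the rest. *)
Lemma interval_to_borel (q : T -> R) (F : T -> R) :
  measurable_fun setT q -> rint mu F ->
  (forall a b, a < b -> \int[mu]_x (ioo a b (q x) * F x) = 0) ->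
  forall A : set R, measurable A -> \int[mu]_x (\1_A (q x) * F x) = 0.
Proof.
move=> mq rF H.
have lim (a : nat -> R) (f : R -> R) : (forall x, ioo (a n) n%:R x @[n --> \oo] --> f x) ->
    \int[mu]_x (f (q x) * F x) = 0.
  move=> af.
  have a0 n : \int[mu]_x (ioo (a n) n%:R (q x) * F x) = 0.
    have [/H->//|na] := ltP (a n) n%:R.
    rewrite -[RHS](@Rint0 _ _ R mu); apply: Rint_ext => x.
    rewrite /ioo ifF ?mul0r//; apply/negbTE/negP; lra.
  apply: (@Rint_dominated_eq _ _ _ mu (fun n x => ioo (a n) n%:R (q x) * F x) _
    (fun x => `|F x|) _ 0 _ _ _ _ a0 (cvg_cst 0)).
  + by move=> n; apply: rint_measurable; exact: rint_ioo.
  + by move=> x; apply: cvgM; [exact: af|exact: cvg_cst].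
  + exact: rint_norm.
  + move=> n x; rewrite /ioo; case: ifP => _; rewrite ?mul1r// mul0r normr0//.
apply: (dynkin_zero (G := @RGenOInfty.G R)) => //.
- exact: RGenOInfty.measurableE.
- move=> _ _ [x ->] [y ->]; exists (Num.max x y).
  by apply/seteqP; split => z /=; rewrite !in_itv/= !andbT gt_max; [move=> [-> ->]|move=> /andP[]].
- have := lim (fun n => - n%:R) (cst 1); rewrite (_ : (fun x => _) = F); last first.
    by apply/funext => x; rewrite mul1r.
  apply => x; apply: cvg_near_cst; near=> n.
  rewrite /ioo ifT// -ltr_norml.
  rewrite (lt_le_trans (archi_boundP (normr_ge0 x)))// ler_nat.
  by near: n; exact: nbhs_infty_ge.
- move=> _ [a ->]; apply: (lim (fun=> a)) => x; apply: cvg_near_cst; near=> n.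
  rewrite indicE mem_setE in_itv/= andbT /ioo.
  have -> : x < n%:R.
    rewrite (le_lt_trans (ler_norm x))// (lt_le_trans (archi_boundP (normr_ge0 x)))// ler_nat.
    by near: n; exact: nbhs_infty_ge.
  by rewrite andbT; case: ifP.
Unshelve. all: by end_near. Qed.

(** For a periodic coordinate only arcs within one period can be cut out by test functions, so
    intervals are clipped to [0, P]. Clipping makes the interval open at 0 and loses the point q =
    0, whence the condition that q is almost everywhere nonzero. *)
Lemma interval_to_borel_clip (q : T -> R) (F : T -> R) (P : R) :
  measurable_fun setT q -> rint mu F -> (forall x, F x != 0 -> 0 <= q x < P) ->
  {ae mu, forall x, q x != 0} ->
  (forall a b, 0 <= a -> a < b -> b <= P ->
     \int[mu]_x (ioo a b (q x) * F x) = 0) ->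
  forall A : set R, measurable A -> \int[mu]_x (\1_A (q x) * F x) = 0.
Proof.
move=> mq rF FP q0 H; apply: interval_to_borel => // a b ab.
have -> : \int[mu]_x (ioo a b (q x) * F x) =
    \int[mu]_x (ioo (Num.max a 0) (Num.min b P) (q x) * F x).
  apply: Rint_ae; [exact/rint_measurable/rint_ioo|exact/rint_measurable/rint_ioo|].
  apply: ae_imp q0 => x qx; have [->|Fx] := eqVneq (F x) 0; first by rewrite !mulr0.
  congr (_ * _); rewrite /ioo; have /andP[h1 h2] := FP x Fx.
  by rewrite gt_max lt_min h2 [0 < _]lt_neqAle eq_sym qx h1 !andbT.
have [ab'|ba] := ltP (Num.max a 0) (Num.min b P).
  by apply: H => //; [rewrite le_max lexx orbT|rewrite ge_min lexx orbT].
rewrite -[RHS](@Rint0 _ _ R mu); apply: Rint_ext => x.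
rewrite /ioo ifF ?mul0r//; apply/negbTE/negP => /andP[h1 h2].
by have := lt_trans h1 h2; rewrite ltNge ba.
Qed.

End intervals.

Section arcs.
Local Open Scope complex_scope.
Context {R : realType}.

(** An arc of the circle is a superlevel set of the cosine centred at its midpoint; this describes
    it by a smooth periodic function. *)
Lemma cos_arc (a b s : R) : 0 <= a -> a < b -> b <= 2 * pi -> 0 <= s < 2 * pi ->
  (cos ((b - a) / 2) < cos (s - (a + b) / 2)) = (a < s < b).
Proof.
move=> a0 ab b2 /andP[s0 s2].
set m := (a + b) / 2; set e := (b - a) / 2.
have pi0 := pi_gt0 R.
have me : m - e = a by rewrite /m /e; field.
have pe : m + e = b by rewrite /m /e; field.
have e0 : 0 < e by rewrite /e divr_gt0// subr_gt0.
have epi : e <= pi by rewrite /e ler_pdivrMr//; lra.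
have ei : e \in `[0, pi] by rewrite in_itv/= ltW.
have -> : (a < s < b) = (`|s - m| < e) by rewrite ltr_norml; apply/idP/idP; lra.
rewrite -[in X in _ < X]cos_norm; set u := `|s - m|.
have u0 : 0 <= u by exact: normr_ge0.
have [upi|piu] := leP u pi.
  by rewrite ltr_cos// in_itv/= u0.
(* Beyond pi the cosine increases again, so u is reflected to 2 pi - u; as a >= 0 and b <= 2 pi,
   this is at least e and the point lies off the arc. *)
have -> : cos u = cos (2 * pi - u).
  rewrite -[in LHS]cosN -(@cosD2pi_int R (- u) 1); congr cos; rewrite mulr1; ring.
have u2 : u <= 2 * pi - e by rewrite /u ler_norml; apply/andP; split; lra.
rewrite ltr_cos//; last by rewrite in_itv/=; apply/andP; split; lra.
by apply/idP/idP; lra.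
Qed.

End arcs.

(** * Approximating boxes by test functions *)

Section test_functions.
Local Open Scope complex_scope.
Context {R : realType} (beta : R).
Hypothesis beta_gt0 : 0 < beta.
Local Notation T := (coords R).
Local Notation mu1 := (@lebesgue_measure R).
Local Notation mu2 := (leb2 R).
Local Notation mu4 := (leb4 R).
Local Notation P := (period beta).

(** Each bound is a closed condition: where it fails it fails nearby, so [b] vanishes near the point
    and so does its derivative there. *)
Lemma supported_derive (b : T -> R) (c M : R) (v : T) :
  (forall p, b p != 0 -> [/\ c <= tfun p, `|p.1.1| <= M & `|p.1.2| <= M]) ->
  forall p, 'D_v b p != 0 -> [/\ c <= tfun p, `|p.1.1| <= M & `|p.1.2| <= M].
Proof.
move=> H p Dp.
have [s1 s2 _ _] := @smooth_coords R.
have far (f : T -> R) (l : R) : continuous f -> (forall q, l < f q -> b q = 0) -> f p <= l.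
  move=> cf fb; rewrite leNgt; apply/negP => lp; move/eqP: Dp; apply.
  apply: derive_near0; near=> q; apply: fb; near: q.
  exact: (cvgr_gt (f p) (cf p) l lp).
split.
- rewrite -lerN2; apply: (far (fun q => - tfun q)).
    by move=> q; apply: cvgN; exact: (smooth_continuous (@smooth_tfun R)).
  move=> q; rewrite ltrN2 => qc; apply/eqP; apply/negPn/negP => /H[].
  by rewrite leNgt qc.
- apply: (far (fun q => `|q.1.1|)).
    by move=> q; apply: cvg_norm; exact: (smooth_continuous s1).
  move=> q qM; apply/eqP; apply/negPn/negP => /H[_].
  by rewrite leNgt qM.
- apply: (far (fun q => `|q.1.2|)).
    by move=> q; apply: cvg_norm; exact: (smooth_continuous s2).
  move=> q qM; apply/eqP; apply/negPn/negP => /H[_ _].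
  by rewrite leNgt qM.
Unshelve. all: by end_near. Qed.

Lemma invariant_derive (b : T -> R) v : invariant_fun beta b -> invariant_fun beta ('D_v b).
Proof.
move=> ib p q /cover_eqP[e1 [k [l [e2 e3]]]].
pose A (p : T) : T := (p.1, (p.2.1 + k%:~R * P, p.2.2 + 2 * l%:~R * pi)).
have AL (h : R) w r : A (h *: w + r) = h *: w + A r.
  by rewrite /A/=; congr pair; rewrite /= ; congr pair => /=; rewrite addrA.
have Aq : A p = q by case: q e1 e2 e3 => [z [r t]] /= <- -> ->.
have bA : b \o A = b.
  apply/funext => r; apply: ib; apply/esym/cover_eqP; split => //.
  by exists k, l.
rewrite -{1}bA (@derive_affine _ T T b A id p v); last by move=> h; exact: AL.
by rewrite Aq.
Qed.

Lemma real_test_derive (b : T -> R) v : real_test beta b -> real_test beta ('D_v b).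
Proof.
move=> [sb ib [c [M [c0 H]]]]; split; first exact: smooth_derive.
- exact: invariant_derive.
- by exists c, M; split => //; exact: supported_derive.
Qed.

Lemma real_test_mul (b g : T -> R) : real_test beta b -> smooth g -> invariant_fun beta g ->
  real_test beta (fun p => b p * g p).
Proof.
move=> [sb ib [c [M [c0 H]]]] sg ig; split; first exact: smoothM.
- by move=> p q pq; rewrite (ib _ _ pq) (ig _ _ pq).
- exists c, M; split => // p; rewrite mulf_eq0 negb_or => /andP[bp _]; exact: H.
Qed.

Lemma real_test_bounded (b : T -> R) : real_test beta b ->
  exists B, forall p, `|b p| <= B.
Proof.
move=> [sb ib [c [M [c0 H]]]].
pose Box : set T := (`[- `|M|, `|M|]%classic `*` `[- `|M|, `|M|]%classic) `*`
   (`[0, P]%classic `*` `[0, 2 * pi]%classic).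
have P0 := period_gt0 beta_gt0.
have pi2 : 0 < 2 * pi :> R by rewrite mulr_gt0// pi_gt0.
have Box0 : Box !=set0.
  exists 0; split; split; rewrite /= in_itv/= ?lexx ?oppr_le0 ?normr_ge0//= ltW//.
have cB : compact Box.
  by apply: compact_setX; apply: compact_setX; exact: segment_compact.
have cb : {within Box, continuous (fun p => `|b p|)}.
  apply: continuous_subspaceT => p; apply: cvg_norm; exact: smooth_continuous.
have [m Bm Hm] := compact_EVT_max Box0 cB cb.
exists `|b m| => p; have [->|bp] := eqVneq (b p) 0; first by rewrite normr0.
have [_ h1 h2] := H p bp; case: p bp h1 h2 => [z [r t]] bp h1 h2.
pose q : T := (z, (r - (Num.floor (r / P))%:~R * P,
   t - 2 * (Num.floor (t / (2 * pi)))%:~R * pi)).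
have -> : b (z, (r, t)) = b q.
  apply: ib; apply/cover_eqP; split => //=.
  exists (- Num.floor (r / P)), (- Num.floor (t / (2 * pi))).
  by rewrite !mulrNz !mulNr mulrN mulNr.
apply: Hm; rewrite inE; have /andP[k1 k2] := floor_itv_period r P0.
have /andP[k3 k4] := floor_itv_period t pi2.
have e : 2 * (Num.floor (t / (2 * pi)))%:~R * pi = (Num.floor (t / (2 * pi)))%:~R * (2 * pi) :> R.
  by ring.
split; split; rewrite /q /= in_itv/= -?ler_norml.
- by rewrite (le_trans h1)// ler_norm.
- by rewrite (le_trans h2)// ler_norm.
- by rewrite k1 ltW.
- by rewrite e k3 ltW.
Qed.

Lemma measurable_smooth (b : T -> R) : smooth b ->
  measurable_fun setT (b : coords (measurableTypeR R) -> measurableTypeR R).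
Proof. by move=> sb; apply: continuous_measurable4; exact: smooth_continuous. Qed.

Definition bxI (M : R) (z : R * R) : R := if (`|z.1| <= M) && (`|z.2| <= M) then 1 else 0.

(** Only z is confined to a bounded set, so this is integrability up to the boundary of O. It lets
    cutoffs approach that boundary under the integral. *)
Definition loc_int (H : T -> R) := measurable_fun (coverO beta) H /\
  forall M, rint mu4 (fun p => bxI M p.1 * (fundI beta p * H p)).

Lemma loc_int_test (H b : T -> R) : loc_int H -> real_test beta b ->
  rint mu4 (fun p => fundI beta p * H p * b p).
Proof.
move=> [mH iH] tb; have [B HB] := real_test_bounded tb.
have [sb ib [c [M [c0 Hs]]]] := tb.
apply: (rint_le _ _ (rintZ B (rint_norm (iH M)))).
  apply: measurable_funM; [exact: measurable_fundIM|exact: measurable_smooth].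
move=> p /=; rewrite normrM; have [->|bp] := eqVneq (b p) 0.
  by rewrite normr0 mulr0 mulr_ge0// (le_trans (normr_ge0 _) (HB p)).
have [_ h1 h2] := Hs p bp; rewrite /bxI h1 h2/= mul1r mulrC.
exact: ler_wpM2r.
Qed.

(** On the circle of length 2 pi c, positive exactly on the arc ]a, b[ by [cos_arc]; c = beta serves
    rho and c = 1 serves theta. *)
Definition arc_fun (c a b : R) (s : R) : R :=
  cos (c^-1 * s - (c^-1 * a + c^-1 * b) / 2) - cos ((c^-1 * b - c^-1 * a) / 2).

(** As n grows the first factors tend to the indicator of an open box. The last one, independent of
    n, confines the support to [tfun p > e], inside O. *)
Definition test_box (n : nat) (e : R) (x0 x1 y0 y1 r0 r1 t0 t1 : R) (p : T) : R :=
  bump (n%:R * (p.1.1 - x0)) * bump (n%:R * (x1 - p.1.1)) *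
  (bump (n%:R * (p.1.2 - y0)) * bump (n%:R * (y1 - p.1.2))) *
  (bump (n%:R * arc_fun beta r0 r1 p.2.1) * bump (n%:R * arc_fun 1 t0 t1 p.2.2)) *
  bump (tfun p - e).

Lemma smooth_affine (f : T -> R) (k l : R) : smooth f -> smooth (fun p => k * (f p + l)).
Proof.
move=> sf; apply: smoothM; first exact: smooth_cst.
by apply: smoothD => //; exact: smooth_cst.
Qed.

Lemma smooth_arc (f : T -> R) (k c a b : R) : smooth f ->
  smooth (fun p => k * arc_fun c a b (f p)).
Proof.
move=> sf; apply: smoothM; first exact: smooth_cst.
apply: smoothB; last exact: smooth_cst.
have := @smooth_comp R (1 *: cos + 0 *: sin)
  (fun p => c^-1 * f p - (c^-1 * a + c^-1 * b) / 2) (@smooth1_cos_sin R 1 0).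
have -> : (fun p : T => (1 *: cos + 0 *: sin : R -> R) (c^-1 * f p - (c^-1 * a + c^-1 * b) / 2)) =
  (fun p => cos (c^-1 * f p - (c^-1 * a + c^-1 * b) / 2)).
  by apply/funext => p; rewrite !fctE scale1r scale0r addr0.
apply; apply: smoothB; last exact: smooth_cst.
by apply: smoothM => //; exact: smooth_cst.
Qed.

Lemma bump_neq0 (t : R) : bump t != 0 -> 0 < t.
Proof. by move=> bt; rewrite ltNge; apply/negP => /bump_le0 b0; rewrite b0 eqxx in bt. Qed.

Lemma test_box_real_test (n : nat) (e x0 x1 y0 y1 r0 r1 t0 t1 : R) : 0 < e ->
  real_test beta (test_box n e x0 x1 y0 y1 r0 r1 t0 t1).
Proof.
move=> e0; have [s1 s2 s3 s4] := @smooth_coords R; split.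
- have sb (f : T -> R) : smooth f -> smooth (fun p => bump (f p)).
    by move=> sf; apply: smooth_comp => //; exact: smooth1_bump.
  have sB (f : T -> R) (k l : R) : smooth f -> smooth (fun p => k * (l - f p)).
    move=> sf; apply: smoothM; first exact: smooth_cst.
    by apply: smoothB => //; exact: smooth_cst.
  apply: smoothM; last first.
    by apply: sb; apply: smoothB; [exact: smooth_tfun|exact: smooth_cst].
  apply: smoothM; last by apply: smoothM; apply: sb; exact: smooth_arc.
  by apply: smoothM; apply: smoothM; apply: sb; [exact: smooth_affine|exact: sB|exact: smooth_affine|exact: sB].
- apply: invariant_funP => z r t k l; rewrite /test_box.
  have -> : tfun (z, (r + k%:~R * P, t + 2 * l%:~R * pi)) = tfun (z, (r, t)).
    apply: (@tfun_invariant R beta); apply/esym/cover_eqP; split => //.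
    by exists k, l.
  congr (_ * (bump (_ * _) * bump (_ * _)) * _); rewrite /arc_fun/=; congr (_ - _).
    rewrite -[RHS](@cosD2pi_int R _ k); congr cos; rewrite /period; field.
    by rewrite gt_eqF.
  rewrite -[RHS](@cosD2pi_int R _ l); congr cos; rewrite invr1; ring.
- exists e, (`|x0| + `|x1| + `|y0| + `|y1|); split => // p.
  rewrite /test_box !mulf_eq0 !negb_or => /andP[/andP[/andP[/andP[A1 A2] /andP[A3 A4]] _]] /bump_neq0 te.
  have n0 (u : R) : bump (n%:R * u) != 0 -> 0 < u.
    move=> /bump_neq0; have [->|nn] := posnP n; first by rewrite mul0r ltxx.
    by rewrite pmulr_rgt0// ltr0n.
  have {}A1 := n0 _ A1; have {}A2 := n0 _ A2; have {}A3 := n0 _ A3; have {}A4 := n0 _ A4.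
  have := ler_norm x1; have := ler_norm (- x0); have := ler_norm y1; have := ler_norm (- y0).
  have := normr_ge0 x1; have := normr_ge0 x0; have := normr_ge0 y1; have := normr_ge0 y0.
  rewrite !normrN => q1 q2 q3 q4 q5 q6 q7 q8.
  by split; rewrite ?ler_norml; [lra|apply/andP; split; lra|apply/andP; split; lra].
Qed.

Lemma test_box_le1 n e x0 x1 y0 y1 r0 r1 t0 t1 p :
  `|test_box n e x0 x1 y0 y1 r0 r1 t0 t1 p| <= 1.
Proof.
have b01 t : `|@bump R t| <= 1 by rewrite ger0_norm ?bump_ge0// bump_le1.
by rewrite /test_box !normrM !mulr_ile1 ?mulr_ge0.
Qed.

Definition ioo4 (x0 x1 y0 y1 r0 r1 t0 t1 : R) (p : T) : R :=
  ioo x0 x1 p.1.1 * ioo y0 y1 p.1.2 * (ioo r0 r1 p.2.1 * ioo t0 t1 p.2.2).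

Lemma test_box_cvg e x0 x1 y0 y1 r0 r1 t0 t1 p : strip beta p.2 != 0 ->
  0 <= r0 -> r0 < r1 -> r1 <= P -> 0 <= t0 -> t0 < t1 -> t1 <= 2 * pi ->
  test_box n e x0 x1 y0 y1 r0 r1 t0 t1 p @[n --> \oo] -->
    ioo4 x0 x1 y0 y1 r0 r1 t0 t1 p * bump (tfun p - e).
Proof.
move=> sp r00 r01 r1P t00 t01 t1P.
have [hr ht] : 0 <= p.2.1 < P /\ 0 <= p.2.2 < 2 * pi.
  by move: sp; rewrite /strip /ico; do 2 case: ifP => //; rewrite ?mul0r ?mulr0 eqxx.
apply: cvgM; last exact: cvg_cst.
have iooE a b x : ioo a b x = (if 0 < x - a then 1 else 0) * (if 0 < b - x then 1 else 0) :> R.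
  by rewrite /ioo !subr_gt0; case: ifP => [/andP[-> ->]|]; rewrite ?mulr1//;
    case: (a < x); case: (x < b); rewrite ?mulr0 ?mul0r.
apply: cvgM.
  by rewrite !iooE; apply: cvgM; apply: cvgM; exact: bump_cvg.
have -> : ioo r0 r1 p.2.1 = if 0 < arc_fun beta r0 r1 p.2.1 then 1 else 0.
  rewrite /arc_fun subr_gt0 cos_arc ?mulr_ge0 ?invr_ge0 ?(ltW beta_gt0)//.
  - by rewrite !ltr_pM2l ?invr_gt0.
  - by rewrite ltr_pM2l ?invr_gt0.
  - by rewrite mulrC ler_pdivrMr.
  - by case/andP: hr => h1 h2; rewrite /= mulrC ltr_pdivrMr.
  - by case/andP: hr.
have -> : ioo t0 t1 p.2.2 = if 0 < arc_fun 1 t0 t1 p.2.2 then 1 else 0.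
  by rewrite /arc_fun subr_gt0 cos_arc !invr1 ?mul1r.
by apply: cvgM; exact: bump_cvg.
Qed.

Lemma ae_rho_neq0 : {ae mu4, forall p : T, p.2.1 != 0}.
Proof. exact: (@ae_snd _ _ _ _ _ mu2 mu2 _ (@coord_nz_ae R)). Qed.

Lemma ae_theta_neq0 : {ae mu4, forall p : T, p.2.2 != 0}.
Proof.
have H : {ae mu1, forall x : R, x != 0}.
  exists [set 0]; split => //; first exact: lebesgue_measure_set1.
  by move=> x /= /negP; rewrite negbK => /eqP.
have H2 : {ae mu2, forall z : R * R, z.2 != 0} by exact: (@ae_snd _ _ _ _ _ mu1 mu1 _ H).
exact: (@ae_snd _ _ _ _ _ mu2 mu2 _ H2).
Qed.

(** F dp is a finite signed measure. One interval factor at a time is replaced by a Borel factor,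
    then rectangles by planar sets, then products of planar sets by sets of R^4; a density that
    integrates to 0 over every Borel set vanishes almost everywhere. *)
Lemma boxes_ae0 (F : T -> R) : rint mu4 F ->
  (forall p, F p != 0 -> strip beta p.2 != 0) ->
  (forall x0 x1 y0 y1 r0 r1 t0 t1, 0 <= r0 -> r0 < r1 -> r1 <= P ->
     0 <= t0 -> t0 < t1 -> t1 <= 2 * pi ->
     \int[mu4]_p (ioo4 x0 x1 y0 y1 r0 r1 t0 t1 p * F p) = 0) ->
  {ae mu4, forall p, F p = 0}.
Proof.
move=> rF Fs H.
pose T4 := coords (measurableTypeR R).
have m11 : measurable_fun setT (fun p : T4 => p.1.1).
  by apply: (measurableT_comp (f := fst)).
have m12 : measurable_fun setT (fun p : T4 => p.1.2).
  by apply: (measurableT_comp (f := snd)).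
have m21 : measurable_fun setT (fun p : T4 => p.2.1).
  by apply: (measurableT_comp (f := fst)).
have m22 : measurable_fun setT (fun p : T4 => p.2.2).
  by apply: (measurableT_comp (f := snd)).
have Fst p : F p != 0 -> 0 <= p.2.1 < P /\ 0 <= p.2.2 < 2 * pi.
  by move=> /Fs; rewrite /strip /ico; do 2 case: ifP => //; rewrite ?mul0r ?mulr0 eqxx.
have s1 y0 y1 r0 r1 t0 t1 (A1 : set R) : 0 <= r0 -> r0 < r1 -> r1 <= P ->
    0 <= t0 -> t0 < t1 -> t1 <= 2 * pi -> measurable A1 ->
    \int[mu4]_p (\1_A1 p.1.1 * (ioo y0 y1 p.1.2 * (ioo r0 r1 p.2.1 * (ioo t0 t1 p.2.2 * F p)))) = 0.
  move=> h1 h2 h3 h4 h5 h6 mA1.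
  apply: (@interval_to_borel _ T4 R mu4 (fun p => p.1.1)) => //.
    by do 3 apply: (@rint_ioo _ T4 R mu4 _ _ _ _ _) => //.
  move=> x0 x1 _; rewrite -[RHS](H x0 x1 y0 y1 r0 r1 t0 t1)//.
  by apply: Rint_ext => p; rewrite /ioo4; ring.
have s2 r0 r1 t0 t1 (A1 A2 : set R) : 0 <= r0 -> r0 < r1 -> r1 <= P ->
    0 <= t0 -> t0 < t1 -> t1 <= 2 * pi -> measurable A1 -> measurable A2 ->
    \int[mu4]_p (\1_A2 p.1.2 * (\1_A1 p.1.1 * (ioo r0 r1 p.2.1 * (ioo t0 t1 p.2.2 * F p)))) = 0.
  move=> h1 h2 h3 h4 h5 h6 mA1 mA2.
  apply: (@interval_to_borel _ T4 R mu4 (fun p => p.1.2)) => //.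
    apply: (@indic_comp_setI _ T4 R mu4 _ _ _ A1) => //.
    by do 2 apply: (@rint_ioo _ T4 R mu4 _ _ _ _ _) => //.
  move=> y0 y1 _; rewrite -[RHS](s1 y0 y1 r0 r1 t0 t1 A1)//.
  by apply: Rint_ext => p; ring.
have s3 t0 t1 (A1 A2 A3 : set R) :
    0 <= t0 -> t0 < t1 -> t1 <= 2 * pi -> measurable A1 -> measurable A2 -> measurable A3 ->
    \int[mu4]_p (\1_A3 p.2.1 * (\1_A2 p.1.2 * (\1_A1 p.1.1 * (ioo t0 t1 p.2.2 * F p)))) = 0.
  move=> h4 h5 h6 mA1 mA2 mA3.
  apply: (@interval_to_borel_clip _ T4 R mu4 (fun p => p.2.1) _ P) => //.
  - apply: (@indic_comp_setI _ T4 R mu4 _ _ _ A2) => //.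
    apply: (@indic_comp_setI _ T4 R mu4 _ _ _ A1) => //.
    by apply: (@rint_ioo _ T4 R mu4 _ _ _ _ _) => //.
  - by move=> p; rewrite !mulf_eq0 !negb_or => /and4P[_ _ _ /Fst[]].
  - exact: ae_rho_neq0.
  - move=> r0 r1 h1 h2 h3; rewrite -[RHS](s2 r0 r1 t0 t1 A1 A2)//.
    by apply: Rint_ext => p; ring.
have s4 (A1 A2 A3 A4 : set R) :
    measurable A1 -> measurable A2 -> measurable A3 -> measurable A4 ->
    \int[mu4]_p (\1_A4 p.2.2 * (\1_A3 p.2.1 * (\1_A2 p.1.2 * (\1_A1 p.1.1 * F p)))) = 0.
  move=> mA1 mA2 mA3 mA4.
  apply: (@interval_to_borel_clip _ T4 R mu4 (fun p => p.2.2) _ (2 * pi)) => //.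
  - do 2 (apply: (@indic_comp_setI _ T4 R mu4 _ _ _ _) => //).
    by apply: (@indic_comp_setI _ T4 R mu4 _ _ _ A1) => //.
  - by move=> p; rewrite !mulf_eq0 !negb_or => /and4P[_ _ _ /Fst[]].
  - exact: ae_theta_neq0.
  - move=> t0 t1 h1 h2 h3; rewrite -[RHS](s3 t0 t1 A1 A2 A3)//.
    by apply: Rint_ext => p; ring.
pose T2 := (measurableTypeR R * measurableTypeR R)%type.
pose G2 := [set (A `*` B : set T2) | A in measurable & B in measurable].
have mG2 : (measurable : set (set T2)) = <<s G2 >> by exact: measurable_prod_measurableType.
have iG2 : setI_closed G2.
  move=> _ _ [A mA [B mB <-]] [C mC [D mD <-]].
  exists (A `&` C); first exact: measurableI.
  by exists (B `&` D); [exact: measurableI|rewrite setXI].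
have iX (U V : Type) (A : set U) (B : set V) (u : U) (v : V) : \1_(A `*` B) (u, v) = \1_A u * \1_B v :> R.
  by rewrite !indicE in_setX/=; case: (_ \in _); case: (_ \in _); rewrite ?mulr0 ?mulr1.
have iT (U : Type) (u : U) : \1_(@setT U) u = 1 :> R by rewrite indicT.
have F00 : Rintegral mu4 setT F = 0.
  rewrite -[RHS](s4 setT setT setT setT)//; apply: Rint_ext => p.
  by rewrite !iT !mul1r.
have s5 (A : set T2) (A3 A4 : set R) : measurable A -> measurable A3 -> measurable A4 ->
    \int[mu4]_p (\1_A p.1 * (\1_A4 p.2.2 * (\1_A3 p.2.1 * F p))) = 0.
  move=> mA mA3 mA4.
  apply: (@dynkin_zero _ T4 R mu4 _ T2 (fun p => p.1) G2) => //.
  - exact: measurable_fst.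
  - by do 2 (apply: (@indic_comp_setI _ T4 R mu4 _ _ _ _) => //).
  - rewrite -[RHS](s4 setT setT A3 A4)//; apply: Rint_ext => p.
    by rewrite !iT !mul1r.
  - move=> _ [A1 mA1 [A2 mA2 <-]]; rewrite -[RHS](s4 A1 A2 A3 A4)//; apply: Rint_ext => -[[x y] w].
    by rewrite iX/=; ring.
have s6 (A B : set T2) : measurable A -> measurable B ->
    \int[mu4]_p (\1_B p.2 * (\1_A p.1 * F p)) = 0.
  move=> mA mB.
  apply: (@dynkin_zero _ T4 R mu4 _ T2 (fun p => p.2) G2) => //.
  - exact: measurable_snd.
  - by apply: (@indic_comp_setI _ T4 R mu4 _ T2 fst) => //; exact: measurable_fst.
  - rewrite -[RHS](s5 A setT setT)//; apply: Rint_ext => p.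
    by rewrite !iT !mul1r.
  - move=> _ [A3 mA3 [A4 mA4 <-]]; rewrite -[RHS](s5 A A3 A4)//; apply: Rint_ext => -[z [r t]].
    by rewrite iX/=; ring.
have s7 (A : set T4) : measurable A -> \int[mu4]_p (\1_A p * F p) = 0.
  move=> mA.
  pose G4 := [set (A `*` B : set T4) | A in measurable & B in measurable].
  apply: (@dynkin_zero _ T4 R mu4 _ T4 id G4) => //.
  - exact: measurable_prod_measurableType.
  - move=> _ _ [A1 mA1 [B mB <-]] [C mC [D mD <-]].
    exists (A1 `&` C); first exact: measurableI.
    by exists (B `&` D); [exact: measurableI|rewrite setXI].
  - move=> _ [A1 mA1 [A2 mA2 <-]]; rewrite -[RHS](s6 A1 A2)//; apply: Rint_ext => -[z w].
    by rewrite iX/=; ring.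
have mF := rint_measurable rF.
have : ae_eq mu4 setT (EFin \o F) (cst 0%E).
  apply: integral_ae_eq => //.
  move=> A _ mA; rewrite integral0.
  have rA : rint mu4 (fun p => \1_A p * F p) by exact: (@indic_comp_setI _ T4 R mu4 _ T4 id).
  transitivity (\int[mu4]_p (\1_A p * F p)%:E)%E; last by rewrite (RintE rA) s7.
  rewrite integral_mkcond; apply: eq_integral => p _.
  by rewrite restrict_EFin patch_indic/= mulrC.
by move=> H0; apply: (ae_imp _ H0) => p /(_ I) /= [].
Qed.

(** A box need not lie in O, so the box indicators are multiplied by [bump (tfun p - e)]. This shows
    that H times this factor vanishes almost everywhere, and at each point of O the factor is
    positive for small e. *)
Lemma fundamental_lemma (H : T -> R) :
  measurable_fun (coverO beta) H -> invariant_fun beta H ->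
  rint mu4 (fun p => fundI beta p * H p) ->
  (forall b, real_test beta b -> \int[mu4]_p (fundI beta p * H p * b p) = 0) ->
  {ae mu4, forall p, coverO beta p -> H p = 0}.
Proof.
move=> mH iH rH H0.
have sb e : smooth (fun p : T => bump (tfun p - e)).
  apply: smooth_comp; first exact: smooth1_bump.
  by apply: smoothB; [exact: smooth_tfun|exact: smooth_cst].
have rb e : rint mu4 (fun p => fundI beta p * H p * bump (tfun p - e)).
  apply: (rint_le _ _ (rint_norm rH)).
    by apply: measurable_funM; [exact: measurable_fundIM|exact: measurable_smooth].
  by move=> p; rewrite normrM ler_piMr// ger0_norm ?bump_ge0// bump_le1.
(* Countably many values e = 1 / (m + 1) suffice, so the exceptional null sets can be united. *)
have step (m : nat) : {ae mu4, forall p, fundI beta p * H p * bump (tfun p - m.+1%:R^-1) = 0}.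
  set e : R := m.+1%:R^-1; have e0 : 0 < e by rewrite invr_gt0.
  apply: boxes_ae0 => //.
    by move=> p; rewrite /fundI !mulf_eq0 !negb_or => /andP[/andP[/andP[]]].
  move=> x0 x1 y0 y1 r0 r1 t0 t1 h1 h2 h3 h4 h5 h6.
  apply: (@Rint_dominated_eq _ _ _ mu4
    (fun n p => fundI beta p * H p * test_box n e x0 x1 y0 y1 r0 r1 t0 t1 p) _
    (fun p => `|fundI beta p * H p|) (fun=> 0) 0 _ _ _ _ _ (cvg_cst 0)).
  - move=> n; apply: measurable_funM; first exact: measurable_fundIM.
    by apply: measurable_smooth; have [] := test_box_real_test n x0 x1 y0 y1 r0 r1 t0 t1 e0.
  - move=> p; have [s0|sn] := eqVneq (strip beta p.2) 0.
      rewrite /fundI s0 !mulr0; under eq_fun do rewrite !mul0r.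
      by rewrite !mul0r mulr0; exact: cvg_cst.
    rewrite [X in _ --> X](_ : _ = fundI beta p * H p *
      (ioo4 x0 x1 y0 y1 r0 r1 t0 t1 p * bump (tfun p - e))); last by ring.
    by apply: cvgM; [exact: cvg_cst|exact: test_box_cvg].
  - exact: rint_norm.
  - by move=> n p; rewrite normrM ler_piMr// test_box_le1.
  - by move=> n; apply: H0; exact: test_box_real_test.
apply: (ae_cover beta_gt0); first by move=> p q pq <-; rewrite (iH _ _ pq).
have := ae_foralln step; apply: ae_imp => p Hp fp.
have fundI1 : fundI beta p = 1 by rewrite fundI_indic indicE mem_set.
have tp : 0 < tfun p by case: fp => /(coverOP beta).
have [m hm] : exists m : nat, m.+1%:R^-1 < tfun p.
  exists (Num.bound (tfun p)^-1).
  rewrite -[ltRHS]invrK ltf_pV2 ?posrE ?invr_gt0//.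
  rewrite (lt_le_trans (archi_boundP _))// ?ler_nat// invr_ge0 ltW//.
have := Hp m; rewrite fundI1 mul1r => /eqP; rewrite mulf_eq0 => /orP[/eqP//|].
by rewrite gt_eqF// bump_gt0// subr_gt0.
Qed.

End test_functions.

(** * The Cauchy-Pompeiu formula *)

Section plane.
Context {R : realType}.
Local Notation mu1 := (@lebesgue_measure R).
Local Notation mu2 := (leb2 R).
Local Notation M2 := (measurableTypeR R * measurableTypeR R)%type.
Local Notation C := (R * R)%type.

Lemma fubini2 (f : C -> R) : rint mu2 f ->
  Rintegral mu2 setT f = \int[mu1]_x (\int[mu1]_y (f (x, y))).
Proof. exact: Rint_fubini1. Qed.

Lemma fubini2' (f : C -> R) : rint mu2 f ->
  Rintegral mu2 setT f = \int[mu1]_y (\int[mu1]_x (f (x, y))).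
Proof. exact: Rint_fubini2. Qed.

Definition cci (M t : R) : R := if `|t| <= M then 1 else 0.

Lemma rint_cci M : rint mu1 (cci M).
Proof.
have -> : cci M = \1_(`[(- M), M]%classic : set R).
  apply/funext => x; rewrite indicE mem_setE /cci in_itv/= -ler_norml; by case: ifP.
exact: (@integrable_indic_itv R (- M) M true false).
Qed.

Lemma cci_ge0 M t : 0 <= cci M t. Proof. by rewrite /cci; case: ifP. Qed.
Lemma cci_le1 M t : cci M t <= 1. Proof. by rewrite /cci; case: ifP. Qed.

Definition box (M : R) (z : C) : R := cci M z.1 * cci M z.2.

Lemma rint_box M : rint mu2 (box M).
Proof. by have [] := @rint_prod _ _ _ _ _ mu1 mu1 _ _ (rint_cci M) (rint_cci M). Qed.

Lemma box_ge0 M z : 0 <= box M z.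
Proof. by rewrite mulr_ge0 ?cci_ge0. Qed.

Lemma box_le1 M z : box M z <= 1.
Proof. by rewrite mulr_ile1 ?cci_ge0 ?cci_le1. Qed.

Lemma box_eq1 M z : `|z.1| <= M -> `|z.2| <= M -> box M z = 1.
Proof. by move=> h1 h2; rewrite /box /cci h1 h2 mulr1. Qed.

Lemma measurable_box M : measurable_fun setT (box M : M2 -> measurableTypeR R).
Proof. exact: rint_measurable (rint_box M). Qed.

Definition vanishes_off (M : R) (f : C -> R) :=
  forall z, M < `|z.1| \/ M < `|z.2| -> f z = 0.

Lemma vanishes_offE M f z : vanishes_off M f -> f z = box M z * f z.
Proof.
move=> fM; rewrite /box /cci; case: (lerP `|z.1| M) => h1; last by rewrite fM ?mulr0//; left.
by case: (lerP `|z.2| M) => h2; [rewrite !mul1r|rewrite fM ?mulr0//; right].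
Qed.

Lemma vanishes_off_bounded M f : continuous f -> vanishes_off M f ->
  exists B, 0 <= B /\ forall z, `|f z| <= B.
Proof.
move=> cf fM.
pose K : set C := `[- `|M|, `|M|]%classic `*` `[- `|M|, `|M|]%classic.
have K0 : K !=set0.
  by exists 0; split; rewrite /= in_itv/= oppr_le0 normr_ge0.
have cK : compact K by apply: compact_setX; exact: segment_compact.
have cb : {within K, continuous (fun p => `|f p|)}.
  by apply: continuous_subspaceT => p; apply: cvg_norm; exact: cf.
have [m Km Hm] := compact_EVT_max K0 cK cb.
exists `|f m|; split => // z; have [->|fz] := eqVneq (f z) 0; first by rewrite normr0.
apply: Hm; rewrite inE; split; rewrite /= in_itv/= -ler_norml.
- rewrite leNgt; apply/negP => h; move/eqP: fz; apply; apply: fM; left.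
  by rewrite (le_lt_trans (ler_norm M)).
- rewrite leNgt; apply/negP => h; move/eqP: fz; apply; apply: fM; right.
  by rewrite (le_lt_trans (ler_norm M)).
Qed.

Lemma rint_vanishes_off M f : continuous f -> vanishes_off M f -> rint mu2 f.
Proof.
move=> cf fM; have [B [B0 HB]] := vanishes_off_bounded cf fM.
apply: (@rint_le _ M2 R mu2 _ _ _ _ (rintZ B (rint_box M))).
  exact: continuous_measurable2.
move=> z; rewrite (vanishes_offE z fM) normrM ger0_norm ?box_ge0// mulrC.
by rewrite ler_wpM2r ?box_ge0.
Qed.

Definition C1c (M : R) (f fx fy : C -> R) :=
  [/\ [/\ continuous f, continuous fx & continuous fy],
      (forall x y : R, is_derive x 1 (fun s : R => f (s, y)) (fx (x, y))),
      (forall x y : R, is_derive y 1 (fun s : R => f (x, s)) (fy (x, y))) &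
      [/\ vanishes_off M f, vanishes_off M fx & vanishes_off M fy]].

Lemma continuous_sectionx (f : C -> R) y : continuous f -> continuous (fun x => f (x, y)).
Proof.
move=> cf x; apply: (@cvg_comp _ _ _ (fun x => (x, y)) f _ (nbhs (x, y))); last exact: cf.
exact: (@cvg_pair _ _ _ (nbhs x) (nbhs x) (nbhs y) _ _ _ id (fun=> y) cvg_id (cvg_cst _)).
Qed.

Lemma continuous_sectiony (f : C -> R) x : continuous f -> continuous (fun y => f (x, y)).
Proof.
move=> cf y; apply: (@cvg_comp _ _ _ (fun y => (x, y)) f _ (nbhs (x, y))); last exact: cf.
exact: (@cvg_pair _ _ _ (nbhs y) (nbhs x) (nbhs y) _ _ _ (fun=> x) id (cvg_cst _) cvg_id).
Qed.

Lemma Rint_by_parts_x M f fx fy (k kx : C -> R) : C1c M f fx fy ->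
  continuous k -> continuous kx ->
  (forall x y : R, is_derive x 1 (fun s : R => k (s, y)) (kx (x, y))) ->
  \int[mu2]_z (fx z * k z) = - \int[mu2]_z (f z * kx z).
Proof.
move=> [[cf cfx cfy] dx dy [vf vfx vfy]] ck ckx dk.
have r1 : rint mu2 (fun z => fx z * k z).
  apply: (@rint_vanishes_off M).
    by move=> z; apply: cvgM; [exact: cfx|exact: ck].
  by move=> z Hz; rewrite vfx// mul0r.
have r2 : rint mu2 (fun z => f z * kx z).
  apply: (@rint_vanishes_off M).
    by move=> z; apply: cvgM; [exact: cf|exact: ckx].
  by move=> z Hz; rewrite vf// mul0r.
apply/eqP; rewrite -subr_eq0 opprK -RintD//; apply/eqP.
rewrite fubini2'; last exact: rintD.
rewrite -[RHS](@Rint0 _ _ R mu1); apply: Rint_ext => y.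
have H := @Rint_derive_compact_support R (fun x => f (x, y) * k (x, y))
  (fun x => fx (x, y) * k (x, y) + f (x, y) * kx (x, y)) M.
have [] // := H.
- move=> x; have h := is_deriveM (dx x y) (dk x y); apply: (is_derive_eq h).
  by rewrite /GRing.scale/= addrC mulrC.
- move=> x; apply: cvgD; apply: cvgM; apply: continuous_sectionx => //.
- by move=> x xM; rewrite vf ?vfx ?mul0r ?addr0//; left.
Qed.

Lemma Rint_by_parts_y M f fx fy (k ky : C -> R) : C1c M f fx fy ->
  continuous k -> continuous ky ->
  (forall x y : R, is_derive y 1 (fun s : R => k (x, s)) (ky (x, y))) ->
  \int[mu2]_z (fy z * k z) = - \int[mu2]_z (f z * ky z).
Proof.
move=> [[cf cfx cfy] dx dy [vf vfx vfy]] ck cky dk.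
have r1 : rint mu2 (fun z => fy z * k z).
  apply: (@rint_vanishes_off M).
    by move=> z; apply: cvgM; [exact: cfy|exact: ck].
  by move=> z Hz; rewrite vfy// mul0r.
have r2 : rint mu2 (fun z => f z * ky z).
  apply: (@rint_vanishes_off M).
    by move=> z; apply: cvgM; [exact: cf|exact: cky].
  by move=> z Hz; rewrite vf// mul0r.
apply/eqP; rewrite -subr_eq0 opprK -RintD//; apply/eqP.
rewrite fubini2; last exact: rintD.
rewrite -[RHS](@Rint0 _ _ R mu1); apply: Rint_ext => x.
have H := @Rint_derive_compact_support R (fun y => f (x, y) * k (x, y))
  (fun y => fy (x, y) * k (x, y) + f (x, y) * ky (x, y)) M.
have [] // := H.
- move=> y; have h := is_deriveM (dy x y) (dk x y); apply: (is_derive_eq h).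
  by rewrite /GRing.scale/= addrC mulrC.
- move=> y; apply: cvgD; apply: cvgM; apply: continuous_sectiony => //.
- by move=> y yM; rewrite vf ?vfy ?mul0r ?addr0//; right.
Qed.

Definition nsq (d : C) : R := d.1 ^+ 2 + d.2 ^+ 2.

Lemma nsq_ge0 d : 0 <= nsq d.
Proof. by rewrite addr_ge0 ?sqr_ge0. Qed.

(** At e = 0 the pair is (Re, - Im) of the Cauchy kernel 1 / d, that is the gradient of log |d|; a
    positive e removes the singularity. *)
Definition ker (e : R) (d : C) : C := (d.1 / (nsq d + e), d.2 / (nsq d + e)).

Lemma is_derive_inv_quad (a e x : R) : 0 < e -> 
  is_derive x 1 (fun s : R => (s ^+ 2 + a ^+ 2 + e)^-1) (- (2 * x) / (x ^+ 2 + a ^+ 2 + e) ^+ 2).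
Proof.
move=> e0.
have D0 : 0 < x ^+ 2 + a ^+ 2 + e by rewrite ltr_wpDl// addr_ge0 ?sqr_ge0.
have h : is_derive x 1 (fun s : R => s ^+ 2 + a ^+ 2 + e) (2 * x).
  have h1 := is_deriveX 2 (is_derive_id x (1 : R)).
  have h2 := is_deriveD (is_deriveD h1 (is_derive_cst (a ^+ 2) x (1 : R))) (is_derive_cst e x (1 : R)).
  by apply: (is_derive_eq h2); rewrite !addr0 expr1 [_ *: 1]mulr1.
have := @is_deriveV R _ x (2 * x) 1 _ h.
rewrite gt_eqF// => /(_ isT) hh; apply: (is_derive_eq hh).
by rewrite /GRing.scale/= mulNr mulrC mulNr.
Qed.

Section regularised.
Variables (e : R) (w : C).
Hypothesis e0 : 0 < e.
Let D (z : C) : R := nsq (z - w) + e.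
Let dx (z : C) : R := z.1 - w.1.
Let dy (z : C) : R := z.2 - w.2.
Let k1 z := (ker e (z - w)).1.
Let k2 z := (ker e (z - w)).2.

Lemma regularised_denom_gt0 z : 0 < D z.
Proof. by rewrite ltr_wpDl// nsq_ge0. Qed.

Let D_neq0 z : D z != 0. Proof. by rewrite gt_eqF// regularised_denom_gt0. Qed.

Let cdx : continuous dx.
Proof. by move=> z; apply: cvgB; [exact: cvg_fst|exact: cvg_cst]. Qed.
Let cdy : continuous dy.
Proof. by move=> z; apply: cvgB; [exact: cvg_snd|exact: cvg_cst]. Qed.
Let cD : continuous D.
Proof.
move=> z; apply: cvgD; last exact: cvg_cst.
by apply: cvgD; apply: cvgM; [exact: cdx|exact: cdx|exact: cdy|exact: cdy].
Qed.
Let cDV : continuous (fun z => (D z)^-1).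
Proof. by move=> z; apply: cvgV; [exact: D_neq0|exact: cD]. Qed.
Let ck1 : continuous k1.
Proof. by move=> z; apply: cvgM; [exact: cdx|exact: cDV]. Qed.
Let ck2 : continuous k2.
Proof. by move=> z; apply: cvgM; [exact: cdy|exact: cDV]. Qed.

Let k1x (z : C) : R := (D z)^-1 - 2 * dx z * dx z * ((D z)^-1 * (D z)^-1).
Let k12 (z : C) : R := - (2 * dx z * dy z * ((D z)^-1 * (D z)^-1)).
Let k2y (z : C) : R := (D z)^-1 - 2 * dy z * dy z * ((D z)^-1 * (D z)^-1).

Let c2 (u v : C -> R) : continuous u -> continuous v ->
  continuous (fun z => 2 * u z * v z * ((D z)^-1 * (D z)^-1)).
Proof.
move=> cu cv z; apply: cvgM; last by apply: cvgM; exact: cDV.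
by apply: cvgM; last exact: cv; apply: cvgM; [exact: cvg_cst|exact: cu].
Qed.

Let ck1x : continuous k1x.
Proof. by move=> z; apply: cvgB; [exact: cDV|exact: c2]. Qed.
Let ck12 : continuous k12.
Proof. by move=> z; apply: cvgN; exact: c2. Qed.
Let ck2y : continuous k2y.
Proof. by move=> z; apply: cvgB; [exact: cDV|exact: c2]. Qed.

Let dDx (x y : R) : is_derive x 1 (fun s : R => (D (s, y))^-1) (- (2 * dx (x, y)) / D (x, y) ^+ 2).
Proof.
have h := @is_derive_inv_quad (y - w.2) e (x - w.1) e0.
have s := is_deriveB (is_derive_id x (1 : R)) (is_derive_cst w.1 x (1 : R)).
have := @is_derive1_comp _ (fun s : R => (s ^+ 2 + (y - w.2) ^+ 2 + e)^-1) (id - cst w.1) x _ _ h s.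
by move=> hh; apply: (is_derive_eq hh); rewrite subr0 mulr1.
Qed.

Let dDy (x y : R) : is_derive y 1 (fun s : R => (D (x, s))^-1) (- (2 * dy (x, y)) / D (x, y) ^+ 2).
Proof.
have h := @is_derive_inv_quad (x - w.1) e (y - w.2) e0.
have s := is_deriveB (is_derive_id y (1 : R)) (is_derive_cst w.2 y (1 : R)).
have := @is_derive1_comp _ (fun s : R => (s ^+ 2 + (x - w.1) ^+ 2 + e)^-1) (id - cst w.2) y _ _ h s.
have -> : (fun s : R => (s ^+ 2 + (x - w.1) ^+ 2 + e)^-1) \o (id - cst w.2) = (fun s : R => (D (x, s))^-1).
  by apply/funext => t; rewrite /D /nsq/= [X in X + e]addrC.
move=> hh; apply: (is_derive_eq hh); rewrite subr0 mulr1.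
by rewrite /D /nsq/= [X in X + e]addrC.
Qed.

Let dk1x (x y : R) : is_derive x 1 (fun s : R => k1 (s, y)) (k1x (x, y)).
Proof.
have s := is_deriveB (is_derive_id x (1 : R)) (is_derive_cst w.1 x (1 : R)).
have h := is_deriveM s (dDx x y); apply: (is_derive_eq h).
rewrite /GRing.scale/= subr0 mulr1 /k1x !fctE /dx/=; field; exact: D_neq0.
Qed.

Let dk1y (x y : R) : is_derive y 1 (fun s : R => k1 (x, s)) (k12 (x, y)).
Proof.
have h := is_deriveM (is_derive_cst (x - w.1) y (1 : R)) (dDy x y); apply: (is_derive_eq h).
rewrite /GRing.scale/= mulr0 addr0 /k12 /dx /dy/=; field; exact: D_neq0.
Qed.

Let dk2x (x y : R) : is_derive x 1 (fun s : R => k2 (s, y)) (k12 (x, y)).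
Proof.
have h := is_deriveM (is_derive_cst (y - w.2) x (1 : R)) (dDx x y); apply: (is_derive_eq h).
rewrite /GRing.scale/= mulr0 addr0 /k12 /dx /dy/=; field; exact: D_neq0.
Qed.

Let dk2y (x y : R) : is_derive y 1 (fun s : R => k2 (x, s)) (k2y (x, y)).
Proof.
have s := is_deriveB (is_derive_id y (1 : R)) (is_derive_cst w.2 y (1 : R)).
have h := is_deriveM s (dDy x y); apply: (is_derive_eq h).
rewrite /GRing.scale/= subr0 mulr1 /k2y !fctE /dy/=; field; exact: D_neq0.
Qed.

(** Integration by parts against the gradient of log(|z - w|^2 + e) / 2: its divergence is 2 e / D^2
    and its curl is 0. *)
Lemma regularised_identities M f fx fy : C1c M f fx fy ->
  [/\ rint mu2 (fun z => fx z * k1 z + fy z * k2 z),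
      rint mu2 (fun z => fy z * k1 z - fx z * k2 z),
   \int[mu2]_z (fx z * k1 z + fy z * k2 z) =
    - \int[mu2]_z (f z * (2 * e / D z ^+ 2)) &
   \int[mu2]_z (fy z * k1 z - fx z * k2 z) = 0].
Proof.
move=> Hf; have [[cf cfx cfy] _ _ [vf vfx vfy]] := Hf.
have r (g h : C -> R) : continuous g -> continuous h -> vanishes_off M g ->
    rint mu2 (fun z => g z * h z).
  move=> cg ch vg; apply: (@rint_vanishes_off M).
    by move=> z; apply: cvgM; [exact: cg|exact: ch].
  by move=> z Hz; rewrite vg// mul0r.
have r1 := r _ _ cfx ck1 vfx; have r2 := r _ _ cfy ck2 vfy.
have r3 := r _ _ cfy ck1 vfy; have r4 := r _ _ cfx ck2 vfx.
split; [exact: rintD|exact: rintB| |].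
- rewrite RintD// (Rint_by_parts_x Hf ck1 ck1x dk1x) (Rint_by_parts_y Hf ck2 ck2y dk2y).
  rewrite -opprD -RintD; [|exact: r|exact: r].
  congr (- _); apply: Rint_ext => z; rewrite -mulrDr; congr (_ * _).
  have Dz := D_neq0 z; rewrite /k1x /k2y.
  have -> : e = D z - dx z ^+ 2 - dy z ^+ 2 by rewrite /D /nsq/= /dx /dy; ring.
  by field.
- rewrite RintB// (Rint_by_parts_y Hf ck1 ck12 dk1y) (Rint_by_parts_x Hf ck2 ck12 dk2x).
  by rewrite opprK addrC subrr.
Qed.

End regularised.
End plane.

(** * Removing the regularisation *)

Section pompeiu.
Context {R : realType}.
Local Notation mu1 := (@lebesgue_measure R).
Local Notation mu2 := (leb2 R).
Local Notation M2 := (measurableTypeR R * measurableTypeR R)%type.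
Local Notation C := (R * R)%type.

Lemma cvg_pairR (T : Type) (F : set_system T) (FF : Filter F) (f g : T -> R) (a b : R) :
  f x @[x --> F] --> a -> g x @[x --> F] --> b -> (f x, g x) @[x --> F] --> (a, b).
Proof. by move=> fa gb; exact: (@cvg_pair _ _ _ F (nbhs a) (nbhs b) _ _ _ f g fa gb). Qed.

Lemma leb2_affine (c a b : R) (A : set M2) : 0 < c -> measurable A ->
  mu2 A = ((c * c)%:E * mu2 ((fun z : M2 => ((c * z.1 + a)%R, (c * z.2 + b)%R) : M2) @^-1` A))%E.
Proof.
move=> c0 mA.
pose f1 (x : measurableTypeR R) : measurableTypeR R := c * x + a.
pose f2 (x : measurableTypeR R) : measurableTypeR R := c * x + b.
have mf1 : measurable_fun setT f1 by exact: measurable_affine.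
have mf2 : measurable_fun setT f2 by exact: measurable_affine.
pose phi (z : M2) : M2 := (f1 z.1, f2 z.2).
have mphi : measurable_fun setT phi.
  by apply/measurable_fun_pair => /=; apply: measurableT_comp.
have cc0 : 0 <= c * c by rewrite mulr_ge0// ltW.
have := @product_measure_unique _ _ _ _ _ mu1 mu1 (mscale (NngNum cc0) (pushforward mu2 phi)).
move=> /(_ mphi) H; rewrite /leb2 (H _ _ mA)//.
move=> B D mB mD.
have mB' : measurable (f1 @^-1` B) by rewrite -[X in measurable X]setTI; exact: mf1.
have mD' : measurable (f2 @^-1` D) by rewrite -[X in measurable X]setTI; exact: mf2.
transitivity ((c * c)%:E * mu2 ((f1 @^-1` B) `*` (f2 @^-1` D)))%E; first by [].
transitivity ((c * c)%:E * (mu1 (f1 @^-1` B) * mu1 (f2 @^-1` D)))%E.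
  by congr (_ * _)%E; exact: product_measure1E.
rewrite EFinM muleACA; congr (_ * _)%E; apply/esym.
  exact: (lebesgue_measure_affine a c0 mB).
exact: (lebesgue_measure_affine b c0 mD).
Qed.

Lemma Rint2_affine (c a b : R) (f : C -> R) : 0 < c -> rint mu2 f ->
  rint mu2 (fun z => f (c * z.1 + a, c * z.2 + b)) /\
  Rintegral mu2 setT f = (c * c) * \int[mu2]_z (f (c * z.1 + a, c * z.2 + b)).
Proof.
move=> c0 rf; have cc0 : 0 < c * c by rewrite mulr_gt0.
pose phi (z : M2) : M2 := (c * z.1 + a, c * z.2 + b).
have mphi : measurable_fun setT phi.
  apply/measurable_fun_pair => /=.
    by apply: (measurableT_comp (measurable_affine c a)).
  by apply: (measurableT_comp (measurable_affine c b)).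
have H A : measurable A -> mu2 A = (((NngNum (ltW cc0))%:num)%:E * mu2 (phi @^-1` A))%E.
  by move=> mA; exact: leb2_affine.
split; first exact: (@rint_scaling _ M2 R mu2 phi mphi (NngNum (ltW cc0)) H f cc0 rf).
exact: (@Rint_scaling _ M2 R mu2 phi mphi (NngNum (ltW cc0)) H f cc0 rf).
Qed.

Lemma continuous_nsq : continuous (@nsq R).
Proof.
move=> z; apply: cvgD; apply: cvgM; [exact: cvg_fst|exact: cvg_fst|exact: cvg_snd|exact: cvg_snd].
Qed.

Lemma inv_quad_Lmaj (x : R) : (1 + x ^+ 2)^-1 <= 2 * Lmaj x.
Proof.
have x2 := sqr_ge0 x; have d0 : 0 < 1 + x ^+ 2 by rewrite ltr_wpDr.
rewrite /Lmaj; case: eqVneq => [->|x0].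
  by rewrite expr0n/= addr0 invr1 mulr1 ler1n.
(* With |x| = s^2 the claim becomes s (1 + s^2) <= 2 (1 + s^4). *)
set s := Num.sqrt `|x|.
have s0 : 0 < s by rewrite sqrtr_gt0 normr_gt0.
have sx : `|x| = s ^+ 2 by rewrite sqr_sqrtr.
have -> : x ^+ 2 = s ^+ 4 by rewrite -real_normK ?num_real// sx -exprM.
rewrite -[leRHS]invrK lef_pV2 ?posrE; last 2 first.
- by rewrite ltr_wpDr// exprn_ge0// ltW.
- by rewrite invr_gt0 mulr_gt0// invr_gt0 sx mulr_gt0// addr_gt0// exprn_gt0.
rewrite invfM invrK sx ler_pdivrMl//.
have h0 := sqr_ge0 (s ^+ 2 - s); have h1 := sqr_ge0 (1 - s); have h2 := sqr_ge0 (1 - s ^+ 2).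
rewrite !exprS expr0 ?mulr1 in h0 h1 h2 *; nra.
Qed.

Definition poisson (z : C) : R := 2 / (nsq z + 1) ^+ 2.

Lemma continuous_poisson : continuous poisson.
Proof.
move=> z; apply: cvgM; first exact: cvg_cst.
have d0 : 0 < nsq z + 1 by rewrite ltr_wpDl// nsq_ge0.
apply: cvgV; first by rewrite expf_neq0// gt_eqF.
have cc : (nsq x + 1) @[x --> z] --> nsq z + 1.
  by apply: cvgD; [exact: continuous_nsq|exact: cvg_cst].
by rewrite expr2; apply: cvgM; exact: cc.
Qed.

Lemma poisson_ge0 z : 0 <= poisson z.
Proof. by rewrite divr_ge0// exprn_ge0// addr_ge0// nsq_ge0. Qed.

Lemma rint_LL : rint mu2 (fun z => Lmaj z.1 * Lmaj z.2).
Proof. by have [] := @rint_prod _ _ _ _ _ mu1 mu1 _ _ (@rint_Lmaj R) (@rint_Lmaj R). Qed.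

Lemma rint_poisson : rint mu2 poisson.
Proof.
(* (1 + x^2) (1 + y^2) <= (1 + |z|^2)^2; the 8 collects the numerator 2 of [poisson] and a factor 2
   from [inv_quad_Lmaj] in each variable. *)
apply: (@rint_le _ M2 R mu2 _ _ _ _ (rintZ 8 rint_LL)).
  by apply: continuous_measurable2; exact: continuous_poisson.
move=> z; rewrite ger0_norm ?poisson_ge0// /poisson.
have h1 := inv_quad_Lmaj z.1; have h2 := inv_quad_Lmaj z.2.
have d1 : 0 < 1 + z.1 ^+ 2 by rewrite ltr_wpDr// sqr_ge0.
have d2 : 0 < 1 + z.2 ^+ 2 by rewrite ltr_wpDr// sqr_ge0.
have d0 : 0 < nsq z + 1 by rewrite ltr_wpDl// nsq_ge0.
apply: (@le_trans _ _ (2 * ((1 + z.1 ^+ 2)^-1 * (1 + z.2 ^+ 2)^-1))).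
  rewrite ler_wpM2l// -invfM lef_pV2 ?posrE ?mulr_gt0// ?exprn_gt0//.
  have := sqr_ge0 z.1; have := sqr_ge0 z.2; rewrite /nsq; nra.
have := @ler_pM _ _ _ _ _ _ _ h1 h2; rewrite !invr_ge0 !(ltW d1, ltW d2) => /(_ isT isT).
lra.
Qed.

(** The number 2 pi, kept symbolic: positivity allows the solution to be normalised by it. *)
Definition poisson_mass : R := Rintegral mu2 setT poisson.

Lemma poisson_mass_gt0 : 0 < poisson_mass.
Proof.
have [r1 i1] := @rint_prod _ _ _ _ _ mu1 mu1 _ _ (rint_cci (1 : R)) (rint_cci (1 : R)).
have i2 : 1 <= Rintegral mu1 setT (cci (1:R)).
  have : Rintegral mu1 setT (cci (1:R)) = 2.
    apply: EFin_inj; rewrite -(RintE (rint_cci 1)).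
    have -> : (fun x => (cci 1 x)%:E) = EFin \o (\1_(`[(- 1), 1]%classic : set R)).
      apply/funext => x /=; rewrite indicE mem_setE /cci in_itv/= -ler_norml; by case: ifP.
    rewrite integral_indic// setIT [LHS](@lebesgue_measure_itv R `[(-1), 1])/= lte_fin.
    have h1 : (-1 : R) < 1 := lt_trans (ltrN10 R) ltr01.
    by rewrite h1 opprK -EFinD -(natrD R 1 1).
  by move=> ->; rewrite ler1n.
(* On the square |x|, |y| <= 1 one has nsq z <= 2, so [poisson] is at least 2 / 9 there. *)
apply: (@lt_le_trans _ _ (2 / 9 * \int[mu2]_z (cci 1 z.1 * cci 1 z.2))).
  by rewrite i1 mulr_gt0 ?divr_gt0// mulr_gt0//; lra.
rewrite -RintZ//; apply: Rint_le; [exact: rintZ|exact: rint_poisson|].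
move=> z; rewrite /cci; case: ifPn => h1; last by rewrite mul0r mulr0 poisson_ge0.
case: ifPn => h2; last by rewrite !mulr0 poisson_ge0.
rewrite !mulr1 /poisson ler_wpM2l// lef_pV2 ?posrE ?exprn_gt0// ?ltr_wpDl ?nsq_ge0//.
have k1 : z.1 ^+ 2 <= 1 by rewrite -real_normK ?num_real// expr_le1.
have k2 : z.2 ^+ 2 <= 1 by rewrite -real_normK ?num_real// expr_le1.
have k0 : 0 <= nsq z := nsq_ge0 z.
have k3 : nsq z <= 2 by rewrite /nsq; lra.
nra.
Qed.

(** An approximate identity: with d = 1 / (n + 1) and regularisation d^2, the substitution z = w + d
    z' turns the kernel into the fixed function [poisson], and the bounded f(w + d z') tends to
    f(w). *)
Lemma poisson_limit M (f fx fy : C -> R) (w : C) : C1c M f fx fy ->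
  \int[mu2]_z (f z * (2 * (n.+1%:R^-1 ^+ 2) / (nsq (z - w) + n.+1%:R^-1 ^+ 2) ^+ 2))
    @[n --> \oo] --> f w * poisson_mass.
Proof.
move=> [[cf _ _] _ _ [vf _ _]].
have [B [B0 HB]] := vanishes_off_bounded cf vf.
have E n : \int[mu2]_z (f z * (2 * (n.+1%:R^-1 ^+ 2) / (nsq (z - w) + n.+1%:R^-1 ^+ 2) ^+ 2)) =
   \int[mu2]_z (f (n.+1%:R^-1 * z.1 + w.1, n.+1%:R^-1 * z.2 + w.2) * poisson z).
  set d : R := n.+1%:R^-1; have d0 : 0 < d by rewrite invr_gt0.
  have rF : rint mu2 (fun z => f z * (2 * d ^+ 2 / (nsq (z - w) + d ^+ 2) ^+ 2)).
    apply: (@rint_vanishes_off _ M); last by move=> z Hz; rewrite vf// mul0r.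
    move=> z; apply: cvgM; first exact: cf.
    apply: cvgM; first exact: cvg_cst.
    have dd0 : 0 < nsq (z - w) + d ^+ 2 by rewrite ltr_wpDl ?nsq_ge0// exprn_gt0.
    apply: cvgV; first by rewrite expf_neq0// gt_eqF.
    have cc : (nsq (x - w) + d ^+ 2) @[x --> z] --> nsq (z - w) + d ^+ 2.
      apply: cvgD; last exact: cvg_cst.
      apply: (@cvg_comp _ _ _ (fun x => x - w) (@nsq R) _ (nbhs (z - w))); last exact: continuous_nsq.
      by apply: cvgB; [exact: cvg_id|exact: cvg_cst].
    by rewrite expr2; apply: cvgM; exact: cc.
  have [rF' ->] := Rint2_affine w.1 w.2 d0 rF.
  rewrite -RintZ//; apply: Rint_ext => z.
  rewrite mulrCA; congr (_ * _); rewrite /poisson.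
  have -> : nsq ((d * z.1 + w.1, d * z.2 + w.2) - w) = d ^+ 2 * nsq z.
    rewrite /nsq/=; ring.
  have k0 : nsq z + 1 != 0 by rewrite gt_eqF// ltr_wpDl// nsq_ge0.
  have -> : d ^+ 2 * nsq z + d ^+ 2 = d ^+ 2 * (nsq z + 1) by ring.
  move: (d) (gt_eqF d0) => d' /negbT d'0; move: (nsq z + 1 : R) k0 => q q0.
  by field; rewrite q0 d'0.
under eq_fun do rewrite E.
rewrite -RintZ; last exact: rint_poisson.
have D := @Rint_dominated _ M2 R mu2
  (fun n z => f (n.+1%:R^-1 * z.1 + w.1, n.+1%:R^-1 * z.2 + w.2) * poisson z)
  (fun z => f w * poisson z) (fun z => B * poisson z).
apply: (proj2 (D _ _ _ _)) => {D}.
- move=> n; apply: measurable_funM; last exact: (rint_measurable rint_poisson).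
  apply: (@continuous_measurable2 R (fun z => f (n.+1%:R^-1 * z.1 + w.1, n.+1%:R^-1 * z.2 + w.2))) => z.
  apply: (@cvg_comp _ _ _ (fun z => (n.+1%:R^-1 * z.1 + w.1, n.+1%:R^-1 * z.2 + w.2)) f _
    (nbhs (n.+1%:R^-1 * z.1 + w.1, n.+1%:R^-1 * z.2 + w.2))); last exact: cf.
  apply: cvg_pairR; (apply: cvgD; last exact: cvg_cst); (apply: cvgM; first exact: cvg_cst).
    exact: cvg_fst.
  exact: cvg_snd.
- move=> z; apply: cvgM; last exact: cvg_cst.
  apply: (@cvg_comp _ _ _ (fun n => (n.+1%:R^-1 * z.1 + w.1, n.+1%:R^-1 * z.2 + w.2)) f _ (nbhs w)); last exact: cf.
  have hz (a b : R) : n.+1%:R^-1 * a + b @[n --> \oo] --> b.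
    rewrite -[X in _ --> X]add0r; apply: cvgD; last exact: cvg_cst.
    rewrite -[X in _ --> X](mul0r a); apply: cvgM; last exact: cvg_cst.
    exact: cvg_harmonic.
  by have := cvg_pairR _ (hz z.1 w.1) (hz z.2 w.2); rewrite -surjective_pairing; apply.
- exact: (rintZ _ rint_poisson).
- by move=> n z; rewrite normrM (ger0_norm (poisson_ge0 z)) ler_wpM2r ?poisson_ge0.
Qed.

Definition isq (t : R) : R := (Num.sqrt `|t|)^-1.

Lemma isq_ge0 t : 0 <= isq t. Proof. by rewrite invr_ge0 sqrtr_ge0. Qed.

Lemma measurable_isq : measurable_fun setT isq.
Proof.
apply: (measurableT_comp measurable_inv).
apply: measurableT_comp => //; apply: continuous_measurable_fun.
exact: sqrt_continuous.
Qed.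

Lemma isq_Lmaj t : isq t <= (1 + `|t|) * Lmaj t.
Proof.
rewrite /isq /Lmaj; case: eqVneq => [->|t0].
  by rewrite normr0 sqrtr0 invr0 addr0 mulr1.
have s0 : 0 < Num.sqrt `|t| by rewrite sqrtr_gt0 normr_gt0.
have d0 : 0 < 1 + `|t| by rewrite ltr_wpDr.
by rewrite invfM mulrCA divff ?mulr1// gt_eqF.
Qed.

(* The kernel has absolute value [1 / |d|], which off the coordinate axes is at most the product [isq d.1 * isq d.2]. *)
Definition kmaj (d : C) : R := isq d.1 * isq d.2 +
  (if (d.1 == 0) || (d.2 == 0) then `|d.1|^-1 + `|d.2|^-1 else 0).

Lemma kmaj_ge0 d : 0 <= kmaj d.
Proof.
by rewrite addr_ge0 ?mulr_ge0 ?isq_ge0//; case: ifP => // _; rewrite addr_ge0// invr_ge0.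
Qed.

Lemma measurable_kmaj : measurable_fun setT (kmaj : M2 -> measurableTypeR R).
Proof.
apply: measurable_funD.
  by apply: measurable_funM; apply: (measurableT_comp measurable_isq).
apply: measurable_fun_ifT => //.
  apply: measurable_or; apply: measurable_fun_eqr => //.
by apply: measurable_funD; apply: (measurableT_comp measurable_inv); apply: measurableT_comp.
Qed.

Lemma coord1_neq_ae (a : R) : {ae mu2, forall z : C, z.1 != a}.
Proof.
have H : {ae mu1, forall x : R, x != a}.
  exists [set a]; split => //; first exact: lebesgue_measure_set1.
  by move=> x /= /negP; rewrite negbK => /eqP.
exact: (@ae_fst _ _ _ _ _ mu1 mu1 _ H).
Qed.

Lemma coord2_neq_ae (a : R) : {ae mu2, forall z : C, z.2 != a}.
Proof.
have H : {ae mu1, forall x : R, x != a}.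
  exists [set a]; split => //; first exact: lebesgue_measure_set1.
  by move=> x /= /negP; rewrite negbK => /eqP.
exact: (@ae_snd _ _ _ _ _ mu1 mu1 _ H).
Qed.

(** For |t| <= M, [isq t] is at most (1 + |M|) [Lmaj t]; the correction on the axes lives on a null
    set. *)
Lemma rint_box_kmaj M : rint mu2 (fun z => box M z * kmaj z).
Proof.
have r1 : rint mu2 (fun z => box M z * (isq z.1 * isq z.2)).
  apply: (@rint_le _ M2 R mu2 _ _ _ _ (rintZ ((1 + `|M|) * (1 + `|M|)) rint_LL)).
    apply: measurable_funM; first exact: measurable_box.
    by apply: measurable_funM; apply: (measurableT_comp measurable_isq).
  move=> z; rewrite ger0_norm ?mulr_ge0 ?isq_ge0 ?cci_ge0//.
  have i0 t : 0 <= cci M t * isq t by rewrite mulr_ge0 ?cci_ge0 ?isq_ge0.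
  have ib t : cci M t * isq t <= (1 + `|M|) * Lmaj t.
    rewrite /cci; case: ifPn => tM; last by rewrite mul0r mulr_ge0 ?Lmaj_ge0// addr_ge0.
    rewrite mul1r (le_trans (isq_Lmaj t))// ler_wpM2r ?Lmaj_ge0// lerD2l.
    by rewrite (le_trans tM)// ler_norm.
  rewrite (_ : box M z * _ = (cci M z.1 * isq z.1) * (cci M z.2 * isq z.2)); last by rewrite /box; ring.
  rewrite [leRHS](_ : _ = ((1 + `|M|) * Lmaj z.1) * ((1 + `|M|) * Lmaj z.2)); last by ring.
  exact: ler_pM.
apply: (@rint_ae _ M2 R mu2 _ _ _ _ r1).
  by apply: measurable_funM; [exact: measurable_box|exact: measurable_kmaj].
have := ae_and (coord1_neq_ae 0) (coord2_neq_ae 0); apply: ae_imp => z [z1 z2].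
by rewrite /kmaj (negbTE z1) (negbTE z2) addr0.
Qed.

(** Off the axes |u| / (u^2 + v^2) <= |u v|^(-1/2): with |u| = s^2 and |v| = t^2 this is s^3 t <=
    s^4 + t^4. On an axis [isq] takes the value 0 and the second summand of [kmaj] takes over. *)
Lemma ker_kmaj (e : R) (d : C) : 0 <= e ->
  `|(ker e d).1| <= kmaj d /\ `|(ker e d).2| <= kmaj d.
Proof.
move=> e0; rewrite /ker/= !normrM.
have n0 := nsq_ge0 d.
have [d0|dn] := eqVneq (nsq d) 0.
  have /andP[/eqP h1 /eqP h2] : (d.1 == 0) && (d.2 == 0).
    by move/eqP: d0; rewrite /nsq paddr_eq0 ?sqr_ge0// !sqrf_eq0.
  by rewrite h1 h2 normr0 !mul0r kmaj_ge0.
have np : 0 < nsq d by rewrite lt_neqAle eq_sym dn.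
have D0 : 0 < nsq d + e by rewrite ltr_wpDr.
have DI : `|(nsq d + e)^-1| <= (nsq d)^-1.
  by rewrite ger0_norm ?invr_ge0 ?(ltW D0)// lef_pV2 ?posrE// lerDl.
suff H (u v : R) : u ^+ 2 + v ^+ 2 = nsq d ->
    (u != 0 -> v != 0 -> `|u| / nsq d <= isq u * isq v) ->
    true.
  suff K (u v : R) : u ^+ 2 + v ^+ 2 = nsq d -> `|u| / nsq d <= isq u * isq v +
      (if (u == 0) || (v == 0) then `|u|^-1 + `|v|^-1 else 0).
    split.
      by apply: le_trans (K d.1 d.2 _) => //; apply: ler_wpM2l.
    apply: (@le_trans _ _ (`|d.2| / nsq d)); first exact: ler_wpM2l.
    apply: le_trans (K d.2 d.1 _) _; first by rewrite addrC.
    by rewrite /kmaj orbC mulrC [X in if _ then X else _]addrC.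
  move=> uv; case: (eqVneq u 0) => [->|u0] /=.
    by rewrite normr0 mul0r addr_ge0 ?mulr_ge0 ?isq_ge0// addr_ge0// invr_ge0.
  case: (eqVneq v 0) => [v0|v0] /=.
    rewrite ler_wpDl ?mulr_ge0 ?isq_ge0// ler_wpDr ?invr_ge0//.
    rewrite -uv v0 expr0n/= addr0 -real_normK ?num_real//.
    by rewrite expr2 invfM mulrA divff ?mul1r// normr_eq0.
  rewrite addr0 /isq -invfM.
  set s := Num.sqrt `|u|; set t := Num.sqrt `|v|.
  have s0 : 0 < s by rewrite sqrtr_gt0 normr_gt0.
  have t0 : 0 < t by rewrite sqrtr_gt0 normr_gt0.
  have su : `|u| = s ^+ 2 by rewrite sqr_sqrtr.
  have tv : `|v| = t ^+ 2 by rewrite sqr_sqrtr.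
  rewrite -uv -(real_normK (num_real u)) -(real_normK (num_real v)) su tv.
  have q0 : 0 < (s ^+ 2) ^+ 2 + (t ^+ 2) ^+ 2 by rewrite addr_gt0// !exprn_gt0.
  rewrite ler_pdivrMr// ler_pdivlMl ?mulr_gt0//.
  have h1 := sqr_ge0 (s ^+ 2 - t ^+ 2); have h2 := sqr_ge0 (s - t).
  have h3 : s ^+ 3 * t <= (s ^+ 2) ^+ 2 + (t ^+ 2) ^+ 2.
    have h4 : s ^+ 3 * t <= s ^+ 2 * (s ^+ 2 + t ^+ 2) / 2.
      rewrite ler_pdivlMr//; rewrite (_ : s ^+ 3 * t * 2 = s ^+ 2 * (2 * s * t)); last by ring.
      by rewrite ler_wpM2l ?sqr_ge0//; rewrite !expr2 in h2 *; nra.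
    apply: (le_trans h4); rewrite !expr2 in h1 *; nra.
  by rewrite (_ : s * t * s ^+ 2 = s ^+ 3 * t)//; ring.
by [].
Qed.

Lemma rint_kmaj_shift M w (f : C -> R) B : continuous f -> vanishes_off M f ->
  (forall z, `|f z| <= B) -> 0 <= B ->
  rint mu2 (fun z => `|f z| * kmaj (z - w)).
Proof.
move=> cf vf HB B0.
(* The box of size N contains the support of f translated by - w. *)
pose N := `|M| + `|w.1| + `|w.2|.
have [r _] := Rint2_affine (- w.1) (- w.2) ltr01 (rint_box_kmaj N).
apply: (@rint_le _ M2 R mu2 _ _ _ _ (rintZ B r)).
  apply: measurable_funM.
    by apply: measurableT_comp => //; exact: continuous_measurable2.
  have ms : measurable_fun setT (fun z : M2 => ((1 * z.1 + - w.1, 1 * z.2 + - w.2) : M2)).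
    apply/measurable_fun_pair => /=.
      by apply: (measurableT_comp (measurable_affine 1 (- w.1))).
    by apply: (measurableT_comp (measurable_affine 1 (- w.2))).
  have := measurableT_comp measurable_kmaj ms.
  by congr (measurable_fun _ _); apply/funext => z /=; rewrite !mul1r.
move=> z; rewrite !mul1r ger0_norm ?mulr_ge0 ?kmaj_ge0//.
rewrite -[(z.1 - w.1, z.2 - w.2)]/(z - w).
have [h|h] := pselect (M < `|z.1| \/ M < `|z.2|).
  by rewrite vf// normr0 mul0r mulr_ge0// mulr_ge0 ?box_ge0 ?kmaj_ge0.
have h1 : `|z.1| <= M by rewrite leNgt; apply/negP => k; apply: h; left.
have h2 : `|z.2| <= M by rewrite leNgt; apply/negP => k; apply: h; right.
rewrite box_eq1 ?mul1r ?ler_wpM2r ?kmaj_ge0//=.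
- by apply: (le_trans (ler_normB _ _)); have := ler_norm M; have := normr_ge0 w.2; rewrite /N; lra.
- by apply: (le_trans (ler_normB _ _)); have := ler_norm M; have := normr_ge0 w.1; rewrite /N; lra.
Qed.

Lemma norm_comb_le (a b u v m : R) : `|u| <= m -> `|v| <= m ->
  `|a * u + b * v| <= `|a| * m + `|b| * m.
Proof.
move=> um vm; apply: (le_trans (ler_normD _ _)); rewrite !normrM.
by apply: lerD; apply: ler_wpM2l.
Qed.

(** Real and imaginary parts of int (f_x + i f_y) / (z - w) = - 2 pi f(w), as limits of the
    regularised identities for e = 1 / (n + 1)^2. [kmaj] dominates the kernels for all e at once;
    the divergence concentrates at w and the curl stays 0. *)
Theorem cauchy_pompeiu M (f fx fy : C -> R) (w : C) : C1c M f fx fy ->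
  [/\ rint mu2 (fun z => fx z * (ker 0 (z - w)).1 + fy z * (ker 0 (z - w)).2),
      rint mu2 (fun z => fy z * (ker 0 (z - w)).1 - fx z * (ker 0 (z - w)).2),
      \int[mu2]_z (fx z * (ker 0 (z - w)).1 + fy z * (ker 0 (z - w)).2) =
        - (f w * poisson_mass) &
      \int[mu2]_z (fy z * (ker 0 (z - w)).1 - fx z * (ker 0 (z - w)).2) = 0].
Proof.
move=> Hf; have [[cf cfx cfy] _ _ [vf vfx vfy]] := Hf.
have [Bx [Bx0 HBx]] := vanishes_off_bounded cfx vfx.
have [By [By0 HBy]] := vanishes_off_bounded cfy vfy.
pose g z := `|fx z| * kmaj (z - w) + `|fy z| * kmaj (z - w).
have rg : rint mu2 g.
  by apply: rintD; [apply: (rint_kmaj_shift w cfx vfx HBx Bx0)|apply: (rint_kmaj_shift w cfy vfy HBy By0)].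
pose e (n : nat) : R := n.+1%:R^-1 ^+ 2.
have e0 n : 0 < e n by rewrite exprn_gt0// invr_gt0.
have reg n := regularised_identities w (e0 n) Hf.
have ce : e n @[n --> \oo] --> (0 : R).
  rewrite /e; under eq_fun do rewrite expr2.
  have := cvgM (@cvg_harmonic R) (@cvg_harmonic R); rewrite mulr0; exact.
have ck z : (ker (e n) z).1 @[n --> \oo] --> (ker 0 z).1 /\ (ker (e n) z).2 @[n --> \oo] --> (ker 0 z).2.
  have [nz|nz] := eqVneq (nsq z) 0.
    have /andP[/eqP h1 /eqP h2] : (z.1 == 0) && (z.2 == 0).
      by move/eqP: nz; rewrite /nsq paddr_eq0 ?sqr_ge0// !sqrf_eq0.
    rewrite /ker/= h1 h2 !mul0r; split; under eq_fun do rewrite mul0r; exact: cvg_cst.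
  have ci : (nsq z + e n)^-1 @[n --> \oo] --> (nsq z + 0)^-1.
    by apply: cvgV; [rewrite addr0|apply: cvgD; [exact: cvg_cst|exact: ce]].
  by split; apply: cvgM => //; exact: cvg_cst.
have gb (a b : R) (d : C) n : `|a * (ker (e n) d).1 + b * (ker (e n) d).2| <= `|a| * kmaj d + `|b| * kmaj d.
  have [k1 k2] := ker_kmaj d (ltW (e0 n)).
  exact: norm_comb_le.
have gb' (a b : R) (d : C) n : `|b * (ker (e n) d).1 - a * (ker (e n) d).2| <= `|a| * kmaj d + `|b| * kmaj d.
  have [k1 k2] := ker_kmaj d (ltW (e0 n)).
  rewrite addrC -mulNr -(normrN a); exact: norm_comb_le.
have D1 := @Rint_dominated _ M2 R mu2
  (fun n z => fx z * (ker (e n) (z - w)).1 + fy z * (ker (e n) (z - w)).2)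
  (fun z => fx z * (ker 0 (z - w)).1 + fy z * (ker 0 (z - w)).2) g.
have D2 := @Rint_dominated _ M2 R mu2
  (fun n z => fy z * (ker (e n) (z - w)).1 - fx z * (ker (e n) (z - w)).2)
  (fun z => fy z * (ker 0 (z - w)).1 - fx z * (ker 0 (z - w)).2) g.
have {D1} [r1 l1] : rint mu2 (fun z => fx z * (ker 0 (z - w)).1 + fy z * (ker 0 (z - w)).2) /\
  \int[mu2]_z (fx z * (ker (e n) (z - w)).1 + fy z * (ker (e n) (z - w)).2) @[n --> \oo] -->
  \int[mu2]_z (fx z * (ker 0 (z - w)).1 + fy z * (ker 0 (z - w)).2).
  apply: D1 => //.
  - by move=> n; have [h _ _ _] := reg n; exact: rint_measurable h.
  - move=> z; have [h1 h2] := ck (z - w).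
    by apply: cvgD; apply: cvgM => //; exact: cvg_cst.
have {D2} [r2 l2] : rint mu2 (fun z => fy z * (ker 0 (z - w)).1 - fx z * (ker 0 (z - w)).2) /\
  \int[mu2]_z (fy z * (ker (e n) (z - w)).1 - fx z * (ker (e n) (z - w)).2) @[n --> \oo] -->
  \int[mu2]_z (fy z * (ker 0 (z - w)).1 - fx z * (ker 0 (z - w)).2).
  apply: D2 => //.
  - by move=> n; have [_ h _ _] := reg n; exact: rint_measurable h.
  - move=> z; have [h1 h2] := ck (z - w).
    by apply: cvgB; apply: cvgM => //; exact: cvg_cst.
split => //.
- apply: (cvg_unique _ l1) => //.
  have -> : (fun n => \int[mu2]_z (fx z * (ker (e n) (z - w)).1 + fy z * (ker (e n) (z - w)).2)) =
    (fun n => - \int[mu2]_z (f z * (2 * e n / (nsq (z - w) + e n) ^+ 2))).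
    by apply/funext => n; have [_ _ -> _] := reg n.
  have h := cvgN (@poisson_limit M f fx fy w Hf); exact: h.
- apply: (cvg_unique _ l2) => //.
  have -> : (fun n => \int[mu2]_z (fy z * (ker (e n) (z - w)).1 - fx z * (ker (e n) (z - w)).2)) = cst 0.
    by apply/funext => n; have [_ _ _ ->] := reg n.
  exact: cvg_cst.
Qed.

End pompeiu.

(** * The solution operator *)

Section integral_estimates.
Context {R : realType}.

Lemma rint_tonelli1 d1 d2 (T1 : measurableType d1) (T2 : measurableType d2)
  (m1 : {sigma_finite_measure set T1 -> \bar R}) (m2 : {sigma_finite_measure set T2 -> \bar R})
  (f : T1 * T2 -> R) (g : T1 -> R) : measurable_fun setT f -> (forall p, 0 <= f p) ->
  (forall x, rint m2 (fun y => f (x, y))) ->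
  (forall x, \int[m2]_y (f (x, y)) <= g x) -> rint m1 g ->
  rint (m1 \x m2)%E f.
Proof.
move=> mf f0 rf fg rg; apply/integrable12ltyP; first exact/measurable_EFinP.
apply: (@le_lt_trans _ _ (\int[m1]_x (g x)%:E)%E); last by rewrite (RintE rg) ltry.
apply: ge0_le_integral => //.
- by move=> x _; apply: integral_ge0 => y _; rewrite lee_fin.
- apply: (@measurable_fun_fubini_tonelli_F _ _ T1 T2 R m2 (fun p => `|(f p)%:E|%E)) => //.
  by apply: measurableT_comp => //; apply/measurable_EFinP.
- by apply/measurable_EFinP; exact: rint_measurable rg.
- move=> x _.
  have -> : (\int[m2]_y `|(EFin \o f) (x, y)|)%E = (\int[m2]_y (f (x, y))%:E)%E.
    by apply: eq_integral => y _; rewrite /= ger0_norm.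
  by rewrite (RintE (rf x)) lee_fin.
Qed.

Lemma rint_tonelli2 d1 d2 (T1 : measurableType d1) (T2 : measurableType d2)
  (m1 : {sigma_finite_measure set T1 -> \bar R}) (m2 : {sigma_finite_measure set T2 -> \bar R})
  (f : T1 * T2 -> R) (g : T2 -> R) : measurable_fun setT f -> (forall p, 0 <= f p) ->
  (forall y, rint m1 (fun x => f (x, y))) ->
  (forall y, \int[m1]_x (f (x, y)) <= g y) -> rint m2 g ->
  rint (m1 \x m2)%E f.
Proof.
move=> mf f0 rf fg rg; apply/integrable21ltyP; first exact/measurable_EFinP.
apply: (@le_lt_trans _ _ (\int[m2]_x (g x)%:E)%E); last by rewrite (RintE rg) ltry.
apply: ge0_le_integral => //.
- by move=> x _; apply: integral_ge0 => y _; rewrite lee_fin.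
- apply: (@measurable_fun_fubini_tonelli_G _ _ T1 T2 R m1 (fun p => `|(f p)%:E|%E)) => //.
  by apply: measurableT_comp => //; apply/measurable_EFinP.
- by apply/measurable_EFinP; exact: rint_measurable rg.
- move=> y _.
  have -> : (\int[m1]_x `|(EFin \o f) (x, y)|)%E = (\int[m1]_x (f (x, y))%:E)%E.
    by apply: eq_integral => x _; rewrite /= ger0_norm.
  by rewrite (RintE (rf y)) lee_fin.
Qed.

Lemma rint_le_ae d (T : measurableType d) (mu : {measure set T -> \bar R}) (f g : T -> R) :
  measurable_fun setT f -> {ae mu, forall x, `|f x| <= g x} -> rint mu g -> rint mu f.
Proof.
move=> mf fg rg; apply/integrableP; split; first exact/measurable_EFinP.
apply: (@le_lt_trans _ _ (\int[mu]_x `|(g x)%:E|)%E); last by have /integrableP[] := rg.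
apply: ae_ge0_le_integral => //.
- by apply: measurableT_comp => //; apply/measurable_EFinP.
- by apply: measurableT_comp => //; apply/measurable_EFinP; exact: rint_measurable rg.
- apply: filterS fg => x h _; rewrite /= lee_fin (le_trans h)//; exact: ler_norm.
Qed.

Lemma sqr_le_weighted (s w e l : R) : 0 <= w -> 0 <= e -> 0 < l -> s ^+ 2 <= w * e ->
  `|s| <= l * w + e / l.
Proof.
move=> w0 e0 l0 h.
have q : 0 <= l * w + e / l by rewrite addr_ge0// ?mulr_ge0// ?invr_ge0 ltW.
rewrite -[leRHS]ger0_norm// -ler_sqr ?nnegrE// !real_normK ?num_real//.
apply: (le_trans h).
have -> : w * e = (l * w) * (e / l) by field; rewrite gt_eqF.
have := sqr_ge0 (l * w - e / l).
have : 0 <= (l * w) * (e / l) by rewrite mulr_ge0 ?divr_ge0 ?mulr_ge0// ltW.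
nra.
Qed.

(** The best l is |s| / (2 a), or (c + 1) / |s| when a = 0. With [sqr_le_weighted] this stands in
    for the Cauchy-Schwarz inequality of integrals: linearise pointwise, integrate, optimise l. *)
Lemma weighted_le_sqr (s a c : R) : 0 <= a -> 0 <= c ->
  (forall l, 0 < l -> `|s| <= l * a + c / l) -> s ^+ 2 <= 4 * a * c.
Proof.
move=> a0 c0 H; have [->|s0] := eqVneq s 0; first by rewrite expr0n/= !mulr_ge0.
have n0 : 0 < `|s| by rewrite normr_gt0.
rewrite -real_normK ?num_real//; move: (`|s|) n0 H => t t0 H.
have [a00|an0] := eqVneq a 0.
  have l0 : 0 < (c + 1) / t by rewrite divr_gt0// ltr_wpDl.
  have := H _ l0; rewrite a00 mulr0 add0r invfM invrK mulrA.
  rewrite -[X in X <= _]mul1r ler_pM2r// => /le_lt_trans/(_ _).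
  have : c / (c + 1) < 1 by rewrite ltr_pdivrMr ?mul1r ?ltrDl// ltr_wpDl.
  by move=> h1 /(_ _ h1); rewrite ltxx.
have ap : 0 < a by rewrite lt_neqAle eq_sym an0.
have l0 : 0 < t / (2 * a) by rewrite divr_gt0// mulr_gt0.
have := H _ l0.
have -> : t / (2 * a) * a + c / (t / (2 * a)) = t / 2 + 2 * a * c / t.
  by field; rewrite an0 gt_eqF.
have -> : 4 * a * c = (2 * a * c / t) * (2 * t) by field; rewrite gt_eqF.
move: (2 * a * c / t) => q; nra.
Qed.

End integral_estimates.

(** * Schur's test for the modified Cauchy kernel *)

Section schur.
Context {R : realType}.
Local Notation mu1 := (@lebesgue_measure R).
Local Notation mu2 := (leb2 R).
Local Notation mu4 := (leb4 R).
Local Notation M2 := (measurableTypeR R * measurableTypeR R)%type.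
Local Notation C := (R * R)%type.
Local Notation T := (coords R).
Local Notation M4 := (coords (measurableTypeR R)).

Definition wt (t : R) : R := (1 + `|t|)^-1.

Lemma wt_gt0 t : 0 < wt t. Proof. by rewrite invr_gt0 ltr_wpDr. Qed.

Lemma measurable_wt : measurable_fun setT wt.
Proof. by apply: (measurableT_comp measurable_inv); apply: measurable_funD. Qed.

(** If |t| <= |s| then [isq s] is at most [isq t] and the product is below [Lmaj t]; otherwise
    [wt t] is at most [wt s] and it is below [Lmaj s]. The factor 2 is needed for t = 0 and |s| <=
    1. *)
Lemma wt_isq_le t s : wt t * isq s <= 2 * (Lmaj t + Lmaj s).
Proof.
have i0 := isq_ge0 s; have L0 := Lmaj_ge0 t; have L1 := Lmaj_ge0 s.
have w0 := wt_gt0 t.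
suff : wt t * isq s <= 2 * Lmaj t \/ wt t * isq s <= 2 * Lmaj s by case=> h; lra.
have [->|s0] := eqVneq s 0.
  by left; rewrite /isq normr0 sqrtr0 invr0 mulr0 mulr_ge0.
have sp : 0 < `|s| by rewrite normr_gt0.
have sq : 0 < Num.sqrt `|s| by rewrite sqrtr_gt0.
have LE : Lmaj s = isq s * wt s by rewrite /Lmaj (negbTE s0) invfM.
case: (lerP `|t| `|s|) => ts.
  have [t0|t0] := eqVneq t 0.
    case: (lerP `|s| 1) => s1.
      right; rewrite LE mulrC [leRHS]mulrCA ler_wpM2l// /wt t0 normr0 addr0 invr1.
      rewrite ler_pdivlMr ?mul1r ?ltr_wpDr//; lra.
    left; rewrite t0 /Lmaj eqxx /wt normr0 addr0 invr1 mul1r mulr1.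
    rewrite (@le_trans _ _ 1)// ?ler1n// invf_le1// -sqrtr1 ler_sqrt// ltW//.
  left; have tp : 0 < `|t| by rewrite normr_gt0.
  have -> : Lmaj t = isq t * wt t by rewrite /Lmaj (negbTE t0) invfM.
  have : isq s <= isq t.
    rewrite lef_pV2 ?posrE// ?sqrtr_gt0// ler_sqrt//.
  by move=> h; have := isq_ge0 t; nra.
right; rewrite LE.
have : wt t <= wt s by rewrite lef_pV2 ?posrE ?ltr_wpDr// lerD2l ltW.
by have := wt_gt0 s; nra.
Qed.

Definition sch (a b : R) : R := wt a * isq (a - b).

Lemma sch_ge0 a b : 0 <= sch a b.
Proof. by rewrite mulr_ge0 ?isq_ge0// ltW// wt_gt0. Qed.

(** The majorant 2 (Lmaj x + Lmaj (x - b)) of [sch x b] integrates to 4 int Lmaj for every b; this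
    uniformity is what Schur's test requires. *)
Definition Q0 : R := 4 * Rintegral mu1 setT (@Lmaj R).

Lemma measurable_sch b : measurable_fun setT (sch ^~ b).
Proof.
apply: measurable_funM; first exact: measurable_wt.
apply: (measurableT_comp measurable_isq); exact: measurable_funB.
Qed.

Lemma rint_sch b : rint mu1 (sch ^~ b) /\ Rintegral mu1 setT (sch ^~ b) <= Q0.
Proof.
have [r i] := Rint_affine (- b) (ltr01 : 0 < (1 : R)) (@rint_Lmaj R).
have rr : rint mu1 (fun x => 2 * (Lmaj x + Lmaj (1 * x + - b))).
  by apply: rintZ; apply: rintD => //; exact: rint_Lmaj.
have h x : `|sch x b| <= 2 * (Lmaj x + Lmaj (1 * x + - b)).
  by rewrite ger0_norm ?sch_ge0// mul1r; exact: wt_isq_le.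
have rs : rint mu1 (sch ^~ b) by apply: (@rint_le _ (measurableTypeR R) R mu1 _ _ _ h rr); exact: measurable_sch.
split => //; apply: (@le_trans _ _ (\int[mu1]_x (2 * (Lmaj x + Lmaj (1 * x + - b))))).
  by apply: Rint_le => // x; apply: le_trans (h x); exact: ler_norm.
rewrite RintZ; last by apply: rintD => //; exact: rint_Lmaj.
rewrite RintD//; last exact: rint_Lmaj.
by rewrite -[X in _ + X]mul1r -i /Q0; lra.
Qed.

Definition sch2 (z w : C) : R := sch z.1 w.1 * sch z.2 w.2.

Lemma sch2_ge0 z w : 0 <= sch2 z w. Proof. by rewrite mulr_ge0 ?sch_ge0. Qed.

Lemma rint_sch2 w : rint mu2 (sch2 ^~ w) /\ Rintegral mu2 setT (sch2 ^~ w) <= Q0 ^+ 2.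
Proof.
have [r1 i1] := rint_sch w.1; have [r2 i2] := rint_sch w.2.
have [r i] := @rint_prod _ _ _ _ _ mu1 mu1 _ _ r1 r2.
split => //; rewrite [leLHS]i expr2; apply: ler_pM => //; apply: Rint_ge0 => x; exact: sch_ge0.
Qed.

Lemma measurable_sch2 : measurable_fun setT (fun p : M4 => sch2 p.1 p.2 : measurableTypeR R).
Proof.
have md1 : measurable_fun setT (fun p : M4 => p.1.1 - p.2.1 : measurableTypeR R).
  by apply: measurable_funB; apply: (measurableT_comp measurable_fst).
have md2 : measurable_fun setT (fun p : M4 => p.1.2 - p.2.2 : measurableTypeR R).
  by apply: measurable_funB; apply: (measurableT_comp measurable_snd).
apply: measurable_funM; apply: measurable_funM.
- by apply: (measurableT_comp measurable_wt); apply: measurableT_comp.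
- exact: (measurableT_comp measurable_isq).
- by apply: (measurableT_comp measurable_wt); apply: measurableT_comp.
- exact: (measurableT_comp measurable_isq).
Qed.

Lemma isqN (t : R) : isq (- t) = isq t. Proof. by rewrite /isq normrN. Qed.

Lemma measurable_swap_sch2 : measurable_fun setT (fun p : M4 => sch2 p.2 p.1 : measurableTypeR R).
Proof.
have ms : measurable_fun setT (fun p : M4 => (p.2, p.1) : M4) by exact/measurable_fun_pair.
exact: (measurableT_comp measurable_sch2 ms).
Qed.

Definition onax (d : C) : bool := (d.1 == 0) || (d.2 == 0).

(** [K1] and [K2] are Re and Im of 1/(z - w) - conj z/(1 + |z|^2) at z = p.1, w = p.2. They are set
    to 0 where z - w lies on an axis: there the product of the [isq] vanishes and could not bound
    the kernel. *)
Definition K1 (p : T) : R := if onax (p.1 - p.2) then 0 else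
  (ker 0 (p.1 - p.2)).1 - p.1.1 / (1 + nsq p.1).

Definition K2 (p : T) : R := if onax (p.1 - p.2) then 0 else
  p.1.2 / (1 + nsq p.1) - (ker 0 (p.1 - p.2)).2.

Lemma one_nsq_gt0 (z : C) : 0 < 1 + nsq z. Proof. by rewrite ltr_wpDr// nsq_ge0. Qed.

Lemma inv_wt (z : C) : (1 + nsq z)^-1 <= 2 * (wt z.1 * wt z.2).
Proof.
have q0 : 0 < (1 + `|z.1|) * (1 + `|z.2|) by rewrite mulr_gt0// ltr_wpDr.
rewrite /wt -invfM ler_pdivlMr// mulrC ler_pdivrMr ?one_nsq_gt0// /nsq -(real_normK (num_real z.1)) -(real_normK (num_real z.2)).
have := sqr_ge0 (`|z.1| - `|z.2|); have := sqr_ge0 (`|z.1| - 1); have := sqr_ge0 (`|z.2| - 1).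
by rewrite !expr2; nra.
Qed.

(* [1 / (z - w) - conj z / (1 + |z|^2) = (1 + conj z w) / ((z - w) (1 + |z|^2))], and
   [|1 + conj z w|^2 + |z - w|^2 = (1 + |z|^2) (1 + |w|^2)]. *)
Lemma K_sqr (p : T) : K1 p ^+ 2 + K2 p ^+ 2 <=
  (1 + nsq p.2) / (1 + nsq p.1) * (isq (p.1 - p.2).1 * isq (p.1 - p.2).2) ^+ 2.
Proof.
rewrite /K1 /K2; case: ifPn => [_|].
  by rewrite expr0n/= addr0 mulr_ge0 ?sqr_ge0// divr_ge0// ltW// one_nsq_gt0.
rewrite negb_or => /andP[]; case: p => -[x y] [x' y']/=.
set a := x - x'; set b := y - y' => a0 b0.
have n0 : 0 < nsq (a, b).
  by rewrite /nsq/= ltr_wpDr ?sqr_ge0// lt_neqAle sqr_ge0 eq_sym sqrf_eq0 a0.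
have A0 := one_nsq_gt0 (x, y).
have -> : (isq a * isq b) ^+ 2 = (`|a| * `|b|)^-1.
  by rewrite /isq -invfM exprVn exprMn !sqr_sqrtr.
apply: (@le_trans _ _ ((1 + nsq (x', y')) / (1 + nsq (x, y)) / nsq (a, b))).
  have -> : nsq ((x, y) - (x', y')) + 0 = nsq (a, b) by rewrite addr0.
  have -> : (a / nsq (a, b) - x / (1 + nsq (x, y))) ^+ 2 + (y / (1 + nsq (x, y)) - b / nsq (a, b)) ^+ 2 =
     (1 + nsq (x', y')) / (1 + nsq (x, y)) / nsq (a, b) - (1 + nsq (x, y))^-1 ^+ 2.
    have e1 : x' = x - a by rewrite /a; ring.
    have e2 : y' = y - b by rewrite /b; ring.
    rewrite e1 e2; move: n0 A0; rewrite /nsq/=.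
    clearbody a b; move=> n0 A0; field; rewrite (gt_eqF n0) (gt_eqF A0)//.
  by rewrite lerBlDr lerDl sqr_ge0.
have q0 : 0 <= (1 + nsq (x', y')) / (1 + nsq (x, y)) by rewrite divr_ge0// ltW// one_nsq_gt0.
apply: (ler_wpM2l q0); rewrite lef_pV2 ?posrE ?mulr_gt0 ?normr_gt0//.
rewrite /nsq/= -(real_normK (num_real a)) -(real_normK (num_real b)).
have := sqr_ge0 (`|a| - `|b|); have := normr_ge0 a; have := normr_ge0 b.
by rewrite !expr2; nra.
Qed.

Section solution.
Variables (v : C -> R) (K : T -> R).
Hypothesis mv : measurable_fun setT (v : M2 -> measurableTypeR R).
Hypothesis rv : rint mu2 (fun z => v z ^+ 2 * (1 + nsq z) ^+ 2).
Hypothesis mK : measurable_fun setT (K : M4 -> measurableTypeR R).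
Hypothesis KE : forall p, K p ^+ 2 <=
  (1 + nsq p.2) / (1 + nsq p.1) * (isq (p.1 - p.2).1 * isq (p.1 - p.2).2) ^+ 2.

Let N (z : C) : R := v z ^+ 2 * (1 + nsq z) ^+ 2.
(** The Schur splitting (v K)^2 <= W E. The factor W carries the density of v and the weights in z,
    so it is integrable over all of R^4 when z is integrated first; E carries the weights in w and
    has uniformly bounded integrals in w. *)
Let W (p : T) : R := N p.2 * sch2 p.1 p.2.
Let E (p : T) : R := 4 * sch2 p.2 p.1.

Let N_ge0 z : 0 <= N z. Proof. by rewrite mulr_ge0 ?sqr_ge0. Qed.
Let W_ge0 p : 0 <= W p. Proof. by rewrite mulr_ge0 ?sch2_ge0. Qed.
Let E_ge0 p : 0 <= E p. Proof. by rewrite mulr_ge0 ?sch2_ge0. Qed.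

(** (1 + |w|^2) / (1 + |z|^2) = (1 + |w|^2)^2 / ((1 + |z|^2) (1 + |w|^2)). The square completes v^2
    to N, and each inverse is at most twice a product of weights, whence the 4 in E. *)
Let vK_sqr p : (v p.2 * K p) ^+ 2 <= W p * E p.
Proof.
have A0 := one_nsq_gt0 p.1; have B0 := one_nsq_gt0 p.2.
have i1 := inv_wt p.1; have i2 := inv_wt p.2.
have w0 : 0 <= wt p.1.1 * wt p.1.2 by rewrite mulr_ge0// ltW// wt_gt0.
have w0' : 0 <= wt p.2.1 * wt p.2.2 by rewrite mulr_ge0// ltW// wt_gt0.
rewrite exprMn (le_trans (ler_wpM2l (sqr_ge0 _) (KE p)))//.
rewrite /W /E /N /sch2 /sch -(isqN (p.2.1 - p.1.1)) -(isqN (p.2.2 - p.1.2)) !opprB.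
have -> : (p.1 - p.2).1 = p.1.1 - p.2.1 by [].
have -> : (p.1 - p.2).2 = p.1.2 - p.2.2 by [].
set ii := isq _ * isq _.
have -> : (1 + nsq p.2) / (1 + nsq p.1) = (1 + nsq p.2) ^+ 2 * ((1 + nsq p.1)^-1 * (1 + nsq p.2)^-1).
  by field; rewrite !gt_eqF.
have h : (1 + nsq p.1)^-1 * (1 + nsq p.2)^-1 <= (2 * (wt p.1.1 * wt p.1.2)) * (2 * (wt p.2.1 * wt p.2.2)).
  by apply: ler_pM => //; rewrite invr_ge0 ltW.
apply: (@le_trans _ _ (v p.2 ^+ 2 * ((1 + nsq p.2) ^+ 2 * ((2 * (wt p.1.1 * wt p.1.2)) * (2 * (wt p.2.1 * wt p.2.2))) * ii ^+ 2))).
  by rewrite ler_wpM2l ?sqr_ge0// ler_wpM2r ?sqr_ge0// ler_wpM2l ?sqr_ge0.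
by rewrite le_eqVlt; apply/orP; left; apply/eqP; rewrite /ii; ring.
Qed.

Let mN : measurable_fun setT (N : M2 -> measurableTypeR R).
Proof. exact: rint_measurable rv. Qed.

Let rW : rint mu4 W.
Proof.
apply: (@rint_tonelli2 R _ _ _ _ mu2 mu2 W (fun w => N w * Q0 ^+ 2)).
- apply: measurable_funM; last exact: measurable_sch2.
  by apply: (measurableT_comp mN).
- exact: W_ge0.
- by move=> w; have [r _] := rint_sch2 w; exact: (@rintZ _ _ _ mu2 (N w) _ r).
- move=> w; have [r i] := rint_sch2 w.
  by rewrite [leLHS](@RintZ _ _ _ mu2 (N w) _ r) ler_wpM2l.
- have := @rintZ _ _ _ mu2 (Q0 ^+ 2) _ rv; apply: rint_ext => z; exact: mulrC.
Qed.

Let rE z : rint mu2 (fun w => E (z, w)) /\ \int[mu2]_w (E (z, w)) <= 4 * Q0 ^+ 2.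
Proof.
have [r i] := rint_sch2 z; split; first exact: (@rintZ _ _ _ mu2 4 _ r).
by rewrite [leLHS](@RintZ _ _ _ mu2 4 _ r) ler_wpM2l.
Qed.

Let rbE M : rint mu4 (fun p => box M p.1 * E p).
Proof.
apply: (@rint_tonelli1 R _ _ _ _ mu2 mu2 _ (fun z => (4 * Q0 ^+ 2) * box M z)).
- apply: measurable_funM; first exact: (measurableT_comp (@measurable_box R M)).
  by apply: measurable_funM => //; exact: measurable_swap_sch2.
- by move=> p; rewrite mulr_ge0 ?box_ge0.
- by move=> z; have [r _] := rE z; exact: (@rintZ _ _ _ mu2 (box M z) _ r).
- move=> z; have [r i] := rE z.
  by rewrite [leLHS](@RintZ _ _ _ mu2 (box M z) _ r) mulrC ler_wpM2r ?box_ge0.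
- exact/rintZ/rint_box.
Qed.

Let mvK : measurable_fun setT (fun p : M4 => v p.2 * K p : measurableTypeR R).
Proof. by apply: measurable_funM => //; exact: (measurableT_comp mv). Qed.

Lemma rint_box_vK M : rint mu4 (fun p => box M p.1 * (v p.2 * K p)).
Proof.
apply: (@rint_le _ M4 R mu4 _ _ _ _ (rintD rW (rbE M))).
  by apply: measurable_funM => //; exact: (measurableT_comp (@measurable_box R M)).
move=> p; have h := sqr_le_weighted (W_ge0 p) (E_ge0 p) ltr01 (vK_sqr p).
rewrite normrM (ger0_norm (box_ge0 _ _)).
have b0 := box_ge0 M p.1; have b1 := box_le1 M p.1.
rewrite mul1r divr1 in h; apply: (le_trans (ler_wpM2l b0 h)).
by rewrite mulrDr lerD2r ler_piMl.
Qed.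

Definition kint (z : C) : R := \int[mu2]_w (v w * K (z, w)).

Lemma box_kint M z : \int[mu2]_w (box M z * (v w * K (z, w))) = box M z * kint z.
Proof.
rewrite /box /cci; case: ifP => _; last first.
  by rewrite !mul0r; under eq_Rintegral do rewrite !mul0r; exact: Rint0.
case: ifP => _; last first.
  by rewrite !(mulr0, mul0r); under eq_Rintegral do rewrite !(mulr0, mul0r); exact: Rint0.
by rewrite !mul1r; apply: Rint_ext => w; rewrite !mul1r.
Qed.

Lemma box_cvg1 (z : C) : box n%:R z @[n --> \oo] --> (1 : R).
Proof.
apply: cvg_near_cst; near=> n.
apply: box_eq1; near: n; exact: nbhs_infty_ger.
Unshelve. all: by end_near.
Qed.

(** Integrability of v K is available for bounded z only, so Fubini is applied to the functions cut
    off by [box n], which tend to [kint] at every point. *)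
Lemma measurable_kint : measurable_fun setT (kint : M2 -> measurableTypeR R).
Proof.
apply: (measurable_fun_cvg (h := fun n z => box n%:R z * kint z)).
- move=> n; have [m _] := Rint_fiber1 (rint_box_vK n%:R).
  by apply: eq_measurable_fun m => z _; exact: box_kint.
- move=> z _; rewrite -[X in _ --> X]mul1r; apply: cvgM; last exact: cvg_cst.
  exact: box_cvg1.
Qed.

Let kint_ae : {ae mu2, forall z, rint mu2 (fun w => W (z, w)) /\ rint mu2 (fun w => v w * K (z, w))}.
Proof.
have := ae_rint1 rW; apply: ae_imp => z rWz; split => //.
have [rEz _] := rE z.
apply: (@rint_le _ M2 R mu2 _ _ _ _ (rintD rWz rEz)).
  exact: (measurableT_comp mvK (@measurable_pair1 _ _ M2 M2 z)).
move=> w; have := sqr_le_weighted (W_ge0 (z, w)) (E_ge0 (z, w)) ltr01 (vK_sqr (z, w)).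
by rewrite mul1r divr1.
Qed.

(** For almost every z, |kint| <= l int W + (1/l) int E for all l > 0. As int E <= 4 Q0^2,
    optimising gives kint^2 <= 16 Q0^2 int W, and the fibre integrals of W are integrable. *)
Lemma rint_kint_sqr : rint mu2 (fun z => kint z ^+ 2).
Proof.
have [_ rA] := Rint_fiber1 rW.
apply: (@rint_le_ae R _ M2 mu2 _ (fun z => (16 * Q0 ^+ 2) * \int[mu2]_w (W (z, w)))).
- apply: (@measurable_funM _ M2 R _ kint kint); exact: measurable_kint.
- apply: ae_imp kint_ae => z [rWz rz]; have [rEz iE] := rE z.
  rewrite ger0_norm ?sqr_ge0//.
  have -> : 16 * Q0 ^+ 2 * \int[mu2]_w (W (z, w)) =
    4 * \int[mu2]_w (W (z, w)) * (4 * Q0 ^+ 2) by ring.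
  apply: weighted_le_sqr; [by apply: Rint_ge0|by rewrite mulr_ge0 ?sqr_ge0|].
  move=> l l0; apply: (le_trans (Rint_norm_le rz)).
  apply: (@le_trans _ _ (\int[mu2]_w (l * W (z, w) + l^-1 * E (z, w)))).
    apply: Rint_le; [exact: rint_norm|by apply: rintD; exact: rintZ|].
    move=> w; rewrite [_^-1 * _]mulrC; exact: (sqr_le_weighted (W_ge0 _) (E_ge0 _) l0 (vK_sqr (z, w))).
  rewrite RintD; [|exact: rintZ|exact: rintZ].
  by rewrite RintZ// RintZ// lerD2l mulrC ler_wpM2r// invr_ge0 ltW.
- exact: rintZ.
Qed.

Lemma kint_test M g : continuous g -> vanishes_off M g ->
  [/\ rint mu4 (fun p => g p.1 * (v p.2 * K p)), rint mu2 (fun z => g z * kint z) &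
   \int[mu2]_z (g z * kint z) = \int[mu4]_p (g p.1 * (v p.2 * K p))].
Proof.
move=> cg vg; have [B [B0 HB]] := vanishes_off_bounded cg vg.
have mg : measurable_fun setT (g : M2 -> measurableTypeR R) by exact: continuous_measurable2.
have r4 : rint mu4 (fun p => g p.1 * (v p.2 * K p)).
  apply: (@rint_le _ M4 R mu4 _ _ _ _ (rintZ B (rint_norm (rint_box_vK M)))).
    by apply: measurable_funM => //; exact: (measurableT_comp mg).
  move=> p; rewrite (vanishes_offE p.1 vg) -mulrA mulrCA normrM.
  by rewrite ler_wpM2r.
have ae_g : {ae mu2, forall z, \int[mu2]_w (g z * (v w * K (z, w))) = g z * kint z}.
  by apply: ae_imp kint_ae => z [_ rz]; rewrite RintZ.
have [m1 i1] := Rint_fiber1 r4.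
have m2 : measurable_fun setT (fun z : M2 => g z * kint z : measurableTypeR R).
  by apply: measurable_funM => //; exact: measurable_kint.
split => //; first exact: (@rint_ae _ M2 R mu2 _ _ m2 ae_g i1).
rewrite fubini4//; apply/esym; exact: Rint_ae.
Qed.

End solution.
End schur.

(** * Solving the equation in the plane *)

Section dbar_plane.
Context {R : realType}.
Local Notation mu2 := (leb2 R).
Local Notation M2 := (measurableTypeR R * measurableTypeR R)%type.
Local Notation C := (R * R)%type.
Local Notation T := (coords R).
Local Notation M4 := (coords (measurableTypeR R)).

Lemma measurable_K : measurable_fun setT (@K1 R : M4 -> measurableTypeR R) /\
  measurable_fun setT (@K2 R : M4 -> measurableTypeR R).
Proof.
have md1 : measurable_fun setT (fun p : M4 => p.1.1 - p.2.1 : measurableTypeR R).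
  by apply: measurable_funB; apply: (measurableT_comp measurable_fst).
have md2 : measurable_fun setT (fun p : M4 => p.1.2 - p.2.2 : measurableTypeR R).
  by apply: measurable_funB; apply: (measurableT_comp measurable_snd).
have mq : measurable_fun setT (fun p : M4 => (nsq (p.1 - p.2) + 0)^-1 : measurableTypeR R).
  apply: (measurableT_comp measurable_inv); apply: measurable_funD => //.
  by apply: measurable_funD; apply: measurable_funM.
have mA : measurable_fun setT (fun p : M4 => (1 + nsq p.1)^-1 : measurableTypeR R).
  apply: (measurableT_comp measurable_inv); apply: measurable_funD => //.
  apply: (measurableT_comp (f := @nsq R : M2 -> measurableTypeR R)) => //.
  by apply: continuous_measurable2; exact: continuous_nsq.
have mo : measurable_fun setT (fun p : M4 => onax (p.1 - p.2)).
  apply: measurable_or; apply: measurable_fun_eqr => //.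
split; apply: measurable_fun_ifT => //.
- apply: measurable_funB; first exact: measurable_funM.
  by apply: measurable_funM => //; apply: (measurableT_comp measurable_fst).
- apply: measurable_funB; last exact: measurable_funM.
  by apply: measurable_funM => //; apply: (measurableT_comp measurable_snd).
Qed.

Lemma K1_bound (p : T) : K1 p ^+ 2 <=
  (1 + nsq p.2) / (1 + nsq p.1) * (isq (p.1 - p.2).1 * isq (p.1 - p.2).2) ^+ 2.
Proof. by apply: le_trans (K_sqr p); rewrite lerDl sqr_ge0. Qed.

Lemma K2_bound (p : T) : K2 p ^+ 2 <=
  (1 + nsq p.2) / (1 + nsq p.1) * (isq (p.1 - p.2).1 * isq (p.1 - p.2).2) ^+ 2.
Proof. by apply: le_trans (K_sqr p); rewrite lerDr sqr_ge0. Qed.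

Lemma offax_ae (w : C) : {ae mu2, forall z : C, ~~ onax (z - w)}.
Proof.
apply: ae_imp (ae_and (coord1_neq_ae w.1) (coord2_neq_ae w.2)) => z [z1 z2].
by rewrite negb_or !subr_eq0 z1.
Qed.

Section one_component.
Variables (v : C -> R).
Hypothesis mv : measurable_fun setT (v : M2 -> measurableTypeR R).
Hypothesis rv : rint mu2 (fun z => v z ^+ 2 * (1 + nsq z) ^+ 2).

(** |v| <= v^2 (1 + |z|^2)^2 + (1 + |z|^2)^(-2), and the last term is integrable over the plane. *)
Lemma rint_of_weighted : rint mu2 v.
Proof.
apply: (@rint_le _ M2 R mu2 _ _ _ _ (rintD rv (@rint_poisson R))) => // z.
have A0 := one_nsq_gt0 z.
have h : v z ^+ 2 <= (v z ^+ 2 * (1 + nsq z) ^+ 2) * ((1 + nsq z) ^+ 2)^-1.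
  by rewrite -mulrA divff ?mulr1// expf_neq0// gt_eqF.
have := sqr_le_weighted _ _ ltr01 h; rewrite mul1r divr1.
have q0 : 0 <= ((1 + nsq z) ^+ 2)^-1 by rewrite invr_ge0 exprn_ge0// ltW.
move=> /(_ (mulr_ge0 (sqr_ge0 _) (sqr_ge0 _)) q0) /le_trans; apply.
by rewrite lerD2l /poisson [nsq z + 1]addrC ler_peMl// ler1n.
Qed.

Hypothesis v0 : Rintegral mu2 setT v = 0.

Let U1 := kint v (@K1 R).
Let U2 := kint v (@K2 R).

(** Integrate in z first. The Cauchy kernel reproduces - f(w) [poisson_mass], with zero imaginary
    part, while the subtracted term does not involve w and yields constants [c1], [c2]; multiplied
    by v(w) and integrated, these disappear because v has mean 0. *)
Lemma kint_identities M f fx fy : C1c M f fx fy ->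
  [/\ rint mu2 (fun z => fx z * U1 z) /\ rint mu2 (fun z => fy z * U1 z),
      rint mu2 (fun z => fx z * U2 z) /\ rint mu2 (fun z => fy z * U2 z),
   \int[mu2]_z (fx z * U1 z - fy z * U2 z) =
     - (poisson_mass * \int[mu2]_z (f z * v z)) &
   \int[mu2]_z (fy z * U1 z + fx z * U2 z) = 0].
Proof.
move=> Hf; have [[cf cfx cfy] _ _ [vf vfx vfy]] := Hf.
have [mK1 mK2] := measurable_K.
have [r1x s1x i1x] := kint_test mv rv mK1 K1_bound cfx vfx.
have [r1y s1y i1y] := kint_test mv rv mK1 K1_bound cfy vfy.
have [r2x s2x i2x] := kint_test mv rv mK2 K2_bound cfx vfx.
have [r2y s2y i2y] := kint_test mv rv mK2 K2_bound cfy vfy.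
have cA : continuous (fun z : C => (1 + nsq z)^-1).
  move=> z; apply: cvgV; first by rewrite gt_eqF// one_nsq_gt0.
  by apply: cvgD; [exact: cvg_cst|exact: continuous_nsq].
have cx : continuous (fun z : C => z.1 / (1 + nsq z)).
  by move=> z; apply: cvgM; [exact: cvg_fst|exact: cA].
have cy : continuous (fun z : C => z.2 / (1 + nsq z)).
  by move=> z; apply: cvgM; [exact: cvg_snd|exact: cA].
have rtest g h : continuous g -> continuous h -> vanishes_off M g -> rint mu2 (fun z => g z * h z).
  move=> cg ch vg; apply: (@rint_vanishes_off _ M).
    by move=> z; apply: cvgM; [exact: cg|exact: ch].
  by move=> z Hz; rewrite vg// mul0r.
pose c1 := Rintegral mu2 setT (fun z : C => fx z * (z.1 / (1 + nsq z)) + fy z * (z.2 / (1 + nsq z))).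
pose c2 := Rintegral mu2 setT (fun z : C => fx z * (z.2 / (1 + nsq z)) - fy z * (z.1 / (1 + nsq z))).
have mfx : measurable_fun setT (fx : M2 -> measurableTypeR R) by exact: continuous_measurable2.
have mfy : measurable_fun setT (fy : M2 -> measurableTypeR R) by exact: continuous_measurable2.
have mK (K : T -> R) (w : C) : measurable_fun setT (K : M4 -> measurableTypeR R) ->
    measurable_fun setT (fun z : M2 => K (z, w) : measurableTypeR R).
  by move=> mK; exact: (measurableT_comp mK (@measurable_pair2 _ _ M2 M2 w)).
have in1 w : \int[mu2]_z (fx z * (v w * K1 (z, w)) - fy z * (v w * K2 (z, w))) =
    v w * (- (f w * poisson_mass) - c1).
  have [p1 _ e1 _] := cauchy_pompeiu w Hf.
  have rc : rint mu2 (fun z : C => fx z * (z.1 / (1 + nsq z)) + fy z * (z.2 / (1 + nsq z))).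
    by apply: rintD; exact: rtest.
  rewrite -e1 /c1 -RintB// -RintZ; last exact: rintB.
  apply: Rint_ae.
  - by apply: measurable_funB; apply: measurable_funM => //; apply: measurable_funM => //; exact: mK.
  - by apply: measurable_funM => //; exact: rint_measurable (rintB p1 rc).
  - by apply: ae_imp (offax_ae w) => z /negbTE zw; rewrite /K1 /K2/= zw; ring.
have in2 w : \int[mu2]_z (fy z * (v w * K1 (z, w)) + fx z * (v w * K2 (z, w))) =
    v w * c2.
  have [_ p1 _ e1] := cauchy_pompeiu w Hf.
  have rc : rint mu2 (fun z : C => fx z * (z.2 / (1 + nsq z)) - fy z * (z.1 / (1 + nsq z))).
    by apply: rintB; exact: rtest.
  rewrite -[c2]add0r -e1 /c2 -RintD// -RintZ; last exact: rintD.
  apply: Rint_ae.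
  - by apply: measurable_funD; apply: measurable_funM => //; apply: measurable_funM => //; exact: mK.
  - by apply: measurable_funM => //; exact: rint_measurable (rintD p1 rc).
  - by apply: ae_imp (offax_ae w) => z /negbTE zw; rewrite /K1 /K2/= zw; ring.
have rv1 := rint_of_weighted.
have mf : measurable_fun setT (f : M2 -> measurableTypeR R) by exact: continuous_measurable2.
have rfv : rint mu2 (fun z => f z * v z).
  have [B [B0 HB]] := vanishes_off_bounded cf vf.
  apply: (@rint_le _ M2 R mu2 _ _ _ _ (rintZ B (rint_norm rv1))).
    by apply: measurable_funM.
  by move=> z; rewrite normrM ler_wpM2r.
split => //.
- rewrite RintB// i1x i2y -RintB// fubini4'; last exact: rintB.
  rewrite (Rint_ext mu2 in1).
  rewrite (@Rint_ext _ _ _ mu2 _ (fun w => (- poisson_mass) * (f w * v w) + (- c1) * v w)); last by move=> w; ring.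
  rewrite RintD; [|exact: rintZ|exact: rintZ].
  by rewrite !RintZ// v0 mulr0 addr0 mulNr.
- rewrite RintD// i1y i2x -RintD// fubini4'; last exact: rintD.
  rewrite (Rint_ext mu2 in2).
  rewrite (@Rint_ext _ _ _ mu2 _ (fun w => c2 * v w)); last by move=> w; rewrite mulrC.
  by rewrite RintZ// v0 mulr0.
Qed.

End one_component.

Theorem dbar_solve (v1 v2 : C -> R) :
  measurable_fun setT (v1 : M2 -> measurableTypeR R) ->
  measurable_fun setT (v2 : M2 -> measurableTypeR R) ->
  rint mu2 (fun z => v1 z ^+ 2 * (1 + nsq z) ^+ 2) ->
  rint mu2 (fun z => v2 z ^+ 2 * (1 + nsq z) ^+ 2) ->
  Rintegral mu2 setT v1 = 0 -> Rintegral mu2 setT v2 = 0 ->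
  exists u1 u2 : C -> R,
    [/\ measurable_fun setT (u1 : M2 -> measurableTypeR R),
        measurable_fun setT (u2 : M2 -> measurableTypeR R),
        rint mu2 (fun z => u1 z ^+ 2), rint mu2 (fun z => u2 z ^+ 2) &
    forall M f fx fy, C1c M f fx fy ->
      \int[mu2]_z (fx z * u1 z - fy z * u2 z) =
        - (2 * \int[mu2]_z (f z * v1 z)) /\
      \int[mu2]_z (fy z * u1 z + fx z * u2 z) =
        - (2 * \int[mu2]_z (f z * v2 z))].
Proof.
move=> mv1 mv2 rv1 rv2 z1 z2; have [mK1 mK2] := measurable_K.
have m11 := measurable_kint mv1 rv1 mK1 K1_bound.
have m12 := measurable_kint mv1 rv1 mK2 K2_bound.
have m21 := measurable_kint mv2 rv2 mK1 K1_bound.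
have m22 := measurable_kint mv2 rv2 mK2 K2_bound.
have q11 := rint_kint_sqr mv1 rv1 mK1 K1_bound.
have q12 := rint_kint_sqr mv1 rv1 mK2 K2_bound.
have q21 := rint_kint_sqr mv2 rv2 mK1 K1_bound.
have q22 := rint_kint_sqr mv2 rv2 mK2 K2_bound.
(* This is the 1 / pi of the Cauchy transform; the 2 comes from dbar = (d_x + i d_y) / 2. *)
pose N0 : R := 2 / poisson_mass.
have P0 := @poisson_mass_gt0 R.
have sq_comb (a b : C -> R) (c : R) : c ^+ 2 = 1 -> measurable_fun setT (a : M2 -> measurableTypeR R) ->
   measurable_fun setT (b : M2 -> measurableTypeR R) ->
   rint mu2 (fun z => a z ^+ 2) -> rint mu2 (fun z => b z ^+ 2) ->
   rint mu2 (fun z => (N0 * (a z + c * b z)) ^+ 2).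
  move=> c2 ma mb ra rb.
  have mab : measurable_fun setT (fun z : M2 => N0 * (a z + c * b z) : measurableTypeR R).
    by apply: measurable_funM => //; apply: measurable_funD => //; exact: measurable_funM.
  apply: (@rint_le _ M2 R mu2 _ _ _ _ (rintZ (2 * N0 ^+ 2) (rintD ra rb))).
    exact: (@measurable_funM _ M2 R _ _ _ mab mab).
  move=> z; rewrite ger0_norm ?sqr_ge0// exprMn -[leRHS]mulrA [leRHS]mulrCA ler_wpM2l ?sqr_ge0//.
  have -> : b z ^+ 2 = (c * b z) ^+ 2 by rewrite exprMn c2 mul1r.
  move: (c * b z) (a z) => t s; have := sqr_ge0 (s - t); rewrite !expr2; lra.
(* Real and imaginary parts of (1 / pi) int (v1 + i v2) (K1 + i K2). *)
exists (fun z => N0 * (kint v1 (@K1 R) z + (-1) * kint v2 (@K2 R) z)).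
exists (fun z => N0 * (kint v1 (@K2 R) z + 1 * kint v2 (@K1 R) z)).
split.
- by apply: measurable_funM => //; apply: measurable_funD => //; exact: measurable_funM.
- by apply: measurable_funM => //; apply: measurable_funD => //; exact: measurable_funM.
- by apply: sq_comb => //; rewrite sqrrN expr1n.
- by apply: sq_comb => //; rewrite expr1n.
move=> M f fx fy Hf.
have [[a1 a2] [a3 a4] a5 a6] := kint_identities mv1 rv1 z1 Hf.
have [[b1 b2] [b3 b4] b5 b6] := kint_identities mv2 rv2 z2 Hf.
split.
- rewrite (@Rint_ext _ _ _ mu2 _ (fun z => N0 * (
    (fx z * kint v1 (@K1 R) z - fy z * kint v1 (@K2 R) z) - (fy z * kint v2 (@K1 R) z + fx z * kint v2 (@K2 R) z)))); last by move=> z; ring.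
  rewrite RintZ; last by apply: rintB; [exact: rintB|exact: rintD].
  rewrite RintB; [|exact: rintB|exact: rintD].
  by rewrite a5 b6 subr0 /N0; field; rewrite gt_eqF.
- rewrite (@Rint_ext _ _ _ mu2 _ (fun z => N0 * (
    (fy z * kint v1 (@K1 R) z + fx z * kint v1 (@K2 R) z) + (fx z * kint v2 (@K1 R) z - fy z * kint v2 (@K2 R) z)))); last by move=> z; ring.
  rewrite RintZ; last by apply: rintD; [exact: rintD|exact: rintB].
  rewrite RintD; [|exact: rintD|exact: rintB].
  by rewrite a6 b5 add0r /N0; field; rewrite gt_eqF.
Qed.

End dbar_plane.

(** * Weak derivatives in real form *)

Section complex_arithmetic.
Local Open Scope complex_scope.
Context {R : realType}.

Lemma divC_real (z : R[i]) (c : R) : z / c%:C = (complex.Re z / c) +i* (complex.Im z / c).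
Proof.
have -> : (c%:C)^-1 = (c^-1)%:C by rewrite -fmorphV.
by case: z => a b; apply/eqP; rewrite eq_complex/= !mulr0 subr0 ?add0r ?addr0 ?[c^-1 * b]mulrC !eqxx.
Qed.

Lemma div2C (z : R[i]) : z / 2 = (complex.Re z / 2) +i* (complex.Im z / 2).
Proof. by rewrite -divC_real; congr (_ / _); rewrite rmorph_nat. Qed.

Lemma Re_dbar (k : R) (u : R[i]) (x y x' y' : R) :
  k * complex.Re (u * ((x +i* y + 'i%C * (x' +i* y')) / 2)) =
  2^-1 * (k * complex.Re u * x - k * complex.Im u * x' -
    (k * complex.Re u * y' + k * complex.Im u * y)).
Proof. by rewrite div2C; case: u => a b /=; ring. Qed.

Lemma Im_dbar (k : R) (u : R[i]) (x y x' y' : R) :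
  k * complex.Im (u * ((x +i* y + 'i%C * (x' +i* y')) / 2)) =
  2^-1 * (k * complex.Re u * x' + k * complex.Im u * x +
    (k * complex.Re u * y - k * complex.Im u * y')).
Proof. by rewrite div2C; case: u => a b /=; ring. Qed.

Lemma Re_mul (k : R) (u v : R[i]) : k * complex.Re (u * v) =
  k * complex.Re u * complex.Re v - k * complex.Im u * complex.Im v.
Proof. by case: u => a b; case: v => c d /=; ring. Qed.

Lemma Im_mul (k : R) (u v : R[i]) : k * complex.Im (u * v) =
  k * complex.Im u * complex.Re v + k * complex.Re u * complex.Im v.
Proof. by case: u => a b; case: v => c d /=; ring. Qed.

End complex_arithmetic.

Section real_form.
Local Open Scope complex_scope.
Context {R : realType} (beta : R).
Hypothesis beta_gt0 : 0 < beta.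
Local Notation T := (coords R).
Local Notation C := (R * R)%type.
Local Notation M2 := (measurableTypeR R * measurableTypeR R)%type.
Local Notation M4 := (coords (measurableTypeR R)).
Local Notation mu1 := (@lebesgue_measure R).
Local Notation mu2 := (leb2 R).
Local Notation mu4 := (leb4 R).
Local Notation P := (period beta).

Definition ex : T := ((1, 0), (0, 0)).
Definition ey : T := ((0, 1), (0, 0)).
Definition er : T := ((0, 0), (1, 0)).
Definition et : T := ((0, 0), (0, 1)).

Lemma bxIE M : bxI M = box M :> (C -> R).
Proof.
apply/funext => z; rewrite /bxI /box /cci.
by case: (`|z.1| <= M); case: (`|z.2| <= M); rewrite ?mulr1 ?mulr0.
Qed.

Lemma rint_strip : rint mu2 (strip beta).
Proof.
have P0 := period_gt0 beta_gt0; have p0 : 0 <= 2 * pi :> R by rewrite mulr_ge0// pi_ge0.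
have [r1 _] := rint_ico (ltW P0); have [r2 _] := rint_ico p0.
by have [] := @rint_prod _ _ _ _ _ mu1 mu1 _ _ r1 r2.
Qed.

Lemma fundI_le_strip (p : T) : fundI beta p <= strip beta p.2.
Proof. by rewrite ler_piMl ?strip_ge0// oI_le1. Qed.

Lemma rint_box_strip M : rint mu4 (fun p => box M p.1 * strip beta p.2).
Proof. by have [] := @rint_prod _ _ _ _ _ mu2 mu2 _ _ (rint_box M) rint_strip. Qed.

Lemma loc_int_L2 (H : T -> R) : measurable_fun (coverO beta) H ->
  rint mu4 (fun p => fundI beta p * H p ^+ 2) -> loc_int beta H.
Proof.
move=> mH rH; split => // M; rewrite bxIE.
apply: (@rint_le _ M4 R mu4 _ _ _ _ (rintD (rint_box_strip M) rH)).
  apply: measurable_funM; last exact: measurable_fundIM.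
  exact: (measurableT_comp (@measurable_box R M)).
move=> p; rewrite normrM (ger0_norm (box_ge0 _ _)) normrM (ger0_norm (fundI_ge0 _ _)).
have f0 := fundI_ge0 beta p; have fs := fundI_le_strip p.
have b0 := box_ge0 M p.1; have b1 := box_le1 M p.1.
have h : `|H p| <= 1 + H p ^+ 2.
  rewrite -real_normK ?num_real//; have := sqr_ge0 (`|H p| - 1); have := normr_ge0 (H p).
  by rewrite !expr2; nra.
apply: (@le_trans _ _ (box M p.1 * (fundI beta p * (1 + H p ^+ 2)))).
  by rewrite ler_wpM2l// ler_wpM2l.
rewrite mulrDr mulr1 mulrDr lerD ?ler_wpM2l// ler_piMl// mulr_ge0 ?sqr_ge0//.
Qed.

(** The weak form of du / d conj = v, tested with real functions and split into real and imaginary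
    parts; e and e' are the real and imaginary directions of the complex coordinate. *)
Definition weak_pair (e e' : T) (u1 u2 v1 v2 : T -> R) :=
  forall a : T -> R, real_test beta a ->
  \int[mu4]_p (fundI beta p * u1 p * 'D_e a p - fundI beta p * u2 p * 'D_e' a p) =
    - (2 * \int[mu4]_p (fundI beta p * v1 p * a p)) /\
  \int[mu4]_p (fundI beta p * u1 p * 'D_e' a p + fundI beta p * u2 p * 'D_e a p) =
    - (2 * \int[mu4]_p (fundI beta p * v2 p * a p)).

Lemma real_test0 : real_test beta (fun=> 0).
Proof.
split; first exact: smooth_cst.
- by [].
- by exists 1, 0; split => // p; rewrite eqxx.
Qed.

(** Both sides are complex linear in the test function, so a complex one is handled through its two
    parts, and a real one is a complex one with imaginary part 0. *)
Lemma weak_derivativeP (e e' : T) (u v : T -> R[i]) :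
  loc_int beta (fun p => complex.Re (u p)) -> loc_int beta (fun p => complex.Im (u p)) ->
  loc_int beta (fun p => complex.Re (v p)) -> loc_int beta (fun p => complex.Im (v p)) ->
  weak_derivative beta (fun F p => (Cderive e F p + 'i%C * Cderive e' F p) / 2) u v <->
  weak_pair e e' (fun p => complex.Re (u p)) (fun p => complex.Im (u p))
    (fun p => complex.Re (v p)) (fun p => complex.Im (v p)).
Proof.
move=> lu1 lu2 lv1 lv2.
pose a (chi : ambient beta -> R[i]) q := complex.Re (lift chi q).
pose b (chi : ambient beta -> R[i]) q := complex.Im (lift chi q).
pose u1 p := complex.Re (u p); pose u2 p := complex.Im (u p).
pose v1 p := complex.Re (v p); pose v2 p := complex.Im (v p).
have rt h c w : loc_int beta h -> real_test beta c -> rint mu4 (fun p => fundI beta p * h p * 'D_w c p).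
  by move=> lh tc; apply: (loc_int_test beta_gt0 lh); exact: real_test_derive.
have L chi : test_fun chi ->
  Cintegral beta (fun p => u p * ((Cderive e (lift chi) p + 'i%C * Cderive e' (lift chi) p) / 2)) =
  (2^-1 * (\int[mu4]_p (fundI beta p * u1 p * 'D_e (a chi) p - fundI beta p * u2 p * 'D_e' (a chi) p)
   - \int[mu4]_p (fundI beta p * u1 p * 'D_e' (b chi) p + fundI beta p * u2 p * 'D_e (b chi) p))) +i*
  (2^-1 * (\int[mu4]_p (fundI beta p * u1 p * 'D_e' (a chi) p + fundI beta p * u2 p * 'D_e (a chi) p)
   + \int[mu4]_p (fundI beta p * u1 p * 'D_e (b chi) p - fundI beta p * u2 p * 'D_e' (b chi) p))).
  move=> tchi; have [ta tb] := test_fun_real tchi.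
  rewrite /Cintegral !Rint_fundO -RintB; [|by apply: rintB; exact: rt|by apply: rintD; exact: rt].
  rewrite -RintD; [|by apply: rintD; exact: rt|by apply: rintB; exact: rt].
  rewrite -!RintZ; [|by apply: rintD; [apply: rintD|apply: rintB]; exact: rt|by apply: rintB; [apply: rintB|apply: rintD]; exact: rt].
  by congr (_ +i* _); apply: Rint_ext => p; [exact: Re_dbar|exact: Im_dbar].
have rt0 h c : loc_int beta h -> real_test beta c -> rint mu4 (fun p => fundI beta p * h p * c p).
  by move=> lh tc; exact: (loc_int_test beta_gt0 lh).
have Rr chi : test_fun chi -> Cintegral beta (fun p => v p * lift chi p) =
  (\int[mu4]_p (fundI beta p * v1 p * a chi p) - \int[mu4]_p (fundI beta p * v2 p * b chi p)) +i*
  (\int[mu4]_p (fundI beta p * v2 p * a chi p) + \int[mu4]_p (fundI beta p * v1 p * b chi p)).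
  move=> tchi; have [ta tb] := test_fun_real tchi.
  rewrite /Cintegral !Rint_fundO -RintB; [|exact: rt0|exact: rt0].
  rewrite -RintD; [|exact: rt0|exact: rt0].
  by congr (_ +i* _); apply: Rint_ext => p; [exact: Re_mul|exact: Im_mul].
split.
- move=> W c tc; have [chi [tchi lchi]] := real_test_test_fun beta_gt0 tc real_test0.
  have ac : a chi = c by apply/funext => p; rewrite /a lchi.
  have bc : b chi = cst 0 by apply/funext => p; rewrite /b lchi.
  have := W chi tchi; rewrite L// Rr// ac bc.
  have z1 : \int[mu4]_p (fundI beta p * u1 p * 'D_e' (cst 0 : T -> R) p + fundI beta p * u2 p * 'D_e (cst 0 : T -> R) p) = 0.
    by rewrite -[RHS](@Rint0 _ _ R mu4); apply: Rint_ext => p; rewrite !derive_cst !mulr0 addr0.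
  have z2 : \int[mu4]_p (fundI beta p * u1 p * 'D_e (cst 0 : T -> R) p - fundI beta p * u2 p * 'D_e' (cst 0 : T -> R) p) = 0.
    by rewrite -[RHS](@Rint0 _ _ R mu4); apply: Rint_ext => p; rewrite !derive_cst !mulr0 subr0.
  have z3 h : \int[mu4]_p (fundI beta p * h p * (cst 0 : T -> R) p) = 0.
    by rewrite -[RHS](@Rint0 _ _ R mu4); apply: Rint_ext => p; rewrite mulr0.
  rewrite z1 z2 !z3 !subr0 !addr0 => /eqP; rewrite eq_complex/= => /andP[/eqP e1 /eqP e2].
  by split; [rewrite -[LHS](mulVKf (_ : 2 != 0 :> R))// e1|rewrite -[LHS](mulVKf (_ : 2 != 0 :> R))// e2]; ring.
- move=> W chi tchi; have [ta tb] := test_fun_real tchi.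
  have [a1 a2] := W _ ta; have [b1 b2] := W _ tb.
  rewrite L// Rr// a1 a2 b1 b2; apply/eqP; rewrite eq_complex/=; apply/andP; split; apply/eqP; by field.
Qed.

Lemma Rint_ico_derive (f g : R -> R) (c d : R) : c < d ->
  (forall x : R, is_derive x 1 f (g x)) -> continuous g ->
  rint mu1 (fun x => ico c d x * g x) /\
  \int[mu1]_x (ico c d x * g x) = f d - f c.
Proof.
move=> cd df cg; have [r i] := Rint_derive_itv cd df cg.
have H : {ae mu1, forall x : R, \1_(`[c, d]%classic : set R) x * g x = ico c d x * g x}.
  have Hd : {ae mu1, forall x : R, x != d}.
    exists [set d]; split => //; first exact: lebesgue_measure_set1.
    by move=> x /= /negP; rewrite negbK => /eqP.
  apply: ae_imp Hd => x xd; congr (_ * _); rewrite indicE mem_setE /ico in_itv/=.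
  by rewrite [x < d]lt_neqAle xd/=; case: ifP.
have m : measurable_fun setT (fun x : measurableTypeR R => ico c d x * g x : measurableTypeR R).
  apply: measurable_funM; first exact: measurable_ico.
  exact: continuous_measurable_fun.
split; first exact: (@rint_ae _ (measurableTypeR R) R mu1 _ _ m H r).
rewrite -i; apply/esym; apply: (@Rint_ae _ (measurableTypeR R) R mu1) => //.
exact: rint_measurable r.
Qed.

Lemma line_ex (x y : R) (w : C) : ((x, y), w) = ((0, y), w) + x *: ex.
Proof.
by case: w => r t; rewrite /ex; congr ((_, _), (_, _)) => /=; rewrite /GRing.scale/= ?mulr1 ?mulr0 ?addr0 ?add0r.
Qed.

Lemma line_ey (x y : R) (w : C) : ((x, y), w) = ((x, 0), w) + y *: ey.
Proof.
by case: w => r t; rewrite /ey; congr ((_, _), (_, _)) => /=; rewrite /GRing.scale/= ?mulr1 ?mulr0 ?addr0 ?add0r.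
Qed.

Lemma line_er (z : C) (r t : R) : (z, (r, t)) = (z, (0, t)) + r *: er.
Proof.
by case: z => x y; rewrite /er; congr ((_, _), (_, _)) => /=; rewrite /GRing.scale/= ?mulr1 ?mulr0 ?addr0 ?add0r.
Qed.

Lemma line_et (z : C) (r t : R) : (z, (r, t)) = (z, (r, 0)) + t *: et.
Proof.
by case: z => x y; rewrite /et; congr ((_, _), (_, _)) => /=; rewrite /GRing.scale/= ?mulr1 ?mulr0 ?addr0 ?add0r.
Qed.

Lemma is_derive_ex (a : T -> R) (w : C) (x y : R) : smooth a ->
  is_derive x 1 (fun s : R => a ((s, y), w)) ('D_ex a ((x, y), w)).
Proof.
move=> sa; have := @is_derive_line R T a ((0, y), w) ex x.
have D : derivable a ((x, y), w) ex by exact: smooth_derivable.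
rewrite -line_ex => /(_ D).
by under eq_fun do rewrite -line_ex.
Qed.

Lemma is_derive_ey (a : T -> R) (w : C) (x y : R) : smooth a ->
  is_derive y 1 (fun s : R => a ((x, s), w)) ('D_ey a ((x, y), w)).
Proof.
move=> sa; have := @is_derive_line R T a ((x, 0), w) ey y.
have D : derivable a ((x, y), w) ey by exact: smooth_derivable.
rewrite -line_ey => /(_ D).
by under eq_fun do rewrite -line_ey.
Qed.

Lemma is_derive_er (a : T -> R) (z : C) (r t : R) : smooth a ->
  is_derive r 1 (fun s : R => a (z, (s, t))) ('D_er a (z, (r, t))).
Proof.
move=> sa; have := @is_derive_line R T a (z, (0, t)) er r.
have D : derivable a (z, (r, t)) er by exact: smooth_derivable.
rewrite -line_er => /(_ D).
by under eq_fun do rewrite -line_er.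
Qed.

Lemma is_derive_et (a : T -> R) (z : C) (r t : R) : smooth a ->
  is_derive t 1 (fun s : R => a (z, (r, s))) ('D_et a (z, (r, t))).
Proof.
move=> sa; have := @is_derive_line R T a (z, (r, 0)) et t.
have D : derivable a (z, (r, t)) et by exact: smooth_derivable.
rewrite -line_et => /(_ D).
by under eq_fun do rewrite -line_et.
Qed.

Lemma continuous_fix1 (f : T -> R) (z : C) : continuous f -> continuous (fun w : C => f (z, w)).
Proof.
move=> cf w; apply: (@cvg_comp _ _ _ (fun w => (z, w)) f _ (nbhs (z, w))); last exact: cf.
exact: (@cvg_pair _ _ _ (nbhs w) (nbhs z) (nbhs w) _ _ _ (fun=> z) id (cvg_cst _) cvg_id).
Qed.

Lemma continuous_fix2 (f : T -> R) (w : C) : continuous f -> continuous (fun z : C => f (z, w)).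
Proof.
move=> cf z; apply: (@cvg_comp _ _ _ (fun z => (z, w)) f _ (nbhs (z, w))); last exact: cf.
exact: (@cvg_pair _ _ _ (nbhs z) (nbhs z) (nbhs w) _ _ _ id (fun=> w) cvg_id (cvg_cst _)).
Qed.

Lemma real_test_slice (a : T -> R) : real_test beta a ->
  exists M, forall w : C, C1c M (fun z => a (z, w)) (fun z => 'D_ex a (z, w)) (fun z => 'D_ey a (z, w)).
Proof.
move=> [sa ia [c [M [c0 H]]]]; exists M => w.
have van (b : T -> R) : (forall p, b p != 0 -> [/\ c <= tfun p, `|p.1.1| <= M & `|p.1.2| <= M]) ->
    vanishes_off M (fun z => b (z, w)).
  move=> Hb z; have [//|/Hb [_ /= h1 h2]] := eqVneq (b (z, w)) 0.
  by case; rewrite ltNge ?h1 ?h2.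
split.
- have cs b : smooth b -> continuous (fun z : C => b (z, w)).
    by move=> sb; apply: (@continuous_fix2 b w); exact: smooth_continuous.
  have h1 := cs _ sa; have h2 := cs _ (smooth_derive ex sa); have h3 := cs _ (smooth_derive ey sa).
  by split.
- by move=> x y; exact: is_derive_ex.
- by move=> x y; exact: is_derive_ey.
- have h1 := van _ H; have h2 := van _ (@supported_derive R a c M ex H).
  have h3 := van _ (@supported_derive R a c M ey H); by split.
Qed.

(** A test function vanishes off O, so against it O may be replaced by the whole period strip, a
    product on which z and zeta separate. *)
Lemma fundI_test (a : T -> R) (p : T) : real_test beta a -> fundI beta p * a p = strip beta p.2 * a p.
Proof.
move=> [_ _ [c [M [c0 H]]]]; have [->|/H[tp _ _]] := eqVneq (a p) 0; first by rewrite !mulr0.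
by rewrite /fundI /oI (lt_le_trans c0 tp) mul1r.
Qed.

(** The derivative of a periodic function integrates to 0 over a period: the endpoint values agree
    by invariance. *)
Lemma zeta_zero_slice (a : T -> R) (z : C) : real_test beta a ->
  (rint mu2 (fun w => strip beta w * 'D_er a (z, w)) /\
   \int[mu2]_w (strip beta w * 'D_er a (z, w)) = 0) /\
  (rint mu2 (fun w => strip beta w * 'D_et a (z, w)) /\
   \int[mu2]_w (strip beta w * 'D_et a (z, w)) = 0).
Proof.
move=> ta; have [sa ia _] := ta.
have P0 := period_gt0 beta_gt0; have p0 : 0 < 2 * pi :> R by rewrite mulr_gt0// pi_gt0.
have cD v : continuous (fun w : C => 'D_v a (z, w)).
  apply: (@continuous_fix1 ('D_v a) z); apply: smooth_continuous; exact: smooth_derive.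
have rs v : rint mu2 (fun w => strip beta w * 'D_v a (z, w)).
  have [B HB] := real_test_bounded beta_gt0 (real_test_derive v ta).
  apply: (@rint_le _ M2 R mu2 _ _ _ _ (rintZ B rint_strip)).
    apply: measurable_funM; first exact: measurable_strip.
    exact: (continuous_measurable2 (cD v)).
  by move=> w; rewrite normrM ger0_norm ?strip_ge0// mulrC ler_wpM2r ?strip_ge0.
split; split => //.
- rewrite fubini2'//= -[RHS](@Rint0 _ _ R mu1); apply: Rint_ext => t.
  transitivity (ico 0 (2 * pi) t * \int[mu1]_r (ico 0 P r * 'D_er a (z, (r, t)))).
    have [r _] := Rint_ico_derive P0 (fun r => is_derive_er z r t sa) (@continuous_sectionx R _ t (cD er)).
    by rewrite -RintZ//; apply: Rint_ext => s; rewrite /strip/=; ring.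
  have [_ ->] := Rint_ico_derive P0 (fun r => is_derive_er z r t sa) (@continuous_sectionx R _ t (cD er)).
  rewrite (_ : a (z, (P, t)) = a (z, (0, t))) ?subrr ?mulr0//.
  apply/esym/ia/cover_eqP; split => //=; exists 1, 0; split; ring.
- rewrite fubini2//= -[RHS](@Rint0 _ _ R mu1); apply: Rint_ext => r.
  transitivity (ico 0 P r * \int[mu1]_t (ico 0 (2 * pi) t * 'D_et a (z, (r, t)))).
    have [q _] := Rint_ico_derive p0 (fun t => is_derive_et z r t sa) (@continuous_sectiony R _ r (cD et)).
    by rewrite -RintZ//; apply: Rint_ext => s; rewrite /strip/=; ring.
  have [_ ->] := Rint_ico_derive p0 (fun t => is_derive_et z r t sa) (@continuous_sectiony R _ r (cD et)).
  rewrite (_ : a (z, (r, 2 * pi)) = a (z, (r, 0))) ?subrr ?mulr0//.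
  apply/esym/ia/cover_eqP; split => //=; exists 0, 1; split; ring.
Qed.

Lemma zeta_zero (h : C -> R) (a : T -> R) : loc_int beta (fun p => h p.1) -> real_test beta a ->
  \int[mu4]_p (fundI beta p * h p.1 * 'D_er a p) = 0 /\
  \int[mu4]_p (fundI beta p * h p.1 * 'D_et a p) = 0.
Proof.
move=> lh ta.
have key v : rint mu4 (fun p => fundI beta p * h p.1 * 'D_v a p) ->
   (forall z, rint mu2 (fun w => strip beta w * 'D_v a (z, w)) /\
     \int[mu2]_w (strip beta w * 'D_v a (z, w)) = 0) ->
   \int[mu4]_p (fundI beta p * h p.1 * 'D_v a p) = 0.
  move=> r H; rewrite fubini4// -[RHS](@Rint0 _ _ R mu2); apply: Rint_ext => z.
  have [rz iz] := H z.
  transitivity (h z * \int[mu2]_w (strip beta w * 'D_v a (z, w))); last by rewrite iz mulr0.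
  rewrite -RintZ//; apply: Rint_ext => w.
  by rewrite mulrAC (fundI_test _ (real_test_derive v ta)) mulrC.
have rt v : rint mu4 (fun p => fundI beta p * h p.1 * 'D_v a p).
  by apply: (loc_int_test beta_gt0 lh); exact: real_test_derive.
split; apply: key => [|z]; try exact: rt.
  exact: (proj1 (zeta_zero_slice z ta)).
exact: (proj2 (zeta_zero_slice z ta)).
Qed.

End real_form.

(** * Extension of the weak equation to test functions on the punctured plane *)

Section annular_functions.
Context {R : realType} (beta : R).
Hypothesis beta_gt0 : 0 < beta.
Local Notation T := (coords R).
Local Notation C := (R * R)%type.
Local Notation ex := (@ex R).
Local Notation ey := (@ey R).
Local Notation et := (@et R).

Lemma le_bump (s t : R) : s <= t -> bump s <= bump t.
Proof.
move=> st; case: (lerP s 0) => s0; first by rewrite (bump_le0 s0) bump_ge0.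
rewrite /bump /flat s0 (lt_le_trans s0 st) !expr0 !invr1 !mul1r ler_expR lerN2.
by rewrite lef_pV2 ?posrE// (lt_le_trans s0).
Qed.

(** Shifting by -1 will move the support of the cutoffs off the boundary; the limit is unaffected
    since n t - 1 >= n t / 2 for large n. *)
Lemma bump_shift_cvg (t : R) : 0 < t -> bump (n%:R * t - 1) @[n --> \oo] --> (1 : R).
Proof.
move=> t0; have t2 : 0 < t / 2 by rewrite divr_gt0.
have := @bump_cvg R (t / 2); rewrite t2 => lim.
apply: (@squeeze_cvgr _ _ _ _ (fun n : nat => bump (n%:R * (t / 2))) (fun=> 1)) => //; last exact: cvg_cst.
near=> n; rewrite bump_le1 andbT; apply: le_bump.
have : 1 <= n%:R * (t / 2).
  rewrite -ler_pdivrMr// mul1r; near: n; exact: nbhs_infty_ger.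
lra.
Unshelve. all: by end_near. Qed.

(** For t > 0 the derivative is t^(-2) exp(-1/t), which the quadratic estimate of [flat_bound]
    bounds. *)
Lemma derive_bump_bounded : exists B : R, 0 <= B /\ forall t, `|derive1 bump t| <= B.
Proof.
have [B [B0 HB]] := @flat_bound R 0; exists B; split => // t.
have [t0|t0] := lerP t 0; first by rewrite derive_bump_le0// normr0.
rewrite derive1E; have [_ ->] := is_derive_flat 0 t.
have := HB t; rewrite oppr0 mul0r add0r /flat t0 expr0 invr1 mul1r normrM.
by rewrite [`|_^-1|]ger0_norm ?invr_ge0 ?sqr_ge0// ler_pdivrMl ?exprn_gt0// mulrC.
Qed.

(** Smoothness is defined on the four coordinates, so a function of z is pulled back to them; its
    gradient can be read at zeta = (0, 0), being constant in zeta. *)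
Definition fst_fun (h : C -> R) (p : T) : R := h p.1.

Definition gradx (h : C -> R) (z : C) : R := 'D_ex (fst_fun h) (z, (0, 0)).
Definition grady (h : C -> R) (z : C) : R := 'D_ey (fst_fun h) (z, (0, 0)).

Lemma derive_fst_fun (h : C -> R) (v p : T) : 'D_v (fst_fun h) p = 'D_(v.1, (0, 0)) (fst_fun h) (p.1, (0, 0)).
Proof.
have := @derive_affine R T T (fst_fun h) (fun p => (p.1, (0, 0))) (fun v => (v.1, (0, 0))) p v.
rewrite -[fst_fun h \o _]/(fst_fun h); apply => k.
by congr pair => //=; rewrite -[RHS]/(k *: (0 : C) + 0) scaler0 addr0.
Qed.

Lemma derive_ex_fst h p : 'D_ex (fst_fun h) p = gradx h p.1.
Proof. exact: derive_fst_fun. Qed.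

Lemma derive_ey_fst h p : 'D_ey (fst_fun h) p = grady h p.1.
Proof. exact: derive_fst_fun. Qed.

Lemma derive_et_fst h p : 'D_et (fst_fun h) p = 0.
Proof.
rewrite derive_fst_fun; rewrite /derive; apply: cvg_lim => //; apply: cvg_near_cst.
apply: nearW => k /=; rewrite /fst_fun /= scaler0 add0r subrr scaler0 //.
Qed.

Definition annular (d M : R) (h : C -> R) := smooth (fst_fun h) /\
  forall z, h z != 0 -> [/\ d <= nsq z, `|z.1| <= M & `|z.2| <= M].

Lemma annular_C1c d M h : annular d M h -> C1c M h (gradx h) (grady h).
Proof.
move=> [sh Hh].
have cs b : smooth b -> continuous (fun z : C => b (z, (0, 0))).
  by move=> sb; apply: (@continuous_fix2 R b (0, 0)); exact: smooth_continuous.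
have h1 := cs _ sh; have h2 := cs _ (smooth_derive ex sh); have h3 := cs _ (smooth_derive ey sh).
have van : vanishes_off M h.
  move=> z; have [//|/Hh[_ k1 k2]] := eqVneq (h z) 0.
  by case; rewrite ltNge ?k1 ?k2.
have vanD v : vanishes_off M (fun z => 'D_v (fst_fun h) (z, (0, 0))).
  have cf1 : continuous (fun q : T => `|q.1.1|).
    by have [s1 _ _ _] := @smooth_coords R; move=> q; apply: cvg_norm; exact: (smooth_continuous s1).
  have cf2 : continuous (fun q : T => `|q.1.2|).
    by have [_ s1 _ _] := @smooth_coords R; move=> q; apply: cvg_norm; exact: (smooth_continuous s1).
  move=> z [zM|zM]; apply: derive_near0; near=> q; apply: van.
    by left; near: q; exact: (cvgr_gt _ (cf1 (z, (0, 0))) M zM).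
  by right; near: q; exact: (cvgr_gt _ (cf2 (z, (0, 0))) M zM).
have c1 : continuous h by exact: h1.
have c2 : continuous (gradx h) by exact: h2.
have c3 : continuous (grady h) by exact: h3.
split; [by split|..|by split; [|exact: vanD|exact: vanD]].
- by move=> x y; have := is_derive_ex (0, 0) x y sh.
- by move=> x y; have := is_derive_ey (0, 0) x y sh.
Unshelve. all: by end_near. Qed.

Section angular_cutoff.
Variable (d : R).
Hypothesis d0 : 0 < d.

Let nq (p : T) : R := p.1.1 * p.1.1 + p.1.2 * p.1.2.
(** Equal to |z|^2 as soon as |z|^2 >= d, yet positive everywhere, so that 1 / sqrt q is smooth on
    the whole space. For |z|^2 >= d the function [s] is cos(arg z + theta). *)
Let q (p : T) : R := nq p + bump (d - nq p).
Let s (p : T) : R := tfun p * (Num.sqrt (q p))^-1.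

Let q_gt0 p : 0 < q p.
Proof.
rewrite /q; have n0 : 0 <= nq p by rewrite addr_ge0// -expr2 sqr_ge0.
have [h|h] := ltrP (nq p) d.
  by rewrite ltr_wpDl// bump_gt0// subr_gt0.
by rewrite ltr_wpDr ?bump_ge0// (lt_le_trans d0).
Qed.

Let sq_neq0 p : Num.sqrt (q p) != 0. Proof. by rewrite gt_eqF// sqrtr_gt0. Qed.

Let smooth_nq : smooth nq.
Proof. by have [s1 s2 _ _] := @smooth_coords R; apply: smoothD; apply: smoothM. Qed.

Let smooth_q : smooth q.
Proof.
apply: smoothD => //; apply: smooth_comp; first exact: smooth1_bump.
by apply: smoothB => //; exact: smooth_cst.
Qed.

Let smooth_s : smooth s.
Proof.
apply: smoothM; first exact: smooth_tfun.
by apply: smoothV => //; apply: smooth_sqrt.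
Qed.

(** Supported in s > 1 / n, hence uniformly away from the boundary of O over an annulus, and tending
    to 1 on O. *)
Definition acut (n : nat) (p : T) : R := bump (n%:R * s p - 1).

Let smooth_ns n : smooth (fun p => n%:R * s p - 1).
Proof. by apply: smoothB; [apply: smoothM => //|]; exact: smooth_cst. Qed.

Lemma smooth_acut n : smooth (acut n).
Proof. by apply: smooth_comp; [exact: smooth1_bump|]. Qed.

Let nqE p : nq p = nsq p.1. Proof. by rewrite /nq /nsq !expr2. Qed.

Lemma invariant_acut n : invariant_fun beta (acut n).
Proof.
move=> p p' pp; rewrite /acut /s (tfun_invariant pp) /q /nq.
by have /cover_eqP[-> _] := pp.
Qed.

Lemma acut_neq0 n p : d <= nsq p.1 -> acut n p != 0 -> Num.sqrt d / n%:R <= tfun p /\ (0 < n)%N.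
Proof.
move=> dp; have [k|k] := lerP (n%:R * s p - 1) 0; first by rewrite /acut bump_le0// eqxx.
move=> _; have n0 : (0 < n)%N.
  by rewrite lt0n; apply/eqP => n0; move: k; rewrite n0 mul0r sub0r oppr_gt0 ltr10.
split => //; rewrite ler_pdivrMr ?ltr0n//.
rewrite subr_gt0 /s mulrA ltr_pdivlMr ?sqrtr_gt0 ?q_gt0// mul1r in k.
rewrite mulrC; apply: le_trans (ltW k); rewrite ler_wsqrtr//.
by rewrite /q nqE ler_wpDr// bump_ge0.
Qed.

Lemma acut_cvg p : 0 < tfun p -> acut n p @[n --> \oo] --> (1 : R).
Proof. by move=> tp; apply: bump_shift_cvg; rewrite mulr_gt0// invr_gt0 sqrtr_gt0. Qed.

Lemma acut_le1 n p : `|acut n p| <= 1.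
Proof. by rewrite ger0_norm ?bump_ge0// bump_le1. Qed.

Let derive_acut n p v : 'D_v (acut n) p = derive1 bump (n%:R * s p - 1) * (n%:R * 'D_v s p).
Proof.
have [_ ->] := derive_comp1 v (@smooth1_derivable R _ (n%:R * s p - 1) (@smooth1_bump R)) (@smooth_differentiable R _ p (smooth_ns n)).
congr (_ * _); have -> : (fun p => n%:R * s p - 1) = n%:R *: s + cst (-1).
  by apply/funext => r; rewrite !fctE.
rewrite deriveD; [|by apply: derivableZ; exact: smooth_derivable|exact: derivable_cst].
by rewrite derive_cst addr0 deriveZ//; exact: smooth_derivable.
Qed.

Let Dx1 (v p : T) : 'D_v (fun p : T => p.1.1) p = v.1.1. Proof. by rewrite derive_coord. Qed.
Let Dx2 (v p : T) : 'D_v (fun p : T => p.1.2) p = v.1.2. Proof. by rewrite derive_coord. Qed.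

Let derive_nq p v : 'D_v nq p = 2 * (p.1.1 * v.1.1 + p.1.2 * v.1.2).
Proof.
have [s1 s2 _ _] := @smooth_coords R.
have -> : nq = (fun p => p.1.1) * (fun p => p.1.1) + (fun p => p.1.2) * (fun p => p.1.2) by [].
rewrite deriveD; try (by apply: derivableM; exact: smooth_derivable).
rewrite !deriveM; try exact: smooth_derivable.
by rewrite Dx1 Dx2 /GRing.scale/=; ring.
Qed.

Let derive_q p v : d <= nq p -> 'D_v q p = 2 * (p.1.1 * v.1.1 + p.1.2 * v.1.2).
Proof.
move=> dp.
have sd : smooth (fun p => d - nq p) by apply: smoothB => //; exact: smooth_cst.
have -> : q = nq + (bump \o (fun p => d - nq p)) by [].
have [db Db] := derive_comp1 v (@smooth1_derivable R _ (d - nq p) (@smooth1_bump R)) (@smooth_differentiable R _ p sd).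
rewrite deriveD; [|exact: smooth_derivable|exact: diff_derivable].
by rewrite Db derive_bump_le0 ?subr_le0// mul0r addr0.
Qed.

Let derive_tfun p v : 'D_v (@tfun R) p = v.1.1 * cos p.2.2 - v.1.2 * sin p.2.2
  - v.2.2 * (p.1.1 * sin p.2.2 + p.1.2 * cos p.2.2).
Proof.
have [s1 s2 _ s4] := @smooth_coords R.
have D4 : 'D_v (fun p : T => p.2.2) p = v.2.2 by rewrite derive_coord.
have dc : derivable (@cos R) p.2.2 1 by exact: derivable_cos.
have ds : derivable (@sin R) p.2.2 1 by exact: derivable_sin.
have [ec Ec] := derive_comp1 v dc (@smooth_differentiable R _ p s4).
have [es Es] := derive_comp1 v ds (@smooth_differentiable R _ p s4).
have -> : @tfun R = (fun p => p.1.1) * (cos \o (fun p => p.2.2)) - (fun p => p.1.2) * (sin \o (fun p => p.2.2)) by [].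
have d1 : derivable (cos \o (fun p : T => p.2.2)) p v by exact: diff_derivable.
have d2 : derivable (sin \o (fun p : T => p.2.2)) p v by exact: diff_derivable.
have d3 := @smooth_derivable R _ p v s1; have d4 := @smooth_derivable R _ p v s2.
rewrite (deriveB (derivableM d3 d1) (derivableM d4 d2)) (deriveM d3 d1) (deriveM d4 d2) Ec Es Dx1 Dx2 D4 !derive1E !derive_val.
by rewrite /GRing.scale/=; ring.
Qed.

Let derive_s p v : d <= nq p -> 'D_v s p =
  (Num.sqrt (nq p))^-1 * ('D_v (@tfun R) p - tfun p * (p.1.1 * v.1.1 + p.1.2 * v.1.2) / nq p).
Proof.
move=> dp; have qE : q p = nq p by rewrite /q bump_le0 ?addr0// subr_le0.
have [dsq Dsq] := derive_sqrt' v (q_gt0 p) (@smooth_differentiable R _ p smooth_q).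
have [dV DV] := derivableV' v (sq_neq0 p) dsq.
have -> : s = @tfun R * (fun r => ((Num.sqrt \o q) r)^-1) by [].
rewrite deriveM; [|exact/smooth_derivable/smooth_tfun|exact: diff_derivable].
rewrite DV Dsq derive_q//= qE.
have nq0 : 0 < nq p by exact: lt_le_trans dp.
set r := Num.sqrt (nq p); have r0 : r != 0 by rewrite gt_eqF// sqrtr_gt0.
have -> : nq p = r ^+ 2 by rewrite sqr_sqrtr// ltW.
by rewrite /GRing.scale/=; field.
Qed.

(** For |z|^2 >= d the cutoff depends on arg z + theta only, so its z-derivatives are its
    theta-derivative times the gradient (- y, x) / |z|^2 of arg z. *)
Lemma derive_acut_angular n p : d <= nsq p.1 ->
  'D_ex (acut n) p = - (p.1.2 / nsq p.1) * 'D_et (acut n) p /\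
  'D_ey (acut n) p = (p.1.1 / nsq p.1) * 'D_et (acut n) p.
Proof.
move=> dp; rewrite !derive_acut; have dq : d <= nq p by rewrite nqE.
rewrite !derive_s// !derive_tfun /ex /ey /et/= -nqE.
have n0 : nq p != 0 by rewrite gt_eqF// (lt_le_trans d0).
rewrite /tfun; move: n0; rewrite /nq.
set A := derive1 _ _; set r := (Num.sqrt _)^-1; set c := cos _; set t := sin _.
move: A r c t p.1.1 p.1.2 => A r c t x y n0.
by split; field.
Qed.

End angular_cutoff.
End annular_functions.

Section weak_extension.
Context {R : realType} (beta : R).
Hypothesis beta_gt0 : 0 < beta.
Local Notation T := (coords R).
Local Notation C := (R * R)%type.
Local Notation M2 := (measurableTypeR R * measurableTypeR R)%type.
Local Notation M4 := (coords (measurableTypeR R)).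
Local Notation mu4 := (leb4 R).
Local Notation ex := (@ex R).
Local Notation ey := (@ey R).
Local Notation fundI := (fundI beta).

Lemma loc_intM (H b : T -> R) (B : R) : loc_int beta H ->
  measurable_fun setT (b : M4 -> measurableTypeR R) -> (forall p, `|b p| <= B) ->
  loc_int beta (fun p => H p * b p).
Proof.
move=> [mH iH] mb bB.
have m : measurable_fun (coverO beta) (fun p : M4 => H p * b p : measurableTypeR R).
  by apply: measurable_funM => //; exact: measurable_funTS.
split => // M; apply: (@rint_le _ M4 R mu4 _ _ _ _ (rintZ B (rint_norm (iH M)))).
  rewrite bxIE; apply: measurable_funM; last exact: measurable_fundIM.
  exact: (measurableT_comp (@measurable_box R M)).
by move=> p; rewrite !mulrA normrM mulrC; apply: ler_wpM2r.
Qed.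

Lemma loc_int_rint (H b : T -> R) (B M : R) : loc_int beta H ->
  measurable_fun setT (b : M4 -> measurableTypeR R) -> (forall p, `|b p| <= B) ->
  (forall p, b p != 0 -> `|p.1.1| <= M /\ `|p.1.2| <= M) ->
  rint mu4 (fun p => fundI p * H p * b p).
Proof.
move=> lH mb bB bM; have [_ iM] := loc_intM lH mb bB.
move: (iM M); apply: rint_ext => p.
have [->|/bM[h1 h2]] := eqVneq (b p) 0; first by rewrite !mulr0.
by rewrite /bxI h1 h2 mul1r mulrA.
Qed.

Lemma measurable_fst_fun (h : C -> R) : measurable_fun setT (h : M2 -> measurableTypeR R) ->
  measurable_fun setT (fun p : M4 => h p.1 : measurableTypeR R).
Proof. by move=> mh; exact: (measurableT_comp mh). Qed.

Lemma vanishes_off_fst (M : R) (h : C -> R) (p : T) : vanishes_off M h -> h p.1 != 0 ->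
  `|p.1.1| <= M /\ `|p.1.2| <= M.
Proof.
move=> vh hp; split; rewrite leNgt; apply/negP => k; move/eqP: hp; apply; apply: vh; tauto.
Qed.

Lemma loc_int_C1c (H : T -> R) M f fx fy : loc_int beta H -> C1c M f fx fy ->
  [/\ rint mu4 (fun p => fundI p * H p * f p.1), rint mu4 (fun p => fundI p * H p * fx p.1) &
      rint mu4 (fun p => fundI p * H p * fy p.1)].
Proof.
move=> lH [[cf cfx cfy] _ _ [vf vfx vfy]].
have key g : continuous g -> vanishes_off M g -> rint mu4 (fun p => fundI p * H p * g p.1).
  move=> cg vg; have [B [_ HB]] := vanishes_off_bounded cg vg.
  apply: (@loc_int_rint H (fun p => g p.1) B M) => //.
    by apply: measurable_fst_fun; exact: continuous_measurable2.
  by move=> p; exact: vanishes_off_fst.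
by split; apply: key.
Qed.

Lemma acut_limit (d : R) (F : T -> R) : 0 < d -> rint mu4 (fun p => fundI p * F p) ->
  \int[mu4]_p (fundI p * F p * acut d n p) @[n --> \oo] -->
  \int[mu4]_p (fundI p * F p).
Proof.
move=> d0 rF.
apply: (proj2 (@Rint_dominated _ M4 R mu4 (fun n p => fundI p * F p * acut d n p)
  (fun p => fundI p * F p) (fun p => `|fundI p * F p|) _ _ _ _)).
- move=> n; apply: measurable_funM; first exact: rint_measurable rF.
  by apply: measurable_smooth; exact: smooth_acut.
- move=> p; have [tp|tp] := ltrP 0 (tfun p).
    by rewrite -[X in _ --> X]mulr1; apply: cvgM; [exact: cvg_cst|exact: acut_cvg].
  rewrite fundI_out; last by move/coverOP; rewrite ltNge tp.
  rewrite !mul0r; under eq_fun do rewrite mul0r; exact: cvg_cst.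
- exact: rint_norm.
- by move=> n p; rewrite normrM ler_piMr// acut_le1.
Qed.

Lemma Rint_perturb (A B1 B2 : T -> R) (c : R) : rint mu4 A ->
  rint mu4 B1 /\ Rintegral mu4 setT B1 = 0 -> rint mu4 B2 /\ Rintegral mu4 setT B2 = 0 ->
  Rintegral mu4 setT A = \int[mu4]_p (A p + c * B1 p - B2 p).
Proof.
move=> rA [r1 z1] [r2 z2]; have rc := rintZ c r1.
by rewrite (RintB (rintD rA rc) r2) (RintD rA rc) RintZ// z1 z2 mulr0 addr0 subr0.
Qed.

Lemma limit_relation (x y : R^nat) (a b : R) : x n @[n --> \oo] --> a -> y n @[n --> \oo] --> b ->
  (forall n, x n = - (2 * y n)) -> a = - (2 * b).
Proof.
move=> xa yb xy.
have H : x n @[n --> \oo] --> - (2 * b).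
  rewrite (_ : x = fun n => - (2 * y n)); last exact/funext.
  by apply: cvgN; apply: cvgM => //; exact: cvg_cst.
exact: (cvg_unique _ xa H).
Qed.

Section test.
Variables (d M : R) (h : C -> R).
Hypotheses (d0 : 0 < d) (Hh : annular d M h).

Let a n (p : T) : R := h p.1 * acut d n p.

(** Stands for |z|^2 in the denominators: equal to it on the support of h and nowhere below d. So x
    / rho and y / rho are bounded functions of z on the whole plane, and multiplying u by them
    preserves local integrability. *)
Let rho (z : C) : R := Num.max (nsq z) d.

Let rho_gt0 z : 0 < rho z. Proof. by rewrite lt_max d0 orbT. Qed.

Let a_test n : real_test beta (a n).
Proof.
have [sh hM] := Hh; split.
- by apply: smoothM => //; exact: smooth_acut.
- move=> p q pq; rewrite /a (invariant_acut d n pq).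
  by have /cover_eqP[-> _] := pq.
- exists (Num.sqrt d / n.+1%:R), M; split; first by rewrite divr_gt0// sqrtr_gt0.
  move=> p; rewrite /a mulf_eq0 negb_or => /andP[/hM [hd h1 h2]] /(acut_neq0 d0 hd) [ht n0].
  split => //; apply: le_trans ht; rewrite ler_wpM2l ?sqrtr_ge0//.
  by rewrite lef_pV2 ?posrE ?ltr0n// ler_nat.
Qed.

Let derive_a n (p v : T) : 'D_v (a n) p = 'D_v (fst_fun h) p * acut d n p + h p.1 * 'D_v (acut d n) p.
Proof.
have [sh _] := Hh; have sa := smooth_acut d0 n.
have -> : a n = fst_fun h * acut d n by [].
rewrite (deriveM (@smooth_derivable R _ p v sh) (@smooth_derivable R _ p v sa)).
by rewrite /GRing.scale/= addrC mulrC.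
Qed.

Let derive_a_angular n p :
  'D_ex (a n) p = gradx h p.1 * acut d n p - p.1.2 / rho p.1 * 'D_et (a n) p /\
  'D_ey (a n) p = grady h p.1 * acut d n p + p.1.1 / rho p.1 * 'D_et (a n) p.
Proof.
have [_ hM] := Hh.
rewrite !derive_a derive_ex_fst derive_ey_fst derive_et_fst.
have key (hz g k c X Y : R) : (hz != 0 -> X = c * Y) -> g * k + hz * X = g * k + c * (0 * k + hz * Y).
  by have [->|hz0] := eqVneq hz 0 => [_|->//]; ring.
have rE : h p.1 != 0 -> d <= nsq p.1 /\ rho p.1 = nsq p.1.
  by move=> /hM [hd _ _]; split => //; rewrite /rho max_l.
split.
- rewrite -mulNr; apply: key => /rE [hd ->]; have [e _] := derive_acut_angular d0 n hd; exact: e.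
- apply: key => /rE [hd ->]; have [_ e] := derive_acut_angular d0 n hd; exact: e.
Qed.

Let coord_rho (z : C) : `|z.1 / rho z| <= 1 + d^-1 /\ `|z.2 / rho z| <= 1 + d^-1.
Proof.
have key (t : R) : t ^+ 2 <= rho z -> `|t / rho z| <= 1 + d^-1.
  have i0 : 0 <= (rho z)^-1 by rewrite invr_ge0 ltW.
  move=> tr; rewrite normrM (ger0_norm i0) ler_pdivrMr//.
  have dr : d <= rho z by rewrite le_max lexx orbT.
  have h1 : 1 <= d^-1 * rho z by rewrite mulrC ler_pdivlMr// mul1r.
  have h2 : `|t| <= 1 + t ^+ 2.
    rewrite -real_normK ?num_real//; have := sqr_ge0 (`|t| - 1); have := normr_ge0 t.
    by rewrite !expr2; nra.
  by rewrite mulrDl mul1r; lra.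
by split; apply: key; rewrite le_max /nsq ?lerDl ?lerDr sqr_ge0.
Qed.

Let m_rho : measurable_fun setT (fun z : M2 => (rho z)^-1 : measurableTypeR R).
Proof.
apply: (measurableT_comp measurable_inv); apply: measurable_maxr => //.
by apply: continuous_measurable2; exact: continuous_nsq.
Qed.

Let loc_rho (u : C -> R) : loc_int beta (fun p => u p.1) ->
  loc_int beta (fun p => u p.1 * (p.1.1 / rho p.1)) /\
  loc_int beta (fun p => u p.1 * (p.1.2 / rho p.1)).
Proof.
move=> lu; split; apply: (loc_intM (B := 1 + d^-1)) => //.
- apply: (@measurable_fst_fun (fun z => z.1 / rho z)); exact: measurable_funM.
- by move=> p; have [] := coord_rho p.1.
- apply: (@measurable_fst_fun (fun z => z.2 / rho z)); exact: measurable_funM.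
- by move=> p; have [] := coord_rho p.1.
Qed.

Variables (u1 u2 : C -> R) (G1 G2 : T -> R).
Hypotheses (lu1 : loc_int beta (fun p => u1 p.1)) (lu2 : loc_int beta (fun p => u2 p.1)).
Hypotheses (lG1 : loc_int beta G1) (lG2 : loc_int beta G2).
Hypothesis W : weak_pair beta ex ey (fun p => u1 p.1) (fun p => u2 p.1) G1 G2.

(* The angular derivatives of the cutoffs [acut] integrate to zero along the fibres, so the weak equation survives in the limit. *)
Lemma weak_extension :
  \int[mu4]_p (fundI p * (u1 p.1 * gradx h p.1 - u2 p.1 * grady h p.1)) =
    - (2 * \int[mu4]_p (fundI p * (G1 p * h p.1))) /\
  \int[mu4]_p (fundI p * (u1 p.1 * grady h p.1 + u2 p.1 * gradx h p.1)) =
    - (2 * \int[mu4]_p (fundI p * (G2 p * h p.1))).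
Proof.
have Hc := annular_C1c Hh.
have [_ r1x r1y] := loc_int_C1c lu1 Hc.
have [_ r2x r2y] := loc_int_C1c lu2 Hc.
have [g1 _ _] := loc_int_C1c lG1 Hc.
have [g2 _ _] := loc_int_C1c lG2 Hc.
have [l1x l1y] := loc_rho lu1; have [l2x l2y] := loc_rho lu2.
have rF1 : rint mu4 (fun p => fundI p * (u1 p.1 * gradx h p.1 - u2 p.1 * grady h p.1)).
  by move: (rintB r1x r2y); apply: rint_ext => p; ring.
have rF2 : rint mu4 (fun p => fundI p * (u1 p.1 * grady h p.1 + u2 p.1 * gradx h p.1)).
  by move: (rintD r1y r2x); apply: rint_ext => p; ring.
have rG1 : rint mu4 (fun p => fundI p * (G1 p * h p.1)).
  by move: g1; apply: rint_ext => p; rewrite mulrA.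
have rG2 : rint mu4 (fun p => fundI p * (G2 p * h p.1)).
  by move: g2; apply: rint_ext => p; rewrite mulrA.
have zt (k : C -> R) n : loc_int beta (fun p => k p.1) ->
    rint mu4 (fun p => fundI p * k p.1 * 'D_et (a n) p) /\
    \int[mu4]_p (fundI p * k p.1 * 'D_et (a n) p) = 0.
  move=> lk; have [_ z] := zeta_zero beta_gt0 lk (a_test n); split => //.
  by apply: (loc_int_test beta_gt0 lk); exact: real_test_derive (a_test n).
have rc (F : T -> R) n : rint mu4 (fun p => fundI p * F p) -> rint mu4 (fun p => fundI p * F p * acut d n p).
  move=> rF; apply: (@rint_le _ M4 R mu4 _ _ _ _ (rint_norm rF)).
    apply: measurable_funM; first exact: rint_measurable rF.
    by apply: measurable_smooth; exact: smooth_acut.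
  by move=> p; rewrite normrM ler_piMr// acut_le1.
have E1 n : \int[mu4]_p (fundI p * (u1 p.1 * gradx h p.1 - u2 p.1 * grady h p.1) * acut d n p) =
    - (2 * \int[mu4]_p (fundI p * (G1 p * h p.1) * acut d n p)).
  have [W1 _] := W (a_test n).
  have z1 := zt (fun z => u1 z * (z.2 / rho z)) n l1y.
  have z2 := zt (fun z => u2 z * (z.1 / rho z)) n l2x.
  have -> : \int[mu4]_p (fundI p * (G1 p * h p.1) * acut d n p) =
      \int[mu4]_p (fundI p * G1 p * a n p).
    by apply: Rint_ext => p; rewrite /a; ring.
  rewrite -W1; have rA := rc _ n rF1.
  (* The terms added here are theta-derivatives of [a n] times functions of z, whose integrals
     vanish by [zeta_zero]; they complete the left side to the integrand tested with [a n]. *)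
  apply: (etrans (Rint_perturb (-1) rA z1 z2)).
  apply: Rint_ext => p; have [-> ->] := derive_a_angular n p.
  move: ('D_et (a n) p) (acut d n p) (gradx h p.1) (grady h p.1) (rho p.1)^-1 => *; ring.
have E2 n : \int[mu4]_p (fundI p * (u1 p.1 * grady h p.1 + u2 p.1 * gradx h p.1) * acut d n p) =
    - (2 * \int[mu4]_p (fundI p * (G2 p * h p.1) * acut d n p)).
  have [_ W1] := W (a_test n).
  have z1 := zt (fun z => u1 z * (z.1 / rho z)) n l1x.
  have z2 := zt (fun z => u2 z * (z.2 / rho z)) n l2y.
  have -> : \int[mu4]_p (fundI p * (G2 p * h p.1) * acut d n p) =
      \int[mu4]_p (fundI p * G2 p * a n p).
    by apply: Rint_ext => p; rewrite /a; ring.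
  rewrite -W1; have rA := rc _ n rF2.
  apply: (etrans (Rint_perturb 1 rA z1 z2)).
  apply: Rint_ext => p; have [-> ->] := derive_a_angular n p.
  move: ('D_et (a n) p) (acut d n p) (gradx h p.1) (grady h p.1) (rho p.1)^-1 => *; ring.
have L1 := acut_limit d0 rF1; have L2 := acut_limit d0 rF2.
have K1 := acut_limit d0 rG1; have K2 := acut_limit d0 rG2.
by split; [exact: (limit_relation L1 K1 E1)|exact: (limit_relation L2 K2 E2)].
Qed.

End test.
End weak_extension.

(** * Fibre averages *)

Section fibre_average.
Context {R : realType} (beta : R).
Hypothesis beta_gt0 : 0 < beta.
Local Notation T := (coords R).
Local Notation C := (R * R)%type.
Local Notation M2 := (measurableTypeR R * measurableTypeR R)%type.
Local Notation M4 := (coords (measurableTypeR R)).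
Local Notation mu2 := (leb2 R).
Local Notation mu4 := (leb4 R).
Local Notation ex := (@ex R).
Local Notation ey := (@ey R).
Local Notation fundI := (fundI beta).
Local Notation fm := (fibre_mass beta).

Lemma measurable_fibre (F : T -> R) : (forall M, rint mu4 (fun p => box M p.1 * F p)) ->
  measurable_fun setT (fun z : M2 => \int[mu2]_w (F (z, w)) : measurableTypeR R).
Proof.
move=> rF.
apply: (measurable_fun_cvg (h := fun n z => box n%:R z * \int[mu2]_w (F (z, w)))).
- move=> n; have [m _] := Rint_fiber1 (rF n%:R).
  apply: eq_measurable_fun m => z _ /=; rewrite /box /cci; case: ifP => _; last first.
    by rewrite !mul0r; under eq_Rintegral do rewrite !mul0r; exact: Rint0.
  case: ifP => _; last first.
    by rewrite !(mulr0, mul0r); under eq_Rintegral do rewrite !(mulr0, mul0r); exact: Rint0.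
  by rewrite !mul1r; apply: Rint_ext => w; rewrite !mul1r.
- move=> z _; rewrite -[X in _ --> X]mul1r; apply: cvgM; last exact: cvg_cst.
  exact: box_cvg1.
Qed.

Definition fav (H : T -> R) (z : C) : R :=
  fm^-1 * \int[mu2]_w (fundI (z, w) * H (z, w)).

Lemma measurable_fav (H : T -> R) : loc_int beta H ->
  measurable_fun setT (fav H : M2 -> measurableTypeR R).
Proof.
move=> [_ iH]; apply: measurable_funM => //.
by apply: (@measurable_fibre (fun p => fundI p * H p)) => M; have := iH M; rewrite bxIE.
Qed.

Lemma measurable_section (F : T -> R) (z : C) :
  measurable_fun setT (F : M4 -> measurableTypeR R) ->
  measurable_fun setT (fun w : M2 => F (z, w) : measurableTypeR R).
Proof. by move=> mF; exact: (measurableT_comp mF (@measurable_pair1 _ _ M2 M2 z)). Qed.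

Lemma fav_eq (H : T -> R) (h : C -> R) : measurable_fun (coverO beta) H ->
  {ae mu4, forall p, coverO beta p -> H p = h p.1} -> {ae mu2, forall z, fav H z = h z}.
Proof.
move=> mH Hh.
have := ae_and (ae_section1 Hh) (@coord_nz_ae R); apply: ae_imp => z [Hz z1].
rewrite /fav -[RHS](mulKf (_ : fm != 0)) ?gt_eqF ?fibre_mass_gt0//; congr (_ * _).
have [{}rz {}iz] := fundI_fibre beta_gt0 z1.
rewrite mulrC -iz -RintZ//; apply: Rint_ae.
- by apply: (@measurable_section (fun p => fundI p * H p) z); exact: measurable_fundIM.
- by apply: measurable_funM => //; apply: (@measurable_section fundI z); exact: measurable_fundI.
- apply: ae_imp Hz => w Hw; rewrite mulrC.
  have [/Hw ->//|nO] := pselect (coverO beta (z, w)).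
  by rewrite fundI_out// !mulr0.
Qed.

Lemma fav_rep (H : T -> R) (h : C -> R) : measurable_fun (coverO beta) H ->
  {ae mu4, forall p, coverO beta p -> H p = h p.1} ->
  {ae mu4, forall p, coverO beta p -> H p = fav H p.1}.
Proof.
move=> mH Hh; have A := @ae_fst _ _ _ _ _ mu2 mu2 _ (fav_eq mH Hh).
by have := ae_and A Hh; apply: ae_imp => p [-> h1] pO; exact: h1.
Qed.

Lemma rint_fundI_fst (h : C -> R) : rint mu2 h ->
  rint mu4 (fun p => fundI p * h p.1).
Proof.
move=> rh; have mh := rint_measurable rh.
have [r _] := @rint_prod _ _ _ _ _ mu2 mu2 _ _ (rint_norm rh) (rint_strip beta_gt0).
apply: (@rint_le _ M4 R mu4 _ _ _ _ r).
  by apply: measurable_funM; [exact: measurable_fundI|exact: measurable_fst_fun].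
move=> p; rewrite normrM (ger0_norm (fundI_ge0 _ _)) mulrC ler_wpM2l//.
exact: fundI_le_strip.
Qed.

Lemma fundI_fst_fibre (h : C -> R) : measurable_fun setT (h : M2 -> measurableTypeR R) ->
  rint mu4 (fun p => fundI p * h p.1) ->
  rint mu2 h /\ \int[mu4]_p (fundI p * h p.1) = fm * Rintegral mu2 setT h.
Proof.
move=> mh r; have [m1 r1] := Rint_fiber1 r.
have E : {ae mu2, forall z, \int[mu2]_w (fundI (z, w) * h z) = fm * h z}.
  apply: ae_imp (@coord_nz_ae R) => z z1; have [rz iz] := fundI_fibre beta_gt0 z1.
  by rewrite mulrC -iz -RintZ//; apply: Rint_ext => w; rewrite mulrC.
have m2 : measurable_fun setT (fun z : M2 => fm * h z : measurableTypeR R) by exact: measurable_funM.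
have r2 : rint mu2 (fun z => fm * h z) by exact: (@rint_ae _ M2 R mu2 _ _ m2 E r1).
have rh : rint mu2 h.
  move: (@rintZ _ M2 R mu2 fm^-1 _ r2); apply: rint_ext => z.
  by rewrite mulKf// gt_eqF// fibre_mass_gt0.
split => //; rewrite fubini4// -RintZ//; exact: Rint_ae.
Qed.

Lemma Rint_fundI_fst (h : C -> R) : rint mu2 h ->
  \int[mu4]_p (fundI p * h p.1) = fm * Rintegral mu2 setT h.
Proof. by move=> rh; have [] := fundI_fst_fibre (rint_measurable rh) (rint_fundI_fst rh). Qed.

Lemma tfun_sqr_le (p : T) : tfun p ^+ 2 <= nsq p.1.
Proof.
rewrite /tfun /nsq; have := cos2Dsin2 p.2.2; move: (cos _) (sin _) p.1.1 p.1.2 => c s x y cs.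
rewrite -[leRHS]mulr1 -cs -subr_ge0.
have -> : (x ^+ 2 + y ^+ 2) * (c ^+ 2 + s ^+ 2) - (x * c - y * s) ^+ 2 = (x * s + y * c) ^+ 2 by ring.
exact: sqr_ge0.
Qed.

(** As |Re (z e^(i theta))| <= |z|, the bound c <= [tfun] forces |z| >= c: a slice of a test
    function stays away from z = 0 and extends by 0 to the plane. *)
Lemma annular_slice (a : T -> R) : real_test beta a -> exists d M, 0 < d /\
  forall w, annular d M (fun z => a (z, w)).
Proof.
move=> [sa _ [c [M [c0 H]]]]; exists (c ^+ 2), M; split; first by rewrite exprn_gt0.
move=> w; split; first exact: smooth_slice.
move=> z /H[h1 h2 h3]; split => //; apply: le_trans (tfun_sqr_le (z, w)).
by rewrite ler_sqr ?nnegrE ?(ltW c0)// (le_trans (ltW c0)).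
Qed.

Lemma derive_slice (a : T -> R) (w : C) (z : C) (v : C) :
  'D_(v, (0, 0)) (fst_fun (fun z => a (z, w))) (z, (0, 0)) = 'D_(v, (0, 0)) a (z, w).
Proof.
have := @derive_affine R T T a (fun p => (p.1, w)) (fun v => (v.1, (0, 0))) (z, (0, 0)) (v, (0, 0)).
rewrite -[a \o _]/(fst_fun (fun z => a (z, w))); apply => k.
by congr pair => //=; rewrite -[RHS]/(k *: (0 : C) + w) scaler0 add0r.
Qed.

Lemma gradx_slice (a : T -> R) (w z : C) : gradx (fun z => a (z, w)) z = 'D_ex a (z, w).
Proof. exact: (derive_slice a w z (1, 0)). Qed.

Lemma grady_slice (a : T -> R) (w z : C) : grady (fun z => a (z, w)) z = 'D_ey a (z, w).
Proof. exact: (derive_slice a w z (0, 1)). Qed.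

(** Multiplication of the equation by - i. It transfers every conclusion about the real part to the
    imaginary part. *)
Lemma weak_pair_rot e e' (u1 u2 G1 G2 : T -> R) :
  loc_int beta u1 -> loc_int beta u2 -> loc_int beta G1 ->
  weak_pair beta e e' u1 u2 G1 G2 ->
  weak_pair beta e e' u2 (fun p => - u1 p) G2 (fun p => - G1 p).
Proof.
move=> l1 l2 lG W a ta; have [W1 W2] := W a ta.
have r1 := loc_int_test beta_gt0 l1 (real_test_derive e ta).
have r2 := loc_int_test beta_gt0 l2 (real_test_derive e' ta).
have rG := loc_int_test beta_gt0 lG ta.
split.
- rewrite -W2; apply: Rint_ext => p.
  by move: ('D_e a p) ('D_e' a p) => X Y; ring.
- have -> : \int[mu4]_p (fundI p * - G1 p * a p) =
    - \int[mu4]_p (fundI p * G1 p * a p).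
    by rewrite -RintN//; apply: Rint_ext => p; ring.
  rewrite mulrN -W1 -(RintN (rintB r1 r2)); apply: Rint_ext => p.
  by move: ('D_e a p) ('D_e' a p) => X Y; ring.
Qed.

Lemma loc_int_rintI (H : T -> R) : measurable_fun (coverO beta) H ->
  rint mu4 (fun p => fundI p * H p) -> loc_int beta H.
Proof.
move=> mH rH; split => // M.
apply: (@rint_le _ M4 R mu4 _ _ _ _ (rint_norm rH)).
  rewrite bxIE; apply: measurable_funM; last exact: measurable_fundIM.
  exact: (measurableT_comp (@measurable_box R M)).
by move=> p; rewrite bxIE normrM ger0_norm ?box_ge0// ler_piMl// box_le1.
Qed.

Section zonly.
Variables (u1 u2 : C -> R) (G1 G2 : T -> R).
Hypotheses (mu_1 : measurable_fun setT (u1 : M2 -> measurableTypeR R))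
  (mu_2 : measurable_fun setT (u2 : M2 -> measurableTypeR R)).
Hypotheses (lu1 : loc_int beta (fun p => u1 p.1)) (lu2 : loc_int beta (fun p => u2 p.1)).
Hypotheses (mG1 : measurable_fun (coverO beta) G1) (mG2 : measurable_fun (coverO beta) G2).
Hypotheses (iG1 : invariant_fun beta G1).
Hypotheses (rG1 : rint mu4 (fun p => fundI p * G1 p)) (rG2 : rint mu4 (fun p => fundI p * G2 p)).
Hypothesis W : weak_pair beta ex ey (fun p => u1 p.1) (fun p => u2 p.1) G1 G2.

Let lG1 := loc_int_rintI mG1 rG1.
Let lG2 := loc_int_rintI mG2 rG2.

Let rfav : rint mu2 (fav G1).
Proof. by have [_ r] := Rint_fiber1 rG1; exact: rintZ. Qed.

(** The extended weak equation with h = a(., w), the parameter w being frozen. Since neither u nor h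
    depends on zeta, integrating over the fibres and dividing by their common area gives an equation
    in the plane for the average of G1. *)
Let fav_slice (a : T -> R) (w : C) : real_test beta a ->
  \int[mu2]_z (fav G1 z * a (z, w)) =
  - (2^-1 * \int[mu2]_z (u1 z * 'D_ex a (z, w) - u2 z * 'D_ey a (z, w))).
Proof.
move=> ta; have [d [M [d0 an]]] := annular_slice ta; have Hh := an w.
have Hc := annular_C1c Hh.
have [g1 _ _] := loc_int_C1c lG1 Hc.
have [_ r1x r1y] := loc_int_C1c lu1 Hc.
have [_ r2x r2y] := loc_int_C1c lu2 Hc.
have [W1 _] := weak_extension beta_gt0 d0 Hh lu1 lu2 lG1 lG2 W.
set h := (fun z => a (z, w)) in Hh Hc g1 r1x r1y r2x r2y W1 *.
have [[ch cx cy] _ _ [vh vx vy]] := Hc.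
have mF : measurable_fun setT (fun z : M2 => u1 z * gradx h z - u2 z * grady h z : measurableTypeR R).
  by apply: measurable_funB; apply: measurable_funM => //; exact: continuous_measurable2.
have rF : rint mu4 (fun p => fundI p * (u1 p.1 * gradx h p.1 - u2 p.1 * grady h p.1)).
  move: (rintB r1x r2y); apply: rint_ext => p.
  by move: (gradx h p.1) (grady h p.1) => X Y; ring.
have [rF2 eF2] := fundI_fst_fibre mF rF.
have f0 : fm != 0 by rewrite gt_eqF// fibre_mass_gt0.
have -> : \int[mu2]_z (fav G1 z * h z) =
    fm^-1 * \int[mu4]_p (fundI p * (G1 p * h p.1)).
  have r4 : rint mu4 (fun p => fundI p * (G1 p * h p.1)).
    by move: g1; apply: rint_ext => p; rewrite mulrA.
  have [m4 s4] := Rint_fiber1 r4.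
  rewrite fubini4// -RintZ//; apply: Rint_ae.
  - apply: measurable_funM; first exact: rint_measurable rfav.
    exact: continuous_measurable2.
  - exact: measurable_funM.
  - have := ae_rint1 rG1; apply: ae_imp => z rz.
    rewrite /fav -mulrA; congr (_ * _); rewrite mulrC -RintZ//; apply: Rint_ext => v /=.
    by rewrite mulrC -mulrA.
have -> : \int[mu4]_p (fundI p * (G1 p * h p.1)) = - (2^-1 * (fm * \int[mu2]_z (u1 z * gradx h z - u2 z * grady h z))).
  by rewrite -eF2 W1; field.
have sc (t : R) : fm^-1 * - (2^-1 * (fm * t)) = - (2^-1 * t) by field.
have e : \int[mu2]_z (u1 z * gradx h z - u2 z * grady h z) =
   \int[mu2]_z (u1 z * 'D_ex a (z, w) - u2 z * 'D_ey a (z, w)).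
  by apply: Rint_ext => z; rewrite /h gradx_slice grady_slice.
exact: (etrans (sc _) (congr1 (fun t => - (2^-1 * t)) e)).
Qed.

(** For a test function b, int G1 b and int (fav G1) b both equal the same integral of u against the
    gradient of b: the first by the weak equation on O, the second by applying [fav_slice] to each
    slice of b and integrating over the strip. The fundamental lemma then identifies G1 with its
    average. *)
Lemma zonly_rep : {ae mu4, forall p, coverO beta p -> G1 p = fav G1 p.1}.
Proof.
have mf := rint_measurable rfav.
have rfI := rint_fundI_fst rfav.
have mD : measurable_fun (coverO beta) (fun p : M4 => G1 p - fav G1 p.1 : measurableTypeR R).
  by apply: measurable_funB => //; apply: measurable_funTS; exact: measurable_fst_fun.
have lf : loc_int beta (fun p => fav G1 p.1).
  by apply: loc_int_rintI => //; apply: measurable_funTS; exact: measurable_fst_fun.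
have rD : rint mu4 (fun p => fundI p * (G1 p - fav G1 p.1)).
  by move: (rintB rG1 rfI); apply: rint_ext => p; rewrite mulrBr.
have iD : invariant_fun beta (fun p => G1 p - fav G1 p.1).
  by move=> p q pq; rewrite (iG1 pq); have /cover_eqP[-> _] := pq.
have := fundamental_lemma beta_gt0 mD iD rD; move=> H.
suff K : forall b, real_test beta b -> \int[mu4]_p (fundI p * (G1 p - fav G1 p.1) * b p) = 0.
  by have := H K; apply: ae_imp => p h pO; apply/eqP; rewrite -subr_eq0 h.
move=> b tb.
have q1 := loc_int_test beta_gt0 lG1 tb; have q2 := loc_int_test beta_gt0 lf tb.
have p1 := loc_int_test beta_gt0 lu1 (real_test_derive ex tb).
have p2 := loc_int_test beta_gt0 lu2 (real_test_derive ey tb).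
have [W1 _] := W tb.
rewrite (_ : Rintegral _ _ _ = \int[mu4]_p (fundI p * G1 p * b p) -
  \int[mu4]_p (fundI p * fav G1 p.1 * b p)); last first.
  by rewrite -RintB//; apply: Rint_ext => p; ring.
apply/eqP; rewrite subr_eq0; apply/eqP.
have -> : \int[mu4]_p (fundI p * G1 p * b p) =
    - (2^-1 * \int[mu4]_p (fundI p * u1 p.1 * 'D_ex b p - fundI p * u2 p.1 * 'D_ey b p)).
  by rewrite W1; field.
apply: (etrans (congr1 (fun t => - (2^-1 * t)) (fubini4' (rintB p1 p2)))).
apply: (etrans _ (esym (fubini4' q2))); rewrite -mulNr.
apply: (etrans (esym (RintZ (- 2^-1) (proj2 (Rint_fiber2 (rintB p1 p2)))))).
apply: Rint_ext => w.
have swap (k : C -> R) (c : T -> R) : real_test beta c ->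
    forall z, fundI (z, w) * k z * c (z, w) = strip beta w * (k z * c (z, w)).
  by move=> tc z; rewrite mulrAC (fundI_test _ tc) /=; ring.
have tx := real_test_derive ex tb; have ty := real_test_derive ey tb.
have e1 : \int[mu2]_z (fundI (z, w) * u1 z * 'D_ex b (z, w) - fundI (z, w) * u2 z * 'D_ey b (z, w)) =
    \int[mu2]_z (strip beta w * (u1 z * 'D_ex b (z, w) - u2 z * 'D_ey b (z, w))).
  by apply: Rint_ext => z; rewrite (swap u1 _ tx) (swap u2 _ ty) mulrBr.
have e2 : \int[mu2]_z (fundI (z, w) * fav G1 z * b (z, w)) =
    \int[mu2]_z (strip beta w * (fav G1 z * b (z, w))).
  by apply: Rint_ext => z; rewrite (swap (fav G1) _ tb).
have [d [M [d0 an]]] := annular_slice tb; have Hc := annular_C1c (an w).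
have [[ch cx cy] _ _ [vh vx vy]] := Hc.
have r1 : rint mu2 (fun z => fav G1 z * b (z, w)).
  have [B [B0 HB]] := vanishes_off_bounded ch vh.
  apply: (@rint_le _ M2 R mu2 _ _ _ _ (rintZ B (rint_norm rfav))).
    by apply: measurable_funM => //; exact: continuous_measurable2.
  by move=> z; rewrite normrM mulrC ler_wpM2r.
have r2 : rint mu2 (fun z => u1 z * 'D_ex b (z, w) - u2 z * 'D_ey b (z, w)).
  have [_ r1x r1y] := loc_int_C1c lu1 Hc.
  have [_ r2x r2y] := loc_int_C1c lu2 Hc.
  have [s1 _] := @fundI_fst_fibre (fun z => u1 z * gradx (fun z => b (z, w)) z)
     (measurable_funM mu_1 (continuous_measurable2 cx)) (rint_ext (fun p => esym (mulrA _ _ _)) r1x).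
  have [s2 _] := @fundI_fst_fibre (fun z => u2 z * grady (fun z => b (z, w)) z)
     (measurable_funM mu_2 (continuous_measurable2 cy)) (rint_ext (fun p => esym (mulrA _ _ _)) r2y).
  by move: (rintB s1 s2); apply: rint_ext => z; rewrite gradx_slice grady_slice.
have {}e1 := etrans e1 (RintZ _ r2); have {}e2 := etrans e2 (RintZ _ r1).
rewrite (fav_slice w tb) in e2.
apply: (etrans (congr1 (fun t => - 2^-1 * t) e1)); apply: (etrans _ (esym e2)).
by move: (Rintegral _ _ _) => t; ring.
Qed.

End zonly.
End fibre_average.

(** * Vanishing of the mean *)

Section cutoff.
Context {R : realType}.
Local Notation T := (coords R).
Local Notation C := (R * R)%type.
Local Notation M2 := (measurableTypeR R * measurableTypeR R)%type.
Local Notation mu2 := (leb2 R).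

Lemma smooth_nsq : smooth (fst_fun (@nsq R)).
Proof.
have [s1 s2 _ _] := @smooth_coords R.
exact: (smoothD (smoothM s1 s1) (smoothM s2 s2)).
Qed.

Lemma derive_nsq (p v : T) : 'D_v (fst_fun (@nsq R)) p = 2 * (p.1.1 * v.1.1 + p.1.2 * v.1.2).
Proof.
have [s1 s2 _ _] := @smooth_coords R.
have Dx1 : 'D_v (fun p : T => p.1.1) p = v.1.1 by rewrite derive_coord.
have Dx2 : 'D_v (fun p : T => p.1.2) p = v.1.2 by rewrite derive_coord.
have -> : fst_fun (@nsq R) = (fun p : T => p.1.1) * (fun p => p.1.1) + (fun p => p.1.2) * (fun p => p.1.2).
  by apply/funext => q; rewrite /fst_fun /nsq !expr2.
have d1 := @smooth_derivable R _ p v s1; have d2 := @smooth_derivable R _ p v s2.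
rewrite (deriveD (derivableM d1 d1) (derivableM d2 d2)) (deriveM d1 d1) (deriveM d2 d2) Dx1 Dx2.
by rewrite /GRing.scale/=; ring.
Qed.

(* As a function of [t], [bump (bump 1 - bump (l + k t))] vanishes for [l + k t >= 1] and is
   constant for [l + k t <= 0]. *)
Definition plateau (k l : R) (z : C) : R := bump (bump 1 - bump (l + k * nsq z)).

Definition transition (k l : R) (z : C) : R := if 0 < l + k * nsq z < 1 then 1 else 0.

Lemma smooth_affine_nsq (k l : R) : smooth (fst_fun (fun z => l + k * nsq z)).
Proof.
by apply: smoothD; [exact: smooth_cst|apply: smoothM; [exact: smooth_cst|exact: smooth_nsq]].
Qed.

Lemma smooth_inner (k l : R) : smooth (fst_fun (fun z => bump 1 - bump (l + k * nsq z))).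
Proof.
apply: smoothB; first exact: smooth_cst.
by apply: smooth_comp; [exact: smooth1_bump|exact: smooth_affine_nsq].
Qed.

Lemma smooth_plateau k l : smooth (fst_fun (plateau k l)).
Proof. by apply: smooth_comp; [exact: smooth1_bump|exact: smooth_inner]. Qed.

Lemma plateau_ge0 k l z : 0 <= plateau k l z. Proof. exact: bump_ge0. Qed.
Lemma plateau_le1 k l z : plateau k l z <= 1. Proof. exact: bump_le1. Qed.

Lemma plateau_neq0 k l z : plateau k l z != 0 -> l + k * nsq z < 1.
Proof.
move=> h; rewrite ltNge; apply/negP => h1; move/eqP: h; apply; apply: bump_le0.
by rewrite subr_le0 le_bump.
Qed.

Lemma plateau_eq k l z : l + k * nsq z <= 0 -> plateau k l z = bump (bump 1).
Proof. by move=> h; rewrite /plateau (bump_le0 h) subr0. Qed.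

Lemma derive_plateau (B : R) k l (p v : T) : (forall t, `|derive1 (@bump R) t| <= B) ->
  `|'D_v (fst_fun (plateau k l)) p| <= B ^+ 2 * `|k| * `|'D_v (fst_fun (@nsq R)) p| * transition k l p.1.
Proof.
move=> HB; have B0 : 0 <= B := le_trans (normr_ge0 _) (HB 0).
have [_ E1] := derive_comp1 v (@smooth1_derivable R _ (bump 1 - bump (l + k * nsq p.1)) (@smooth1_bump R))
  (@smooth_differentiable R _ p (smooth_inner k l)).
have [d2 E2] := derive_comp1 v (@smooth1_derivable R _ (l + k * nsq p.1) (@smooth1_bump R))
  (@smooth_differentiable R _ p (smooth_affine_nsq k l)).
have E3 : 'D_v (fst_fun (fun z => bump 1 - bump (l + k * nsq z))) p =
    - (derive1 bump (l + k * nsq p.1) * 'D_v (fst_fun (fun z => l + k * nsq z)) p).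
  have -> : fst_fun (fun z => bump 1 - bump (l + k * nsq z)) =
    cst (bump 1) - (bump \o fst_fun (fun z => l + k * nsq z)) by [].
  rewrite (deriveB (derivable_cst _ _ _) (diff_derivable d2)) derive_cst sub0r; congr (- _); exact: E2.
have E4 : 'D_v (fst_fun (fun z => l + k * nsq z)) p = k * 'D_v (fst_fun (@nsq R)) p.
  have -> : fst_fun (fun z => l + k * nsq z) = cst l + k *: fst_fun (@nsq R) by [].
  have d := @smooth_derivable R _ p v smooth_nsq.
  by rewrite (deriveD (derivable_cst _ _ _) (derivableZ d)) derive_cst add0r (deriveZ _ d).
have -> : 'D_v (fst_fun (plateau k l)) p = - (derive1 bump (bump 1 - bump (l + k * nsq p.1)) *
    (derive1 bump (l + k * nsq p.1) * (k * 'D_v (fst_fun (@nsq R)) p))).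
  by rewrite -E4 -mulrN -E3; exact: E1.
move: ('D_v (fst_fun (@nsq R)) p) => X {E1 E2 E3 E4 d2}; rewrite normrN /transition.
case: ifPn => [_|].
  by rewrite mulr1 !normrM expr2 -!mulrA; apply: ler_pM => //; apply: ler_wpM2r.
rewrite negb_and -!leNgt mulr0 => /orP[h|h].
  by rewrite [X in _ * (X * _)]derive_bump_le0// mul0r mulr0 normr0.
by rewrite derive_bump_le0 ?mul0r ?normr0// subr_le0 le_bump.
Qed.

(** With N = n + 1, the first factor vanishes for |z|^2 <= 1 / N^2 and is constant for |z|^2 >= 2 /
    N^2; the second is constant for |z|^2 <= N^2 and vanishes for |z|^2 >= 2 N^2. The limit is the
    positive constant [bump (bump 1) ^+ 2] rather than 1. *)
Definition eta (n : nat) (z : C) : R :=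
  plateau (- n.+1%:R ^+ 2) 2 z * plateau (n.+1%:R ^- 2) (-1) z.

Lemma eta_ge0 n z : 0 <= eta n z. Proof. by rewrite mulr_ge0 ?plateau_ge0. Qed.
Lemma eta_le1 n z : eta n z <= 1.
Proof. by rewrite mulr_ile1 ?plateau_ge0 ?plateau_le1. Qed.

Lemma eta_annular n : annular (n.+1%:R ^- 2) (2 * n.+1%:R) (eta n).
Proof.
split; first by apply: smoothM; exact: smooth_plateau.
move=> z; rewrite mulf_eq0 negb_or => /andP[/plateau_neq0 h1 /plateau_neq0 h2].
have N0 : 0 < n.+1%:R ^+ 2 :> R by rewrite exprn_gt0.
have h3 : 1 <= n.+1%:R ^+ 2 * nsq z by lra.
have h4 : nsq z <= 2 * n.+1%:R ^+ 2.
  by rewrite -ler_pdivrMr// mulrC; move: (_^-1 * _) h2 => t; lra.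
have key (t : R) : t ^+ 2 <= nsq z -> `|t| <= 2 * n.+1%:R.
  move=> ht; rewrite -ler_sqr ?nnegrE ?mulr_ge0// real_normK ?num_real// exprMn.
  by apply: (le_trans ht); apply: (le_trans h4); rewrite ler_wpM2r ?ltW//; rewrite expr2; lra.
split; [|apply: key|apply: key].
- by rewrite -[leLHS]mul1r ler_pdivrMr// mulrC.
- by rewrite /nsq lerDl sqr_ge0.
- by rewrite /nsq lerDr sqr_ge0.
Qed.

Lemma eta_cvg z : 0 < nsq z -> eta n z @[n --> \oo] --> bump (bump 1) ^+ 2.
Proof.
move=> z0; apply: cvg_near_cst; near=> n.
have N1 : 1 <= n.+1%:R :> R by rewrite ler1n.
rewrite /eta [RHS]expr2 !plateau_eq//.
- have : nsq z <= n.+1%:R by rewrite (_ : n.+1%:R = n%:R + 1); [|by rewrite -natr1]; rewrite ler_wpDr//; near: n; exact: nbhs_infty_ger.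
  move=> h; rewrite addrC subr_le0 mulrC ler_pdivrMr ?exprn_gt0// mul1r (le_trans h)//.
  by rewrite expr2 ler_peMl.
- have : 2 / nsq z <= n.+1%:R by rewrite (_ : n.+1%:R = n%:R + 1); [|by rewrite -natr1]; rewrite ler_wpDr//; near: n; exact: nbhs_infty_ger.
  rewrite ler_pdivrMr// => h; rewrite mulNr subr_le0 (le_trans h)//; apply: ler_wpM2r; first exact: ltW.
  by rewrite expr2 ler_peMl.
Unshelve. all: by end_near. Qed.

Definition zone n (z : C) : R := transition (- n.+1%:R ^+ 2) 2 z + transition (n.+1%:R ^- 2) (-1) z.
(** Majorant of |grad eta|^2 up to a constant. In a transition zone of coefficient k the gradient is
    of size |k| |z| and |k| |z|^2 <= 2, so its square is of order |k|. *)
Definition gmaj n (z : C) : R := n.+1%:R ^+ 2 * transition (- n.+1%:R ^+ 2) 2 z +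
  n.+1%:R ^- 2 * transition (n.+1%:R ^- 2) (-1) z.

Lemma transition_ge0 k l z : 0 <= transition k l z. Proof. by rewrite /transition; case: ifP. Qed.
Lemma transition_le1 k l z : transition k l z <= 1. Proof. by rewrite /transition; case: ifP. Qed.

Lemma measurable_transition k l : measurable_fun setT (transition k l : M2 -> measurableTypeR R).
Proof.
have m : measurable_fun setT (fun z : M2 => l + k * nsq z : measurableTypeR R).
  apply: measurable_funD => //; apply: measurable_funM => //.
  by apply: continuous_measurable2; exact: continuous_nsq.
apply: measurable_fun_ifT => //; apply: measurable_and; exact: measurable_fun_ltr.
Qed.

(** A point z <> 0 satisfies 2 / (n+1)^2 <= |z|^2 <= (n+1)^2 for large n and has then left both
    zones; z = 0 never lies in one. *)
Lemma zone_cvg z : zone n z @[n --> \oo] --> (0 : R).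
Proof.
have [z0|zn] := eqVneq (nsq z) 0.
  rewrite (_ : (fun n => zone n z) = cst 0); first exact: cvg_cst.
  apply/funext => n; rewrite /zone /transition z0 !mulr0 !addr0 oppr_gt0 ltr10 /=.
  by rewrite (_ : (2 < 1 :> R) = false) ?andbF ?addr0//; apply/negbTE; rewrite -leNgt ler1n.
have z0 : 0 < nsq z by rewrite lt_neqAle eq_sym zn nsq_ge0.
apply: cvg_near_cst; near=> n.
have N1 : 1 <= n.+1%:R :> R by rewrite ler1n.
have h1 : nsq z <= n.+1%:R by rewrite (_ : n.+1%:R = n%:R + 1); [|by rewrite -natr1]; rewrite ler_wpDr//; near: n; exact: nbhs_infty_ger.
have h2 : 2 / nsq z <= n.+1%:R by rewrite (_ : n.+1%:R = n%:R + 1); [|by rewrite -natr1]; rewrite ler_wpDr//; near: n; exact: nbhs_infty_ger.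
have k1 : -1 + n.+1%:R ^- 2 * nsq z <= 0.
  rewrite addrC subr_le0 mulrC ler_pdivrMr ?exprn_gt0// mul1r (le_trans h1)//.
  by rewrite expr2 ler_peMl.
have k2 : 2 + - n.+1%:R ^+ 2 * nsq z <= 0.
  rewrite ler_pdivrMr// in h2; rewrite mulNr subr_le0 (le_trans h2)//; apply: ler_wpM2r; first exact: ltW.
  by rewrite expr2 ler_peMl.
by rewrite /zone /transition !ltNge k1 k2 /= addr0.
Unshelve. all: by end_near. Qed.

Lemma Rint_box_scale (c : R) : 0 < c ->
  Rintegral mu2 setT (@box R (2 * c)) = c ^+ 2 * Rintegral mu2 setT (@box R 2).
Proof.
move=> c0; have [_ ->] := Rint2_affine 0 0 c0 (rint_box (2 * c)).
rewrite expr2; congr (_ * _); apply: Rint_ext => z.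
have h (t : R) : (`|c * t + 0| <= 2 * c) = (`|t| <= 2).
  by rewrite addr0 normrM (gtr0_norm c0) mulrC ler_pM2r.
by rewrite /box /cci/= !h.
Qed.

Lemma transition_box_in n z : transition (- n.+1%:R ^+ 2) 2 z <= box (2 * n.+1%:R^-1) z.
Proof.
rewrite /transition; case: ifPn => [/andP[h _]|_]; last exact: box_ge0.
have N0 : 0 < n.+1%:R ^+ 2 :> R by rewrite exprn_gt0.
have h4 : nsq z <= 2 * n.+1%:R ^- 2 by rewrite ler_pdivlMr// mulrC; lra.
have key (t : R) : t ^+ 2 <= nsq z -> `|t| <= 2 * n.+1%:R^-1.
  move=> ht; rewrite -ler_sqr ?nnegrE ?mulr_ge0// real_normK ?num_real// exprMn exprVn.
  by apply: (le_trans ht); apply: (le_trans h4); rewrite ler_wpM2r ?invr_ge0 ?ltW//; rewrite expr2; lra.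
by rewrite box_eq1//; apply: key; rewrite /nsq ?lerDl ?lerDr sqr_ge0.
Qed.

Lemma transition_box_out n z : transition (n.+1%:R ^- 2) (-1) z <= box (2 * n.+1%:R) z.
Proof.
rewrite /transition; case: ifPn => [/andP[_ h]|_]; last exact: box_ge0.
have N0 : 0 < n.+1%:R ^+ 2 :> R by rewrite exprn_gt0.
have h4 : nsq z <= 2 * n.+1%:R ^+ 2 by rewrite -ler_pdivrMr// mulrC; move: (_^-1 * _) h => t; lra.
have key (t : R) : t ^+ 2 <= nsq z -> `|t| <= 2 * n.+1%:R.
  move=> ht; rewrite -ler_sqr ?nnegrE ?mulr_ge0// real_normK ?num_real// exprMn.
  by apply: (le_trans ht); apply: (le_trans h4); rewrite ler_wpM2r ?ltW//; rewrite expr2; lra.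
by rewrite box_eq1//; apply: key; rewrite /nsq ?lerDl ?lerDr sqr_ge0.
Qed.

(** A zone of coefficient k sits in a box of area proportional to 1 / |k|, so k cancels. This is the
    scale invariance of the Dirichlet integral in the plane, and it makes the bound independent of
    n. *)
Lemma rint_gmaj n : rint mu2 (gmaj n) /\
  Rintegral mu2 setT (gmaj n) <= 2 * Rintegral mu2 setT (@box R 2).
Proof.
have N0 : 0 < n.+1%:R ^+ 2 :> R by rewrite exprn_gt0.
have r1 := rintZ (n.+1%:R ^+ 2) (rint_box (2 * n.+1%:R^-1 : R)).
have r2 := rintZ (n.+1%:R ^- 2) (rint_box (2 * n.+1%:R : R)).
have h z : `|gmaj n z| <= n.+1%:R ^+ 2 * box (2 * n.+1%:R^-1) z + n.+1%:R ^- 2 * box (2 * n.+1%:R) z.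
  rewrite ger0_norm; last by rewrite addr_ge0// mulr_ge0 ?invr_ge0 ?transition_ge0 ?ltW.
  by rewrite lerD// ler_wpM2l ?invr_ge0 ?(ltW N0)// ?transition_box_in ?transition_box_out.
have rg : rint mu2 (gmaj n).
  apply: (@rint_le _ M2 R mu2 _ _ _ h (rintD r1 r2)).
  by apply: measurable_funD; apply: measurable_funM => //; exact: measurable_transition.
split => //; apply: (@le_trans _ _ (Rintegral mu2 setT (fun z : C => n.+1%:R ^+ 2 * box (2 * n.+1%:R^-1) z + n.+1%:R ^- 2 * box (2 * n.+1%:R) z))).
  by apply: Rint_le => //; [exact: rintD|move=> z; exact: le_trans (ler_norm _) (h z)].
rewrite (RintD r1 r2) (RintZ _ (rint_box _)) (RintZ _ (rint_box _)) !Rint_box_scale ?invr_gt0//.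
rewrite exprVn mulrA divff ?gt_eqF// mul1r mulKf ?gt_eqF//; lra.
Qed.

Lemma sqr_transition_le (B c t i D : R) : 0 <= c -> `|D| <= B ^+ 2 * c * `|2 * t| * i ->
  i = 0 \/ i = 1 /\ c * t ^+ 2 <= 2 -> D ^+ 2 <= 8 * B ^+ 4 * (c * i).
Proof.
move=> c0 h [i0|[i1 ct]].
  move: h; rewrite i0 !mulr0 normr_le0 => /eqP ->; by rewrite expr0n.
rewrite i1 !mulr1 in h *.
have B2 : 0 <= B ^+ 2 := sqr_ge0 B.
rewrite -real_normK ?num_real//.
apply: (@le_trans _ _ ((B ^+ 2 * c * `|2 * t|) ^+ 2)).
  have q0 : 0 <= B ^+ 2 * c * `|2 * t| := mulr_ge0 (mulr_ge0 B2 c0) (normr_ge0 _).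
  exact: lerXn2r.
rewrite exprMn real_normK ?num_real//.
have -> : (B ^+ 2 * c) ^+ 2 * (2 * t) ^+ 2 = (4 * B ^+ 4 * c) * (c * t ^+ 2) by ring.
have -> : 8 * B ^+ 4 * c = (4 * B ^+ 4 * c) * 2 by ring.
have B4 : 0 <= B ^+ 4 by rewrite (exprM B 2 2) sqr_ge0.
exact: (ler_wpM2l (mulr_ge0 (mulr_ge0 (ler0n _ 4) B4) c0) ct).
Qed.

Lemma product_grad_le (B a b t ia ib p1 p2 D D1 D2 : R) : 0 <= a -> 0 <= b ->
  0 <= p1 <= 1 -> 0 <= p2 <= 1 -> D = p1 * D2 + p2 * D1 ->
  `|D1| <= B ^+ 2 * a * `|2 * t| * ia -> `|D2| <= B ^+ 2 * b * `|2 * t| * ib ->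
  ia = 0 \/ ia = 1 /\ a * t ^+ 2 <= 2 -> ib = 0 \/ ib = 1 /\ b * t ^+ 2 <= 2 ->
  D ^+ 2 <= 16 * B ^+ 4 * (a * ia + b * ib) /\ (D != 0 -> 1 <= ia + ib).
Proof.
move=> a0 b0 /andP[p10 p11] /andP[p20 p21] E P1 P2 ia01 ib01.
have bD : `|D| <= `|D1| + `|D2|.
  rewrite E (le_trans (ler_normD _ _))// addrC !normrM (ger0_norm p10) (ger0_norm p20).
  by apply: lerD; [rewrite -[leRHS]mul1r|rewrite -[leRHS]mul1r]; apply: ler_wpM2r.
have b1 := sqr_transition_le a0 P1 ia01.
have b2 := sqr_transition_le b0 P2 ib01.
split.
  have : D ^+ 2 <= 2 * (D1 ^+ 2 + D2 ^+ 2).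
    rewrite -real_normK ?num_real// -(real_normK (num_real D1)) -(real_normK (num_real D2)).
    have := normr_ge0 D; have := sqr_ge0 (`|D1| - `|D2|).
    by move: bD; rewrite !expr2; nra.
  by rewrite mulrDr; lra.
move=> Dn; rewrite leNgt; apply/negP => h.
have [iaE ibE] : ia = 0 /\ ib = 0.
  by case: ia01 h => [->|[-> _]]; case: ib01 => [->|[-> _]]; lra.
rewrite iaE mulr0 normr_le0 in P1; rewrite ibE mulr0 normr_le0 in P2.
by move: bD; rewrite (eqP P1) (eqP P2) normr0 addr0 normr_le0 (negbTE Dn).
Qed.

Lemma transition_in n (z : C) (t : R) : t ^+ 2 <= nsq z ->
  transition (- n.+1%:R ^+ 2) 2 z = 0 \/
  transition (- n.+1%:R ^+ 2) 2 z = 1 /\ n.+1%:R ^+ 2 * t ^+ 2 <= 2.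
Proof.
move=> tz; rewrite /transition; case: ifPn => [/andP[h _]|_]; [right|by left]; split => //.
apply: (@le_trans _ _ (n.+1%:R ^+ 2 * nsq z)); first by rewrite ler_wpM2l ?exprn_ge0.
by rewrite -subr_ge0 -mulNr ltW.
Qed.

Lemma transition_out n (z : C) (t : R) : t ^+ 2 <= nsq z ->
  transition (n.+1%:R ^- 2) (-1) z = 0 \/
  transition (n.+1%:R ^- 2) (-1) z = 1 /\ n.+1%:R ^- 2 * t ^+ 2 <= 2.
Proof.
move=> tz; rewrite /transition; case: ifPn => [/andP[_ h]|_]; [right|by left]; split => //.
apply: (@le_trans _ _ (n.+1%:R ^- 2 * nsq z)); first by rewrite ler_wpM2l ?invr_ge0 ?exprn_ge0.
by move: h; move: (_ * nsq z) => x; lra.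
Qed.

Lemma eta_grad_dir (B : R) n (z : C) (v : T) (t : R) : (forall t, `|derive1 (@bump R) t| <= B) ->
  'D_v (fst_fun (@nsq R)) (z, (0, 0)) = 2 * t -> t ^+ 2 <= nsq z ->
  'D_v (fst_fun (eta n)) (z, (0, 0)) ^+ 2 <= 16 * B ^+ 4 * gmaj n z /\
  ('D_v (fst_fun (eta n)) (z, (0, 0)) != 0 -> 1 <= zone n z).
Proof.
move=> HB Dt tz.
have N0 : 0 <= n.+1%:R ^+ 2 :> R by rewrite exprn_ge0.
have NV0 : 0 <= n.+1%:R ^- 2 :> R by rewrite invr_ge0.
have P1 := derive_plateau (- n.+1%:R ^+ 2) 2 (z, (0, 0)) v HB.
have P2 := derive_plateau (n.+1%:R ^- 2) (-1) (z, (0, 0)) v HB.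
rewrite Dt normrN (ger0_norm N0) in P1.
rewrite Dt (ger0_norm NV0) in P2.
have E : 'D_v (fst_fun (eta n)) (z, (0, 0)) =
  plateau (- n.+1%:R ^+ 2) 2 z * 'D_v (fst_fun (plateau (n.+1%:R ^- 2) (-1))) (z, (0, 0)) +
  plateau (n.+1%:R ^- 2) (-1) z * 'D_v (fst_fun (plateau (- n.+1%:R ^+ 2) 2)) (z, (0, 0)).
  have -> : fst_fun (eta n) = fst_fun (plateau (- n.+1%:R ^+ 2) 2) * fst_fun (plateau (n.+1%:R ^- 2) (-1)) by [].
  exact: (deriveM (@smooth_derivable R _ (z, (0, 0)) v (smooth_plateau _ _)) (@smooth_derivable R _ (z, (0, 0)) v (smooth_plateau _ _))).
apply: (product_grad_le N0 NV0 _ _ E P1 P2 (transition_in n tz) (transition_out n tz)).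
  by rewrite plateau_ge0 plateau_le1.
by rewrite plateau_ge0 plateau_le1.
Qed.

Lemma eta_grad : exists Cg : R, 0 <= Cg /\ forall n z,
  [/\ gradx (eta n) z ^+ 2 <= Cg * gmaj n z, grady (eta n) z ^+ 2 <= Cg * gmaj n z,
      gradx (eta n) z != 0 -> 1 <= zone n z & grady (eta n) z != 0 -> 1 <= zone n z].
Proof.
have [B [B0 HB]] := @derive_bump_bounded R.
exists (16 * B ^+ 4); split; first by rewrite mulr_ge0// exprn_ge0.
move=> n z.
have kx : z.1 ^+ 2 <= nsq z by rewrite /nsq lerDl sqr_ge0.
have ky : z.2 ^+ 2 <= nsq z by rewrite /nsq lerDr sqr_ge0.
have dx : 'D_ex (fst_fun (@nsq R)) (z, (0, 0)) = 2 * z.1 by rewrite derive_nsq/=; ring.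
have dy : 'D_ey (fst_fun (@nsq R)) (z, (0, 0)) = 2 * z.2 by rewrite derive_nsq/=; ring.
have [x1 x2] := eta_grad_dir n HB dx kx.
have [y1 y2] := eta_grad_dir n HB dy ky.
split; [exact: x1|exact: y1|exact: x2|exact: y2].
Qed.

End cutoff.

Section mean_zero.
Context {R : realType} (beta : R).
Hypothesis beta_gt0 : 0 < beta.
Local Notation T := (coords R).
Local Notation C := (R * R)%type.
Local Notation M2 := (measurableTypeR R * measurableTypeR R)%type.
Local Notation M4 := (coords (measurableTypeR R)).
Local Notation mu2 := (leb2 R).
Local Notation mu4 := (leb4 R).
Local Notation ex := (@ex R).
Local Notation ey := (@ey R).
Local Notation fundI := (fundI beta).
Local Notation fm := (fibre_mass beta).

Lemma le0_of_le_div (x c : R) : (forall l, 0 < l -> x <= c / l) -> x <= 0.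
Proof.
move=> H; rewrite leNgt; apply/negP => x0.
have c1 : 0 < `|c| + 1 by rewrite ltr_wpDl.
have := H ((`|c| + 1) / x) (divr_gt0 c1 x0); rewrite invfM invrK mulrA.
rewrite -ler_pdivrMr// divff ?gt_eqF// ler_pdivlMr// mul1r.
by have := ler_norm c; lra.
Qed.

Lemma grad_weighted_le (u g cg s l : R) : 0 < l -> 0 <= cg -> 0 <= s -> g ^+ 2 <= cg -> (g != 0 -> 1 <= s) ->
  `|u * g| <= l * (u ^+ 2 * s) + cg / l.
Proof.
move=> l0 cg0 s0 gc gs.
have i0 : 0 <= cg / l by rewrite divr_ge0// ltW.
have [->|gn] := eqVneq g 0.
  have h := mulr_ge0 (ltW l0) (mulr_ge0 (sqr_ge0 u) s0).
  by rewrite mulr0 normr0 (addr_ge0 h i0).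
have := @sqr_le_weighted R (u * g) (u ^+ 2) cg l (sqr_ge0 _) cg0 l0.
rewrite exprMn ler_wpM2l ?sqr_ge0// => /(_ isT) /le_trans; apply.
by rewrite lerD2r ler_wpM2l ?(ltW l0)// ler_peMr ?sqr_ge0// gs.
Qed.

Lemma loc_int_fst_L2 (u : C -> R) : measurable_fun setT (u : M2 -> measurableTypeR R) ->
  rint mu2 (fun z => u z ^+ 2) -> loc_int beta (fun p => u p.1).
Proof.
move=> mu qu; apply: (loc_int_L2 beta_gt0 _ (rint_fundI_fst beta_gt0 qu)).
by apply: measurable_funTS; exact: measurable_fst_fun.
Qed.

Section cutoff_limit.
Variables (u1 u2 : C -> R) (G1 G2 : T -> R).
Hypotheses (m1 : measurable_fun setT (u1 : M2 -> measurableTypeR R))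
  (m2 : measurable_fun setT (u2 : M2 -> measurableTypeR R)).
Hypotheses (q1 : rint mu2 (fun z => u1 z ^+ 2)) (q2 : rint mu2 (fun z => u2 z ^+ 2)).
Hypotheses (mG1 : measurable_fun (coverO beta) G1) (mG2 : measurable_fun (coverO beta) G2).
Hypotheses (rG1 : rint mu4 (fun p => fundI p * G1 p)) (rG2 : rint mu4 (fun p => fundI p * G2 p)).
Hypothesis W : weak_pair beta ex ey (fun p => u1 p.1) (fun p => u2 p.1) G1 G2.

(** The energy of the cutoffs is bounded but not small; smallness comes from u, whose L^2 mass [w n]
    on the transition zones tends to 0. The inequality |2 x_n| <= fm l w_n + C / l combines the
    two. *)
Lemma mean_zero : \int[mu4]_p (fundI p * G1 p) = 0.
Proof.
have lu1 := loc_int_fst_L2 m1 q1; have lu2 := loc_int_fst_L2 m2 q2.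
have lG1 := loc_int_rintI mG1 rG1; have lG2 := loc_int_rintI mG2 rG2.
have f0 := fibre_mass_gt0 beta_gt0.
have [Cg [Cg0 HC]] := @eta_grad R.
pose b := @bump R (bump 1) ^+ 2.
have b0 : 0 < b by rewrite exprn_gt0// !bump_gt0.
pose w n := \int[mu2]_z ((u1 z ^+ 2 + u2 z ^+ 2) * zone n z).
have z0 n (z : C) : 0 <= zone n z by rewrite addr_ge0// transition_ge0.
have z2 n (z : C) : zone n z <= 2.
  by have := transition_le1 (- n.+1%:R ^+ 2) 2 z; have := transition_le1 (n.+1%:R ^- 2) (-1) z; rewrite /zone; lra.
have mz n : measurable_fun setT (@zone R n : M2 -> measurableTypeR R).
  by apply: measurable_funD; exact: measurable_transition.
have mW n : measurable_fun setT (fun z : M2 => (u1 z ^+ 2 + u2 z ^+ 2) * zone n z : measurableTypeR R).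
  exact: (@measurable_funM _ M2 R _ _ _ (rint_measurable (rintD q1 q2)) (mz n)).
have s0 z : 0 <= u1 z ^+ 2 + u2 z ^+ 2 by rewrite addr_ge0// sqr_ge0.
have bW n z : `|(u1 z ^+ 2 + u2 z ^+ 2) * zone n z| <= 2 * (u1 z ^+ 2 + u2 z ^+ 2).
  by rewrite ger0_norm ?mulr_ge0// mulrC ler_wpM2r.
have rW n : rint mu2 (fun z => (u1 z ^+ 2 + u2 z ^+ 2) * zone n z).
  exact: (@rint_le _ M2 R mu2 _ _ (mW n) (bW n) (rintZ 2 (rintD q1 q2))).
have w_cvg : w n @[n --> \oo] --> (0 : R).
  rewrite -(@Rint0 _ _ R mu2).
  apply: (proj2 (@Rint_dominated _ M2 R mu2 (fun n z => (u1 z ^+ 2 + u2 z ^+ 2) * zone n z)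
    (fun=> 0) (fun z => 2 * (u1 z ^+ 2 + u2 z ^+ 2)) mW _ (rintZ 2 (rintD q1 q2)) bW)).
  move=> z; rewrite -[X in _ --> X](mulr0 (u1 z ^+ 2 + u2 z ^+ 2)); apply: cvgM; first exact: cvg_cst.
  exact: zone_cvg.
pose x n := \int[mu4]_p (fundI p * (G1 p * eta n p.1)).
have x_cvg : x n @[n --> \oo] --> b * \int[mu4]_p (fundI p * G1 p).
  rewrite -RintZ//.
  apply: (proj2 (@Rint_dominated _ M4 R mu4 (fun n p => fundI p * (G1 p * eta n p.1))
    (fun p => b * (fundI p * G1 p)) (fun p => `|fundI p * G1 p|) _ _ (rint_norm rG1) _)).
  - move=> n; have [sn _] := @eta_annular R n.
    have mn := measurable_smooth sn.
    have := measurable_funM (rint_measurable rG1) mn.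
    by apply: eq_measurable_fun => p _; rewrite mulrA.
  - move=> p; have [tp|tp] := ltrP 0 (tfun p).
      rewrite mulrC; under eq_fun do rewrite mulrA; apply: cvgM; first exact: cvg_cst.
      by apply: eta_cvg; apply: lt_le_trans (tfun_sqr_le p); rewrite exprn_gt0.
    rewrite fundI_out; last by move/coverOP; rewrite ltNge tp.
    rewrite !mul0r mulr0; under eq_fun do rewrite mul0r; exact: cvg_cst.
  - move=> n p; rewrite mulrA normrM ler_piMr// ger0_norm ?eta_ge0 ?eta_le1//.
have bound n l : 0 < l -> `|2 * x n| <= fm * (l * w n) + fm * (2 * Cg * (2 * Rintegral mu2 setT (@box R 2))) / l.
  move=> l0; have Hh := @eta_annular R n.
  have d0 : 0 < n.+1%:R ^- 2 :> R by rewrite invr_gt0 exprn_gt0.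
  have [W1 _] := weak_extension beta_gt0 d0 Hh lu1 lu2 lG1 lG2 W.
  have Hc := annular_C1c Hh.
  have [_ r1x r1y] := loc_int_C1c lu1 Hc.
  have [_ r2x r2y] := loc_int_C1c lu2 Hc.
  have [[ch cx cy] _ _ [vh vx vy]] := Hc.
  have [rg ig] := @rint_gmaj R n.
  have g0 z : 0 <= gmaj n z :> R.
    by rewrite addr_ge0// mulr_ge0 ?transition_ge0// ?invr_ge0 exprn_ge0.
  have p0 z : `|u1 z * gradx (eta n) z - u2 z * grady (eta n) z| <=
      l * ((u1 z ^+ 2 + u2 z ^+ 2) * zone n z) + l^-1 * (2 * Cg) * gmaj n z.
    have [c1 c2 c3 c4] := HC n z; have k0 := mulr_ge0 Cg0 (g0 z).
    have k1 := grad_weighted_le (u1 z) l0 k0 (z0 n z) c1 c3.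
    have k2 := grad_weighted_le (u2 z) l0 k0 (z0 n z) c2 c4.
    apply: (le_trans (ler_normB _ _)); apply: (le_trans (lerD k1 k2)).
    by rewrite le_eqVlt; apply/orP; left; apply/eqP; ring.
  have mF : measurable_fun setT (fun z : M2 => u1 z * gradx (eta n) z - u2 z * grady (eta n) z : measurableTypeR R).
    by apply: measurable_funB; apply: measurable_funM => //; exact: continuous_measurable2.
  have rM : rint mu2 (fun z => l * ((u1 z ^+ 2 + u2 z ^+ 2) * zone n z) + l^-1 * (2 * Cg) * gmaj n z).
    by apply: rintD; exact: rintZ.
  have rF := @rint_le _ M2 R mu2 _ _ mF p0 rM.
  have e : 2 * x n = - (fm * \int[mu2]_z (u1 z * gradx (eta n) z - u2 z * grady (eta n) z)).
    by rewrite -(Rint_fundI_fst beta_gt0 rF) W1 opprK.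
  rewrite e normrN normrM (gtr0_norm f0) -mulrA -mulrDr; apply: ler_wpM2l; first exact: ltW.
  apply: (le_trans (Rint_norm_le rF)); apply: (le_trans (Rint_le (rint_norm rF) rM p0)).
  rewrite (RintD (rintZ l (rW n)) (rintZ _ rg)) (RintZ _ (rW n)) (RintZ _ rg) -/(w n) lerD2l.
  have li : 0 <= l^-1 by rewrite invr_ge0 ltW.
  have c2 : 0 <= 2 * Cg by rewrite mulr_ge0.
  have := ler_wpM2l li (ler_wpM2l c2 ig); rewrite mulrA => /le_trans; apply.
  by rewrite mulrC.
apply/eqP; rewrite -normr_le0.
(* Letting n tend to infinity at fixed l removes the term in [w n]; after that l may be as large as
   one likes. *)
have K l : 0 < l -> `|2 * (b * \int[mu4]_p (fundI p * G1 p))| <=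
   fm * (2 * Cg * (2 * Rintegral mu2 setT (@box R 2))) / l.
  move=> l0; set rhs := (_ / l).
  have c1 : `|2 * x n| @[n --> \oo] --> `|2 * (b * \int[mu4]_p (fundI p * G1 p))|.
    by apply: cvg_norm; apply: cvgM => //; exact: cvg_cst.
  have c2 : fm * (l * w n) + rhs @[n --> \oo] --> fm * (l * 0) + rhs.
    apply: cvgD; last exact: cvg_cst.
    by apply: cvgM; [exact: cvg_cst|apply: cvgM => //; exact: cvg_cst].
  rewrite !mulr0 add0r in c2.
  by apply: (ler_cvg_to c1 c2); apply: nearW => n; exact: bound.
clearbody b; have := le0_of_le_div K; rewrite !normrM (gtr0_norm b0) (gtr0_norm (ltr0n R 2)).
by rewrite pmulr_rle0 ?ltr0n// pmulr_rle0.
Qed.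

End cutoff_limit.
End mean_zero.

(** * Square-integrable forms *)

Section forms.
Local Open Scope complex_scope.
Context {R : realType} (beta : R).
Hypothesis beta_gt0 : 0 < beta.
Local Notation T := (coords R).
Local Notation M4 := (coords (measurableTypeR R)).
Local Notation mu4 := (leb4 R).
Local Notation fundI := (fundI beta).
Local Notation Re := complex.Re.
Local Notation Im := complex.Im.

Lemma hzE (p : T) : hz p = 1 + nsq p.1. Proof. by []. Qed.

Lemma hz_gt0 (p : T) : 0 < hz p. Proof. exact: one_nsq_gt0. Qed.

Lemma hz_neq0 (p : T) : hz p != 0. Proof. by rewrite gt_eqF// hz_gt0. Qed.

Lemma smooth_hz : smooth (@hz R).
Proof. by apply: smoothD; [exact: smooth_cst|exact: (@smooth_nsq R)]. Qed.

Lemma smooth_hzV : smooth (fun p : T => (hz p)^-1).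
Proof. by apply: smoothV; [exact: hz_neq0|exact: smooth_hz]. Qed.

Lemma measurable_hzV : measurable_fun setT (fun p : M4 => (hz p)^-1 : measurableTypeR R).
Proof. by apply: measurable_smooth; exact: smooth_hzV. Qed.

Lemma measurable_hzMV (F : T -> R) k : measurable_fun (coverO beta) F ->
  measurable_fun (coverO beta) (fun p : M4 => F p * (hz p)^-1 ^+ k : measurableTypeR R).
Proof.
move=> mF; apply: measurable_funM => //; apply: measurable_funTS.
elim: k => [|k IH]; first exact: measurable_cst.
have := @measurable_funM _ M4 R _ _ _ measurable_hzV IH.
by apply: eq_measurable_fun => p _; rewrite exprS.
Qed.

Lemma vol_integral_rint (F : ambient beta -> R) : (forall x, 0 <= F x) ->
  measurable_fun (coverO beta) (lift F : M4 -> measurableTypeR R) ->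
  (vol_integral_ge0 F < +oo)%E <-> rint mu4 (fun p => fundI p * (lift F p / hz p ^+ 2)).
Proof.
move=> F0 mF.
have G0 p : 0 <= fundI p * (lift F p / hz p ^+ 2).
  by rewrite mulr_ge0 ?fundI_ge0// divr_ge0 ?exprn_ge0 ?(ltW (hz_gt0 _))//; exact: F0.
have mG : measurable_fun setT (fun p : M4 => fundI p * (lift F p / hz p ^+ 2) : measurableTypeR R).
  apply: measurable_fundIM; have := measurable_hzMV 2 mF.
  by apply: eq_measurable_fun => p _; rewrite exprVn.
rewrite /vol_integral_ge0 integral_fundO; split.
- move=> h; apply: (@rint_lt_pinfty _ M4 R mu4 _ _ _ _ h mG) => // p.
  by rewrite ger0_norm.
- by move=> r; rewrite (RintE r) ltry.
Qed.

Lemma normCsq_ge0 (z : R[i]) : 0 <= normCsq z.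
Proof. by rewrite addr_ge0 ?sqr_ge0. Qed.

Lemma rint_sum_sqr (a b : T -> R) : measurable_fun (coverO beta) a -> measurable_fun (coverO beta) b ->
  rint mu4 (fun p => fundI p * (a p ^+ 2 + b p ^+ 2)) <->
  rint mu4 (fun p => fundI p * a p ^+ 2) /\ rint mu4 (fun p => fundI p * b p ^+ 2).
Proof.
move=> ma mb; split; last first.
  by move=> [ra rb]; move: (rintD ra rb); apply: rint_ext => p; rewrite mulrDr.
have msq (a' : T -> R) : measurable_fun (coverO beta) a' ->
  measurable_fun (coverO beta) (fun p : M4 => a' p ^+ 2 : measurableTypeR R).
  by move=> m; exact: (@measurable_funM _ M4 R _ _ _ m m).
move=> r; split; apply: (@rint_le _ M4 R mu4 _ _ _ _ r); try (by apply: measurable_fundIM; exact: msq).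
- move=> p; rewrite normrM (ger0_norm (fundI_ge0 _ _)) (ger0_norm (sqr_ge0 _)).
  by apply: ler_wpM2l; [exact: fundI_ge0|rewrite lerDl sqr_ge0].
- move=> p; rewrite normrM (ger0_norm (fundI_ge0 _ _)) (ger0_norm (sqr_ge0 _)).
  by apply: ler_wpM2l; [exact: fundI_ge0|rewrite lerDr sqr_ge0].
Qed.

(** The volume element is dx dy drho dtheta / hz^2, so a coefficient is square-integrable on O
    exactly when its quotient by hz is so for the flat measure; H is such a quotient. *)
Definition L2c (H : T -> R) := measurable_fun (coverO beta) H /\
  rint mu4 (fun p => fundI p * H p ^+ 2).

Lemma measurable_normCsq (F : ambient beta -> R[i]) : measurableO F ->
  measurable_fun (coverO beta) (lift (fun x => normCsq (F x)) : M4 -> measurableTypeR R).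
Proof.
move=> [m1 m2]; apply: measurable_funD.
  exact: (@measurable_funM _ M4 R _ _ _ m1 m1).
exact: (@measurable_funM _ M4 R _ _ _ m2 m2).
Qed.

Lemma L2_20P (f : form20 beta) : measurableO f ->
  (normsq20 f < +oo)%E <->
  L2c (fun p => Re (lift f p) * (hz p)^-1) /\ L2c (fun p => Im (lift f p) * (hz p)^-1).
Proof.
move=> mf; have [m1 m2] := mf.
have k1 := measurable_hzMV 1 m1; have k2 := measurable_hzMV 1 m2; rewrite /= in k1 k2.
have := vol_integral_rint (fun x => normCsq_ge0 (f x)) (measurable_normCsq mf).
have := rint_sum_sqr k1 k2 => H1 H2.
have E : rint mu4 (fun p => fundI p * (lift (fun x => normCsq (f x)) p / hz p ^+ 2)) <->
   rint mu4 (fun p => fundI p * ((Re (lift f p) * (hz p)^-1) ^+ 2 + (Im (lift f p) * (hz p)^-1) ^+ 2)).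
  by split; apply: rint_ext => p; rewrite !exprMn -mulrDl exprVn.
split.
- by move=> /H2 /E /H1 [r1 r2].
- by move=> [[_ r1] [_ r2]]; apply/H2/E/H1.
Qed.

Lemma L2_21P (g : form21 beta) : measurableO g.1 -> measurableO g.2 ->
  (normsq21 g < +oo)%E <->
  (L2c (fun p => Re (lift g.1 p) * (hz p)^-1) /\ L2c (fun p => Im (lift g.1 p) * (hz p)^-1)) /\
  (L2c (fun p => Re (lift g.2 p) * (hz p)^-1) /\ L2c (fun p => Im (lift g.2 p) * (hz p)^-1)).
Proof.
move=> mg1 mg2.
have F0 x : 0 <= normCsq (g.1 x) + normCsq (g.2 x) by rewrite addr_ge0// normCsq_ge0.
have n1 := measurable_normCsq mg1; have n2 := measurable_normCsq mg2.
have mF : measurable_fun (coverO beta) (lift (fun x => normCsq (g.1 x) + normCsq (g.2 x)) : M4 -> measurableTypeR R).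
  exact: (@measurable_funD _ M4 R _ _ _ n1 n2).
have H := vol_integral_rint F0 mF.
have V1 := vol_integral_rint (fun x => normCsq_ge0 (g.1 x)) n1.
have V2 := vol_integral_rint (fun x => normCsq_ge0 (g.2 x)) n2.
rewrite -(L2_20P mg1) -(L2_20P mg2) /normsq20 V1 V2 /normsq21 H.
have mi (F : ambient beta -> R[i]) : measurableO F -> measurable_fun setT (fun p : M4 =>
   fundI p * (lift (fun x => normCsq (F x)) p / hz p ^+ 2) : measurableTypeR R).
  move=> mF'; apply: measurable_fundIM; have := measurable_hzMV 2 (measurable_normCsq mF').
  by apply: eq_measurable_fun => p _; rewrite exprVn.
have i0 (F : ambient beta -> R[i]) p : 0 <= fundI p * (lift (fun x => normCsq (F x)) p / hz p ^+ 2).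
  by rewrite mulr_ge0 ?fundI_ge0// divr_ge0 ?exprn_ge0 ?(ltW (hz_gt0 _))//; exact: normCsq_ge0.
have E p : fundI p * (lift (fun x => normCsq (g.1 x) + normCsq (g.2 x)) p / hz p ^+ 2) =
  fundI p * (lift (fun x => normCsq (g.1 x)) p / hz p ^+ 2) + fundI p * (lift (fun x => normCsq (g.2 x)) p / hz p ^+ 2).
  by rewrite -mulrDr -mulrDl.
split.
- move=> r; split; apply: (@rint_le _ M4 R mu4 _ _ _ _ r); try exact: mi.
  + by move=> p; rewrite E ger0_norm ?i0// lerDl i0.
  + by move=> p; rewrite E ger0_norm ?i0// lerDr i0.
- by move=> [r1 r2]; move: (rintD r1 r2); apply: rint_ext => p; rewrite E.
Qed.

Lemma rint_hzV2 : rint mu4 (fun p => fundI p * (hz p)^-1 ^+ 2).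
Proof.
have r := rint_fundI_fst beta_gt0 (rintZ 2^-1 (@rint_poisson R)).
move: r; apply: rint_ext => p; congr (_ * _).
by rewrite /poisson hzE mulrA mulVf ?pnatr_eq0// mul1r exprVn addrC.
Qed.

(** |H| / hz <= H^2 + hz^(-2), and the integral of hz^(-2) is the finite volume of O. *)
Lemma L2c_L1 (H : T -> R) : L2c H -> rint mu4 (fun p => fundI p * (H p * (hz p)^-1)).
Proof.
move=> [mH rH]; apply: (@rint_le _ M4 R mu4 _ _ _ _ (rintD rH rint_hzV2)).
  by apply: measurable_fundIM; have := measurable_hzMV 1 mH.
move=> p; rewrite normrM (ger0_norm (fundI_ge0 _ _)) -mulrDr ler_wpM2l ?fundI_ge0// normrM.
rewrite -(real_normK (num_real (H p))) -(real_normK (num_real (hz p)^-1)).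
have := sqr_ge0 (`|H p| - `|(hz p)^-1|); have := normr_ge0 (H p); have := normr_ge0 (hz p)^-1.
by rewrite !expr2; nra.
Qed.

End forms.

(** * Coefficients of forms, and the conditions on the range *)

Section characterisation.
Local Open Scope complex_scope.
Context {R : realType} (beta : R).
Hypothesis beta_gt0 : 0 < beta.
Local Notation T := (coords R).
Local Notation C := (R * R)%type.
Local Notation M2 := (measurableTypeR R * measurableTypeR R)%type.
Local Notation M4 := (coords (measurableTypeR R)).
Local Notation mu2 := (leb2 R).
Local Notation mu4 := (leb4 R).
Local Notation ex := (@ex R).
Local Notation ey := (@ey R).
Local Notation er := (@er R).
Local Notation et := (@et R).
Local Notation fundI := (fundI beta).
Local Notation Re := complex.Re.
Local Notation Im := complex.Im.

(** k = 1 gives the flat L^2 normalisation, and also the coefficients with respect to dz /\ psi and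
    conj psi /\ dz /\ psi; k = 2 gives the coefficient v of conj dz /\ dz /\ psi. *)
Definition re_coef (k : nat) (F : ambient beta -> R[i]) (p : T) : R := Re (lift F p) * (hz p)^-1 ^+ k.
Definition im_coef (k : nat) (F : ambient beta -> R[i]) (p : T) : R := Im (lift F p) * (hz p)^-1 ^+ k.

Lemma invariant_coef k F : invariant_fun beta (re_coef k F) /\ invariant_fun beta (im_coef k F).
Proof.
by split=> p q pq; rewrite /re_coef /im_coef (lift_invariant F pq) !hzE;
  have /cover_eqP[-> _] := pq.
Qed.

Lemma measurable_coef k F : measurableO F ->
  measurable_fun (coverO beta) (re_coef k F) /\ measurable_fun (coverO beta) (im_coef k F).
Proof. by move=> [m1 m2]; split; exact: measurable_hzMV. Qed.

Lemma loc_int_L2c (H : T -> R) : L2c beta H -> loc_int beta H.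
Proof. by move=> [mH rH]; exact: loc_int_L2. Qed.

Lemma L2_20_coef (f : form20 beta) : L2_20 beta f -> 
  L2c beta (re_coef 1 f) /\ L2c beta (im_coef 1 f).
Proof. by move=> [mf /(L2_20P mf)]. Qed.

Lemma L2_21_coef (g : form21 beta) : L2_21 beta g ->
  [/\ L2c beta (re_coef 1 g.1), L2c beta (im_coef 1 g.1), L2c beta (re_coef 1 g.2) & L2c beta (im_coef 1 g.2)].
Proof. by move=> [m1 m2 /(L2_21P m1 m2)[[? ?] [? ?]]]. Qed.

Lemma coef2E F p : re_coef 2 F p = re_coef 1 F p * (hz p)^-1 /\ im_coef 2 F p = im_coef 1 F p * (hz p)^-1.
Proof. by rewrite /re_coef /im_coef !expr2 !expr1 !mulrA. Qed.

Lemma rint_coef2 (g : form21 beta) : L2_21 beta g ->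
  rint mu4 (fun p => fundI p * re_coef 2 g.1 p) /\ rint mu4 (fun p => fundI p * im_coef 2 g.1 p).
Proof.
move=> /L2_21_coef[l1 l2 _ _].
split; [move: (L2c_L1 beta_gt0 l1)|move: (L2c_L1 beta_gt0 l2)]; apply: rint_ext => p.
  by have [-> _] := coef2E g.1 p.
by have [_ ->] := coef2E g.1 p.
Qed.

Lemma loc_int_coef2 (g : form21 beta) : L2_21 beta g ->
  loc_int beta (re_coef 2 g.1) /\ loc_int beta (im_coef 2 g.1).
Proof.
move=> Lg; have [m1 _ _] := Lg; have [r1 r2] := rint_coef2 Lg.
by have [k1 k2] := measurable_coef 2 m1; split; exact: loc_int_rintI.
Qed.

Lemma coef_div (F : ambient beta -> R[i]) k (c : T -> R) : (forall p, c p = hz p ^+ k) ->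
  (fun p => Re (lift F p / (c p)%:C)) = re_coef k F /\
  (fun p => Im (lift F p / (c p)%:C)) = im_coef k F.
Proof.
by move=> ck; split; apply/funext => p; rewrite divC_real /re_coef /im_coef/= ck exprVn.
Qed.

Lemma weak_dbarP (f : form20 beta) (g : form21 beta) : L2_20 beta f -> L2_21 beta g ->
  weak_dbar f g <->
  weak_pair beta ex ey (re_coef 1 f) (im_coef 1 f) (re_coef 2 g.1) (im_coef 2 g.1) /\
  weak_pair beta er et (re_coef 1 f) (im_coef 1 f) (re_coef 1 g.2) (im_coef 1 g.2).
Proof.
move=> Lf Lg; have [a1 a2] := L2_20_coef Lf; have [_ _ a3 a4] := L2_21_coef Lg.
have [l1 l2] := loc_int_coef2 Lg.
have [b1 b2] := @coef_div f 1 (@hz R) (fun p => esym (expr1 _)).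
have [c1 c2] := @coef_div g.1 2 (fun p => hz p ^+ 2) (fun p => erefl).
have [d1 d2] := @coef_div g.2 1 (@hz R) (fun p => esym (expr1 _)).
have W1 := @weak_derivativeP R beta beta_gt0 ex ey (fun p => lift f p / (hz p)%:C)
  (fun p => lift g.1 p / (hz p ^+ 2)%:C).
have W2 := @weak_derivativeP R beta beta_gt0 er et (fun p => lift f p / (hz p)%:C)
  (fun p => lift g.2 p / (hz p)%:C).
rewrite b1 b2 c1 c2 in W1; rewrite b1 b2 d1 d2 in W2.
have {}W1 := W1 (loc_int_L2c a1) (loc_int_L2c a2) l1 l2.
have {}W2 := W2 (loc_int_L2c a1) (loc_int_L2c a2) (loc_int_L2c a3) (loc_int_L2c a4).
by split=> -[h1 h2]; (split; [exact/W1|exact/W2]).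
Qed.

Lemma Rint_fundI_ae (F F' b : T -> R) : measurable_fun (coverO beta) F -> measurable_fun (coverO beta) F' ->
  measurable_fun setT (b : M4 -> measurableTypeR R) ->
  {ae mu4, forall p, coverO beta p -> F p = F' p} ->
  \int[mu4]_p (fundI p * F p * b p) = \int[mu4]_p (fundI p * F' p * b p).
Proof.
move=> mF mF' mb FF; apply: (@Rint_ae _ M4 R mu4).
- by apply: measurable_funM => //; exact: measurable_fundIM.
- by apply: measurable_funM => //; exact: measurable_fundIM.
- apply: ae_imp FF => p Fp; have [/Fp ->//|nO] := pselect (coverO beta p).
  by rewrite fundI_out// !mul0r.
Qed.

Lemma rint_fundI_ae (F F' : T -> R) : measurable_fun (coverO beta) F' ->
  {ae mu4, forall p, coverO beta p -> F p = F' p} ->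
  rint mu4 (fun p => fundI p * F p) -> rint mu4 (fun p => fundI p * F' p).
Proof.
move=> mF' FF; apply: (@rint_ae _ M4 R mu4); first exact: measurable_fundIM.
apply: ae_imp FF => p Fp; have [/Fp ->//|nO] := pselect (coverO beta p).
by rewrite fundI_out// !mul0r.
Qed.

Lemma weak_pair_ae e e' (u1 u2 u1' u2' v1 v2 : T -> R) :
  loc_int beta u1 -> loc_int beta u2 -> loc_int beta u1' -> loc_int beta u2' ->
  {ae mu4, forall p, coverO beta p -> u1 p = u1' p} ->
  {ae mu4, forall p, coverO beta p -> u2 p = u2' p} ->
  weak_pair beta e e' u1 u2 v1 v2 -> weak_pair beta e e' u1' u2' v1 v2.
Proof.
move=> l1 l2 l1' l2' E1 E2 W a ta; have [W1 W2] := W a ta.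
have te := real_test_derive e ta; have te' := real_test_derive e' ta.
have [se _ _] := te; have [se' _ _] := te'.
have me := measurable_smooth se; have me' := measurable_smooth se'.
have r u b : loc_int beta u -> real_test beta b -> rint mu4 (fun p => fundI p * u p * b p).
  by move=> lu tb; exact: loc_int_test lu tb.
have q1 := Rint_fundI_ae (proj1 l1) (proj1 l1') me E1.
have q1' := Rint_fundI_ae (proj1 l1) (proj1 l1') me' E1.
have q2 := Rint_fundI_ae (proj1 l2) (proj1 l2') me E2.
have q2' := Rint_fundI_ae (proj1 l2) (proj1 l2') me' E2.
split.
- rewrite -W1; apply: (etrans (RintB (r _ _ l1' te) (r _ _ l2' te'))).
  apply: (etrans _ (esym (RintB (r _ _ l1 te) (r _ _ l2 te')))).
  exact: (congr2 (fun s t => s - t) (esym q1) (esym q2')).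
- rewrite -W2; apply: (etrans (RintD (r _ _ l1' te') (r _ _ l2' te))).
  apply: (etrans _ (esym (RintD (r _ _ l1 te') (r _ _ l2 te)))).
  exact: (congr2 (fun s t => s + t) (esym q1') (esym q2)).
Qed.

Lemma Re_mulC (x : R[i]) (c : R) : Re (x * c%:C) = Re x * c /\ Im (x * c%:C) = Im x * c.
Proof. by case: x => a b /=; rewrite !mulr0 subr0 add0r. Qed.

Lemma coef_zonly k (F : ambient beta -> R[i]) (u : R[i] -> R[i]) :
  {ae mu4, forall p, coverO beta p -> lift F p = u (zc p) * (hz p ^+ k)%:C} ->
  {ae mu4, forall p, coverO beta p -> re_coef k F p = Re (u (p.1.1 +i* p.1.2))} /\
  {ae mu4, forall p, coverO beta p -> im_coef k F p = Im (u (p.1.1 +i* p.1.2))}.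
Proof.
move=> H; have h0 p : hz p ^+ k != 0 :> R by rewrite expf_neq0// hz_neq0.
split; apply: ae_imp H => p Hp pO; rewrite /re_coef /im_coef (Hp pO) exprVn.
  by have [-> _] := Re_mulC (u (zc p)) (hz p ^+ k); rewrite mulfK.
by have [_ ->] := Re_mulC (u (zc p)) (hz p ^+ k); rewrite mulfK.
Qed.

Lemma L2_fav (H : T -> R) : L2c beta H -> {ae mu4, forall p, coverO beta p -> H p = fav beta H p.1} ->
  measurable_fun setT (fav beta H : M2 -> measurableTypeR R) /\
  rint mu2 (fun z => fav beta H z ^+ 2).
Proof.
move=> LH E; have [mH rH] := LH.
have mf := measurable_fav (loc_int_L2c LH); split => //.
have m2 : measurable_fun setT (fun z : M2 => fav beta H z ^+ 2 : measurableTypeR R).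
  exact: (@measurable_funM _ M2 R _ _ _ mf mf).
have [] // := @fundI_fst_fibre R beta beta_gt0 (fun z => fav beta H z ^+ 2) m2.
apply: rint_fundI_ae rH; first by apply: measurable_funTS; exact: (measurable_fst_fun m2).
by apply: ae_imp E => p Ep pO; rewrite (Ep pO).
Qed.

(** H itself may fail to be integrable over O, but H / hz is; the factor 1 / hz is smooth and
    invariant, so the test function absorbs it. *)
Lemma fundamental_lemma_loc (H : T -> R) : L2c beta H -> invariant_fun beta H ->
  (forall b, real_test beta b -> \int[mu4]_p (fundI p * H p * b p) = 0) ->
  {ae mu4, forall p, coverO beta p -> H p = 0}.
Proof.
move=> LH iH H0; have [mH rH] := LH.
have mK := measurable_hzMV 1 mH.
have H1 b : real_test beta b -> \int[mu4]_p (fundI p * (H p * (hz p)^-1) * b p) = 0.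
  move=> tb; rewrite -[RHS](H0 (fun p => b p * (hz p)^-1)).
    by apply: Rint_ext => p; ring.
  apply: real_test_mul => //; first exact: smooth_hzV.
  by move=> p q pq; rewrite !hzE; have /cover_eqP[-> _] := pq.
have iK : invariant_fun beta (fun p => H p * (hz p)^-1).
  by move=> p q pq; rewrite (iH p q pq) !hzE; have /cover_eqP[-> _] := pq.
have := fundamental_lemma beta_gt0 mK iK (L2c_L1 beta_gt0 LH) H1.
apply: ae_imp => p Hp pO; have /eqP := Hp pO.
by rewrite mulf_eq0 invr_eq0 (negbTE (hz_neq0 p)) orbF => /eqP.
Qed.

Lemma inner21_phi (g : form21 beta) :
  inner21 g (phibar_phi_psi beta) =
  \int[mu4]_p (fundI p * re_coef 2 g.1 p) +i*
  \int[mu4]_p (fundI p * im_coef 2 g.1 p).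
Proof.
have [c1 c2] := @coef_div g.1 2 (fun p => hz p ^+ 2) (fun p => erefl).
rewrite /inner21 /vol_integral /Cintegral !Rint_fundO -c1 -c2.
have E p : lift (fun x => g.1 x * ((phibar_phi_psi beta).1 x)^*%C + g.2 x * ((phibar_phi_psi beta).2 x)^*%C) p = lift g.1 p.
  rewrite -[LHS]/(lift g.1 p * (1 : R[i])^*%C + lift g.2 p * (0 : R[i])^*%C).
  by rewrite conjc1 conjc0 mulr1 mulr0 addr0.
by congr (_ +i* _); apply: Rint_ext => p; rewrite E.
Qed.

Lemma zero_of_parts (F : ambient beta -> R[i]) :
  {ae mu4, forall p, coverO beta p -> re_coef 1 F p = 0} ->
  {ae mu4, forall p, coverO beta p -> im_coef 1 F p = 0} ->
  {ae mu4, forall p, coverO beta p -> lift F p = 0}.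
Proof.
move=> h1 h2; have := ae_and h1 h2; apply: ae_imp => p [k1 k2] pO.
move: (k1 pO) (k2 pO); rewrite /re_coef /im_coef expr1 => /eqP + /eqP.
rewrite !mulf_eq0 invr_eq0 (negbTE (hz_neq0 p)) !orbF => /eqP e1 /eqP e2.
by apply/eqP; rewrite eq_complex e1 e2 !eqxx.
Qed.

Lemma zonly_of_parts (g : form21 beta) (v1 v2 : C -> R) : L2_21 beta g ->
  {ae mu4, forall p, coverO beta p -> re_coef 2 g.1 p = v1 p.1} ->
  {ae mu4, forall p, coverO beta p -> im_coef 2 g.1 p = v2 p.1} ->
  {ae mu4, forall p, coverO beta p -> lift g.2 p = 0} -> L2_21_zonly beta g.
Proof.
move=> Lg h1 h2 h3; split => //.
exists (fun z => v1 (Re z, Im z) +i* v2 (Re z, Im z)).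
have := ae_and (ae_and h1 h2) h3; apply: ae_imp => p [[k1 k2] k3] pO; split; last exact: k3.
have h0 : hz p ^+ 2 != 0 by rewrite expf_neq0// hz_neq0.
have E1 : Re (lift g.1 p) = v1 p.1 * hz p ^+ 2 by rewrite -(k1 pO) /re_coef exprVn mulfVK.
have E2 : Im (lift g.1 p) = v2 p.1 * hz p ^+ 2 by rewrite -(k2 pO) /im_coef exprVn mulfVK.
have [m1 m2] := Re_mulC (v1 (Re (zc p), Im (zc p)) +i* v2 (Re (zc p), Im (zc p))) (hz p ^+ 2).
by apply/eqP; rewrite eq_complex m1 m2 E1 E2 /= -surjective_pairing !eqxx.
Qed.

Lemma range_orth (f : form20 beta) (g : form21 beta) : L2_20_zonly beta f -> L2_21 beta g ->
  weak_dbar f g -> L2_21_zonly beta g /\ inner21 g (phibar_phi_psi beta) = 0.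
Proof.
move=> [Lf [u Hu]] Lg; have [mg1 mg2 _] := Lg.
have [a1 a2] := L2_20_coef Lf; have [_ _ a3 a4] := L2_21_coef Lg.
move=> /(weak_dbarP Lf Lg)[W1 W2].
have Hu1 : {ae mu4, forall p, coverO beta p -> lift f p = u (zc p) * (hz p ^+ 1)%:C}.
  by apply: ae_imp Hu => p; rewrite expr1.
have [z1 z2] := coef_zonly Hu1.
(* The function u of z is an arbitrary representative, possibly not measurable; the fibre averages
   of its real and imaginary parts are measurable ones. *)
have e1 := fav_rep beta_gt0 (h := fun z => Re (u (z.1 +i* z.2))) (proj1 a1) z1.
have e2 := fav_rep beta_gt0 (h := fun z => Im (u (z.1 +i* z.2))) (proj1 a2) z2.
have [m1 q1] := L2_fav a1 e1; have [m2 q2] := L2_fav a2 e2.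
have l1 := loc_int_fst_L2 beta_gt0 m1 q1; have l2 := loc_int_fst_L2 beta_gt0 m2 q2.
have {}W1 := weak_pair_ae (loc_int_L2c a1) (loc_int_L2c a2) l1 l2 e1 e2 W1.
have {}W2 := weak_pair_ae (loc_int_L2c a1) (loc_int_L2c a2) l1 l2 e1 e2 W2.
have [lG1 lG2] := loc_int_coef2 Lg; have [rG1 rG2] := rint_coef2 Lg.
have [i1 i2] := invariant_coef 2 g.1.
(* The rotated equation gives for the imaginary part of g.1 what the original one gives for the real
   part. *)
have W1' := weak_pair_rot beta_gt0 l1 l2 lG1 W1.
have mN : measurable_fun setT (fun z : M2 => - fav beta (re_coef 1 f) z : measurableTypeR R).
  exact: measurable_funN.
have qN : rint mu2 (fun z => (- fav beta (re_coef 1 f) z) ^+ 2).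
  by move: q1; apply: rint_ext => z; rewrite sqrrN.
have lN := loc_int_fst_L2 beta_gt0 mN qN.
have mGN : measurable_fun (coverO beta) (fun p : M4 => - re_coef 2 g.1 p : measurableTypeR R).
  by apply: measurable_funN; exact: (proj1 lG1).
have rGN : rint mu4 (fun p => fundI p * - re_coef 2 g.1 p).
  by move: (rintN rG1); apply: rint_ext => p; rewrite mulrN.
have v1 := zonly_rep beta_gt0 m1 m2 l1 l2 (proj1 lG1) (proj1 lG2) i1 rG1 rG2 W1.
have v2 := zonly_rep beta_gt0 m2 mN l2 lN (proj1 lG2) mGN i2 rG2 rGN W1'.
have s1 := mean_zero beta_gt0 m1 m2 q1 q2 (proj1 lG1) (proj1 lG2) rG1 rG2 W1.
have s2 := mean_zero beta_gt0 m2 mN q2 qN (proj1 lG2) mGN rG2 rGN W1'.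
have [j1 j2] := invariant_coef 1 g.2.
(* A function of z has zero weak derivative in zeta, so the conj psi coefficient of g annihilates
   all test functions. *)
have Z b : real_test beta b ->
  \int[mu4]_p (fundI p * re_coef 1 g.2 p * b p) = 0 /\
  \int[mu4]_p (fundI p * im_coef 1 g.2 p * b p) = 0.
  move=> tb; have [w1 w2] := W2 b tb.
  have [x1 x2] := zeta_zero beta_gt0 l1 tb; have [y1 y2] := zeta_zero beta_gt0 l2 tb.
  have rr h v : loc_int beta (fun p => h p.1) -> rint mu4 (fun p => fundI p * h p.1 * 'D_v b p).
    by move=> lh; apply: (loc_int_test beta_gt0 lh); exact: real_test_derive.
  have k1 := etrans (RintB (rr _ er l1) (rr _ et l2)) (etrans (congr2 (fun s t => s - t) x1 y2) (subrr 0)).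
  have k2 := etrans (RintD (rr _ et l1) (rr _ er l2)) (etrans (congr2 (fun s t => s + t) x2 y1) (addr0 0)).
  have n2 : 2 != 0 :> R by rewrite pnatr_eq0.
  have fin (t s : R) : s = - (2 * t) -> s = 0 -> t = 0.
    by move=> -> /eqP; rewrite oppr_eq0 mulf_eq0 (negbTE n2) => /eqP.
  by split; [exact: (fin _ _ w1 k1)|exact: (fin _ _ w2 k2)].
have c1 := fundamental_lemma_loc a3 j1 (fun b tb => proj1 (Z b tb)).
have c2 := fundamental_lemma_loc a4 j2 (fun b tb => proj2 (Z b tb)).
split; first exact: (zonly_of_parts Lg v1 v2 (zero_of_parts c1 c2)).
by rewrite inner21_phi s1 s2.
Qed.

End characterisation.

(** * The range *)

Section zonly_forms.
Local Open Scope complex_scope.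
Context {R : realType} (beta : R).
Hypothesis beta_gt0 : 0 < beta.
Local Notation T := (coords R).
Local Notation C := (R * R)%type.
Local Notation M2 := (measurableTypeR R * measurableTypeR R)%type.
Local Notation M4 := (coords (measurableTypeR R)).
Local Notation mu2 := (leb2 R).
Local Notation mu4 := (leb4 R).
Local Notation ex := (@ex R).
Local Notation ey := (@ey R).
Local Notation fundI := (fundI beta).
Local Notation Re := complex.Re.
Local Notation Im := complex.Im.

(** The form u dz /\ psi in terms of phi, with value 0 over infinity, outside O. *)
Definition zform (u1 u2 : C -> R) : form20 beta := fun x =>
  if x.1 is Some z then (u1 (Re z, Im z) +i* u2 (Re z, Im z)) * (1 + normCsq z)%:C else 0.

Lemma lift_zform u1 u2 p : lift (zform u1 u2) p = (u1 p.1 +i* u2 p.1) * (hz p)%:C.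
Proof. by rewrite /lift/= /zform/= -surjective_pairing. Qed.

Lemma coef_zform u1 u2 : re_coef 1 (zform u1 u2) = (fun p => u1 p.1) /\
  im_coef 1 (zform u1 u2) = (fun p => u2 p.1).
Proof.
split; apply/funext => p; have [e1 e2] := Re_mulC (u1 p.1 +i* u2 p.1) (hz p).
  by rewrite /re_coef lift_zform e1 expr1 mulfK// hz_neq0.
by rewrite /im_coef lift_zform e2 expr1 mulfK// hz_neq0.
Qed.

Lemma zform_L2 (u1 u2 : C -> R) : measurable_fun setT (u1 : M2 -> measurableTypeR R) ->
  measurable_fun setT (u2 : M2 -> measurableTypeR R) ->
  rint mu2 (fun z => u1 z ^+ 2) -> rint mu2 (fun z => u2 z ^+ 2) -> L2_20_zonly beta (zform u1 u2).
Proof.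
move=> m1 m2 q1 q2.
have mh : measurable_fun setT (@hz R : M4 -> measurableTypeR R).
  by apply: measurable_smooth; exact: smooth_hz.
have mO : measurableO (zform u1 u2).
  split.
  - have := @measurable_funTS _ _ M4 _ (coverO beta) _ (@measurable_funM _ M4 R _ _ _ (measurable_fst_fun m1) mh).
    apply: eq_measurable_fun => p _; rewrite lift_zform.
    by have [-> _] := Re_mulC (u1 p.1 +i* u2 p.1) (hz p).
  - have := @measurable_funTS _ _ M4 _ (coverO beta) _ (@measurable_funM _ M4 R _ _ _ (measurable_fst_fun m2) mh).
    apply: eq_measurable_fun => p _; rewrite lift_zform.
    by have [_ ->] := Re_mulC (u1 p.1 +i* u2 p.1) (hz p).
have [c1 c2] := coef_zform u1 u2.
split; last first.
  exists (fun z => u1 (Re z, Im z) +i* u2 (Re z, Im z)).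
  apply: nearW => p _; rewrite lift_zform /=; by case: p => [[x y] w].
split => //; apply/(L2_20P mO).
rewrite -[X in L2c beta X /\ _]/(re_coef 1 (zform u1 u2)) -[X in _ /\ L2c beta X]/(im_coef 1 (zform u1 u2)) c1 c2.
split; split.
- by apply: measurable_funTS; exact: measurable_fst_fun.
- exact: (rint_fundI_fst beta_gt0 q1).
- by apply: measurable_funTS; exact: measurable_fst_fun.
- exact: (rint_fundI_fst beta_gt0 q2).
Qed.

Lemma Rint_strip_slice (A : T -> R) (B : T -> R) (c : R) :
  rint mu4 (fun p => strip beta p.2 * A p) -> rint mu4 (fun p => strip beta p.2 * B p) ->
  {ae mu2, forall w, rint mu2 (fun z => A (z, w)) /\ rint mu2 (fun z => B (z, w))} ->
  (forall w, \int[mu2]_z (A (z, w)) = c * \int[mu2]_z (B (z, w))) ->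
  \int[mu4]_p (strip beta p.2 * A p) = c * \int[mu4]_p (strip beta p.2 * B p).
Proof.
move=> rA rB AB E; have [mA iA] := Rint_fiber2 rA; have [mB iB] := Rint_fiber2 rB.
rewrite (fubini4' rA) (fubini4' rB) -(RintZ c iB); apply: (@Rint_ae _ M2 R mu2) => //.
  exact: measurable_funM.
apply: ae_imp AB => w [rAw rBw] /=.
have h1 := RintZ (strip beta w) rAw; have h2 := RintZ (strip beta w) rBw.
apply: (etrans h1); apply: (etrans _ (esym (congr1 (fun t => c * t) h2))).
by rewrite (E w) mulrCA.
Qed.

Lemma C1c_rint (u : C -> R) M (f : C -> R) : loc_int beta (fun p => u p.1) ->
  measurable_fun setT (u : M2 -> measurableTypeR R) -> continuous f -> vanishes_off M f ->
  rint mu2 (fun z => u z * f z).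
Proof.
move=> lu mu cf vf; have [B [_ HB]] := vanishes_off_bounded cf vf.
have mf : measurable_fun setT (f : M2 -> measurableTypeR R) by exact: continuous_measurable2.
have r : rint mu4 (fun p => fundI p * (u p.1 * f p.1)).
  have := @loc_int_rint R beta (fun p => u p.1) (fun p => f p.1) B M lu (measurable_fst_fun mf)
    (fun p => HB p.1) (fun p => @vanishes_off_fst R beta M f p vf).
  by apply: rint_ext => p; rewrite mulrA.
have [] // := @fundI_fst_fibre R beta beta_gt0 (fun z => u z * f z) _ r.
exact: (@measurable_funM _ M2 R _ _ _ mu mf).
Qed.

(* Slicing along [zeta = const] turns the weak equation on [C] into the one on [O]. *)
Lemma weak_pair_of_plane (u1 u2 v1 v2 : C -> R) :
  measurable_fun setT (u1 : M2 -> measurableTypeR R) -> measurable_fun setT (u2 : M2 -> measurableTypeR R) ->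
  measurable_fun setT (v1 : M2 -> measurableTypeR R) -> measurable_fun setT (v2 : M2 -> measurableTypeR R) ->
  loc_int beta (fun p => u1 p.1) -> loc_int beta (fun p => u2 p.1) ->
  loc_int beta (fun p => v1 p.1) -> loc_int beta (fun p => v2 p.1) ->
  (forall M f fx fy, C1c M f fx fy ->
      \int[mu2]_z (fx z * u1 z - fy z * u2 z) =
        - (2 * \int[mu2]_z (f z * v1 z)) /\
      \int[mu2]_z (fy z * u1 z + fx z * u2 z) =
        - (2 * \int[mu2]_z (f z * v2 z))) ->
  weak_pair beta ex ey (fun p => u1 p.1) (fun p => u2 p.1) (fun p => v1 p.1) (fun p => v2 p.1).
Proof.
move=> mu1 mu2' mv1 mv2 lu1 lu2 lv1 lv2 H a ta.
have tx := real_test_derive ex ta; have ty := real_test_derive ey ta.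
have [M HM] := real_test_slice ta.
have sw (k : C -> R) (b : T -> R) : real_test beta b ->
    forall p, fundI p * k p.1 * b p = strip beta p.2 * (b p * k p.1).
  by move=> tb p; rewrite mulrAC (fundI_test _ tb) mulrA.
have r (k : C -> R) (b : T -> R) : loc_int beta (fun p => k p.1) -> real_test beta b ->
    rint mu4 (fun p => strip beta p.2 * (b p * k p.1)).
  move=> lk tb; have := loc_int_test beta_gt0 lk tb; apply: rint_ext => p; exact: sw.
have rs (k f : C -> R) : loc_int beta (fun p => k p.1) ->
    measurable_fun setT (k : M2 -> measurableTypeR R) -> continuous f -> vanishes_off M f ->
    rint mu2 (fun z => f z * k z).
  by move=> lk mk cf vf; move: (C1c_rint lk mk cf vf); apply: rint_ext => z; rewrite mulrC.
have big (x1 x2 y : T -> R) : rint mu4 (fun p => strip beta p.2 * x1 p) -> rint mu4 (fun p => strip beta p.2 * x2 p) ->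
    rint mu4 (fun p => strip beta p.2 * (x1 p + x2 p)).
  by move=> h1 h2; move: (rintD h1 h2); apply: rint_ext => p; rewrite mulrDr.
split.
- have R1 : rint mu4 (fun p => strip beta p.2 * ('D_ex a p * u1 p.1 - 'D_ey a p * u2 p.1)).
    move: (rintB (r _ _ lu1 tx) (r _ _ lu2 ty)); apply: rint_ext => p; rewrite mulrBr; reflexivity.
  have K := @Rint_strip_slice (fun p => 'D_ex a p * u1 p.1 - 'D_ey a p * u2 p.1) (fun p => a p * v1 p.1) (-2) R1 (r _ _ lv1 ta).
  have e1 : \int[mu4]_p (fundI p * u1 p.1 * 'D_ex a p - fundI p * u2 p.1 * 'D_ey a p) =
     \int[mu4]_p (strip beta p.2 * ('D_ex a p * u1 p.1 - 'D_ey a p * u2 p.1)).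
    apply: Rint_ext => p; rewrite mulrBr; exact: (congr2 (fun s t => s - t) (sw u1 _ tx p) (sw u2 _ ty p)).
  have e2 : \int[mu4]_p (fundI p * v1 p.1 * a p) = \int[mu4]_p (strip beta p.2 * (a p * v1 p.1)).
    by apply: Rint_ext => p; exact: sw.
  apply: (etrans e1); apply: (etrans (K _ _)).
  + apply: nearW => w; have [[cf cx cy] _ _ [vf vx vy]] := HM w.
    split; last exact: (rs v1 (fun z => a (z, w)) lv1 mv1 cf vf).
    exact: (rintB (rs u1 (fun z => 'D_ex a (z, w)) lu1 mu1 cx vx) (rs u2 (fun z => 'D_ey a (z, w)) lu2 mu2' cy vy)).
  + by move=> w; have [h _] := H M _ _ _ (HM w); apply: (etrans h); rewrite mulNr.
  + by rewrite e2 mulNr.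
- have R1 : rint mu4 (fun p => strip beta p.2 * ('D_ey a p * u1 p.1 + 'D_ex a p * u2 p.1)).
    move: (rintD (r _ _ lu1 ty) (r _ _ lu2 tx)); apply: rint_ext => p; rewrite mulrDr; reflexivity.
  have K := @Rint_strip_slice (fun p => 'D_ey a p * u1 p.1 + 'D_ex a p * u2 p.1) (fun p => a p * v2 p.1) (-2) R1 (r _ _ lv2 ta).
  have e1 : \int[mu4]_p (fundI p * u1 p.1 * 'D_ey a p + fundI p * u2 p.1 * 'D_ex a p) =
     \int[mu4]_p (strip beta p.2 * ('D_ey a p * u1 p.1 + 'D_ex a p * u2 p.1)).
    apply: Rint_ext => p; rewrite mulrDr; exact: (congr2 (fun s t => s + t) (sw u1 _ ty p) (sw u2 _ tx p)).
  have e2 : \int[mu4]_p (fundI p * v2 p.1 * a p) = \int[mu4]_p (strip beta p.2 * (a p * v2 p.1)).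
    by apply: Rint_ext => p; exact: sw.
  apply: (etrans e1); apply: (etrans (K _ _)).
  + apply: nearW => w; have [[cf cx cy] _ _ [vf vx vy]] := HM w.
    split; last exact: (rs v2 (fun z => a (z, w)) lv2 mv2 cf vf).
    exact: (rintD (rs u1 (fun z => 'D_ey a (z, w)) lu1 mu1 cy vy) (rs u2 (fun z => 'D_ex a (z, w)) lu2 mu2' cx vx)).
  + by move=> w; have [_ h] := H M _ _ _ (HM w); apply: (etrans h); rewrite mulNr.
  + by rewrite e2 mulNr.
Qed.

End zonly_forms.

(** Replacing g by max f g changes no integral and makes the inequality hold everywhere. *)
Lemma Rint_le_ae d (T : measurableType d) (R : realType) (mu : {measure set T -> \bar R}) (f g : T -> R) :
  rint mu f -> rint mu g -> {ae mu, forall x, f x <= g x} ->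
  Rintegral mu setT f <= Rintegral mu setT g.
Proof.
move=> rf rg fg; pose h x := Num.max (f x) (g x).
have mh : measurable_fun setT h.
  by apply: measurable_maxr; [exact: rint_measurable rf|exact: rint_measurable rg].
have gh : {ae mu, forall x, g x = h x} by apply: ae_imp fg => x fgx; rewrite /h max_r.
rewrite (Rint_ae (rint_measurable rg) mh gh); apply: Rint_le => //; first exact: rint_ae gh rg.
by move=> x; rewrite le_max lexx.
Qed.

(** * From mean zero to a solution *)

Section converse.
Local Open Scope complex_scope.
Context {R : realType} (beta : R).
Hypothesis beta_gt0 : 0 < beta.
Local Notation T := (coords R).
Local Notation C := (R * R)%type.
Local Notation M2 := (measurableTypeR R * measurableTypeR R)%type.
Local Notation M4 := (coords (measurableTypeR R)).
Local Notation mu2 := (leb2 R).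
Local Notation mu4 := (leb4 R).
Local Notation er := (@er R).
Local Notation et := (@et R).
Local Notation fundI := (fundI beta).
Local Notation fm := (fibre_mass beta).
Local Notation Re := complex.Re.
Local Notation Im := complex.Im.

Lemma Rint_fundI_ae1 (F F' : T -> R) : measurable_fun (coverO beta) F -> measurable_fun (coverO beta) F' ->
  {ae mu4, forall p, coverO beta p -> F p = F' p} ->
  \int[mu4]_p (fundI p * F p) = \int[mu4]_p (fundI p * F' p).
Proof.
move=> mF mF' FF.
have := @Rint_fundI_ae R beta F F' (fun=> 1) mF mF' (@measurable_cst _ _ M4 (measurableTypeR R) setT 1) FF.
move=> X; transitivity (\int[mu4]_p (fundI p * F p * 1)).
  by apply: Rint_ext => p; rewrite mulr1.
by rewrite X; apply: Rint_ext => p; rewrite mulr1.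
Qed.

(** hz is a function of z and K agrees with its average, so (fav K)^2 hz^2 = c^2 almost everywhere:
    the flat L^2 bound on c becomes the weighted bound in the plane that [dbar_solve] asks for. *)
Lemma fav_weighted (c K : T -> R) (h : C -> R) : L2c beta c -> measurable_fun (coverO beta) K ->
  (forall p, K p = c p * (hz p)^-1) ->
  {ae mu4, forall p, coverO beta p -> K p = h p.1} ->
  [/\ measurable_fun setT (fav beta K : M2 -> measurableTypeR R),
      rint mu2 (fun z => fav beta K z ^+ 2 * (1 + nsq z) ^+ 2),
      {ae mu4, forall p, coverO beta p -> K p = fav beta K p.1},
      rint mu4 (fun p => fundI p * K p) &
      \int[mu4]_p (fundI p * K p) = fm * Rintegral mu2 setT (fav beta K)].
Proof.
move=> Lc mK Kc Kh; have [mc rc] := Lc.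
have rK : rint mu4 (fun p => fundI p * K p).
  by move: (L2c_L1 beta_gt0 Lc); apply: rint_ext => p; rewrite Kc.
have lK := loc_int_rintI mK rK.
have E := fav_rep beta_gt0 mK Kh.
have mf := measurable_fav lK.
have rf : rint mu2 (fav beta K) by have [_ r] := Rint_fiber1 rK; exact: rintZ.
have mn : measurable_fun setT (fun z : M2 => 1 + nsq z : measurableTypeR R).
  by apply: measurable_funD => //; exact: continuous_measurable2 (@continuous_nsq R).
have mw : measurable_fun setT (fun z : M2 => fav beta K z ^+ 2 * (1 + nsq z) ^+ 2 : measurableTypeR R).
  exact: (@measurable_funM _ M2 R _ _ _ (@measurable_funM _ M2 R _ _ _ mf mf) (@measurable_funM _ M2 R _ _ _ mn mn)).
split => //.
- have [] // := @fundI_fst_fibre R beta beta_gt0 _ mw.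
  apply: rint_fundI_ae rc; first by apply: measurable_funTS; exact: (measurable_fst_fun mw).
  apply: ae_imp E => p Ep pO; rewrite -hzE -(Ep pO) Kc -exprMn mulfVK//; exact: hz_neq0.
- rewrite -(Rint_fundI_fst beta_gt0 rf).
  have m1 : measurable_fun (coverO beta) (fun p : M4 => fav beta K p.1 : measurableTypeR R).
    by apply: measurable_funTS; exact: measurable_fst_fun.
  exact: Rint_fundI_ae1.
Qed.

Lemma weak_pair_source_ae e e' (u1 u2 v1 v2 v1' v2' : T -> R) :
  measurable_fun (coverO beta) v1 -> measurable_fun (coverO beta) v2 ->
  measurable_fun (coverO beta) v1' -> measurable_fun (coverO beta) v2' ->
  {ae mu4, forall p, coverO beta p -> v1 p = v1' p} ->
  {ae mu4, forall p, coverO beta p -> v2 p = v2' p} ->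
  weak_pair beta e e' u1 u2 v1' v2' -> weak_pair beta e e' u1 u2 v1 v2.
Proof.
move=> n1 n2 n1' n2' E1 E2 W a ta; have [W1 W2] := W a ta; have [sa _ _] := ta.
have ma := measurable_smooth sa.
have q1 := Rint_fundI_ae n1 n1' ma E1; have q2 := Rint_fundI_ae n2 n2' ma E2.
split; [apply: (etrans W1)|apply: (etrans W2)].
  exact: (congr1 (fun t => - (2 * t)) (esym q1)).
exact: (congr1 (fun t => - (2 * t)) (esym q2)).
Qed.

Lemma weak_pair_zeta (u1 u2 : C -> R) : loc_int beta (fun p => u1 p.1) -> loc_int beta (fun p => u2 p.1) ->
  weak_pair beta er et (fun p => u1 p.1) (fun p => u2 p.1) (fun=> 0) (fun=> 0).
Proof.
move=> l1 l2 a ta.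
have [x1 x2] := zeta_zero beta_gt0 l1 ta; have [y1 y2] := zeta_zero beta_gt0 l2 ta.
have rr h v : loc_int beta (fun p => h p.1) -> rint mu4 (fun p => fundI p * h p.1 * 'D_v a p).
  by move=> lh; apply: (loc_int_test beta_gt0 lh); exact: real_test_derive.
have z0 : \int[mu4]_p (fundI p * 0 * a p) = 0.
  by rewrite -[RHS](Rint0 mu4); apply: Rint_ext => p; rewrite mulr0 mul0r.
have z1 : 0 = - (2 * \int[mu4]_p (fundI p * 0 * a p)) by rewrite z0 mulr0 oppr0.
split.
- apply: (etrans (RintB (rr _ er l1) (rr _ et l2))); apply: etrans z1.
  exact: (etrans (congr2 (fun s t => s - t) x1 y2) (subrr 0)).
- apply: (etrans (RintD (rr _ et l1) (rr _ er l2))); apply: etrans z1.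
  exact: (etrans (congr2 (fun s t => s + t) x2 y1) (addr0 0)).
Qed.

Lemma orth_range (g : form21 beta) : L2_21_zonly beta g ->
  inner21 g (phibar_phi_psi beta) = 0 ->
  exists2 f, L2_20_zonly beta f & weak_dbar f g.
Proof.
move=> [Lg [v Hv]] I0; have [a1 a2 a3 a4] := L2_21_coef Lg.
have [l1 l2] := loc_int_coef2 beta_gt0 Lg.
have H1 : {ae mu4, forall p, coverO beta p -> lift g.1 p = v (zc p) * (hz p ^+ 2)%:C}.
  by apply: ae_imp Hv => p Hp pO; have [] := Hp pO.
have H2 : {ae mu4, forall p, coverO beta p -> lift g.2 p = 0}.
  by apply: ae_imp Hv => p Hp pO; have [] := Hp pO.
have [z1 z2] := coef_zonly H1.
have [n1 w1 e1 r1 s1] := @fav_weighted (re_coef 1 g.1) (re_coef 2 g.1) (fun z => Re (v (z.1 +i* z.2)))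
  a1 (proj1 l1) (fun p => proj1 (coef2E g.1 p)) z1.
have [n2 w2 e2 r2 s2] := @fav_weighted (im_coef 1 g.1) (im_coef 2 g.1) (fun z => Im (v (z.1 +i* z.2)))
  a2 (proj1 l2) (fun p => proj2 (coef2E g.1 p)) z2.
have fm0 (t : R) : fm * t == 0 -> t = 0.
  by rewrite mulf_eq0 (negbTE (lt0r_neq0 (fibre_mass_gt0 beta_gt0))) => /eqP.
move: I0; rewrite inner21_phi s1 s2 => /eqP; rewrite eq_complex => /andP[/fm0 i1 /fm0 i2].
have [u1 [u2 [m1 m2 q1 q2 sol]]] := dbar_solve n1 n2 w1 w2 i1 i2.
have Lf := zform_L2 beta_gt0 m1 m2 q1 q2.
have ll1 := loc_int_fst_L2 beta_gt0 m1 q1; have ll2 := loc_int_fst_L2 beta_gt0 m2 q2.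
have tr (h : C -> R) : measurable_fun setT (h : M2 -> measurableTypeR R) ->
   measurable_fun (coverO beta) (fun p : M4 => h p.1 : measurableTypeR R).
  by move=> mh; apply: measurable_funTS; exact: measurable_fst_fun.
have lf (c : T -> R) (h : C -> R) : rint mu4 (fun p => fundI p * c p) ->
   measurable_fun setT (h : M2 -> measurableTypeR R) ->
  {ae mu4, forall p, coverO beta p -> c p = h p.1} -> loc_int beta (fun p => h p.1).
  move=> rc mh ch; apply: loc_int_rintI; first exact: tr.
  by apply: rint_fundI_ae rc => //; exact: tr.
have k1 := lf _ _ r1 n1 e1; have k2 := lf _ _ r2 n2 e2.
exists (zform u1 u2) => //; apply/(weak_dbarP beta_gt0 (proj1 Lf) Lg).
have [-> ->] := coef_zform beta u1 u2; split.
- apply: (weak_pair_source_ae (proj1 l1) (proj1 l2) (tr _ n1) (tr _ n2) e1 e2).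
  exact: weak_pair_of_plane.
- have mz : measurable_fun (coverO beta) (fun p : M4 => 0 : measurableTypeR R) by exact: measurable_cst.
  apply: (weak_pair_source_ae (proj1 a3) (proj1 a4) mz mz).
  + by apply: ae_imp H2 => p Hp pO; rewrite /re_coef (Hp pO) /= mul0r.
  + by apply: ae_imp H2 => p Hp pO; rewrite /im_coef (Hp pO) /= mul0r.
  + exact: weak_pair_zeta.
Qed.

End converse.

(** * Closedness *)

Section closedness.
Local Open Scope complex_scope.
Context {R : realType} (beta : R).
Hypothesis beta_gt0 : 0 < beta.
Local Notation T := (coords R).
Local Notation M2 := (measurableTypeR R * measurableTypeR R)%type.
Local Notation M4 := (coords (measurableTypeR R)).
Local Notation mu2 := (leb2 R).
Local Notation mu4 := (leb4 R).
Local Notation fundI := (fundI beta).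
Local Notation fm := (fibre_mass beta).
Local Notation Re := complex.Re.
Local Notation Im := complex.Im.

Lemma zero_of_fundI (D : T -> R) : invariant_fun beta D -> rint mu4 (fun p => fundI p * D p) ->
  \int[mu4]_p (`|fundI p * D p|) = 0 ->
  {ae mu4, forall p, coverO beta p -> D p = 0}.
Proof.
move=> iD rD D0; apply: (@ae_cover R beta beta_gt0 (fun p => D p = 0)).
  by move=> p q pq; rewrite (iD p q pq).
apply: ae_imp (Rint_norm0_ae rD D0) => p + pF.
by rewrite fundI_indic indicE mem_set// mul1r.
Qed.

(** The triangle inequality on each fibre, the area of the fibre cancelling the normalisation:
    averaging is a contraction of L^1. *)
Lemma fav_norm_le (J : T -> R) : rint mu4 (fun p => fundI p * J p) ->
  rint mu4 (fun p => fundI p * fav beta J p.1) /\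
  \int[mu4]_p (`|fundI p * fav beta J p.1|) <= \int[mu4]_p (`|fundI p * J p|).
Proof.
move=> rJ; have [_ r1] := Rint_fiber1 rJ.
have rf : rint mu2 (fav beta J) by exact: rintZ.
split; first exact: rint_fundI_fst.
have f0 := fibre_mass_gt0 beta_gt0.
have rn := rint_norm rJ; have [_ r2] := Rint_fiber1 rn.
have -> : \int[mu4]_p (`|fundI p * fav beta J p.1|) =
    fm * \int[mu2]_z (`|fav beta J z|).
  rewrite -(Rint_fundI_fst beta_gt0 (rint_norm rf)); apply: Rint_ext => p.
  by rewrite normrM (ger0_norm (fundI_ge0 _ _)).
rewrite (fubini4 rn) -(RintZ fm (rint_norm rf)).
apply: (@Rint_le_ae _ M2 R mu2) => //; first exact: (rintZ fm (rint_norm rf)).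
apply: ae_imp (ae_rint1 rJ) => z rz.
rewrite /fav normrM (gtr0_norm _) ?invr_gt0// mulVKf ?gt_eqF//.
exact: Rint_norm_le.
Qed.

Lemma fav_sub_ae (F G : T -> R) : rint mu4 (fun p => fundI p * F p) -> rint mu4 (fun p => fundI p * G p) ->
  {ae mu2, forall z, fav beta (fun p => F p - G p) z = fav beta F z - fav beta G z}.
Proof.
move=> rF rG; apply: ae_imp (ae_and (ae_rint1 rF) (ae_rint1 rG)) => z [hF hG].
rewrite /fav -mulrBr -RintB//; congr (_ * _); apply: Rint_ext => w; exact: mulrBr.
Qed.

(** H is its own average, so K - fav K = (K - H) - fav (K - H), and averaging being a contraction
    both terms are at most e / 2 in L^1. The integral passes to the limit in the same norm. *)
Lemma fst_limit (K : T -> R) : measurable_fun (coverO beta) K -> invariant_fun beta K ->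
  rint mu4 (fun p => fundI p * K p) ->
  (forall e, 0 < e -> exists H h, [/\ measurable_fun (coverO beta) H,
    rint mu4 (fun p => fundI p * H p), {ae mu4, forall p, coverO beta p -> H p = h p.1},
    \int[mu4]_p (fundI p * H p) = 0 &
    \int[mu4]_p (`|fundI p * (K p - H p)|) <= e]) ->
  {ae mu4, forall p, coverO beta p -> K p = fav beta K p.1} /\
  \int[mu4]_p (fundI p * K p) = 0.
Proof.
move=> mK iK rK app.
have lK := loc_int_rintI mK rK.
have [rf _] := fav_norm_le rK.
have rDH H : rint mu4 (fun p => fundI p * H p) -> rint mu4 (fun p => fundI p * (K p - H p)).
  by move=> rH; move: (rintB rK rH); apply: rint_ext => p; rewrite mulrBr.
have small (x : R) : (forall e, 0 < e -> x <= e) -> x <= 0.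
  by move=> h; apply/ler_addgt0Pr => e e0; rewrite add0r h.
split; last first.
  apply/eqP; rewrite -normr_le0; apply: small => e e0.
  have [H [h [mH rH _ H0 He]]] := app e e0; apply: le_trans He.
  apply: le_trans (Rint_norm_le (rDH H rH)).
  rewrite le_eqVlt; apply/orP; left; apply/eqP; congr (`|_|).
  rewrite -[LHS]subr0 -[X in _ - X]H0 -RintB//; apply: Rint_ext => p; exact: esym (mulrBr _ _ _).
have rD : rint mu4 (fun p => fundI p * (K p - fav beta K p.1)) by exact: rDH.
have iD : invariant_fun beta (fun p => K p - fav beta K p.1).
  by move=> p q pq; rewrite (iK p q pq); have /cover_eqP[-> _] := pq.
suff Z : \int[mu4]_p (`|fundI p * (K p - fav beta K p.1)|) = 0.
  by apply: ae_imp (zero_of_fundI iD rD Z) => p Hp pO; apply/eqP; rewrite -subr_eq0 Hp.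
apply/eqP; rewrite eq_le Rint_ge0 ?andbT; last by move=> p; exact: normr_ge0.
apply: small => e e0; have e2 : 0 < e / 2 by rewrite divr_gt0.
have [H [h [mH rH Hh _ He]]] := app _ e2.
have rJ := rDH H rH.
have [rfJ fJ] := fav_norm_le rJ.
have E1 := fav_rep beta_gt0 mH Hh.
have E2 := @ae_fst _ _ _ _ _ mu2 mu2 _ (fav_sub_ae rK rH).
have rS := rintD (rint_norm rJ) (rint_norm rfJ).
apply: (@le_trans _ _ (\int[mu4]_p (`|fundI p * (K p - H p)| + `|fundI p * fav beta (fun p => K p - H p) p.1|))).
  apply: (@Rint_le_ae _ M4 R mu4) => //; first exact: rint_norm.
  apply: ae_imp (ae_and E1 E2) => p [Ep ->].
  have [/Ep Hp|nO] := pselect (coverO beta p); last by rewrite fundI_out// !mul0r normr0 addr0.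
  apply: le_trans (ler_normB _ _); rewrite -mulrBr -Hp le_eqVlt; apply/orP; left; apply/eqP.
  by congr (`|_ * _|); ring.
rewrite (RintD (rint_norm rJ) (rint_norm rfJ)) (splitr e) lerD//.
exact: le_trans fJ He.
Qed.

Lemma normsq21E (g : form21 beta) : L2_21 beta g ->
  normsq21 g = (\int[mu4]_p (fundI p * (re_coef 1 g.1 p ^+ 2 + im_coef 1 g.1 p ^+ 2 +
    (re_coef 1 g.2 p ^+ 2 + im_coef 1 g.2 p ^+ 2))))%:E.
Proof.
move=> Lg; have [[_ r1] [_ r2] [_ r3] [_ r4]] := L2_21_coef Lg.
rewrite /normsq21 /vol_integral_ge0 integral_fundO -RintE.
  apply: eq_integral => p _; congr EFin; congr (_ * _).
  rewrite /re_coef /im_coef expr1 !exprMn -!mulrDl exprVn; reflexivity.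
move: (rintD (rintD r1 r2) (rintD r3 r4)); apply: rint_ext => p; by rewrite -!mulrDr.
Qed.

Lemma normsq21_coef (g : form21 beta) (e : R) : L2_21 beta g -> (normsq21 g < (e ^+ 2)%:E)%E ->
  [/\ \int[mu4]_p (fundI p * re_coef 1 g.1 p ^+ 2) <= e ^+ 2,
      \int[mu4]_p (fundI p * im_coef 1 g.1 p ^+ 2) <= e ^+ 2,
      \int[mu4]_p (fundI p * re_coef 1 g.2 p ^+ 2) <= e ^+ 2 &
      \int[mu4]_p (fundI p * im_coef 1 g.2 p ^+ 2) <= e ^+ 2].
Proof.
move=> Lg; rewrite normsq21E// lte_fin => /ltW le.
have [[_ r1] [_ r2] [_ r3] [_ r4]] := L2_21_coef Lg.
have rs := rintD (rintD r1 r2) (rintD r3 r4).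
have rS : rint mu4 (fun p => fundI p * (re_coef 1 g.1 p ^+ 2 + im_coef 1 g.1 p ^+ 2 +
    (re_coef 1 g.2 p ^+ 2 + im_coef 1 g.2 p ^+ 2))).
  by move: rs; apply: rint_ext => p; rewrite -!mulrDr.
have S (x y z w : R) : [/\ x ^+ 2 <= x ^+ 2 + y ^+ 2 + (z ^+ 2 + w ^+ 2),
  y ^+ 2 <= x ^+ 2 + y ^+ 2 + (z ^+ 2 + w ^+ 2), z ^+ 2 <= x ^+ 2 + y ^+ 2 + (z ^+ 2 + w ^+ 2)
  & w ^+ 2 <= x ^+ 2 + y ^+ 2 + (z ^+ 2 + w ^+ 2)].
  have := sqr_ge0 x; have := sqr_ge0 y; have := sqr_ge0 z; have := sqr_ge0 w.
  by move: (x ^+ 2) (y ^+ 2) (z ^+ 2) (w ^+ 2) => a b c d *; split; lra.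
by split; apply: le_trans le; apply: Rint_le => // p; apply: ler_wpM2l; rewrite ?fundI_ge0//;
  have [] := S (re_coef 1 g.1 p) (im_coef 1 g.1 p) (re_coef 1 g.2 p) (im_coef 1 g.2 p).
Qed.

(** |c| / hz <= c^2 / e + e / hz^2; with int c^2 <= e^2 this choice of weight makes both terms
    linear in e. *)
Lemma fundI_hz_le (c : T -> R) (e : R) : 0 < e -> L2c beta c ->
  \int[mu4]_p (fundI p * c p ^+ 2) <= e ^+ 2 ->
  \int[mu4]_p (`|fundI p * (c p * (hz p)^-1)|) <=
    e * (1 + \int[mu4]_p (fundI p * (hz p)^-1 ^+ 2)).
Proof.
move=> e0 Lc le; have [mc rc] := Lc; have rw := rint_hzV2 beta_gt0.
have r1 := rintZ e^-1 rc; have r2 := rintZ e rw.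
apply: (@le_trans _ _ (\int[mu4]_p (e^-1 * (fundI p * c p ^+ 2) + e * (fundI p * (hz p)^-1 ^+ 2)))).
  apply: Rint_le; first exact: (rint_norm (L2c_L1 beta_gt0 Lc)).
    exact: rintD.
  move=> p; rewrite normrM (ger0_norm (fundI_ge0 _ _)) !(mulrCA _ (fundI p)) -mulrDr.
  apply: ler_wpM2l; first exact: fundI_ge0.
  rewrite normrM -(real_normK (num_real (c p))) -(real_normK (num_real (hz p)^-1)).
  move: `|c p| `|(hz p)^-1| (normr_ge0 (c p)) (normr_ge0 (hz p)^-1) => a b a0 b0.
  have : 0 <= e^-1 * (a - e * b) ^+ 2 + a * b.
    by apply: addr_ge0; apply: mulr_ge0 => //; [rewrite invr_ge0 ltW|exact: sqr_ge0].
  have -> : e^-1 * (a - e * b) ^+ 2 + a * b = e^-1 * a ^+ 2 + e * b ^+ 2 - a * b.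
    by field; rewrite gt_eqF.
  by rewrite subr_ge0.
rewrite (RintD r1 r2) (RintZ _ rc) (RintZ _ rw) mulrDr lerD2r mulr1.
by rewrite mulrC ler_pdivrMr// -expr2.
Qed.

Lemma sub21_coef k (g h : form21 beta) p :
  [/\ re_coef k (sub21 g h).1 p = re_coef k g.1 p - re_coef k h.1 p,
      im_coef k (sub21 g h).1 p = im_coef k g.1 p - im_coef k h.1 p,
      re_coef k (sub21 g h).2 p = re_coef k g.2 p - re_coef k h.2 p &
      im_coef k (sub21 g h).2 p = im_coef k g.2 p - im_coef k h.2 p].
Proof.
have s (x y : R[i]) : Re (x - y) = Re x - Re y /\ Im (x - y) = Im x - Im y by case: x; case: y.
split; rewrite /re_coef /im_coef -mulrBl; congr (_ * _).
- by have [] := s (lift g.1 p) (lift h.1 p).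
- by have [] := s (lift g.1 p) (lift h.1 p).
- by have [] := s (lift g.2 p) (lift h.2 p).
- by have [] := s (lift g.2 p) (lift h.2 p).
Qed.

Lemma sub21_L2 (g h : form21 beta) (e : R) : L2_21 beta g -> L2_21 beta h ->
  (normsq21 (sub21 g h) < e%:E)%E -> L2_21 beta (sub21 g h).
Proof.
move=> [[g1 g2] [g3 g4] _] [[h1 h2] [h3 h4] _] lt; split; last exact: lt_trans lt (ltry _).
- have s (x y : R[i]) : Re (x - y) = Re x - Re y /\ Im (x - y) = Im x - Im y by case: x; case: y.
  split; [move: (@measurable_funB _ M4 R _ _ _ g1 h1)|move: (@measurable_funB _ M4 R _ _ _ g2 h2)];
    apply: eq_measurable_fun => p _; have [k1 k2] := s (lift g.1 p) (lift h.1 p).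
    exact: esym k1.
  exact: esym k2.
- have s (x y : R[i]) : Re (x - y) = Re x - Re y /\ Im (x - y) = Im x - Im y by case: x; case: y.
  split; [move: (@measurable_funB _ M4 R _ _ _ g3 h3)|move: (@measurable_funB _ M4 R _ _ _ g4 h4)];
    apply: eq_measurable_fun => p _; have [k1 k2] := s (lift g.2 p) (lift h.2 p).
    exact: esym k1.
  exact: esym k2.
Qed.

(** In its use c is a conj psi coefficient of g and c' that of g - h, with h approximating g and
    having no conj psi part; so c has arbitrarily small norm. *)
Lemma zero_limit (c : T -> R) : invariant_fun beta c -> L2c beta c ->
  (forall e, 0 < e -> exists2 c', {ae mu4, forall p, coverO beta p -> c p = c' p} &
    L2c beta c' /\ \int[mu4]_p (fundI p * c' p ^+ 2) <= e ^+ 2) ->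
  {ae mu4, forall p, coverO beta p -> c p = 0}.
Proof.
move=> ic Lc app; have [mc rc] := Lc.
have isq : invariant_fun beta (fun p => c p ^+ 2) by move=> p q pq; rewrite (ic p q pq).
suff Z : \int[mu4]_p (`|fundI p * c p ^+ 2|) = 0.
  by apply: ae_imp (zero_of_fundI isq rc Z) => p Hp pO; apply/eqP; rewrite -sqrf_eq0 Hp.
apply/eqP; rewrite eq_le Rint_ge0 ?andbT; last by move=> p; exact: normr_ge0.
apply/ler_addgt0Pr => e e0; rewrite add0r.
have se : 0 < Num.sqrt e by rewrite sqrtr_gt0.
have [c' cc [[mc' rc'] le]] := app _ se.
rewrite sqr_sqrtr ?(ltW e0)// in le; apply: le_trans le.
rewrite le_eqVlt; apply/orP; left; apply/eqP.
have sq (a : T -> R) : measurable_fun (coverO beta) a -> measurable_fun (coverO beta) (fun p : M4 => a p ^+ 2 : measurableTypeR R).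
  by move=> m; exact: (@measurable_funM _ M4 R _ _ _ m m).
have cc2 : {ae mu4, forall p, coverO beta p -> c p ^+ 2 = c' p ^+ 2}.
  by apply: ae_imp cc => p Hp pO; rewrite Hp.
apply: etrans (Rint_fundI_ae1 (sq _ mc) (sq _ mc') cc2).
by apply: Rint_ext => p; rewrite ger0_norm// mulr_ge0 ?fundI_ge0 ?sqr_ge0.
Qed.

Lemma orth_closed (g : form21 beta) : L2_21 beta g ->
  (forall e : R, 0 < e -> exists2 h, L2_21_zonly beta h /\ inner21 h (phibar_phi_psi beta) = 0 &
    (normsq21 (sub21 g h) < (e ^+ 2)%:E)%E) ->
  L2_21_zonly beta g /\ inner21 g (phibar_phi_psi beta) = 0.
Proof.
move=> Lg app; have [a1 a2 a3 a4] := L2_21_coef Lg.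
have [l1 l2] := loc_int_coef2 beta_gt0 Lg; have [r1 r2] := rint_coef2 beta_gt0 Lg.
have [i1 i2] := invariant_coef 2 g.1; have [j1 j2] := invariant_coef 1 g.2.
have Z (h : form21 beta) p : lift h.2 p = 0 -> re_coef 1 h.2 p = 0 /\ im_coef 1 h.2 p = 0.
  by move=> h0; rewrite /re_coef /im_coef h0 /= !mul0r.
have c1 : {ae mu4, forall p, coverO beta p -> re_coef 1 g.2 p = 0}.
  apply: zero_limit => // e e0; have [h [[Lh [v Hv]] _] lt] := app e e0.
  have Ls := sub21_L2 Lg Lh lt; have [_ _ b3 _] := L2_21_coef Ls; have [_ _ d3 _] := normsq21_coef Ls lt.
  exists (re_coef 1 (sub21 g h).2) => //; apply: ae_imp Hv => p Hp pO.
  by have [_ /Z[k _]] := Hp pO; have [_ _ -> _] := sub21_coef 1 g h p; rewrite k subr0.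
have c2 : {ae mu4, forall p, coverO beta p -> im_coef 1 g.2 p = 0}.
  apply: zero_limit => // e e0; have [h [[Lh [v Hv]] _] lt] := app e e0.
  have Ls := sub21_L2 Lg Lh lt; have [_ _ _ b3] := L2_21_coef Ls; have [_ _ _ d3] := normsq21_coef Ls lt.
  exists (im_coef 1 (sub21 g h).2) => //; apply: ae_imp Hv => p Hp pO.
  by have [_ /Z[_ k]] := Hp pO; have [_ _ _ ->] := sub21_coef 1 g h p; rewrite k subr0.
pose W := \int[mu4]_p (fundI p * (hz p)^-1 ^+ 2).
have W0 : 0 < 1 + W.
  by rewrite ltr_wpDr// Rint_ge0// => p; rewrite mulr_ge0 ?fundI_ge0 ?sqr_ge0.
have app' e : 0 < e -> exists h : form21 beta, [/\ L2_21_zonly beta h, inner21 h (phibar_phi_psi beta) = 0,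
   \int[mu4]_p (`|fundI p * (re_coef 2 g.1 p - re_coef 2 h.1 p)|) <= e &
   \int[mu4]_p (`|fundI p * (im_coef 2 g.1 p - im_coef 2 h.1 p)|) <= e].
  (* [fundI_hz_le] costs the factor 1 + W, W being the volume of O, so the L^2 distance is asked to
     be below e / (1 + W). *)
  move=> e0; have f0 : 0 < e / (1 + W) by rewrite divr_gt0.
  have [h [zh oh] lt] := app _ f0; exists h; have [Lh _] := zh.
  have Ls := sub21_L2 Lg Lh lt; have [b1 b2 _ _] := L2_21_coef Ls; have [d1 d2 _ _] := normsq21_coef Ls lt.
  have k1 := fundI_hz_le f0 b1 d1; have k2 := fundI_hz_le f0 b2 d2.
  rewrite -/W divfK ?gt_eqF// in k1 k2; split => //.
    move: k1; congr (_ <= _); apply: Rint_ext => p.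
    have [<- _ _ _] := sub21_coef 2 g h p; by have [-> _] := coef2E (sub21 g h).1 p.
  move: k2; congr (_ <= _); apply: Rint_ext => p.
  have [_ <- _ _] := sub21_coef 2 g h p; by have [_ ->] := coef2E (sub21 g h).1 p.
have rep (h : form21 beta) : L2_21_zonly beta h -> exists v : R[i] -> R[i],
    {ae mu4, forall p, coverO beta p -> re_coef 2 h.1 p = Re (v (p.1.1 +i* p.1.2))} /\
    {ae mu4, forall p, coverO beta p -> im_coef 2 h.1 p = Im (v (p.1.1 +i* p.1.2))}.
  move=> [_ [v Hv]]; exists v; apply: coef_zonly.
  by apply: ae_imp Hv => p Hp pO; have [] := Hp pO.
have [e1 s1] : {ae mu4, forall p, coverO beta p -> re_coef 2 g.1 p = fav beta (re_coef 2 g.1) p.1} /\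
   \int[mu4]_p (fundI p * re_coef 2 g.1 p) = 0.
  apply: fst_limit => //; first exact: (proj1 l1).
  move=> e /app'[h [zh oh le _]]; have [v [v1 _]] := rep h zh; have [Lh _] := zh.
  have [q1 _] := rint_coef2 beta_gt0 Lh; have [[m1 _] _] := loc_int_coef2 beta_gt0 Lh.
  exists (re_coef 2 h.1), (fun z => Re (v (z.1 +i* z.2))); split => //.
  by move: oh; rewrite inner21_phi => /eqP; rewrite eq_complex => /andP[/eqP].
have [e2 s2] : {ae mu4, forall p, coverO beta p -> im_coef 2 g.1 p = fav beta (im_coef 2 g.1) p.1} /\
   \int[mu4]_p (fundI p * im_coef 2 g.1 p) = 0.
  apply: fst_limit => //; first exact: (proj1 l2).
  move=> e /app'[h [zh oh _ le]]; have [v [_ v1]] := rep h zh; have [Lh _] := zh.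
  have [_ q1] := rint_coef2 beta_gt0 Lh; have [_ [m1 _]] := loc_int_coef2 beta_gt0 Lh.
  exists (im_coef 2 h.1), (fun z => Im (v (z.1 +i* z.2))); split => //.
  by move: oh; rewrite inner21_phi => /eqP; rewrite eq_complex => /andP[_ /eqP].
split; first exact: (zonly_of_parts Lg e1 e2 (zero_of_parts c1 c2)).
by rewrite inner21_phi s1 s2.
Qed.

End closedness.

Theorem proposition5p3 (R : realType) (beta : R) (beta_gt0 : 0 < beta) :
  closed_in_L2_21 (range_dbar_zonly beta) /\
  range_dbar_zonly beta =
    orth_complement_in (L2_21_zonly beta) (phibar_phi_psi beta).
Proof.
have E : range_dbar_zonly beta =
    orth_complement_in (L2_21_zonly beta) (phibar_phi_psi beta).
  apply/seteqP; split => g.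
  - by move=> [Lg [f Lf W]]; exact: range_orth Lf Lg W.
  - by move=> [zg og]; split; [have [] := zg|exact: orth_range].
split => //; rewrite E; split; first by move=> g [[]].
by move=> g Lg app; exact: orth_closed.
Qed.
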